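(* Let $I(z)=\int_a^b \exp\left(-zp(t)+z^{\nu/\mu}r(t)\right)q(t)\,dt$, where the integral is taken along a contour $\mathscr{P}$ in the complex plane joining $a$ to $b$, and suppose that $p,q,r,\mathscr{P},\mu,\nu,\lambda,\theta_1,\theta_2,Z$ satisfy Conditions (i)--(vi) listed in the context, with $\mu\ge2$ an integer and $\nu=1$. Then $$I(z)\sim e^{-zp(a)}\sum_{n=0}^{\mu-1}\frac{1}{z^{(\lceil n/2\rceil+\lambda)/\mu}}\operatorname{Fi}^{(n)}\left(\frac1\mu,\frac\lambda\mu;\frac{r_0}{p_0^{1/\mu}}\right)\sum_{m=0}^\infty\frac{\widetilde f_{n,m}}{z^{m/\mu}}$$ $$= e^{-zp(a)}\sum_{n=0}^{\mu-1}\frac{1}{z^{(\lceil n/2\rceil+\lambda)/\mu}}\operatorname{Fi}\left(\frac1\mu,\frac{\lambda+n}\mu;\frac{r_0}{p_0^{1/\mu}}\right)\sum_{m=0}^\infty\frac{\widetilde f_{n,m}}{z^{m/\mu}}$$ as $|z|\to+\infty$ uniformly in the sector $\theta_1\le\arg z\le\theta_2$. Here the coefficients are $$\widetilde f_{n,m}=\sum_{j=m}^{\lceil n/2\rceil+2m} g_{\lceil n/2\rceil+j,\,n}\left(\frac{r_0}{p_0^{1/\mu}}\right) f_{\lceil n/2\rceil+m,\,j-m},$$ with the polynomials $g_{j,n}$ and the coefficients $f_{n,m}$ defined in the context, and the branches of $z^{(\lceil n/2\rceil+\lambda)/\mu}$ and $z^{m/\mu}$ are $\exp\left((\lceil n/2\rceil+\lambda)(\log|z|+i\theta)/\mu\right)$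 and $\exp\left(m(\log|z|+i\theta)/\mu\right)$, respectively, with $\theta=\arg z$.
   Context: Notation. For points $t_1,t_2$ of the contour $\mathscr{P}$, $(t_1,t_2)_{\mathscr P}$ denotes the part of $\mathscr P$ strictly between $t_1$ and $t_2$. $\varpi=\lim \arg(t-a)$ as $t\to a$ along $\mathscr P$ is the angle of slope of $\mathscr P$ at $a$. $\theta=\arg z$; neither $\varpi$ nor $\theta$ need be principal values, provided consistency is maintained. $z^{\nu/\mu}=\exp\left((\nu/\mu)(\log|z|+i\theta)\right)$. Conditions. (i) The functions $p(t)$, $q(t)$, $r(t)$ are independent of $z$, and single-valued and analytic in a domain $\mathbf T\subset\mathbb C$. (ii) $\mathscr P$ is independent of $z$, $a$ is finite, $b$ is finite or infinite, and $(a,b)_{\mathscr P}$ lies within $\mathbf T$ (so $a$ and/or $b$ may be boundary points of $\mathbf T$). (iii) In the neighbourhood of $a$, $p,q,r$ can be expanded in convergent series $$p(t)=p(a)+\sum_{n=0}^\infty p_n(t-a)^{n+\mu},\quad q(t)=\sum_{n=0}^\infty q_n(t-a)^{n+\lambda-1},\quad r(t)=\sum_{n=0}^\infty r_n(t-a)^{n+\nu},$$ where $p_0\neq0$, $\mu>\nu\ge0$ are (real) constants, and $\Re(\lambda)>0$. When $\mu$, $\lambda$ or $\nu$ is not an integer (possible only when $a$ is on the boundary of $\mathbf T$), the branches of $(t-a)^\mu,(t-a)^\lambda,(t-a)^\nu$ are specified by $(t-a)^\mu\sim|t-a|^\mu e^{i\mu\varpi}$, $(t-a)^\lambda\sim|t-a|^\lambda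 e^{i\lambda\varpi}$, $(t-a)^\nu\sim|t-a|^\nu e^{i\nu\varpi}$ as $t\to a$ along $\mathscr P$, and by continuity elsewhere on $\mathscr P$. (iv) $z$ ranges along a ray or over an annular sector given by $\theta_1\le\theta\le\theta_2$ and $|z|\ge Z$, where $\theta=\arg z$, $\theta_2-\theta_1<\pi$, and $Z>0$. Furthermore, $I(Ze^{i\theta})$ converges at $b$ both absolutely and uniformly with respect to $\theta$. (v) $\left|\arg\left(e^{i\theta}p(t)-e^{i\theta}p(a)\right)\right|\le\frac\pi2-\delta$ with a fixed (small) positive $\delta$ when $t\in(a,b)_{\mathscr P}$, and $\Re\left(e^{i\theta}p(t)-e^{i\theta}p(a)\right)$ is bounded away from zero uniformly with respect to $\theta$ as $t\to b$ along $\mathscr P$. (vi) $r(t)=\mathcal O(|p(t)-p(a)|)$ as $t\to b$ along $\mathscr P$. Branch of powers of $p_0$. All powers $p_0^s$ mean $\exp\left(s(\log|p_0|+i\varpi_0)\right)$, where $\varpi_0$ is the value of $\arg p_0$ (not necessarily principal) chosen so that $|\varpi_0+\theta+\mu\varpi|\le\frac\pi2$; under the conditions this $\varpi_0$ is unique and independent of $\theta\in[\theta_1,\theta_2]$. In the residues below, $(p(t)-p(a))^{s}$ means $p_0^{s}(t-a)^{\mu s}\left(1+\sum_{n\ge1}(p_n/p_0)(t-a)^n\right)^{s}$ with the last factor equal to $1$ at $t=a$; the functions whose residues are taken are then single-valued Laurent series about $a$. Faxén integral: $\operatorname{Fi}(\alpha,\beta;x)=\int_0^{+\infty}\exp(-t+xt^\alpha)t^{\beta-1}\,dt$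 for $0\le\alpha<1$, $\Re(\beta)>0$, $x\in\mathbb C$; $\operatorname{Fi}^{(n)}(\alpha,\beta;x)=\frac{d^n}{dx^n}\operatorname{Fi}(\alpha,\beta;x)$. Coefficients $f_{n,m}$ ($0\le m\le n$), with $\nu=1$: $$f_{n,m}=\frac{1}{m!}\sum_{j=m}^n b_{n-j}\,\mathsf{B}_{j,m}(c_1,\ldots,c_{j-m+1}),$$ $$b_n=\frac1\mu\operatorname*{Res}_{t=a}\left[\frac{q(t)}{(p(t)-p(a))^{(n+\lambda)/\mu}}\right]\ (n\ge 0),\qquad c_n=\frac1\mu\operatorname*{Res}_{t=a}\left[\frac{p'(t)r(t)}{(p(t)-p(a))^{(n+\nu)/\mu+1}}\right]\ (n\ge1),$$ where the partial ordinary Bell polynomial $\mathsf B_{n,m}(x_1,\ldots,x_{n-m+1})$ is the coefficient of $y^n$ in $\left(\sum_{j\ge1}x_jy^j\right)^m$ (so $\mathsf B_{0,0}=1$ and $\mathsf B_{n,0}=0$ for $n\ge1$). Polynomials $g_{j,n}(x)$ ($j\ge0$, $0\le n\le\mu-1$): for $j<\mu$, $g_{j,j}(x)=1$ and $g_{j,n}(x)=0$ for $n\ne j$. Further, $g_{\mu,0}(x)=\lambda/\mu$, $g_{\mu,1}(x)=x/\mu$, $g_{\mu,2}(x)=\cdots=g_{\mu,\mu-1}(x)=0$, and for $j\ge\mu$, $$g_{j+1,0}(x)=g_{j,0}'(x)+(\lambda/\mu)g_{j,\mu-1}(x),\quad g_{j+1,1}(x)=g_{j,0}(x)+g_{j,1}'(x)+(x/\mu)g_{j,\mu-1}(x),$$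 $$g_{j+1,n}(x)=g_{j,n-1}(x)+g_{j,n}'(x)\quad(2\le n\le\mu-1).$$ Meaning of the expansion: for each integer $N\ge0$, $e^{zp(a)}I(z)$ minus the sum of all terms with $\lceil n/2\rceil+m\le N-1$ (and $0\le n\le\mu-1$, $m\ge0$) is $\mathcal O\left(|z|^{-(N+\Re\lambda)/\mu}\right)$ as $|z|\to+\infty$, uniformly with respect to $\theta\in[\theta_1,\theta_2]$. *)

(* Defs.v *)
From Stdlib Require Export Reals List Factorial.
From Coquelicot Require Export Coquelicot.

Open Scope R_scope.

Definition Cexp (w : C) : C :=
  (exp (Re w) * cos (Im w), exp (Re w) * sin (Im w)).

(** [polar_pow rho theta s] is the branch [exp (s (ln rho + i theta))] of
    [w ^ s], where [w = rho e^{i theta}]; [theta] is any value of [arg w], so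
    that the pair [(rho, theta)] is a point of the Riemann surface of the
    logarithm. *)
Definition polar_pow (rho theta : R) (s : C) : C := Cexp (s * (ln rho, theta))%C.

Definition is_arg (w : C) (phi : R) : Prop :=
  w = (Cmod w * Cexp (Ci * phi))%C.

(** Principal argument, in (-pi, pi], and principal power. *)
Definition Carg (w : C) : R :=
  if Rle_dec 0 (Im w) then acos (Re w / Cmod w) else - acos (Re w / Cmod w).

Definition principal_pow (w s : C) : C := polar_pow (Cmod w) (Carg w) s.

(** Junk value if the series diverges. *)
Definition Csum (u : nat -> C) : C :=
  iota (T := C_CompleteNormedModule) (is_series u).

Definition CRInt (f : R -> C) (x y : R) : C :=
  RInt (V := C_R_CompleteNormedModule) f x y.

Definition CRInt_gen (f : R -> C) (Fx Fy : (R -> Prop) -> Prop) : C :=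
  RInt_gen (V := C_R_CompleteNormedModule) f Fx Fy.

Definition Csum_range (u : nat -> C) (m n : nat) : C :=
  sum_n_m (G := C_AbelianMonoid) u m n.

Definition connected_set (T : C -> Prop) : Prop :=
  forall U V : C -> Prop,
    open (T := C_UniformSpace) U -> open (T := C_UniformSpace) V ->
    (forall t, T t -> U t \/ V t) ->
    (forall t, T t -> U t -> V t -> False) ->
    (exists t, T t /\ U t) -> forall t, T t -> U t.

Definition complex_domain (T : C -> Prop) : Prop :=
  (exists t, T t) /\ open (T := C_UniformSpace) T /\ connected_set T.

Definition analytic_on (T : C -> Prop) (f : C -> C) : Prop :=
  forall t, T t -> ex_derive (K := C_AbsRing) (V := C_NormedModule) f t.

(** Meaningful where the derivative of [gam] exists. *)
Definition velocity (gam : R -> C) (s : R) : C :=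
  (Derive (fun u => Re (gam u)) s, Derive (fun u => Im (gam u)) s).

(** [None] is the point at infinity. *)
Definition tends_to_endpoint
    (gam : R -> C) (F : (R -> Prop) -> Prop) (b : option C) : Prop :=
  match b with
  | Some b' => filterlim gam F (locally (T := C_UniformSpace) b')
  | None => filterlim (fun s => Cmod (gam s)) F (Rbar_locally p_infty)
  end.

(** A contour joining [a] to [b] is parametrized by the open interval (0,1):
    the points strictly between [a] and [b] are the [gam s] with [0 < s < 1].
    It is continuous and piecewise continuously differentiable, with finitely
    many corners in each [(0,c)], [c < 1]; corners may accumulate only at [b]. *)
Record is_contour (gam : R -> C) (a : C) (b : option C) : Prop := {
  contour_start : filterlim gam (at_right 0) (locally (T := C_UniformSpace) a);
  contour_end : tends_to_endpoint gam (at_left 1) b;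
  contour_continuous :
    forall s, 0 < s < 1 -> continuous (U := C_UniformSpace) gam s;
  contour_piecewise_C1 :
    forall c, c < 1 -> exists corners : list R,
      forall s, 0 < s < c -> ~ In s corners ->
        ex_derive (K := R_AbsRing) (V := C_R_NormedModule) gam s /\
        continuous (U := C_UniformSpace) (velocity gam) s;
  contour_velocity_right :
    forall s, 0 <= s < 1 -> exists v : C,
      filterlim (velocity gam) (at_right s) (locally (T := C_UniformSpace) v);
  contour_velocity_left :
    forall s, 0 < s < 1 -> exists v : C,
      filterlim (velocity gam) (at_left s) (locally (T := C_UniformSpace) v)
}.

(** [phi] is the continuous determination of [arg (t - a)] along the contour
    which tends to [varpi], the angle of slope at [a]. *)
Definition is_arg_along
    (gam : R -> C) (a : C) (varpi : R) (phi : R -> R) : Prop :=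
  (forall s, 0 < s < 1 -> is_arg (gam s - a)%C (phi s)) /\
  (forall s, 0 < s < 1 -> continuous phi s) /\
  filterlim phi (at_right 0) (locally varpi).

(** Here [z = rho e^{i theta}] and [t = gam s]. *)
Definition I_integrand (p q r : C -> C) (gam : R -> C) (mu nu : R)
    (rho theta : R) (s : R) : C :=
  let t := gam s in
  (Cexp (- polar_pow rho theta 1 * p t
         + polar_pow rho theta (nu / mu)%R * r t)
   * q t * velocity gam s)%C.

(** Improper at both endpoints. *)
Definition I_integral (p q r : C -> C) (gam : R -> C) (mu nu : R)
    (rho theta : R) : C :=
  CRInt_gen (I_integrand p q r gam mu nu rho theta) (at_right 0) (at_left 1).

Definition cond_i_analytic (T : C -> Prop) (p q r : C -> C) : Prop :=
  complex_domain T /\ analytic_on T p /\ analytic_on T q /\ analytic_on T r.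

Definition cond_ii_contour
    (T : C -> Prop) (gam : R -> C) (a : C) (b : option C) : Prop :=
  is_contour gam a b /\ forall s, 0 < s < 1 -> T (gam s).

(** The expansions are stated at the points of the contour close to [a],
    because that is where the branches of the powers of [t - a] are specified;
    by the identity theorem they then hold throughout the part of T adjacent
    to the contour near [a]. *)
Definition cond_iii_expansions (p q r : C -> C) (gam : R -> C) (a : C)
    (mu nu : R) (lam : C) (varpi : R) (pn qn rn : nat -> C) : Prop :=
  pn 0%nat <> 0%C /\ 0 <= nu < mu /\ 0 < Re lam /\
  exists phi : R -> R, is_arg_along gam a varpi phi /\
  exists c, 0 < c < 1 /\ forall s, 0 < s < c ->
    let pow := polar_pow (Cmod (gam s - a)) (phi s) in
    is_series (K := C_AbsRing) (V := C_NormedModule)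
      (fun n => (pn n * pow (INR n + mu)%R)%C) (p (gam s) - p a)%C /\
    is_series (K := C_AbsRing) (V := C_NormedModule)
      (fun n => (qn n * pow (INR n + lam - 1))%C) (q (gam s)) /\
    is_series (K := C_AbsRing) (V := C_NormedModule)
      (fun n => (rn n * pow (INR n + nu)%R)%C) (r (gam s)).

Definition cond_iv_sector (p q r : C -> C) (gam : R -> C) (mu nu : R)
    (theta1 theta2 Z : R) : Prop :=
  theta1 <= theta2 /\ theta2 - theta1 < PI /\ 0 < Z /\
  exists c, 0 < c < 1 /\
    (forall theta, theta1 <= theta <= theta2 ->
       ex_RInt_gen (V := R_NormedModule)
         (fun s => Cmod (I_integrand p q r gam mu nu Z theta s))
         (at_point c) (at_left 1)) /\
    (exists J : R -> C, forall eps, 0 < eps ->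
       exists d, c < d < 1 /\
         forall theta y, theta1 <= theta <= theta2 -> d < y < 1 ->
           Cmod (CRInt (I_integrand p q r gam mu nu Z theta) c y - J theta)
             < eps).

Definition cond_v_phase (p : C -> C) (gam : R -> C) (a : C)
    (theta1 theta2 : R) : Prop :=
  let w theta s := (Cexp (Ci * theta) * (p (gam s) - p a))%C in
  (exists delta, 0 < delta /\
     forall theta s, theta1 <= theta <= theta2 -> 0 < s < 1 ->
       w theta s <> 0%C /\
       exists phi, is_arg (w theta s) phi /\ Rabs phi <= PI / 2 - delta) /\
  (exists eta c, 0 < eta /\ c < 1 /\
     forall theta s, theta1 <= theta <= theta2 -> 0 < s < 1 -> c < s ->
       eta <= Rabs (Re (w theta s))).

Definition cond_vi_growth (p r : C -> C) (gam : R -> C) (a : C) : Prop :=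
  exists K c, c < 1 /\
    forall s, 0 < s < 1 -> c < s ->
      Cmod (r (gam s)) <= K * Cmod (p (gam s) - p a).

(** The value [varpi0] of [arg p_0] used in all the powers of [p_0]. *)
Definition is_arg_p0 (p0 : C) (mu varpi theta1 theta2 varpi0 : R) : Prop :=
  is_arg p0 varpi0 /\
  forall theta, theta1 <= theta <= theta2 ->
    Rabs (varpi0 + theta + mu * varpi) <= PI / 2.

(** [res] is the coefficient of [(t-a)^(-1)] in a Laurent expansion of [f] in
    a punctured disc about [a]. *)
Definition is_residue (f : C -> C) (a : C) (res : C) : Prop :=
  exists (rad : R) (u v : nat -> C), 0 < rad /\ v 0%nat = res /\
    forall t, 0 < Cmod (t - a) < rad ->
      exists A B : C,
        is_series (K := C_AbsRing) (V := C_NormedModule)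
          (fun k => (u k * Cpow (t - a) k)%C) A /\
        is_series (K := C_AbsRing) (V := C_NormedModule)
          (fun k => (v k / Cpow (t - a) (S k))%C) B /\
        f t = (A + B)%C.

Definition Residue (f : C -> C) (a : C) : C :=
  iota (T := C_CompleteNormedModule) (is_residue f a).

(** Near [a], [p - p(a)], [p'], [q], [r] and the powers of [p - p(a)] are given
    by their expansions in [t - a].  The principal branch of the powers of
    [t - a] is used in all of them: in the functions whose residue is taken
    below the exponents add up to integers, so that these functions do not
    depend on this choice and are single-valued. *)
Definition p_diff_pow (a : C) (mu varpi0 : R) (pn : nat -> C) (s t : C) : C :=
  let p0 := pn 0%nat in
  (polar_pow (Cmod p0) varpi0 s
   * principal_pow (t - a) (mu * s)
   * principal_pow (1 + Csum (fun n => pn (S n) / p0 * Cpow (t - a) (S n))) s)%C.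

Definition p_deriv_expansion (a : C) (mu : R) (pn : nat -> C) (t : C) : C :=
  Csum (fun n => (INR n + mu)%R * pn n
                 * principal_pow (t - a) (INR n + mu - 1)%R)%C.

Definition q_expansion (a lam : C) (qn : nat -> C) (t : C) : C :=
  Csum (fun n => qn n * principal_pow (t - a) (INR n + lam - 1))%C.

Definition r_expansion (a : C) (nu : R) (rn : nat -> C) (t : C) : C :=
  Csum (fun n => rn n * principal_pow (t - a) (INR n + nu)%R)%C.

Definition b_coef (a : C) (mu : R) (lam : C) (varpi0 : R)
    (pn qn : nat -> C) (n : nat) : C :=
  (/ mu * Residue (fun t => q_expansion a lam qn t
                   / p_diff_pow a mu varpi0 pn ((INR n + lam) / mu) t) a)%C.

Definition c_coef (a : C) (mu nu varpi0 : R)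
    (pn rn : nat -> C) (n : nat) : C :=
  (/ mu * Residue (fun t => p_deriv_expansion a mu pn t * r_expansion a nu rn t
                   / p_diff_pow a mu varpi0 pn ((INR n + nu) / mu + 1)%R t) a)%C.

(** Coefficients of the [m]-th power of the formal power series [sum u_j y^j]. *)
Fixpoint series_pow (u : nat -> C) (m : nat) : nat -> C :=
  match m with
  | O => fun n => match n with O => 1%C | S _ => 0%C end
  | S m' => fun n =>
      Csum_range (fun k => u k * series_pow u m' (n - k)%nat)%C 0 n
  end.

Definition ordinary_bell (n m : nat) (x : nat -> C) : C :=
  series_pow (fun j => match j with O => 0%C | S _ => x j end) m n.

Definition f_coef (a : C) (mu : R) (lam : C) (varpi0 : R)
    (pn qn rn : nat -> C) (n m : nat) : C :=
  (/ INR (fact m)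
   * Csum_range (fun j => b_coef a mu lam varpi0 pn qn (n - j)
                          * ordinary_bell j m (c_coef a mu 1 varpi0 pn rn)) m n)%C.

(** Only used for [n <= mu - 1]; polynomials are represented by polynomial
    functions. *)
Fixpoint g_poly (mu : nat) (lam : C) (j n : nat) (x : C) : C :=
  match j with
  | O => match n with O => 1%C | S _ => 0%C end
  | S j' =>
      if Nat.ltb j mu then (if Nat.eqb n j then 1%C else 0%C)
      else if Nat.eqb j mu then
        match n with
        | 0%nat => (lam / INR mu)%C
        | 1%nat => (x / INR mu)%C
        | _ => 0%C
        end
      else
        match n with
        | 0%nat => (C_derive (g_poly mu lam j' 0) x
                    + lam / INR mu * g_poly mu lam j' (mu - 1) x)%C
        | 1%nat => (g_poly mu lam j' 0 x + C_derive (g_poly mu lam j' 1) x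
                    + x / INR mu * g_poly mu lam j' (mu - 1) x)%C
        | S n' => (g_poly mu lam j' n' x + C_derive (g_poly mu lam j' n) x)%C
        end
  end.

Definition ceil_half (n : nat) : nat := Nat.div2 (S n).

Definition f_tilde (a : C) (mu : nat) (lam : C) (varpi0 : R)
    (pn qn rn : nat -> C) (x : C) (n m : nat) : C :=
  Csum_range
    (fun j => g_poly mu lam (ceil_half n + j) n x
              * f_coef a (INR mu) lam varpi0 pn qn rn
                  (ceil_half n + m) (j - m))%C
    m (ceil_half n + 2 * m).

Definition Faxen (alpha : R) (beta x : C) : C :=
  CRInt_gen
    (fun t => Cexp (- t + x * Rpower t alpha) * polar_pow t 0 (beta - 1))%C
    (at_right 0) (Rbar_locally p_infty).

Definition Faxen_derive_n (n : nat) (alpha : R) (beta : C) : C -> C :=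
  Nat.iter n C_derive (Faxen alpha beta).

(** Sum over [0 <= n <= mu - 1] and [m >= 0] with [ceil (n/2) + m <= N - 1] of
    [F n / z^((ceil (n/2) + lam)/mu) * ft n m / z^(m/mu)]. *)
Definition partial_expansion (mu : nat) (lam : C) (F : nat -> C)
    (ft : nat -> nat -> C) (N : nat) (rho theta : R) : C :=
  Csum_range (fun n => Csum_range (fun m =>
    if Nat.ltb (ceil_half n + m) N
    then (/ polar_pow rho theta ((INR (ceil_half n) + lam) / INR mu) * F n
          * (ft n m / polar_pow rho theta (INR m / INR mu)%R))%C
    else 0%C) 0 N) 0 (mu - 1).

Definition has_expansion (G : R -> R -> C) (mu : nat) (lam : C) (F : nat -> C)
    (ft : nat -> nat -> C) (theta1 theta2 : R) : Prop :=
  forall N : nat, exists K X : R, 0 < X /\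
    forall rho theta : R, X <= rho -> theta1 <= theta <= theta2 ->
      Cmod (G rho theta - partial_expansion mu lam F ft N rho theta)
        <= K * Rpower rho (- ((INR N + Re lam) / INR mu)).

(* Main.v *)
Require Import Defs.
From Stdlib Require Import Lra Lia Psatz Wf_nat Compare_dec.

(** With the local coordinate [u = (p(t) - p(a))^{1/mu} = P0 (t - a) e^{Lm}] and [Y = z^{1/mu} u], the integrand near
    [a] is [exp(-Y^mu + x Y)], times [exp(Y h)] where [h = r / u - x] vanishes at [a], times [q dt].  The coefficients
    of [q dt] and [r] in powers of [u] are the residues [b_n] and [c_n], so that expanding [exp(Y h)] yields the
    [f_{n,m}], and [exp(-Y^mu + x Y) Y^{lam + j} dY / Y] integrates to the [j]-th Faxén integral.

    No contour is deformed: all local integrals are differences of explicit primitives on the Riemann surface of the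
    logarithm, obtained by integrating power series.  The contour may be arbitrarily wild at [a], where the integral
    need not converge absolutely; its part near [a] only enters through the value of such a primitive at one point [c],
    which can be computed along the ray from [a] to [c] instead.  Beyond [c] the integrand is exponentially small.

    Finally [Fi^{(mu)} = (lam / mu) Fi + (x / mu) Fi'], by parts, reduces the derivatives of order at least [mu] and
    produces the [g_{j,n}]. *)

(** Every branch is carried by a logarithm: [z], [p_0] and [t - a] enter as pairs of the logarithm
    of the modulus and a chosen argument, powers are [Cexp (s * _)], and an equality of branches
    becomes a linear identity between exponents. Complex analysis is limited to what convergent
    power series and a mean value inequality on real intervals provide; residues are read off as
    Taylor coefficients.

    The orders are governed by one identity: a term [u^k Y^i] of the expansion equals
    [z^{-k/mu} Y^{k+i}], so it contributes at order [(k + lam)/mu] a multiple of the Faxén integral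
    of index [k + i], where [i <= k] since [h] vanishes at [a]. For [k < n/2] and [n < mu] one has
    [k + i < n], so index [n] cannot appear yet; this is the origin of [ceil (n/2)].

    Uniformity in [theta] is obtained by fixing all constants before [rho] and [theta]: in the
    variable [W = log Y] the dependence on [z] is a translation, and the dominating functions of [W]
    do not involve [z]. *)

Lemma C_eq (u v : C) : Re u = Re v -> Im u = Im v -> u = v.
Proof. destruct u, v; simpl; intros -> ->; reflexivity. Qed.

Lemma Cexp_plus (u v : C) : Cexp (u + v) = (Cexp u * Cexp v)%C.
Proof.
  unfold Cexp; apply C_eq; unfold Re, Im; simpl; rewrite exp_plus, ?cos_plus, ?sin_plus; ring.
Qed.

Lemma Cexp_0 : Cexp 0 = 1%C.
Proof. unfold Cexp; simpl. rewrite exp_0, cos_0, sin_0. apply C_eq; simpl; ring. Qed.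

Lemma Cmod_Cexp (w : C) : Cmod (Cexp w) = exp (Re w).
Proof.
  unfold Cmod, Cexp; simpl.
  replace (_ + _) with (exp (Re w) * exp (Re w)).
  - apply sqrt_square. left; apply exp_pos.
  - generalize (sin2_cos2 (Im w)); unfold Rsqr; intros H.
    rewrite !Rmult_1_r. unfold Re, Im in *.
    transitivity (exp (fst w) * exp (fst w) * (sin (snd w) * sin (snd w) + cos (snd w) * cos (snd w))); [rewrite H|]; ring.
Qed.

Lemma Cexp_neq_0 (w : C) : Cexp w <> 0%C.
Proof. apply Cmod_gt_0. rewrite Cmod_Cexp. apply exp_pos. Qed.

Lemma Cexp_opp (w : C) : Cexp (- w) = (/ Cexp w)%C.
Proof.
  assert (H := Cexp_neq_0 w).
  replace (Cexp (- w)) with (Cexp (- w) * Cexp w * / Cexp w)%C by (field; exact H).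
  rewrite <- Cexp_plus. replace (- w + w)%C with (RtoC 0) by ring.
  rewrite Cexp_0. ring.
Qed.

Lemma Cexp_minus (u v : C) : Cexp (u - v) = (Cexp u / Cexp v)%C.
Proof. unfold Cminus, Cdiv. rewrite Cexp_plus, Cexp_opp; reflexivity. Qed.

Lemma Cexp_pow (w : C) (n : nat) : Cexp (INR n * w) = (Cexp w ^ n)%C.
Proof.
  induction n as [|n IH].
  - simpl. replace (0 * w)%C with (RtoC 0) by ring. apply Cexp_0.
  - rewrite Cpow_S, <- IH, <- Cexp_plus, S_INR, RtoC_plus. f_equal. ring.
Qed.

Lemma Cexp_real (x : R) : Cexp x = exp x.
Proof. unfold Cexp; apply C_eq; simpl; rewrite ?cos_0, ?sin_0; ring. Qed.

Lemma Im_le_Cmod (w : C) : Rabs (Im w) <= Cmod w.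
Proof. eapply Rle_trans; [|apply Rmax_Cmod]. apply Rmax_r. Qed.

Lemma Cmod_le_Re_Im (w : C) : Cmod w <= Rabs (Re w) + Rabs (Im w).
Proof.
  replace w with (Re w + Ci * Im w)%C at 1.
  - eapply Rle_trans; [apply Cmod_triangle|].
    rewrite Cmod_mult, Cmod_Ci, !Cmod_R. lra.
  - apply C_eq; simpl; ring.
Qed.

Lemma Cmod_minus_sym (u v : C) : Cmod (u - v) = Cmod (v - u).
Proof. rewrite <- Cmod_opp. f_equal. ring. Qed.

Lemma Cmod_triangle_inv (u v : C) : Cmod u <= Cmod v + Cmod (u - v).
Proof.
  replace u with (v + (u - v))%C at 1 by ring. apply Cmod_triangle.
Qed.

(** * Derivatives *)

(** Free of division and with a closed inequality, so that [h = 0] is covered and the statement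
    passes to complex values through the modulus. *)
Lemma is_derive_eps (g : R -> R) (s l : R) :
  is_derive g s l <->
  forall eps, 0 < eps -> exists d, 0 < d /\ forall h, Rabs h < d ->
    Rabs (g (s + h) - g s - l * h) <= eps * Rabs h.
Proof.
  rewrite is_derive_Reals. split.
  - intros H eps He. destruct (H eps He) as [d Hd].
    exists d; split; [apply cond_pos|]. intros h Hh.
    destruct (Req_dec h 0) as [->|Hn].
    + rewrite Rplus_0_r, Rabs_R0. replace (_ - _ - _) with 0 by ring. rewrite Rabs_R0; lra.
    + specialize (Hd h Hn Hh).
      replace (g (s + h) - g s - l * h) with (((g (s + h) - g s) / h - l) * h) by (field; exact Hn).
      rewrite Rabs_mult. apply Rmult_le_compat_r; [apply Rabs_pos|lra].
  - intros H eps He. destruct (H (eps / 2)) as [d [Hd0 Hd]]; [lra|].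
    exists (mkposreal d Hd0). intros h Hn Hh. specialize (Hd h Hh).
    replace ((g (s + h) - g s) / h - l) with ((g (s + h) - g s - l * h) / h) by (field; exact Hn).
    unfold Rdiv. rewrite Rabs_mult, Rabs_inv.
    assert (0 < Rabs h) by now apply Rabs_pos_lt.
    apply Rle_lt_trans with (eps / 2 * Rabs h * / Rabs h).
    + apply Rmult_le_compat_r; [left; now apply Rinv_0_lt_compat|exact Hd].
    + field_simplify; lra.
Qed.

(** Componentwise, so that sums, products and exponentials reduce to real calculus; [Cder_eps] is
    the modulus form used for compositions. *)
Definition Cder (f : R -> C) (s : R) (l : C) : Prop :=
  is_derive (fun u => Re (f u)) s (Re l) /\ is_derive (fun u => Im (f u)) s (Im l).

Lemma Cder_eps (f : R -> C) (s : R) (l : C) :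
  Cder f s l <->
  forall eps, 0 < eps -> exists d, 0 < d /\ forall h, Rabs h < d ->
    Cmod (f (s + h)%R - f s - l * h) <= eps * Rabs h.
Proof.
  unfold Cder; rewrite !is_derive_eps. split.
  - intros [H1 H2] eps He.
    destruct (H1 (eps / 2)) as [d1 [Hd1 K1]]; [lra|].
    destruct (H2 (eps / 2)) as [d2 [Hd2 K2]]; [lra|].
    exists (Rmin d1 d2). split; [now apply Rmin_pos|].
    intros h Hh.
    specialize (K1 h (Rlt_le_trans _ _ _ Hh (Rmin_l _ _))).
    specialize (K2 h (Rlt_le_trans _ _ _ Hh (Rmin_r _ _))).
    eapply Rle_trans; [apply Cmod_le_Re_Im|].
    replace (Re _) with (Re (f (s + h)) - Re (f s) - Re l * h) by (unfold Re; simpl; ring).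
    replace (Im _) with (Im (f (s + h)) - Im (f s) - Im l * h) by (unfold Im; simpl; ring).
    lra.
  - intros H; split; intros eps He; destruct (H eps He) as [d [Hd K]]; exists d; split; try exact Hd;
    intros h Hh; specialize (K h Hh); eapply Rle_trans; [|exact K| |exact K].
    + replace (Re (f (s + h)) - Re (f s) - Re l * h) with (Re (f (s + h)%R - f s - l * h)) by (unfold Re; simpl; ring).
      apply re_le_Cmod.
    + replace (Im (f (s + h)) - Im (f s) - Im l * h) with (Im (f (s + h)%R - f s - l * h)) by (unfold Im; simpl; ring).
      apply Im_le_Cmod.
Qed.

(** A quadratic remainder is stronger than complex differentiability. A convergent power series
    supplies it inside its disc, and it makes the chain rule a direct estimate. *)
Definition Cdiff (F : C -> C) (t l : C) : Prop :=
  exists K d, 0 < d /\ forall h, Cmod h < d ->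
    Cmod (F (t + h)%C - F t - l * h) <= K * (Cmod h * Cmod h).

Lemma Cdiff_Lipschitz (F : C -> C) (t l : C) :
  Cdiff F t l -> exists K d, 0 < K /\ 0 < d /\ forall h, Cmod h < d ->
    Cmod (F (t + h)%C - F t)%C <= K * Cmod h.
Proof.
  intros [K [d [Hd H]]].
  exists (Rabs K + Cmod l + 1), (Rmin d 1).
  assert (H0 := Cmod_ge_0 l). assert (H1 := Rabs_pos K).
  repeat split; [lra|now apply Rmin_pos; lra|].
  intros h Hh.
  assert (Hh1 : Cmod h < d) by (eapply Rlt_le_trans; [exact Hh|apply Rmin_l]).
  assert (Hh2 : Cmod h < 1) by (eapply Rlt_le_trans; [exact Hh|apply Rmin_r]).
  specialize (H h Hh1).
  assert (Hp := Cmod_ge_0 h).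
  eapply Rle_trans; [apply (Cmod_triangle_inv _ (l * h)%C)|].
  rewrite Cmod_mult.
  assert (K * (Cmod h * Cmod h) <= Rabs K * Cmod h).
  { apply Rle_trans with (Rabs K * (Cmod h * Cmod h)).
    - apply Rmult_le_compat_r; [nra|apply Rle_abs].
    - apply Rmult_le_compat_l; [lra|nra]. }
  nra.
Qed.

Lemma Cder_comp (F : C -> C) (f : R -> C) (s : R) (l v : C) :
  Cdiff F (f s) l -> Cder f s v -> Cder (fun u => F (f u)) s (l * v).
Proof.
  intros [K [d [Hd H]]] Hf. apply Cder_eps. rewrite Cder_eps in Hf. intros eps He.
  set (A := Cmod v + 1). assert (HA : 1 <= A) by (unfold A; generalize (Cmod_ge_0 v); lra).
  (* The bound 1 gives [|k| <= A |h|] for the increment [k]; the other bound makes the linear error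
     [|l| e1] at most [eps / 2]. The second half of [eps] pays for the quadratic remainder. *)
  set (e1 := Rmin 1 (eps / 2 / (Cmod l + 1))).
  assert (Hl := Cmod_ge_0 l).
  assert (He1 : 0 < e1).
  { apply Rmin_pos; [lra|]. apply Rdiv_lt_0_compat; lra. }
  destruct (Hf e1 He1) as [d1 [Hd1 H1]].
  set (K' := Rabs K + 1). assert (HK : 0 < K') by (unfold K'; generalize (Rabs_pos K); lra).
  set (d2 := Rmin d1 (Rmin (d / A) (eps / 2 / (K' * A * A)))).
  assert (HKA : 0 < K' * A * A) by (repeat apply Rmult_lt_0_compat; lra).
  exists d2. split.
  { unfold d2. repeat apply Rmin_pos; try lra; apply Rdiv_lt_0_compat; lra. }
  intros h Hh.
  assert (Hh1 : Rabs h < d1) by (eapply Rlt_le_trans; [exact Hh|apply Rmin_l]).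
  assert (Hh2 : Rabs h < d / A).
  { eapply Rlt_le_trans; [exact Hh|]. eapply Rle_trans; [apply Rmin_r|apply Rmin_l]. }
  assert (Hh3 : Rabs h < eps / 2 / (K' * A * A)).
  { eapply Rlt_le_trans; [exact Hh|]. eapply Rle_trans; [apply Rmin_r|apply Rmin_r]. }
  assert (Hp := Rabs_pos h).
  specialize (H1 h Hh1). set (k := (f (s + h)%R - f s)%C) in *.
  assert (Hk : Cmod k <= A * Rabs h).
  { eapply Rle_trans; [apply (Cmod_triangle_inv _ (v * h)%C)|].
    rewrite Cmod_mult, Cmod_R. unfold A.
    assert (e1 * Rabs h <= 1 * Rabs h) by (apply Rmult_le_compat_r; [lra|apply Rmin_l]).
    lra. }
  assert (Hkd : Cmod k < d).
  { eapply Rle_lt_trans; [exact Hk|].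
    apply Rmult_lt_reg_r with (/ A); [apply Rinv_0_lt_compat; lra|].
    unfold Rdiv in Hh2. rewrite Rmult_comm, <- Rmult_assoc, Rinv_l, Rmult_1_l; lra. }
  specialize (H k Hkd).
  replace (f s + k)%C with (f (s + h)%R) in H by (unfold k; ring).
  eapply Rle_trans; [apply (Cmod_triangle_inv _ (F (f (s + h)%R) - F (f s) - l * k)%C)|].
  replace (F (f (s + h)%R) - F (f s) - l * v * h - (F (f (s + h)%R) - F (f s) - l * k))%C
    with (l * (k - v * h))%C by ring.
  rewrite Cmod_mult.
  assert (HB : Cmod l * Cmod (k - v * h)%C <= eps / 2 * Rabs h).
  { apply Rle_trans with (Cmod l * (e1 * Rabs h)); [apply Rmult_le_compat_l; lra|].
    assert (Cmod l * e1 <= eps / 2).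
    { apply Rle_trans with ((Cmod l + 1) * (eps / 2 / (Cmod l + 1))).
      - apply Rmult_le_compat; try lra. apply Rmin_r.
      - right. field. lra. }
    nra. }
  assert (HC : K * (Cmod k * Cmod k) <= eps / 2 * Rabs h).
  { assert (Hk0 := Cmod_ge_0 k).
    apply Rle_trans with (K' * ((A * Rabs h) * (A * Rabs h))).
    - apply Rle_trans with (K' * (Cmod k * Cmod k)).
      + apply Rmult_le_compat_r; [nra|]. unfold K'. generalize (Rle_abs K); lra.
      + apply Rmult_le_compat_l; [lra|]. apply Rmult_le_compat; lra.
    - assert (K' * A * A * Rabs h <= eps / 2).
      { apply Rlt_le. apply Rmult_lt_reg_r with (/ (K' * A * A)); [now apply Rinv_0_lt_compat|].
        unfold Rdiv in Hh3. rewrite Rmult_comm, <- Rmult_assoc, Rinv_l, Rmult_1_l; lra. }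
      nra. }
  lra.
Qed.

Lemma Cder_ext (f g : R -> C) (s : R) (l : C) :
  (forall u, f u = g u) -> Cder f s l -> Cder g s l.
Proof. intros H [H1 H2]; split; (eapply is_derive_ext; [|eassumption]); intros u; simpl; now rewrite H. Qed.

Lemma Cder_ext_loc (f g : R -> C) (s : R) (l : C) (d : R) : 0 < d ->
  (forall u, Rabs (u - s) < d -> f u = g u) -> Cder f s l -> Cder g s l.
Proof.
  intros Hd H [H1 H2]; split; (eapply is_derive_ext_loc; [|eassumption]);
  exists (mkposreal d Hd); intros u Hu; simpl; (rewrite H; [reflexivity|]); exact Hu.
Qed.

Lemma Cder_val (f : R -> C) (s : R) (l l' : C) : l = l' -> Cder f s l -> Cder f s l'.
Proof. intros ->; auto. Qed.

Lemma Cder_const (c : C) (s : R) : Cder (fun _ => c) s 0.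
Proof. split; simpl; apply (@is_derive_const R_AbsRing). Qed.

Lemma Cder_RtoC (g : R -> R) (s l : R) : is_derive g s l -> Cder (fun u => RtoC (g u)) s l.
Proof. intros H; split; simpl; [exact H|apply (@is_derive_const R_AbsRing)]. Qed.

Lemma Cder_id (s : R) : Cder (fun u => RtoC u) s 1.
Proof. apply Cder_RtoC. apply (@is_derive_id R_AbsRing). Qed.

Lemma Cder_plus (f g : R -> C) (s : R) (l m : C) :
  Cder f s l -> Cder g s m -> Cder (fun u => f u + g u)%C s (l + m).
Proof.
  intros [A B] [A' B']; split; simpl; [apply (is_derive_plus _ _ _ _ _ A A')|apply (is_derive_plus _ _ _ _ _ B B')].
Qed.

Lemma Cder_opp (f : R -> C) (s : R) (l : C) :
  Cder f s l -> Cder (fun u => - f u)%C s (- l).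
Proof.
  intros [A B]; split; simpl; [apply (is_derive_opp _ _ _ A)|apply (is_derive_opp _ _ _ B)].
Qed.

Lemma Cder_minus (f g : R -> C) (s : R) (l m : C) :
  Cder f s l -> Cder g s m -> Cder (fun u => f u - g u)%C s (l - m).
Proof. intros A B. apply Cder_plus; [|apply Cder_opp]; assumption. Qed.

Lemma Cder_mult (f g : R -> C) (s : R) (l m : C) :
  Cder f s l -> Cder g s m -> Cder (fun u => f u * g u)%C s (l * g s + f s * m).
Proof.
  intros [A B] [A' B']; split; simpl.
  - replace (_ + _) with (minus (plus (Re l * Re (g s)) (Re (f s) * Re m)) (plus (Im l * Im (g s)) (Im (f s) * Im m)))
      by (unfold minus, plus, opp, Re, Im; simpl; ring).
    apply (is_derive_minus (fun u => Re (f u) * Re (g u)) (fun u => Im (f u) * Im (g u)));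
    [apply (is_derive_mult _ _ _ _ _ A A')|apply (is_derive_mult _ _ _ _ _ B B')]; intros; apply Rmult_comm.
  - replace (_ + _) with (plus (plus (Re l * Im (g s)) (Re (f s) * Im m)) (plus (Im l * Re (g s)) (Im (f s) * Re m)))
      by (unfold minus, plus, opp, Re, Im; simpl; ring).
    apply (is_derive_plus (fun u => Re (f u) * Im (g u)) (fun u => Im (f u) * Re (g u)));
    [apply (is_derive_mult _ _ _ _ _ A B')|apply (is_derive_mult _ _ _ _ _ B A')]; intros; apply Rmult_comm.
Qed.

Lemma Cder_scal (c : C) (f : R -> C) (s : R) (l : C) :
  Cder f s l -> Cder (fun u => c * f u)%C s (c * l).
Proof.
  intros A. eapply Cder_val; [|apply (Cder_mult _ _ _ _ _ (Cder_const c s) A)]. simpl; ring.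
Qed.

Lemma Cder_exp (f : R -> C) (s : R) (l : C) :
  Cder f s l -> Cder (fun u => Cexp (f u)) s (l * Cexp (f s)).
Proof.
  assert (HC : forall (g h : R -> R) a b, is_derive g s a -> is_derive h s b ->
    is_derive (fun u => exp (g u) * cos (h u)) s (a * (exp (g s) * cos (h s)) - b * (exp (g s) * sin (h s))) /\
    is_derive (fun u => exp (g u) * sin (h u)) s (a * (exp (g s) * sin (h s)) + b * (exp (g s) * cos (h s)))).
  { intros g h a b A B.
    assert (A' : ex_derive g s) by (eexists; exact A).
    assert (B' : ex_derive h s) by (eexists; exact B).
    apply is_derive_unique in A. apply is_derive_unique in B.
    split; auto_derive; auto; rewrite <- A, <- B;
    change (fun x => g x) with g; change (fun x => h x) with h; ring. }
  intros [A B]. exact (HC _ _ _ _ A B).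
Qed.

Lemma Cder_continuous (f : R -> C) (s : R) (l : C) :
  Cder f s l -> continuous (U := C_UniformSpace) f s.
Proof.
  intros [A B].
  assert (A' := ex_derive_continuous _ s (ex_intro _ _ A)).
  assert (B' := ex_derive_continuous _ s (ex_intro _ _ B)).
  apply (continuous_ext (fun u => (Re (f u), Im (f u)))).
  - intros; symmetry; apply surjective_pairing.
  - apply (continuous_comp_2 (fun u => Re (f u)) (fun u => Im (f u)) (fun x y => (x, y))); try assumption.
    apply (continuous_ext (fun z : R * R => z)); [intros []; reflexivity|apply continuous_id].
Qed.

(** Mean value inequality, tested against the fixed direction of [f b - f a]. *)
Lemma Cder_mean_value (f f' : R -> C) (g g' : R -> R) (a b : R) : a <= b ->
  (forall s, a <= s <= b -> Cder f s (f' s)) ->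
  (forall s, a <= s <= b -> is_derive g s (g' s)) ->
  (forall s, a <= s <= b -> Cmod (f' s) <= g' s) ->
  Cmod (f b - f a) <= g b - g a.
Proof.
  intros Hab Hf Hg Hb.
  set (w := (f b - f a)%C). set (M := Cmod w).
  (* Without a direction to test against, only [g a <= g b] remains to be shown. *)
  destruct (Req_dec M 0) as [H0|H0].
  { rewrite H0. destruct (MVT_gen g a b g') as [c [Hc E]].
    - intros s Hs. apply Hg. rewrite Rmin_left, Rmax_right in Hs by lra. lra.
    - intros s Hs. rewrite Rmin_left, Rmax_right in Hs by lra.
      apply derivable_continuous_pt. exists (g' s). apply is_derive_Reals. apply Hg; lra.
    - rewrite Rmin_left, Rmax_right in Hc by lra. rewrite E.
      apply Rmult_le_pos; [|lra]. eapply Rle_trans; [apply Cmod_ge_0|apply Hb; lra]. }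
  assert (HM : 0 < M) by (generalize (Cmod_ge_0 w); unfold M in *; lra).
  (* [M g] minus the real inner product of [w] with [f] is nondecreasing by Cauchy-Schwarz, and its
     increment is [M (g b - g a) - M^2]. *)
  set (phi := fun s => M * g s - (Re w * Re (f s) + Im w * Im (f s))).
  set (phi' := fun s => M * g' s - (Re w * Re (f' s) + Im w * Im (f' s))).
  assert (D : forall s, a <= s <= b -> is_derive phi s (phi' s)).
  { intros s Hs. destruct (Hf s Hs) as [A B]. assert (G := Hg s Hs).
    apply (is_derive_minus (fun s => M * g s) (fun s => Re w * Re (f s) + Im w * Im (f s))).
    - apply (is_derive_scal g); exact G.
    - apply (is_derive_plus (fun s => Re w * Re (f s)) (fun s => Im w * Im (f s)));
      [apply (is_derive_scal (fun s => Re (f s)))|apply (is_derive_scal (fun s => Im (f s)))]; assumption. }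
  assert (Hw : M * M = Re w * Re w + Im w * Im w).
  { assert (E := Cmod2_alt w). fold M in E. lra. }
  destruct (MVT_gen phi a b phi') as [c [Hc E]].
  - intros s Hs. apply D. rewrite Rmin_left, Rmax_right in Hs by lra. lra.
  - intros s Hs. rewrite Rmin_left, Rmax_right in Hs by lra.
    apply derivable_continuous_pt. exists (phi' s). apply is_derive_Reals. apply D; lra.
  - rewrite Rmin_left, Rmax_right in Hc by lra.
    assert (P : 0 <= phi' c).
    { unfold phi'. specialize (Hb c Hc).
      assert (Re w * Re (f' c) + Im w * Im (f' c) <= M * Cmod (f' c)).
      { eapply Rle_trans; [apply Rle_abs|].
        replace (Re w * Re (f' c) + Im w * Im (f' c)) with (Re (w * Cconj (f' c))%C) by (unfold Re, Im; simpl; ring).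
        eapply Rle_trans; [apply re_le_Cmod|]. rewrite Cmod_mult, Cmod_conj. apply Rle_refl. }
      assert (M * Cmod (f' c) <= M * g' c) by (apply Rmult_le_compat_l; lra). lra. }
    assert (Q : 0 <= phi b - phi a) by (rewrite E; apply Rmult_le_pos; lra).
    unfold phi in Q.
    assert (W : Re w * (Re (f b) - Re (f a)) + Im w * (Im (f b) - Im (f a)) = M * M).
    { rewrite Hw. unfold w, Re, Im; simpl. ring. }
    apply Rmult_le_reg_l with M; [exact HM|]. lra.
Qed.

Lemma Cder_zero_const (f : R -> C) (a b : R) : a <= b ->
  (forall s, a <= s <= b -> Cder f s 0) -> f b = f a.
Proof.
  intros Hab H.
  assert (E : Cmod (f b - f a) <= 0 - 0).
  { apply (Cder_mean_value f (fun _ => 0%C) (fun _ => 0) (fun _ => 0)); auto.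
    - intros; apply (@is_derive_const R_AbsRing).
    - intros; rewrite Cmod_0; lra. }
  assert (E2 : (f b - f a)%C = 0%C) by (apply Cmod_eq_0; generalize (Cmod_ge_0 (f b - f a)%C); lra).
  replace (f b) with (f b - f a + f a)%C by ring. rewrite E2. ring.
Qed.

(** * Finite sums *)

Fixpoint csum (f : nat -> C) (n : nat) : C :=
  match n with O => 0%C | S k => (csum f k + f k)%C end.

Lemma csum_ext (f g : nat -> C) (n : nat) :
  (forall k, (k < n)%nat -> f k = g k) -> csum f n = csum g n.
Proof. induction n; simpl; intros H; [reflexivity|]. rewrite IHn, H; auto. Qed.

Lemma csum_plus (f g : nat -> C) (n : nat) :
  csum (fun k => f k + g k)%C n = (csum f n + csum g n)%C.
Proof. induction n; simpl; [ring|]. rewrite IHn; ring. Qed.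

Lemma csum_scal (c : C) (f : nat -> C) (n : nat) :
  csum (fun k => c * f k)%C n = (c * csum f n)%C.
Proof. induction n; simpl; [ring|]. rewrite IHn; ring. Qed.

Lemma csum_zero (n : nat) : csum (fun _ => 0%C) n = 0%C.
Proof. induction n; simpl; [ring|]. rewrite IHn; ring. Qed.

Lemma csum_split_first (f : nat -> C) (n : nat) :
  csum f (S n) = (f 0%nat + csum (fun k => f (S k)) n)%C.
Proof. induction n; [simpl; ring|]. change (csum f (S (S n))) with (csum f (S n) + f (S n))%C. rewrite IHn; simpl; ring. Qed.

Lemma csum_add_range (f : nat -> C) (m n : nat) :
  csum f (m + n) = (csum f m + csum (fun k => f (m + k)%nat) n)%C.
Proof.
  induction n; [rewrite Nat.add_0_r; simpl; ring|].
  rewrite Nat.add_succ_r; simpl. rewrite IHn; ring.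
Qed.

Lemma csum_swap (f : nat -> nat -> C) (m n : nat) :
  csum (fun i => csum (f i) n) m = csum (fun j => csum (fun i => f i j) m) n.
Proof.
  induction m; simpl; [now rewrite csum_zero|]. rewrite IHm, <- csum_plus. reflexivity.
Qed.

Lemma Csum_range_csum (f : nat -> C) (m n : nat) :
  Csum_range f m n = csum (fun k => f (m + k)%nat) (S n - m).
Proof.
  unfold Csum_range. induction n as [|n IH].
  - destruct m; simpl.
    + rewrite sum_n_n. unfold zero; simpl. ring.
    + rewrite sum_n_m_zero by lia. reflexivity.
  - destruct (Nat.le_gt_cases m (S n)) as [H|H].
    + rewrite sum_n_Sm by lia. rewrite IH.
      replace (S (S n) - m)%nat with (S (S n - m)) by lia. cbn [csum].
      replace (m + (S n - m))%nat with (S n) by lia. reflexivity.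
    + rewrite sum_n_m_zero by lia. replace (S (S n) - m)%nat with 0%nat by lia. reflexivity.
Qed.

(** * Exponential remainder *)

Lemma Cmod_Cexp_le (w : C) : Cmod (Cexp w) <= exp (Cmod w).
Proof.
  rewrite Cmod_Cexp. destruct (Rle_lt_or_eq_dec (Re w) (Cmod w)) as [H| ->]; [|left; now apply exp_increasing|apply Rle_refl].
  eapply Rle_trans; [apply Rle_abs|apply re_le_Cmod].
Qed.

Lemma exp_le (x y : R) : x <= y -> exp x <= exp y.
Proof. intros [H| ->]; [left; now apply exp_increasing|apply Rle_refl]. Qed.

Lemma Cpow_0_l (n : nat) : (0 < n)%nat -> (0 ^ n)%C = 0%C.
Proof. destruct n; [lia|]. intros _. simpl. ring. Qed.

Lemma fact_C_neq_0 (n : nat) : RtoC (INR (fact n)) <> 0%C.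
Proof. intros H. apply RtoC_inj in H. now apply INR_fact_neq_0 in H. Qed.

Lemma INR_S_C_neq_0 (n : nat) : RtoC (INR (S n)) <> 0%C.
Proof. intros H. apply RtoC_inj in H. now apply (not_0_INR (S n)). Qed.

(** Along the segment [s w] the derivative of the remainder of order [N + 1] is [w] times the
    remainder of order [N], so the mean value inequality gives the bound by induction. The factor
    [1 / N!] is given up. *)
Lemma Cexp_remainder (w : C) (N : nat) :
  Cmod (Cexp w - csum (fun m => / INR (fact m) * w ^ m)%C N) <= Cmod w ^ N * exp (Cmod w).
Proof.
  cut (forall s, 0 <= s ->
    Cmod (Cexp (s * w) - csum (fun m => / INR (fact m) * (s * w) ^ m)%C N)
      <= s ^ N * (Cmod w ^ N * exp (s * Cmod w))).
  { intros H. specialize (H 1). rewrite pow1, !Rmult_1_l in H.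
    replace (RtoC 1 * w)%C with w in H by ring. apply H; lra. }
  induction N as [|N IH]; intros s Hs.
  - simpl. replace (Cexp (s * w) - 0)%C with (Cexp (s * w)) by ring.
    eapply Rle_trans; [apply Cmod_Cexp_le|]. rewrite Cmod_mult, Cmod_R, Rabs_right by lra. lra.
  - set (f := fun (u : R) => (Cexp (u * w) - csum (fun m => / INR (fact m) * (u * w) ^ m) (S N))%C).
    set (P := fun M (u : R) => csum (fun m => / INR (fact m) * (u * w) ^ m)%C M).
    assert (DP : forall M u, Cder (P (S M)) u (w * P M u)).
    { intros M u. induction M as [|M IHM].
      - eapply Cder_val; [|eapply Cder_ext; [|apply (Cder_const 1 u)]].
        + unfold P; simpl; ring.
        + intros v; unfold P; simpl. apply C_eq; simpl; field.
      - assert (DQ : forall n, Cder (fun v : R => (v * w) ^ n)%C u (INR n * w * (u * w) ^ (pred n))).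
        { induction n as [|n IHn].
          - simpl. eapply Cder_val; [|apply Cder_const]. ring.
          - eapply Cder_val; [|eapply Cder_ext; [|apply (Cder_mult (fun v : R => (v * w)%C) (fun v : R => ((v * w) ^ n)%C) u (1 * w))]].
            4: exact IHn.
            + rewrite S_INR, RtoC_plus. destruct n; simpl; ring.
            + intros v. now rewrite Cpow_S.
            + eapply Cder_val; [|apply Cder_mult; [apply Cder_id|apply Cder_const]]. cbv beta; ring. }
        eapply Cder_val; [|eapply Cder_ext; [|apply (Cder_plus _ _ _ _ _ IHM (Cder_scal (/ INR (fact (S M))) _ _ _ (DQ (S M))))]].
        + change (P (S M) u) with (P M u + / INR (fact M) * (u * w) ^ M)%C.
          change (pred (S M)) with M. rewrite fact_simpl, mult_INR, RtoC_mult.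
          field. split; [apply fact_C_neq_0|apply INR_S_C_neq_0].
        + intros v; reflexivity. }
    (* The part of [g'] that differentiates [u^(N+1)] carries a factor [N + 1 >= 1] and already
       dominates the induction bound. *)
    set (g := fun u => u ^ S N * (Cmod w ^ S N * exp (u * Cmod w))).
    set (g' := fun u => INR (S N) * u ^ N * (Cmod w ^ S N * exp (u * Cmod w)) + u ^ S N * (Cmod w ^ S N * (Cmod w * exp (u * Cmod w)))).
    assert (E : Cmod (f s - f 0) <= g s - g 0).
    { apply (Cder_mean_value f (fun u => w * (Cexp (u * w) - P N u))%C g g'); try exact Hs.
      - intros u Hu. eapply Cder_val; [|apply Cder_minus; [apply Cder_exp; apply (Cder_mult (fun v : R => RtoC v) (fun _ => w)); [apply Cder_id|apply Cder_const]|apply (DP N u)]].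
        cbv beta; ring.
      - intros u Hu. unfold g, g'. auto_derive; [exact I|]. destruct N; simpl; ring.
      - intros u [Hu _]. unfold g'. rewrite Cmod_mult. specialize (IH u Hu).
        assert (0 <= Cmod w) by apply Cmod_ge_0.
        assert (Hex := exp_pos (u * Cmod w)).
        assert (0 <= u ^ N) by now apply pow_le.
        assert (0 <= Cmod w ^ N) by now apply pow_le.
        apply Rle_trans with (Cmod w * (u ^ N * (Cmod w ^ N * exp (u * Cmod w)))).
        + apply Rmult_le_compat_l; assumption.
        + rewrite S_INR. simpl (_ ^ S N).
          assert (0 <= INR N) by apply pos_INR.
          assert (0 <= u ^ N * (Cmod w * Cmod w ^ N * exp (u * Cmod w))).
          { apply Rmult_le_pos; [assumption|]. apply Rmult_le_pos; [nra|lra]. }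
          assert (0 <= INR N * (u ^ N * (Cmod w * Cmod w ^ N * exp (u * Cmod w)))) by nra.
          assert (0 <= u * Cmod w * (u ^ N * (Cmod w * Cmod w ^ N * exp (u * Cmod w)))) by (apply Rmult_le_pos; nra).
          nra. }
    replace (f 0) with (RtoC 0) in E.
    + replace (g 0) with 0 in E by (unfold g; simpl; ring).
      rewrite Rminus_0_r in E. replace (f s - 0)%C with (f s) in E by ring. exact E.
    + unfold f. rewrite csum_split_first.
      replace (RtoC 0 * w)%C with (RtoC 0) by ring. rewrite Cexp_0.
      rewrite (csum_ext _ (fun _ => 0%C)).
      * rewrite csum_zero. apply C_eq; simpl; field.
      * intros k _. rewrite Cpow_0_l by lia. ring.
Qed.

Lemma Cdiff_Cexp (w : C) : Cdiff Cexp w (Cexp w).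
Proof.
  exists (exp (Re w) * exp 1), 1. split; [lra|]. intros h Hh.
  replace (Cexp (w + h) - Cexp w - Cexp w * h)%C with (Cexp w * (Cexp h - 1 - h))%C by (rewrite Cexp_plus; ring).
  rewrite Cmod_mult, Cmod_Cexp.
  assert (E := Cexp_remainder h 2).
  replace (Cexp h - csum (fun m => / INR (fact m) * h ^ m) 2)%C with (Cexp h - 1 - h)%C in E.
  - rewrite Rmult_assoc. apply Rmult_le_compat_l; [left; apply exp_pos|].
    eapply Rle_trans; [exact E|]. simpl. rewrite Rmult_1_r.
    rewrite Rmult_comm. apply Rmult_le_compat_r; [generalize (Cmod_ge_0 h); nra|].
    apply exp_le; lra.
  - simpl. apply C_eq; simpl; field.
Qed.

(** * Complex series *)

(** Componentwise, as for derivatives; [cser_iff] connects it with the complex convergence used in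
    the definitions. *)
Definition cser (u : nat -> C) (l : C) : Prop :=
  is_series (fun k => Re (u k)) (Re l) /\ is_series (fun k => Im (u k)) (Im l).

Lemma Re_sum_n (u : nat -> C) (n : nat) :
  Re (sum_n (G := C_AbelianMonoid) u n) = sum_n (fun k => Re (u k)) n.
Proof. induction n; [now rewrite !sum_O|]. rewrite !sum_Sn, <- IHn. reflexivity. Qed.

Lemma Im_sum_n (u : nat -> C) (n : nat) :
  Im (sum_n (G := C_AbelianMonoid) u n) = sum_n (fun k => Im (u k)) n.
Proof. induction n; [now rewrite !sum_O|]. rewrite !sum_Sn, <- IHn. reflexivity. Qed.

Lemma filterlim_C_components {T : Type} (F : (T -> Prop) -> Prop) {FF : Filter F} (f : T -> C) (l : C) :
  filterlim f F (locally (T := C_UniformSpace) l) <->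
  filterlim (fun x => Re (f x)) F (locally (Re l)) /\ filterlim (fun x => Im (f x)) F (locally (Im l)).
Proof.
  rewrite !filterlim_locally. split.
  - intros H. split; intros eps; (eapply filter_imp; [|apply (H eps)]); intros x Hx; apply Hx.
  - intros [H1 H2] eps. eapply filter_imp; [|apply (filter_and _ _ (H1 eps) (H2 eps))].
    intros x [A B]. split; assumption.
Qed.

Lemma cser_iff (u : nat -> C) (l : C) :
  is_series (K := C_AbsRing) (V := C_NormedModule) u l <-> cser u l.
Proof.
  unfold is_series, cser. etransitivity; [apply (filterlim_C_components eventually)|].
  assert (E1 : forall n, Re (sum_n (G := C_AbelianMonoid) u n) = sum_n (fun k => Re (u k)) n) by apply Re_sum_n.
  assert (E2 : forall n, Im (sum_n (G := C_AbelianMonoid) u n) = sum_n (fun k => Im (u k)) n) by apply Im_sum_n.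
  split; intros [A B]; split.
  - eapply filterlim_ext; [|exact A]. exact E1.
  - eapply filterlim_ext; [|exact B]. exact E2.
  - eapply filterlim_ext; [|exact A]. intros n; symmetry; apply E1.
  - eapply filterlim_ext; [|exact B]. intros n; symmetry; apply E2.
Qed.

Lemma is_series_R_unique (u : nat -> R) (l m : R) : is_series u l -> is_series u m -> l = m.
Proof. intros A B. apply is_series_unique in A. apply is_series_unique in B. congruence. Qed.

Lemma cser_unique (u : nat -> C) (l m : C) : cser u l -> cser u m -> l = m.
Proof. intros [A B] [A' B']. apply C_eq; eapply is_series_R_unique; eassumption. Qed.

Lemma Csum_cser (u : nat -> C) (l : C) : cser u l -> Csum u = l.
Proof.
  intros H. apply cser_iff in H. unfold Csum.
  apply (@iota_unique C_AbsRing C_CompleteNormedModule); [|exact H].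
  intros y Hy. apply cser_iff in Hy. apply cser_iff in H. eapply cser_unique; eassumption.
Qed.

Lemma cser_ext (u v : nat -> C) (l : C) : (forall k, u k = v k) -> cser u l -> cser v l.
Proof. intros E [A B]; split; (eapply is_series_ext; [|eassumption]); intros k; simpl; now rewrite E. Qed.

Lemma cser_val (u : nat -> C) (l m : C) : l = m -> cser u l -> cser u m.
Proof. intros ->; auto. Qed.

Lemma cser_plus (u v : nat -> C) (l m : C) :
  cser u l -> cser v m -> cser (fun k => u k + v k)%C (l + m).
Proof.
  intros [A B] [A' B']; split; [apply (is_series_plus _ _ _ _ A A')|apply (is_series_plus _ _ _ _ B B')].
Qed.

Lemma cser_scal (c : C) (u : nat -> C) (l : C) : cser u l -> cser (fun k => c * u k)%C (c * l).
Proof.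
  intros [A B]; split.
  - apply (is_series_minus _ _ _ _ (is_series_scal (Re c) _ _ A) (is_series_scal (Im c) _ _ B)).
  - apply (is_series_plus _ _ _ _ (is_series_scal (Re c) _ _ B) (is_series_scal (Im c) _ _ A)).
Qed.

Lemma cser_minus (u v : nat -> C) (l m : C) :
  cser u l -> cser v m -> cser (fun k => u k - v k)%C (l - m).
Proof.
  intros A B. apply (cser_scal (-1)) in B.
  eapply cser_val; [|eapply cser_ext; [|apply (cser_plus _ _ _ _ A B)]].
  - apply C_eq; simpl; ring.
  - intros k. apply C_eq; simpl; ring.
Qed.

Lemma cser_zero : cser (fun _ => 0%C) 0.
Proof.
  assert (Z : is_series (fun _ : nat => 0) 0).
  { apply (filterlim_ext (fun _ => 0)); [|apply filterlim_const].
    intros n. symmetry. apply (sum_n_m_const_zero (G := R_AbelianMonoid)). }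
  split; exact Z.
Qed.

Lemma cser_decr (u : nat -> C) (l : C) : cser (fun k => u (S k)) (l - u 0%nat) <-> cser u l.
Proof.
  split; intros [A B]; split.
  - apply is_series_decr_1. exact A.
  - apply is_series_decr_1. exact B.
  - apply (is_series_incr_1 (fun k => Re (u k))).
    replace (plus _ _) with (Re l); [exact A|]. unfold plus, Re; simpl; ring.
  - apply (is_series_incr_1 (fun k => Im (u k))).
    replace (plus _ _) with (Im l); [exact B|]. unfold plus, Im; simpl; ring.
Qed.

Definition CSeries (u : nat -> C) : C :=
  (Series (fun k => Re (u k)), Series (fun k => Im (u k))).

Lemma cser_abs (u : nat -> C) : ex_series (fun k => Cmod (u k)) -> cser u (CSeries u).
Proof.
  intros H. split; apply Series_correct; eapply (ex_series_le (K := R_AbsRing) (V := R_CompleteNormedModule)); try exact H;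
  intros k; [apply re_le_Cmod|apply Im_le_Cmod].
Qed.

(** Testing against the direction of [l] turns the claim into a comparison of two real series,
    [|l|^2 <= |l| B]. *)
Lemma cser_bound (u : nat -> C) (l : C) (b : nat -> R) (B : R) :
  cser u l -> (forall k, Cmod (u k) <= b k) -> is_series b B -> Cmod l <= B.
Proof.
  intros [H1 H2] Hb HB.
  set (M := Cmod l).
  assert (HM : 0 <= M) by apply Cmod_ge_0.
  assert (S1 : is_series (fun k => Re l * Re (u k) + Im l * Im (u k)) (M * M)).
  { replace (M * M) with (Re l * Re l + Im l * Im l) by (generalize (Cmod2_alt l); fold M; intros E; lra).
    apply (is_series_plus _ _ _ _ (is_series_scal (Re l) _ _ H1) (is_series_scal (Im l) _ _ H2)). }
  assert (S2 : is_series (fun k => M * b k) (M * B)) by apply (is_series_scal M _ _ HB).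
  assert (L : M * M <= M * B).
  { apply (filterlim_le (F := eventually) (sum_n (fun k => Re l * Re (u k) + Im l * Im (u k))) (sum_n (fun k => M * b k)) (M * M) (M * B)); try assumption.
    exists 0%nat. intros n _. apply sum_n_m_le. intros k.
    apply Rle_trans with (M * Cmod (u k)); [|apply Rmult_le_compat_l; auto].
    replace (Re l * Re (u k) + Im l * Im (u k)) with (Re (l * Cconj (u k))%C) by (unfold Re, Im; simpl; ring).
    eapply Rle_trans; [apply Rle_abs|]. eapply Rle_trans; [apply re_le_Cmod|].
    rewrite Cmod_mult, Cmod_conj. apply Rle_refl. }
  assert (HB0 : 0 <= B).
  { apply (filterlim_le (F := eventually) (fun _ => 0) (sum_n b) 0 B); try assumption.
    - exists 0%nat. intros n _. rewrite <- (sum_n_m_const_zero (G := R_AbelianMonoid) 0 n : _ = 0).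
      apply sum_n_m_le. intros k. eapply Rle_trans; [apply Cmod_ge_0|apply Hb].
    - apply filterlim_const. }
  destruct (Req_dec M 0) as [->|Hn]; [exact HB0|].
  apply Rmult_le_reg_l with M; lra.
Qed.

Lemma cser_terms_bounded (u : nat -> C) (l : C) : cser u l -> exists M, forall k, Cmod (u k) <= M.
Proof.
  intros [A B].
  assert (HH : forall v : nat -> R, ex_series v -> exists M, forall k, Rabs (v k) <= M).
  { intros v Hv. apply ex_series_lim_0 in Hv.
    assert (E : exists n, forall k, (n <= k)%nat -> Rabs (v k) <= 1).
    { apply is_lim_seq_spec in Hv. destruct (Hv (mkposreal 1 Rlt_0_1)) as [n Hn]. exists n.
      intros k Hk. specialize (Hn k Hk). simpl in Hn. rewrite Rminus_0_r in Hn. lra. }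
    destruct E as [n Hn].
    assert (E : exists M, forall k, (k < n)%nat -> Rabs (v k) <= M).
    { clear Hn. induction n as [|n [M HM]]; [exists 0; lia|].
      exists (Rmax M (Rabs (v n))). intros k Hk.
      destruct (Nat.eq_dec k n) as [->|]; [apply Rmax_r|].
      eapply Rle_trans; [apply HM; lia|apply Rmax_l]. }
    destruct E as [M HM]. exists (Rmax M 1). intros k.
    destruct (Nat.lt_ge_cases k n); [eapply Rle_trans; [now apply HM|apply Rmax_l]|eapply Rle_trans; [now apply Hn|apply Rmax_r]]. }
  destruct (HH _ (ex_intro _ _ A)) as [M1 H1]. destruct (HH _ (ex_intro _ _ B)) as [M2 H2].
  exists (M1 + M2). intros k. eapply Rle_trans; [apply Cmod_le_Re_Im|].
  specialize (H1 k); specialize (H2 k); lra.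
Qed.

Definition cconv (a b : nat -> C) (n : nat) : C :=
  csum (fun i => a i * b (n - i)%nat)%C (S n).

Lemma Re_csum (f : nat -> C) (n : nat) : Re (csum f (S n)) = sum_f_R0 (fun k => Re (f k)) n.
Proof. induction n; [unfold Re, Im; simpl; ring|]. change (csum f (S (S n))) with (csum f (S n) + f (S n))%C. simpl sum_f_R0. rewrite <- IHn. reflexivity. Qed.

Lemma Im_csum (f : nat -> C) (n : nat) : Im (csum f (S n)) = sum_f_R0 (fun k => Im (f k)) n.
Proof. induction n; [unfold Re, Im; simpl; ring|]. change (csum f (S (S n))) with (csum f (S n) + f (S n))%C. simpl sum_f_R0. rewrite <- IHn. reflexivity. Qed.

Lemma cser_mult (u v : nat -> C) (l m : C) :
  ex_series (fun k => Cmod (u k)) -> ex_series (fun k => Cmod (v k)) ->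
  cser u l -> cser v m -> cser (cconv u v) (l * m).
Proof.
  intros Hu Hv [A B] [A' B'].
  assert (DR : forall w, ex_series (fun k => Cmod (w k)) -> ex_series (fun k => Rabs (Re (w k)))).
  { intros w Hw. eapply (ex_series_le (K := R_AbsRing) (V := R_CompleteNormedModule)); [|exact Hw]. intros k. unfold norm; simpl. unfold abs; simpl.
    rewrite Rabs_Rabsolu. apply re_le_Cmod. }
  assert (DI : forall w, ex_series (fun k => Cmod (w k)) -> ex_series (fun k => Rabs (Im (w k)))).
  { intros w Hw. eapply (ex_series_le (K := R_AbsRing) (V := R_CompleteNormedModule)); [|exact Hw]. intros k. unfold norm; simpl. unfold abs; simpl.
    rewrite Rabs_Rabsolu. apply Im_le_Cmod. }
  split.
  - eapply is_series_ext; [|apply (is_series_minus _ _ _ _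
      (is_series_mult _ _ _ _ A A' (DR _ Hu) (DR _ Hv)) (is_series_mult _ _ _ _ B B' (DI _ Hu) (DI _ Hv)))].
    intros n. unfold cconv. rewrite Re_csum.
    unfold plus, opp; simpl.
    match goal with |- ?x + - ?y = ?z => change (x - y = z) end.
    rewrite <- minus_sum. apply sum_eq. intros i _. unfold Re, Im; simpl; ring.
  - eapply is_series_ext; [|apply (is_series_plus _ _ _ _
      (is_series_mult _ _ _ _ A B' (DR _ Hu) (DI _ Hv)) (is_series_mult _ _ _ _ B A' (DI _ Hu) (DR _ Hv)))].
    intros n. unfold cconv. rewrite Im_csum.
    unfold plus; simpl. rewrite <- plus_sum. apply sum_eq. intros i _. unfold Re, Im; simpl; ring.
Qed.

(** * Power series *)

(** Terms bounded at every radius below [R0]: the radius of convergence is at least [R0], phrased so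
    that it can be verified for coefficients given by a recursion. *)
Definition geo (R0 : R) (a : nat -> C) : Prop :=
  forall r, 0 <= r < R0 -> exists M, forall k, Cmod (a k) * r ^ k <= M.

(** The function is a parameter rather than the sum [CPS a], since most functions met here are given
    by closed formulas. *)
Definition psr (R0 : R) (a : nat -> C) (f : C -> C) : Prop :=
  forall t, Cmod t < R0 -> cser (fun k => a k * t ^ k)%C (f t).

Definition CPS (a : nat -> C) (t : C) : C := CSeries (fun k => a k * t ^ k)%C.

Definition PS (R0 : R) (f : C -> C) : Prop := exists a, psr R0 a f.

(** Abel's lemma: convergence at a single point, later a point of the contour, yields a disc of
    convergence. *)
Lemma geo_of_point (a : nat -> C) (t l : C) : cser (fun k => a k * t ^ k)%C l -> geo (Cmod t) a.
Proof.
  intros H r Hr. destruct (cser_terms_bounded _ _ H) as [M HM]. exists M. intros k.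
  eapply Rle_trans; [|apply (HM k)]. rewrite Cmod_mult, Cmod_pow.
  apply Rmult_le_compat_l; [apply Cmod_ge_0|]. apply pow_incr; lra.
Qed.

Lemma psr_geo (R0 : R) (a : nat -> C) (f : C -> C) : psr R0 a f -> geo R0 a.
Proof.
  intros H r Hr.
  destruct (geo_of_point a (RtoC ((r + R0) / 2)) (f (RtoC ((r + R0) / 2)))) with (r := r) as [M HM].
  - apply H. rewrite Cmod_R, Rabs_right; lra.
  - rewrite Cmod_R, Rabs_right; lra.
  - exists M; exact HM.
Qed.

Lemma ex_series_geo_bound (u : nat -> R) (M q : R) : 0 <= q < 1 ->
  (forall k, Rabs (u k) <= M * q ^ k) -> ex_series u.
Proof.
  intros Hq H. apply (ex_series_le (K := R_AbsRing) (V := R_CompleteNormedModule) u (fun k => M * q ^ k)).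
  - exact H.
  - exists (M * / (1 - q)). apply (is_series_scal M (fun k => q ^ k)). apply is_series_geom. rewrite Rabs_right; lra.
Qed.

(** Comparison with the geometric series of ratio [r / r'], where [r'] lies midway between [r] and
    [R0]. *)
Lemma geo_abs (R0 : R) (a : nat -> C) (r : R) : geo R0 a -> 0 <= r < R0 ->
  ex_series (fun k => Cmod (a k) * r ^ k).
Proof.
  intros H Hr. destruct (H ((r + R0) / 2)) as [M HM]; [lra|].
  set (r' := (r + R0) / 2) in *. assert (Hr' : 0 < r' /\ r < r') by (unfold r'; lra).
  apply (ex_series_geo_bound _ M (r / r')).
  - split; [apply Rdiv_le_0_compat; lra|]. apply Rmult_lt_reg_r with r'; [lra|]. field_simplify; lra.
  - intros k. rewrite Rabs_right.
    + specialize (HM k). unfold Rdiv. rewrite Rpow_mult_distr, pow_inv.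
      assert (P : 0 < r' ^ k) by (apply pow_lt; lra).
      assert (P2 : 0 <= r ^ k) by (apply pow_le; lra).
      apply Rmult_le_reg_r with (r' ^ k); [exact P|].
      replace (M * (r ^ k * / r' ^ k) * r' ^ k) with (M * r ^ k) by (field; lra).
      replace (Cmod (a k) * r ^ k * r' ^ k) with ((Cmod (a k) * r' ^ k) * r ^ k) by ring.
      apply Rmult_le_compat_r; assumption.
    + apply Rle_ge, Rmult_le_pos; [apply Cmod_ge_0|apply pow_le; lra].
Qed.

Lemma geo_abs_C (R0 : R) (a : nat -> C) (t : C) : geo R0 a -> Cmod t < R0 ->
  ex_series (fun k => Cmod (a k * t ^ k)%C).
Proof.
  intros H Ht. eapply ex_series_ext; [|apply (geo_abs R0 a (Cmod t) H)].
  - intros k. simpl. now rewrite Cmod_mult, Cmod_pow.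
  - split; [apply Cmod_ge_0|exact Ht].
Qed.

Lemma geo_psr (R0 : R) (a : nat -> C) : geo R0 a -> psr R0 a (CPS a).
Proof. intros H t Ht. apply cser_abs. eapply geo_abs_C; eassumption. Qed.

Lemma psr_ext (R0 : R) (a : nat -> C) (f g : C -> C) :
  (forall t, Cmod t < R0 -> f t = g t) -> psr R0 a f -> psr R0 a g.
Proof. intros E H t Ht. rewrite <- E by assumption. now apply H. Qed.

Lemma psr_le (R0 R1 : R) (a : nat -> C) (f : C -> C) : R1 <= R0 -> psr R0 a f -> psr R1 a f.
Proof. intros E H t Ht. apply H; lra. Qed.

Lemma PS_ext (R0 : R) (f g : C -> C) :
  (forall t, Cmod t < R0 -> f t = g t) -> PS R0 f -> PS R0 g.
Proof. intros E [a H]. exists a. eapply psr_ext; eassumption. Qed.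

Lemma PS_le (R0 R1 : R) (f : C -> C) : R1 <= R0 -> PS R0 f -> PS R1 f.
Proof. intros E [a H]. exists a. eapply psr_le; eassumption. Qed.

Lemma psr_plus (R0 : R) (a b : nat -> C) (f g : C -> C) :
  psr R0 a f -> psr R0 b g -> psr R0 (fun k => a k + b k)%C (fun t => f t + g t)%C.
Proof.
  intros A B t Ht. eapply cser_ext; [|apply (cser_plus _ _ _ _ (A t Ht) (B t Ht))]. intros k; simpl; ring.
Qed.

Lemma psr_scal (R0 : R) (c : C) (a : nat -> C) (f : C -> C) :
  psr R0 a f -> psr R0 (fun k => c * a k)%C (fun t => c * f t)%C.
Proof.
  intros A t Ht. eapply cser_ext; [|apply (cser_scal c _ _ (A t Ht))]. intros k; simpl; ring.
Qed.

Lemma psr_mult (R0 : R) (a b : nat -> C) (f g : C -> C) :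
  psr R0 a f -> psr R0 b g -> psr R0 (cconv a b) (fun t => f t * g t)%C.
Proof.
  intros A B t Ht. eapply cser_ext; [|apply cser_mult; [| |apply (A t Ht)|apply (B t Ht)]].
  - intros n. unfold cconv. rewrite Cmult_comm, <- csum_scal. apply csum_ext. intros i Hi.
    replace (t ^ n)%C with (t ^ i * t ^ (n - i))%C; [ring|].
    rewrite <- Cpow_add_r. f_equal. lia.
  - eapply geo_abs_C; [eapply psr_geo; eassumption|exact Ht].
  - eapply geo_abs_C; [eapply psr_geo; eassumption|exact Ht].
Qed.

Lemma cser_first (u : nat -> C) : (forall k, u (S k) = 0%C) -> cser u (u 0%nat).
Proof.
  intros H. apply cser_decr. eapply cser_val; [|eapply cser_ext; [|apply cser_zero]].
  - ring.
  - intros k; simpl; now rewrite H.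
Qed.

Lemma psr_const (R0 : R) (c : C) : psr R0 (fun k => match k with O => c | _ => 0%C end) (fun _ => c).
Proof.
  intros t Ht. eapply cser_val; [|apply cser_first].
  - simpl; ring.
  - intros k; simpl; ring.
Qed.

Lemma psr_shift (R0 : R) (a : nat -> C) (f : C -> C) :
  psr R0 a f -> psr R0 (fun k => match k with O => 0%C | S j => a j end) (fun t => t * f t)%C.
Proof.
  intros H t Ht. apply cser_decr. eapply cser_val; [|eapply cser_ext; [|apply (cser_scal t _ _ (H t Ht))]].
  - simpl; ring.
  - intros k; simpl; ring.
Qed.

Lemma psr_unshift (R0 : R) (a : nat -> C) (f : C -> C) : psr R0 a f ->
  psr R0 (fun k => a (S k)) (CPS (fun k => a (S k))) /\
  forall t, Cmod t < R0 -> f t = (a 0%nat + t * CPS (fun k => a (S k)) t)%C.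
Proof.
  intros H.
  assert (G : psr R0 (fun k => a (S k)) (CPS (fun k => a (S k)))).
  { apply geo_psr. intros r Hr. assert (G := psr_geo _ _ _ H).
    destruct (Req_dec r 0) as [->|Hn].
    - exists (Cmod (a 1%nat)). intros k. destruct k; simpl; [lra|]. rewrite Rmult_0_l, Rmult_0_r. apply Cmod_ge_0.
    - destruct (G r Hr) as [M HM]. exists (M / r). intros k. specialize (HM (S k)). simpl in HM.
      apply Rmult_le_reg_r with r; [lra|]. replace (M / r * r) with M by (field; lra).
      eapply Rle_trans; [|exact HM]. right; ring. }
  split; [exact G|]. intros t Ht. eapply cser_unique; [apply (H t Ht)|].
  apply cser_decr. eapply cser_val; [|eapply cser_ext; [|apply (cser_scal t _ _ (G t Ht))]].
  - simpl; ring.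
  - intros k; simpl; ring.
Qed.

Lemma psr_at_0 (R0 : R) (a : nat -> C) (f : C -> C) : 0 < R0 -> psr R0 a f -> f 0%C = a 0%nat.
Proof.
  intros HR H. destruct (psr_unshift _ _ _ H) as [_ E]. rewrite E by (rewrite Cmod_0; exact HR). ring.
Qed.

Lemma PS_plus (R0 : R) (f g : C -> C) : PS R0 f -> PS R0 g -> PS R0 (fun t => f t + g t)%C.
Proof. intros [a A] [b B]; eexists; apply psr_plus; eassumption. Qed.

Lemma PS_scal (R0 : R) (c : C) (f : C -> C) : PS R0 f -> PS R0 (fun t => c * f t)%C.
Proof. intros [a A]; eexists; apply psr_scal; eassumption. Qed.

Lemma PS_mult (R0 : R) (f g : C -> C) : PS R0 f -> PS R0 g -> PS R0 (fun t => f t * g t)%C.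
Proof. intros [a A] [b B]; eexists; apply psr_mult; eassumption. Qed.

Lemma PS_const (R0 : R) (c : C) : PS R0 (fun _ => c).
Proof. eexists; apply psr_const. Qed.

Lemma PS_id (R0 : R) : PS R0 (fun t => t).
Proof.
  apply (PS_ext _ (fun t => t * 1)%C); [intros; ring|]. eexists. apply psr_shift. apply psr_const.
Qed.

Lemma PS_pow (R0 : R) (f : C -> C) (n : nat) : PS R0 f -> PS R0 (fun t => f t ^ n)%C.
Proof. intros H. induction n; [exact (PS_const R0 1)|]. apply (PS_ext _ (fun t => f t * f t ^ n)%C); [reflexivity|]. now apply PS_mult. Qed.

Lemma PS_unshift (R0 : R) (f : C -> C) : 0 < R0 -> PS R0 f ->
  exists g, PS R0 g /\ forall t, Cmod t < R0 -> f t = (f 0%C + t * g t)%C.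
Proof.
  intros HR [a H]. destruct (psr_unshift _ _ _ H) as [G E].
  exists (CPS (fun k => a (S k))). split; [eexists; exact G|].
  intros t Ht. rewrite (psr_at_0 _ _ _ HR H). auto.
Qed.

Lemma PS_bounded (R0 : R) (f : C -> C) (r : R) : r < R0 -> PS R0 f ->
  exists M, 0 < M /\ forall t, Cmod t <= r -> Cmod (f t) <= M.
Proof.
  intros Hr [a H]. destruct (Rlt_le_dec r 0) as [Hn|Hp].
  { exists 1. split; [lra|]. intros t Ht. generalize (Cmod_ge_0 t); lra. }
  destruct (geo_abs R0 a r (psr_geo _ _ _ H) (conj Hp Hr)) as [B HB].
  exists (Rabs B + 1). split; [generalize (Rabs_pos B); lra|]. intros t Ht.
  apply Rle_trans with B; [|generalize (Rle_abs B); lra].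
  eapply cser_bound; [apply (H t); lra| |exact HB].
  intros k. cbv beta. rewrite Cmod_mult, Cmod_pow. apply Rmult_le_compat_l; [apply Cmod_ge_0|].
  apply pow_incr. split; [apply Cmod_ge_0|exact Ht].
Qed.


Definition dcoef (a : nat -> C) (k : nat) : C := (INR (S k) * a (S k))%C.

(** Bernoulli's inequality for [1 / q = 1 + d] gives [k q^k <= 1 / d]. *)
Lemma pow_mult_bounded (q : R) : 0 <= q < 1 -> exists M, forall k, INR (S k) * q ^ k <= M.
Proof.
  intros Hq. destruct (Req_dec q 0) as [->|Hn].
  { exists 1. intros [|k]; simpl; [lra|]. rewrite Rmult_0_l, Rmult_0_r; lra. }
  set (d := / q - 1).
  assert (Hd : 0 < d).
  { unfold d. apply Rlt_Rminus. rewrite <- Rinv_1. apply Rinv_lt_contravar; lra. }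
  exists (1 + / d). intros k.
  assert (B : 1 + INR k * d <= (/ q) ^ k).
  { replace (/ q) with (1 + d) by (unfold d; ring). clear - Hd. induction k as [|k IH]; [simpl; lra|].
    rewrite S_INR. simpl ((1 + d) ^ S k). assert (0 <= INR k) by apply pos_INR.
    apply Rle_trans with ((1 + d) * (1 + INR k * d)); [nra|]. apply Rmult_le_compat_l; lra. }
  assert (Q : 0 < q ^ k) by (apply pow_lt; lra).
  assert (E : q ^ k * (/ q) ^ k = 1) by (rewrite <- Rpow_mult_distr, Rinv_r, pow1; lra).
  assert (K : q ^ k * (1 + INR k * d) <= 1) by (rewrite <- E; apply Rmult_le_compat_l; lra).
  assert (0 <= INR k) by apply pos_INR.
  assert (q ^ k <= 1) by (rewrite <- (pow1 k); apply pow_incr; lra).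
  assert (INR k * q ^ k <= / d).
  { apply Rmult_le_reg_r with d; [exact Hd|]. rewrite Rinv_l by lra. nra. }
  rewrite S_INR. lra.
Qed.

(** The factor [k + 1] is absorbed by passing to a slightly larger radius. *)
Lemma geo_dcoef (R0 : R) (a : nat -> C) : geo R0 a -> geo R0 (dcoef a).
Proof.
  intros H r Hr. set (r' := (r + R0) / 2). assert (Hr' : 0 < r' /\ r < r' < R0) by (unfold r'; lra).
  destruct (H r') as [M HM]; [lra|].
  assert (Hq : 0 <= r / r' < 1).
  { split; [apply Rdiv_le_0_compat; lra|]. apply Rmult_lt_reg_r with r'; [lra|]. field_simplify; lra. }
  destruct (pow_mult_bounded _ Hq) as [N HN].
  exists (M / r' * N). intros k. unfold dcoef. rewrite Cmod_mult, Cmod_R, Rabs_right by (apply Rle_ge, pos_INR).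
  specialize (HM (S k)). specialize (HN k). simpl in HM.
  assert (P : 0 < r' ^ k) by (apply pow_lt; lra).
  assert (P2 : 0 <= r ^ k) by (apply pow_le; lra).
  assert (P3 := Cmod_ge_0 (a (S k))).
  assert (P4 : 0 <= INR (S k)) by apply pos_INR.
  assert (E : Cmod (a (S k)) * r' ^ k <= M / r').
  { apply Rmult_le_reg_r with r'; [lra|]. replace (M / r' * r') with M by (field; lra). nra. }
  replace (INR (S k) * Cmod (a (S k)) * r ^ k) with ((Cmod (a (S k)) * r' ^ k) * (INR (S k) * (r / r') ^ k)).
  - apply Rmult_le_compat; try assumption.
    + apply Rmult_le_pos; lra.
    + apply Rmult_le_pos; [exact P4|]. apply pow_le; lra.
  - unfold Rdiv. rewrite Rpow_mult_distr, pow_inv. field. lra.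
Qed.

(** The constant is that of the second derivative at radius [r], without the factor 1/2, so that
    summation over [k] produces the series of [dcoef (dcoef a)]. *)
Lemma Cpow_taylor2 (t h : C) (r : R) (k : nat) : Cmod t <= r -> Cmod (t + h) <= r ->
  Cmod ((t + h) ^ S (S k) - t ^ S (S k) - INR (S (S k)) * (h * t ^ S k))%C
    <= INR (S (S k)) * INR (S k) * r ^ k * (Cmod h * Cmod h).
Proof.
  intros Ht Hth.
  assert (Hr : 0 <= r) by (eapply Rle_trans; [apply Cmod_ge_0|exact Ht]).
  assert (D1 : forall j, Cmod ((t + h) ^ S j - t ^ S j)%C <= INR (S j) * r ^ j * Cmod h).
  { induction j as [|j IH].
    - simpl. replace ((t + h) * 1 - t * 1)%C with h by ring. lra.
    - replace ((t + h) ^ S (S j) - t ^ S (S j))%C with ((t + h) * ((t + h) ^ S j - t ^ S j) + h * t ^ S j)%C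
        by (rewrite !Cpow_S; ring).
      eapply Rle_trans; [apply Cmod_triangle|]. rewrite !Cmod_mult, Cmod_pow.
      assert (Cmod t ^ S j <= r ^ S j) by (apply pow_incr; split; [apply Cmod_ge_0|assumption]).
      assert (0 <= Cmod h) by apply Cmod_ge_0.
      assert (Cmod (t + h) * Cmod ((t + h) ^ S j - t ^ S j)%C <= r * (INR (S j) * r ^ j * Cmod h)).
      { apply Rmult_le_compat; try apply Cmod_ge_0; assumption. }
      assert (Cmod h * Cmod t ^ S j <= Cmod h * r ^ S j) by (apply Rmult_le_compat_l; assumption).
      rewrite (S_INR (S j)). simpl (r ^ S j) in *. nra. }
  induction k as [|k IH].
  - simpl. replace (_ - _)%C with (h * h)%C by (rewrite RtoC_plus; ring).
    rewrite Cmod_mult. assert (H := Cmod_ge_0 h). nra.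
  - replace ((t + h) ^ S (S (S k)) - t ^ S (S (S k)) - INR (S (S (S k))) * (h * t ^ S (S k)))%C
      with ((t + h) * ((t + h) ^ S (S k) - t ^ S (S k) - INR (S (S k)) * (h * t ^ S k))
            + INR (S (S k)) * (h * (h * t ^ S k)))%C
      by (rewrite (S_INR (S (S k))), RtoC_plus, !Cpow_S; ring).
    eapply Rle_trans; [apply Cmod_triangle|]. rewrite Cmod_mult, (Cmod_mult (INR (S (S k)))), !Cmod_mult, Cmod_pow, Cmod_R.
    rewrite Rabs_right by (apply Rle_ge, pos_INR).
    set (H2 := Cmod h * Cmod h) in *.
    assert (HH : 0 <= H2) by (unfold H2; generalize (Cmod_ge_0 h); nra).
    assert (Q : Cmod t ^ S k <= r ^ S k) by (apply pow_incr; split; [apply Cmod_ge_0|assumption]).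
    assert (A1 : Cmod (t + h) * Cmod ((t + h) ^ S (S k) - t ^ S (S k) - INR (S (S k)) * (h * t ^ S k))%C
       <= r * (INR (S (S k)) * INR (S k) * r ^ k * H2)).
    { apply Rmult_le_compat; try apply Cmod_ge_0; assumption. }
    assert (P : 0 <= INR (S (S k))) by apply pos_INR.
    replace (INR (S (S k)) * (Cmod h * (Cmod h * Cmod t ^ S k))) with (INR (S (S k)) * (H2 * Cmod t ^ S k)) by (unfold H2; ring).
    assert (A2 : INR (S (S k)) * (H2 * Cmod t ^ S k) <= INR (S (S k)) * (H2 * r ^ S k)).
    { apply Rmult_le_compat_l; [exact P|]. apply Rmult_le_compat_l; assumption. }
    eapply Rle_trans; [apply Rplus_le_compat; [exact A1|exact A2]|].
    rewrite (S_INR (S (S k))), !(S_INR (S k)), !(S_INR k). simpl (r ^ S k).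
    assert (0 <= r ^ k) by now apply pow_le.
    assert (0 <= INR k) by apply pos_INR.
    assert (0 <= r * r ^ k * H2) by (apply Rmult_le_pos; [apply Rmult_le_pos|]; assumption).
    set (X := r * r ^ k * H2) in *. set (n := INR k) in *.
    replace (r * ((n + 1 + 1) * (n + 1) * r ^ k * H2)) with ((n + 1 + 1) * (n + 1) * X) by (unfold X; ring).
    replace ((n + 1 + 1) * (H2 * (r * r ^ k))) with ((n + 1 + 1) * X) by (unfold X; ring).
    replace ((n + 1 + 1 + 1) * (n + 1 + 1) * (r * r ^ k) * H2) with ((n + 1 + 1 + 1) * (n + 1 + 1) * X) by (unfold X; ring).
    nra.
Qed.

Lemma psr_dcoef (R0 : R) (a : nat -> C) (f : C -> C) : psr R0 a f -> psr R0 (dcoef a) (CPS (dcoef a)).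
Proof. intros H. apply geo_psr, geo_dcoef. eapply psr_geo; eassumption. Qed.

(** The second-order remainders of the powers are summed termwise; their majorant is the series of
    absolute values of the second derivative at a radius [r] between [|t|] and [R0]. *)
Lemma psr_Cdiff (R0 : R) (a : nat -> C) (f : C -> C) (t : C) :
  psr R0 a f -> Cmod t < R0 -> Cdiff f t (CPS (dcoef a) t).
Proof.
  intros H Ht. set (r := (Cmod t + R0) / 2).
  assert (Hp := Cmod_ge_0 t).
  assert (Hr : Cmod t < r < R0) by (unfold r; lra).
  assert (G := psr_geo _ _ _ H).
  destruct (geo_abs R0 (dcoef (dcoef a)) r) as [B HB].
  { apply geo_dcoef, geo_dcoef, G. }
  { lra. }
  exists B, (r - Cmod t). split; [lra|]. intros h Hh.
  assert (Hth : Cmod (t + h) <= r) by (eapply Rle_trans; [apply Cmod_triangle|lra]).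
  set (u := fun k => (a k * (t + h) ^ k - a k * t ^ k - h * (match k with O => 0 | S j => dcoef a j * t ^ j end))%C).
  assert (S1 : cser u (f (t + h) - f t - CPS (dcoef a) t * h)%C).
  { replace (CPS (dcoef a) t * h)%C with (h * CPS (dcoef a) t)%C by ring.
    apply cser_minus; [apply cser_minus; apply H; lra|]. apply cser_scal.
    apply cser_decr. eapply cser_val; [|apply (psr_dcoef _ _ _ H t Ht)]. ring. }
  set (b := fun k => match k with S (S j) => Cmod h * Cmod h * (Cmod (dcoef (dcoef a) j) * r ^ j) | _ => 0 end).
  assert (S2 : is_series b (Cmod h * Cmod h * B)).
  { apply is_series_decr_1, is_series_decr_1. unfold b; simpl.
    replace (plus _ _) with (Cmod h * Cmod h * B) by (unfold plus, opp; simpl; ring).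
    apply (is_series_scal (Cmod h * Cmod h) _ _ HB). }
  rewrite (Rmult_comm B). eapply cser_bound; [exact S1| |exact S2].
  intros k. unfold u, b, dcoef. destruct k as [|[|k]].
  - simpl. replace (_ - _ - _)%C with (RtoC 0) by ring. rewrite Cmod_0; lra.
  - simpl. replace (_ - _ - _)%C with (RtoC 0) by ring. rewrite Cmod_0; lra.
  - replace (a (S (S k)) * (t + h) ^ S (S k) - a (S (S k)) * t ^ S (S k) - h * (INR (S (S k)) * a (S (S k)) * t ^ S k))%C
      with (a (S (S k)) * ((t + h) ^ S (S k) - t ^ S (S k) - INR (S (S k)) * (h * t ^ S k)))%C by ring.
    rewrite Cmod_mult, !(Cmod_mult (INR _)), !Cmod_R, !Rabs_right by (apply Rle_ge, pos_INR).
    assert (E := Cpow_taylor2 t h r k (Rlt_le _ _ (proj1 Hr)) Hth).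
    assert (P := Cmod_ge_0 (a (S (S k)))).
    apply Rle_trans with (Cmod (a (S (S k))) * (INR (S (S k)) * INR (S k) * r ^ k * (Cmod h * Cmod h))); [now apply Rmult_le_compat_l|].
    right; ring.
Qed.

Lemma psr_Cder (R0 : R) (a : nat -> C) (f : C -> C) (g : R -> C) (s : R) (v : C) :
  psr R0 a f -> Cmod (g s) < R0 -> Cder g s v -> Cder (fun u => f (g u)) s (CPS (dcoef a) (g s) * v).
Proof. intros H Hg Dg. apply Cder_comp; [|exact Dg]. now apply (psr_Cdiff R0). Qed.

Lemma PS_Cdiff (R0 : R) (f : C -> C) : PS R0 f ->
  exists f', PS R0 f' /\ forall t, Cmod t < R0 -> Cdiff f t (f' t).
Proof.
  intros [a H]. exists (CPS (dcoef a)). split; [eexists; eapply psr_dcoef; eassumption|].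
  intros t Ht. now apply (psr_Cdiff R0).
Qed.

(** Recursion on all earlier values. [tab n] stores the values below [n]; since [F n] reads only
    those, the diagonal [h] satisfies the equation. *)
Lemma course_of_values (F : nat -> (nat -> C) -> C) :
  (forall n h h', (forall k, (k < n)%nat -> h k = h' k) -> F n h = F n h') ->
  exists h, forall n, h n = F n h.
Proof.
  intros HF.
  set (tab := fix tab (n : nat) : nat -> C := match n with
    | O => fun _ => RtoC 0
    | S m => fun k => if Nat.eqb k m then F m (tab m) else tab m k end).
  set (h := fun k => tab (S k) k). exists h.
  assert (E : forall n k, (k < n)%nat -> tab n k = h k).
  { induction n as [|n IH]; intros k Hk; [lia|].
    destruct (Nat.eq_dec k n) as [->|Hn]; [reflexivity|].
    simpl. rewrite (proj2 (Nat.eqb_neq k n) Hn). apply IH; lia. }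
  intros n. unfold h at 1. simpl. rewrite Nat.eqb_refl. apply HF. intros k Hk. now apply E.
Qed.

Lemma csum_bound (f : nat -> C) (b : nat -> R) (M B : R) (n : nat) :
  0 <= M -> (forall k, 0 <= b k) -> is_series b B ->
  (forall k, (k < n)%nat -> Cmod (f k) <= M * b k) -> Cmod (csum f n) <= M * B.
Proof.
  intros HM Hb HB H.
  assert (P : forall m, sum_n b m <= B).
  { apply (is_lim_seq_incr_compare (sum_n b) B); [exact HB|].
    intros m. rewrite sum_Sn. unfold plus; simpl. specialize (Hb (S m)); lra. }
  destruct n as [|n].
  { simpl. rewrite Cmod_0. apply Rmult_le_pos; [exact HM|].
    specialize (P 0%nat). rewrite sum_O in P. specialize (Hb 0%nat). lra. }
  apply Rle_trans with (M * sum_n b n); [|now apply Rmult_le_compat_l].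
  induction n as [|n IH].
  - simpl. rewrite sum_O. replace (0 + f 0%nat)%C with (f 0%nat) by ring. apply H; lia.
  - change (csum f (S (S n))) with (csum f (S n) + f (S n))%C.
    rewrite sum_Sn. unfold plus; simpl. eapply Rle_trans; [apply Cmod_triangle|].
    rewrite Rmult_plus_distr_l. apply Rplus_le_compat; [apply IH; intros; apply H; lia|apply H; lia].
Qed.

Lemma finite_bound (u : nat -> R) (n : nat) : exists M, forall k, (k <= n)%nat -> u k <= M.
Proof.
  induction n as [|n [M HM]].
  - exists (u 0%nat). intros k Hk. replace k with 0%nat by lia. lra.
  - exists (Rmax M (u (S n))). intros k Hk. destruct (Nat.eq_dec k (S n)) as [->|]; [apply Rmax_r|].
    eapply Rle_trans; [apply HM; lia|apply Rmax_l].
Qed.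

Lemma geo_at_0 (a : nat -> C) : exists M, forall k, Cmod (a k) * 0 ^ k <= M.
Proof.
  exists (Cmod (a 0%nat)). intros [|k]; simpl; [lra|]. rewrite Rmult_0_l, Rmult_0_r. apply Cmod_ge_0.
Qed.

(** The coefficients [h] solve [h' = a' h]; the gain [1 / (k + 1)] keeps the whole disc of convergence of [a]. *)
Lemma psr_exp (a : nat -> C) : exists h, forall R0 f, 0 < R0 -> psr R0 a f -> psr R0 h (fun t => Cexp (f t)).
Proof.
  destruct (course_of_values (fun n h => match n with O => Cexp (a 0%nat)
    | S k => (/ INR (S k) * csum (fun j => dcoef a j * h (k - j)%nat) (S k))%C end)) as [h Hh].
  { intros [|n] h h' E; [reflexivity|]. f_equal. apply csum_ext. intros k Hk. rewrite E by lia. reflexivity. }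
  exists h. intros R0 f HR H.
  assert (G : geo R0 h).
  { intros r Hr. destruct (Req_dec r 0) as [->|Hr0]; [apply geo_at_0|].
    destruct (geo_abs R0 (dcoef a) r) as [B HB]; [apply geo_dcoef; eapply psr_geo; eassumption|lra|].
    (* Beyond [K0] the gain [1 / (k + 1)] outweighs [r B], so a bound [M] valid up to [K0 + 1]
       propagates. *)
    destruct (nfloor_ex (Rabs (r * B)) (Rabs_pos _)) as [K0 HK0].
    destruct (finite_bound (fun k => Cmod (h k) * r ^ k) (S K0)) as [M HM].
    exists M. intros k. induction k as [k IH] using lt_wf_ind.
    destruct (Nat.le_gt_cases k (S K0)) as [Hk|Hk]; [now apply HM|].
    destruct k as [|k]; [lia|].
    assert (HM0 : 0 <= M).
    { eapply Rle_trans; [|apply (HM 0%nat); lia]. simpl. rewrite Rmult_1_r. apply Cmod_ge_0. }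
    rewrite Hh. rewrite Cmod_mult, <- RtoC_inv by (apply not_0_INR; lia). rewrite Cmod_R, Rabs_right.
    2:{ apply Rle_ge. left. apply Rinv_0_lt_compat, lt_0_INR; lia. }
    assert (E : Cmod (csum (fun j => dcoef a j * h (k - j)%nat * RtoC (r ^ k))%C (S k)) <= M * B).
    { apply (csum_bound _ (fun j => Cmod (dcoef a j) * r ^ j)); auto.
      - intros j. apply Rmult_le_pos; [apply Cmod_ge_0|apply pow_le; lra].
      - intros j Hj. rewrite !Cmod_mult, Cmod_R, Rabs_right by (apply Rle_ge, pow_le; lra).
        replace (r ^ k) with (r ^ j * r ^ (k - j)) by (rewrite <- pow_add; f_equal; lia).
        specialize (IH (k - j)%nat ltac:(lia)).
        replace (Cmod (dcoef a j) * Cmod (h (k - j)%nat) * (r ^ j * r ^ (k - j)))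
          with ((Cmod (h (k - j)%nat) * r ^ (k - j)) * (Cmod (dcoef a j) * r ^ j)) by ring.
        apply Rmult_le_compat_r; [|exact IH]. apply Rmult_le_pos; [apply Cmod_ge_0|apply pow_le; lra]. }
    assert (E2 : Cmod (csum (fun j => dcoef a j * h (k - j)%nat)%C (S k)) * r ^ k <= M * B).
    { rewrite (csum_ext _ (fun j => RtoC (r ^ k) * (dcoef a j * h (k - j)%nat))%C) in E by (intros; ring).
      rewrite csum_scal, Cmod_mult, Cmod_R, Rabs_right in E by (apply Rle_ge, pow_le; lra).
      rewrite Rmult_comm. exact E. }
    simpl (r ^ S k).
    assert (P : 0 < INR (S k)) by (apply lt_0_INR; lia).
    apply Rmult_le_reg_l with (INR (S k)); [exact P|].
    set (X := Cmod (csum (fun j => dcoef a j * h (k - j)%nat)%C (S k))) in *.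
    replace (INR (S k) * (/ INR (S k) * X * (r * r ^ k))) with (r * (X * r ^ k)) by (field; lra).
    apply Rle_trans with (r * (M * B)); [apply Rmult_le_compat_l; lra|].
    replace (r * (M * B)) with (M * (r * B)) by ring. rewrite (Rmult_comm _ M). apply Rmult_le_compat_l; [exact HM0|].
    apply Rle_trans with (Rabs (r * B)); [apply Rle_abs|].
    apply Rle_trans with (INR (S K0)); [rewrite S_INR; lra|]. apply le_INR; lia. }
  assert (DE : forall k, dcoef h k = cconv (dcoef a) h k).
  { intros k. unfold dcoef at 1. rewrite Hh. unfold cconv. field. apply INR_S_C_neq_0. }
  assert (Gh := geo_psr _ _ G).
  assert (E : forall t, Cmod t < R0 -> CPS (dcoef h) t = (CPS (dcoef a) t * CPS h t)%C).
  { intros t Ht. eapply cser_unique; [apply (psr_dcoef _ _ _ Gh t Ht)|].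
    eapply cser_ext; [|apply (psr_mult _ _ _ _ _ (psr_dcoef _ _ _ H) Gh t Ht)].
    intros k; cbv beta. now rewrite DE. }
  apply (psr_ext _ _ (CPS h)); [|exact Gh]. intros t Ht.
  (* Along the segment from 0 to [t] the product of the new series with [Cexp (- f)] has derivative
     zero. *)
  set (Z := fun s : R => (CPS h (s * t) * Cexp (- f (s * t)))%C).
  assert (E1 : Z 1 = Z 0).
  { apply Cder_zero_const; [lra|]. intros s Hs.
    assert (Hst : Cmod (s * t) < R0).
    { rewrite Cmod_mult, Cmod_R, Rabs_right by lra. generalize (Cmod_ge_0 t); nra. }
    assert (Dt : Cder (fun s : R => (s * t)%C) s t).
    { eapply Cder_val; [|apply Cder_mult; [apply Cder_id|apply Cder_const]]. cbv beta; ring. }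
    eapply Cder_val; [|apply Cder_mult; [apply (psr_Cder R0 _ _ _ _ _ Gh Hst Dt)|apply Cder_exp, Cder_opp, (psr_Cder R0 _ _ _ _ _ H Hst Dt)]].
    cbv beta. rewrite E by exact Hst. ring. }
  unfold Z in E1. replace (RtoC 1 * t)%C with t in E1 by ring. replace (RtoC 0 * t)%C with (RtoC 0) in E1 by ring.
  rewrite (psr_at_0 _ _ _ HR Gh), (psr_at_0 _ _ _ HR H) in E1.
  rewrite (Hh 0%nat), <- Cexp_plus in E1. replace (a 0%nat + - a 0%nat)%C with (RtoC 0) in E1 by ring.
  rewrite Cexp_0 in E1.
  replace (CPS h t) with (CPS h t * Cexp (- f t) * Cexp (f t))%C; [rewrite E1; ring|].
  rewrite <- Cmult_assoc, <- Cexp_plus. replace (- f t + f t)%C with (RtoC 0) by ring. rewrite Cexp_0. ring.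
Qed.

Lemma PS_exp (R0 : R) (f : C -> C) : 0 < R0 -> PS R0 f -> PS R0 (fun t => Cexp (f t)).
Proof. intros HR [a H]. destruct (psr_exp a) as [h Hh]. exists h. now apply Hh. Qed.

(** The coefficients are forced by the product being 1. If those of [f] are at most [M s^j] relative
    to [a 0], those of the inverse grow at most like [(M + s)^k], which gives convergence for
    [|t| < 1 / (M + s)]. *)
Lemma PS_inv (R0 : R) (f : C -> C) : 0 < R0 -> PS R0 f -> f 0%C <> 0%C ->
  exists R1, 0 < R1 <= R0 /\ PS R1 (fun t => / f t)%C /\ forall t, Cmod t < R1 -> f t <> 0%C.
Proof.
  intros HR [a H] H0. rewrite (psr_at_0 _ _ _ HR H) in H0.
  destruct (course_of_values (fun n h => match n with O => (/ a 0%nat)%C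
    | S k => (- / a 0%nat * csum (fun j => a (S j) * h (k - j)%nat) (S k))%C end)) as [d Hd].
  { intros [|n] h h' E; [reflexivity|]. f_equal. apply csum_ext. intros k Hk. rewrite E by lia. reflexivity. }
  set (A0 := Cmod (a 0%nat)). assert (HA0 : 0 < A0) by now apply Cmod_gt_0.
  destruct (psr_geo _ _ _ H (R0 / 2)) as [M0 HM0]; [lra|].
  set (s := / (R0 / 2)). assert (Hs : 0 < s) by (apply Rinv_0_lt_compat; lra).
  set (M := Rabs M0 * s / A0 + 1).
  assert (HMp : 0 < M).
  { unfold M. assert (0 <= Rabs M0 * s / A0); [|lra]. apply Rdiv_le_0_compat; [|lra]. apply Rmult_le_pos; [apply Rabs_pos|lra]. }
  assert (Ha : forall j, Cmod (a (S j)) <= A0 * (M * s ^ j)).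
  { intros j. specialize (HM0 (S j)).
    assert (P : 0 < (R0 / 2) ^ S j) by (apply pow_lt; lra).
    apply Rmult_le_reg_r with ((R0 / 2) ^ S j); [exact P|].
    eapply Rle_trans; [exact HM0|].
    replace (A0 * (M * s ^ j) * (R0 / 2) ^ S j) with (Rabs M0 + A0 * (R0 / 2)).
    - generalize (Rle_abs M0). assert (0 < A0 * (R0 / 2)) by (apply Rmult_lt_0_compat; lra). lra.
    - unfold M, s. rewrite pow_inv. simpl. field. repeat split; try lra. apply pow_nonzero; lra. }
  set (q := M + s).
  assert (Hdb : forall k, Cmod (d k) <= / A0 * q ^ k).
  { intros k. induction k as [k IH] using lt_wf_ind. destruct k as [|k].
    - rewrite Hd, Cmod_inv by assumption. fold A0. simpl. lra.
    - rewrite Hd, Cmod_mult, Cmod_opp, Cmod_inv by assumption. fold A0.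
      apply Rmult_le_compat_l; [left; now apply Rinv_0_lt_compat|].
      (* Since [q - s = M], the bounds on the successive terms telescope. *)
      assert (E : forall n, (n <= S k)%nat -> Cmod (csum (fun j => a (S j) * d (k - j)%nat)%C n) <= q ^ S k - s ^ n * q ^ (S k - n)).
      { induction n as [|n IHn]; intros Hn.
        - simpl csum. rewrite Cmod_0, Nat.sub_0_r. simpl (s ^ 0). lra.
        - simpl csum. eapply Rle_trans; [apply Cmod_triangle|]. specialize (IHn ltac:(lia)).
          rewrite Cmod_mult. specialize (IH (k - n)%nat ltac:(lia)). specialize (Ha n).
          assert (Cmod (a (S n)) * Cmod (d (k - n)%nat) <= (A0 * (M * s ^ n)) * (/ A0 * q ^ (k - n))).
          { apply Rmult_le_compat; auto; apply Cmod_ge_0. }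
          replace (A0 * (M * s ^ n) * (/ A0 * q ^ (k - n))) with (M * s ^ n * q ^ (k - n)) in H1 by (field; lra).
          replace (S k - n)%nat with (S (k - n)) in IHn by lia.
          replace (S k - S n)%nat with (k - n)%nat by lia.
          set (X := q ^ (k - n)) in *. simpl (s ^ S n). simpl (q ^ S (k - n)) in IHn. fold X in IHn.
          replace (s ^ n * (q * X)) with (M * s ^ n * X + s * s ^ n * X) in IHn by (unfold q; ring). lra. }
      specialize (E (S k) (le_n _)). eapply Rle_trans; [exact E|].
      rewrite Nat.sub_diag. assert (0 < s ^ S k) by (now apply pow_lt). simpl (q ^ 0). lra. }
  assert (Hq : 0 < q) by (unfold q; lra).
  set (R1 := Rmin R0 (/ q)).
  assert (HR1 : 0 < R1) by (apply Rmin_pos; [exact HR|now apply Rinv_0_lt_compat]).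
  assert (HR10 : R1 <= R0) by apply Rmin_l.
  assert (G : geo R1 d).
  { intros r Hr. exists (/ A0). intros k.
    apply Rle_trans with (/ A0 * q ^ k * r ^ k).
    - apply Rmult_le_compat_r; [apply pow_le; lra|apply Hdb].
    - rewrite Rmult_assoc, <- Rpow_mult_distr. rewrite <- (Rmult_1_r (/ A0)) at 2.
      apply Rmult_le_compat_l; [left; now apply Rinv_0_lt_compat|].
      rewrite <- (pow1 k). apply pow_incr. split; [apply Rmult_le_pos; lra|].
      assert (r <= / q) by (apply Rle_trans with R1; [lra|apply Rmin_r]).
      apply Rle_trans with (q * / q); [apply Rmult_le_compat_l; lra|]. rewrite Rinv_r; lra. }
  assert (Gd := geo_psr _ _ G).
  assert (E : forall t, Cmod t < R1 -> (f t * CPS d t)%C = 1%C).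
  { intros t Ht. eapply cser_unique; [apply (psr_mult R1 a d f (CPS d)); try assumption; eapply psr_le; eassumption|].
    eapply cser_ext; [|apply (psr_const R1 1 t Ht)]. intros [|k]; cbv beta.
    - unfold cconv. simpl. rewrite Hd. field. exact H0.
    - unfold cconv. rewrite csum_split_first. rewrite Nat.sub_0_r, (Hd (S k)).
      change (fun j => a (S j) * d (S k - S j)%nat)%C with (fun j => a (S j) * d (k - j)%nat)%C.
      field. exact H0. }
  exists R1. split; [lra|].
  assert (NZ : forall t, Cmod t < R1 -> f t <> 0%C).
  { intros t Ht E0. specialize (E t Ht). rewrite E0 in E.
    replace (0 * CPS d t)%C with (RtoC 0) in E by ring. apply RtoC_inj in E. lra. }
  split; [|exact NZ]. exists d. apply (psr_ext _ _ (CPS d)); [|exact Gd].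
  intros t Ht. specialize (NZ t Ht). replace (CPS d t) with (/ f t * (f t * CPS d t))%C by (field; exact NZ).
  rewrite E by exact Ht. ring.
Qed.

Lemma PS_primitive (R0 : R) (f : C -> C) : 0 < R0 -> PS R0 f ->
  exists F, PS R0 F /\ F 0%C = 0%C /\ forall t, Cmod t < R0 -> Cdiff F t (f t).
Proof.
  intros HR [a H].
  set (b := fun k : nat => match k return C with O => RtoC 0 | S j => (/ INR (S j) * a j)%C end).
  assert (E : forall k, dcoef b k = a k).
  { intros k. unfold dcoef, b. field. apply INR_S_C_neq_0. }
  assert (G : geo R0 b).
  { intros r Hr. destruct (psr_geo _ _ _ H r Hr) as [M HM].
    assert (M0 : 0 <= M) by (eapply Rle_trans; [|apply (HM 0%nat)]; simpl; rewrite Rmult_1_r; apply Cmod_ge_0).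
    exists (r * M). intros [|k].
    - simpl. rewrite Cmod_0. nra.
    - unfold b. rewrite Cmod_mult, <- RtoC_inv by (apply not_0_INR; lia). rewrite Cmod_R, Rabs_right.
      2:{ apply Rle_ge. left. apply Rinv_0_lt_compat, lt_0_INR; lia. }
      specialize (HM k). simpl (r ^ S k).
      assert (Q : / INR (S k) <= 1).
      { rewrite <- Rinv_1. apply Rinv_le_contravar; [lra|]. rewrite S_INR. generalize (pos_INR k); lra. }
      assert (Q0 : 0 <= / INR (S k)) by (left; apply Rinv_0_lt_compat, lt_0_INR; lia).
      assert (P : 0 <= Cmod (a k) * r ^ k) by (apply Rmult_le_pos; [apply Cmod_ge_0|apply pow_le; lra]).
      replace (/ INR (S k) * Cmod (a k) * (r * r ^ k)) with (r * (/ INR (S k) * (Cmod (a k) * r ^ k))) by ring.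
      apply Rmult_le_compat_l; [lra|]. nra. }
  assert (Gb := geo_psr _ _ G).
  exists (CPS b). split; [now exists b|]. split; [now rewrite (psr_at_0 _ _ _ HR Gb)|].
  intros t Ht. replace (f t) with (CPS (dcoef b) t); [now apply (psr_Cdiff R0)|].
  eapply cser_unique; [apply (psr_dcoef _ _ _ Gb t Ht)|]. eapply cser_ext; [|apply (H t Ht)].
  intros k; cbv beta. now rewrite E.
Qed.

(** [L] is the primitive of [f' / f] vanishing at 0, and [f e^{-L}] is constant along segments from
    0. As a power series this logarithm involves no choice of a principal branch. *)
Lemma PS_log (R0 : R) (f : C -> C) : 0 < R0 -> PS R0 f -> f 0%C = 1%C ->
  exists R1 L L', 0 < R1 <= R0 /\ PS R1 L /\ PS R1 L' /\ L 0%C = 0%C /\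
    (forall t, Cmod t < R1 -> Cdiff L t (L' t)) /\ (forall t, Cmod t < R1 -> Cexp (L t) = f t).
Proof.
  intros HR H H0.
  destruct (PS_inv R0 f HR H) as [R1 [HR1 [Hi NZ]]].
  { rewrite H0. intros E; apply RtoC_inj in E; lra. }
  assert (H1 : PS R1 f) by (apply (PS_le R0); [lra|exact H]).
  destruct (PS_Cdiff R1 f H1) as [f' [Hf' Df]].
  destruct (PS_primitive R1 (fun t => f' t * / f t)%C) as [L [HL [L0 DL]]]; [lra|now apply PS_mult|].
  exists R1, L, (fun t => f' t * / f t)%C. repeat split; try lra; try assumption; [now apply PS_mult|].
  intros t Ht. set (Z := fun s : R => (f (s * t)%C * Cexp (- L (s * t)%C))%C).
  assert (E1 : Z 1 = Z 0).
  { apply Cder_zero_const; [lra|]. intros s Hs.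
    assert (Hst : Cmod (s * t) < R1).
    { rewrite Cmod_mult, Cmod_R, Rabs_right by lra. generalize (Cmod_ge_0 t); nra. }
    assert (Dt : Cder (fun s : R => (s * t)%C) s t).
    { eapply Cder_val; [|apply Cder_mult; [apply Cder_id|apply Cder_const]]. cbv beta; ring. }
    eapply Cder_val; [|apply Cder_mult; [apply (Cder_comp f _ _ _ _ (Df _ Hst) Dt)|apply Cder_exp, Cder_opp, (Cder_comp L _ _ _ _ (DL _ Hst) Dt)]].
    cbv beta. field. now apply NZ. }
  unfold Z in E1. replace (RtoC 1 * t)%C with t in E1 by ring. replace (RtoC 0 * t)%C with (RtoC 0) in E1 by ring.
  rewrite L0, H0 in E1. replace (- 0)%C with (RtoC 0) in E1 by ring. rewrite Cexp_0 in E1.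
  replace (f t) with (f t * Cexp (- L t) * Cexp (L t))%C.
  - rewrite E1; ring.
  - rewrite <- Cmult_assoc, <- Cexp_plus. replace (- L t + L t)%C with (RtoC 0) by ring. rewrite Cexp_0. ring.
Qed.

(** A primitive of [e^{lam tau} f (e^tau)], i.e. of [t^{lam-1} f t dt] on the Riemann surface of the logarithm. *)
Lemma psr_power_primitive (a : nat -> C) (lam : C) : 0 < Re lam ->
  exists F : C -> C, forall R0 f, 0 < R0 -> psr R0 a f -> PS R0 F /\
    forall (tau : R -> C) s v, Cmod (Cexp (tau s)) < R0 -> Cder tau s v ->
      Cder (fun u => Cexp (lam * tau u) * F (Cexp (tau u)))%C s (v * (Cexp (lam * tau s) * f (Cexp (tau s)))).
Proof.
  intros Hlam.
  (* Termwise, [t^(lam+k-1)] has the primitive [t^(lam+k) / (lam+k)], and [Re lam > 0] keeps the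
     denominators away from 0. *)
  set (b := fun k => (a k / (lam + INR k))%C).
  assert (NZ : forall k, (lam + INR k)%C <> 0%C).
  { intros k E. assert (E1 : Re (lam + INR k)%C = 0) by now rewrite E. simpl in E1. unfold Re in Hlam. generalize (pos_INR k); lra. }
  exists (CPS b). intros R0 f HR H.
  assert (G : geo R0 b).
  { intros r Hr. destruct (psr_geo _ _ _ H r Hr) as [M HM].
    exists (/ Re lam * M). intros k. unfold b. rewrite Cmod_div by apply NZ.
    assert (Q : Re lam <= Cmod (lam + INR k)).
    { eapply Rle_trans; [|apply re_le_Cmod]. eapply Rle_trans; [|apply Rle_abs]. simpl. unfold Re. generalize (pos_INR k); lra. }
    unfold Rdiv. rewrite (Rmult_comm (Cmod _)), Rmult_assoc.
    apply Rmult_le_compat; [left; apply Rinv_0_lt_compat; lra| |now apply Rinv_le_contravar|apply HM].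
    apply Rmult_le_pos; [apply Cmod_ge_0|apply pow_le; lra]. }
  assert (Gb := geo_psr _ _ G).
  split; [now exists b|]. intros tau s v Ht D.
  assert (E : forall t, Cmod t < R0 -> (lam * CPS b t + t * CPS (dcoef b) t)%C = f t).
  { intros t Ht'. eapply cser_unique; [|apply (H t Ht')].
    eapply cser_ext; [|apply cser_plus; [apply (cser_scal lam), (Gb t Ht')|apply (psr_shift _ _ _ (psr_dcoef _ _ _ Gb) t Ht')]].
    intros [|k]; cbv beta.
    - unfold b. simpl. field. intros E. apply (NZ 0%nat). rewrite E. simpl; ring.
    - unfold dcoef, b. field. apply NZ. }
  eapply Cder_val; [|apply Cder_mult; [apply Cder_exp, Cder_scal, D|exact (psr_Cder R0 b (CPS b) (fun u => Cexp (tau u)) s _ Gb Ht (Cder_exp _ _ _ D))]].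
  cbv beta. rewrite <- (E _ Ht). ring.
Qed.

(** * Laurent series *)

Lemma cos_lt_1 (x : R) : 0 < x < 2 * PI -> cos x < 1.
Proof.
  intros Hx. replace x with (2 * (x / 2)) by field. rewrite cos_2a_sin.
  assert (0 < sin (x / 2)) by (apply sin_gt_0; lra). nra.
Qed.

Definition root_of_unity (M : nat) : C := Cexp (Ci * (2 * PI / INR M)%R).

Lemma root_of_unity_pow (M n : nat) :
  (root_of_unity M ^ n)%C = (cos (2 * PI * INR n / INR M), sin (2 * PI * INR n / INR M)).
Proof.
  unfold root_of_unity. rewrite <- Cexp_pow. unfold Cexp.
  replace (Re (INR n * (Ci * (2 * PI / INR M)%R))%C) with 0 by (unfold Re; simpl; ring).
  replace (Im (INR n * (Ci * (2 * PI / INR M)%R))%C) with (2 * PI * INR n / INR M) by (unfold Im; simpl; unfold Rdiv; ring).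
  rewrite exp_0, !Rmult_1_l. reflexivity.
Qed.

Lemma root_of_unity_M (M : nat) : (0 < M)%nat -> (root_of_unity M ^ M)%C = 1%C.
Proof.
  intros HM. rewrite root_of_unity_pow.
  replace (2 * PI * INR M / INR M) with (2 * PI) by (field; apply not_0_INR; lia).
  rewrite cos_2PI, sin_2PI. reflexivity.
Qed.

Lemma root_of_unity_neq_1 (M n : nat) : (0 < n < M)%nat -> (root_of_unity M ^ n)%C <> 1%C.
Proof.
  intros Hn E. rewrite root_of_unity_pow in E. apply (f_equal Re) in E. unfold Re in E; simpl in E.
  assert (H := cos_lt_1 (2 * PI * INR n / INR M)).
  assert (P := PI_RGT_0).
  assert (0 < INR n < INR M) by (split; [apply lt_0_INR; lia|apply lt_INR; lia]).
  rewrite E in H. apply (Rlt_irrefl 1), H. split.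
  - apply Rdiv_lt_0_compat; [|lra]. apply Rmult_lt_0_compat; lra.
  - apply Rmult_lt_reg_r with (INR M); [lra|]. unfold Rdiv. rewrite Rmult_assoc, Rinv_l by lra. nra.
Qed.

Lemma csum_geometric_zero (z : C) (M : nat) : (z ^ M)%C = 1%C -> z <> 1%C -> csum (fun j => z ^ j)%C M = 0%C.
Proof.
  intros H1 H2.
  assert (E : forall n, (csum (fun j => z ^ j) n * (z - 1) = z ^ n - 1)%C).
  { induction n as [|n IH]; simpl; [ring|]. rewrite Cmult_plus_distr_r, IH. ring. }
  specialize (E M). rewrite H1 in E.
  assert (H3 : (z - 1)%C <> 0%C). { intros E0. apply H2. replace z with (z - 1 + 1)%C by ring. rewrite E0; ring. }
  replace (csum (fun j => z ^ j)%C M) with (csum (fun j => z ^ j)%C M * (z - 1) * / (z - 1))%C by (field; exact H3).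
  rewrite E. ring.
Qed.

Lemma cser_csum (u : nat -> nat -> C) (l : nat -> C) (n : nat) :
  (forall j, (j < n)%nat -> cser (u j) (l j)) -> cser (fun k => csum (fun j => u j k) n) (csum l n).
Proof.
  induction n as [|n IH]; intros H; simpl; [apply cser_zero|].
  apply cser_plus; [apply IH; auto|apply H; lia].
Qed.

Lemma csum_Cmod_le (f : nat -> C) (n : nat) (b : R) :
  (forall k, (k < n)%nat -> Cmod (f k) <= b) -> Cmod (csum f n) <= INR n * b.
Proof.
  induction n as [|n IH]; intros H.
  - simpl. rewrite Cmod_0. lra.
  - rewrite S_INR. simpl csum. eapply Rle_trans; [apply Cmod_triangle|].
    specialize (IH ltac:(auto)). specialize (H n ltac:(lia)). lra.
Qed.

Lemma geo_ones : geo 1 (fun _ => 1%C).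
Proof. intros r Hr. exists 1. intros k. rewrite Cmod_1, Rmult_1_l, <- (pow1 k). apply pow_incr; lra. Qed.

(** Averaging over the [M]-th roots of unity kills all exponents that are not multiples of [M]. *)
Lemma Laurent_zero (u v : nat -> C) (rad : R) : 0 < rad ->
  (forall t, 0 < Cmod t < rad -> exists A B,
     cser (fun k => u k * t ^ k)%C A /\ cser (fun k => v k / t ^ S k)%C B /\ (A + B = 0)%C) ->
  v 0%nat = 0%C.
Proof.
  intros Hrad H.
  (* On the circle of radius [rho] the first series is controlled by its convergence at [r1 > rho],
     the second by its convergence at [r2 < rho]; both decay at least with ratio [q = 2 / 3]. *)
  set (rho := rad / 2). set (r1 := 3 * rad / 4). set (r2 := rad / 4).
  destruct (H (RtoC r1)) as [A1 [_ [S1 _]]]; [rewrite Cmod_R, Rabs_right; unfold r1; lra|].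
  destruct (H (RtoC r2)) as [_ [B2 [_ [S2 _]]]]; [rewrite Cmod_R, Rabs_right; unfold r2; lra|].
  destruct (cser_terms_bounded _ _ S1) as [M1 HM1].
  destruct (cser_terms_bounded _ _ S2) as [M2 HM2].
  assert (HM1p : 0 <= M1) by (eapply Rle_trans; [apply Cmod_ge_0|apply (HM1 0%nat)]).
  assert (HM2p : 0 <= M2) by (eapply Rle_trans; [apply Cmod_ge_0|apply (HM2 0%nat)]).
  set (q := 2 / 3).
  assert (Hu : forall t k, Cmod t = rho -> Cmod (u k * t ^ S k)%C <= M1 * rho * q ^ k).
  { intros t k Ht. specialize (HM1 k). rewrite Cmod_mult, Cmod_pow in *. rewrite Cmod_R, Rabs_right in HM1 by (unfold r1; lra).
    rewrite Ht. replace rho with (q * r1) by (unfold rho, q, r1; field). rewrite Rpow_mult_distr. simpl.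
    assert (0 <= q * q ^ k) by (apply Rmult_le_pos; [|apply pow_le]; unfold q; lra).
    assert (0 <= r1) by (unfold r1; lra).
    apply Rle_trans with (Cmod (u k) * r1 ^ k * (q * q ^ k * r1)); [right; ring|].
    apply Rle_trans with (M1 * (q * q ^ k * r1)); [apply Rmult_le_compat_r; [apply Rmult_le_pos; assumption|exact HM1]|right; ring]. }
  assert (Hv : forall t k, Cmod t = rho -> Cmod (v k / t ^ k)%C <= M2 * r2 * q ^ k).
  { intros t k Ht. specialize (HM2 k).
    assert (Hr2 : 0 < r2) by (unfold r2; lra). assert (Hrho : 0 < rho) by (unfold rho; lra).
    assert (Ht0 : t <> 0%C) by (apply Cmod_gt_0; rewrite Ht; exact Hrho).
    rewrite Cmod_div in * by (apply Cpow_nz; auto; intros E; apply RtoC_inj in E; lra).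
    rewrite Cmod_pow in *. rewrite Cmod_R, Rabs_right in HM2 by lra. rewrite Ht.
    assert (P : 0 < rho ^ k) by now apply pow_lt. assert (P2 : 0 < r2 ^ S k) by now apply pow_lt.
    apply Rmult_le_reg_r with (rho ^ k); [exact P|].
    replace (Cmod (v k) / rho ^ k * rho ^ k) with (Cmod (v k) / r2 ^ S k * r2 ^ S k) by (field; lra).
    apply Rle_trans with (M2 * r2 ^ S k); [apply Rmult_le_compat_r; lra|].
    rewrite Rmult_assoc, <- Rpow_mult_distr. simpl. rewrite Rmult_assoc. apply Rmult_le_compat_l; [exact HM2p|].
    apply Rmult_le_compat_l; [lra|]. apply pow_incr. unfold q, rho, r2. lra. }
  set (K := M1 * rho + M2 * r2).
  destruct (geo_abs 1 (dcoef (fun _ => 1%C)) q) as [S0 HS0].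
  { apply geo_dcoef, geo_ones. } { unfold q; lra. }
  assert (HS : is_series (fun k => K * (INR (S k) * q ^ k)) (K * S0)).
  { eapply is_series_ext; [|exact (is_series_scal K _ _ HS0)]. intros k. unfold scal; simpl; unfold mult; simpl. unfold dcoef.
    rewrite Cmult_1_r, Cmod_R, Rabs_right; [reflexivity|apply Rle_ge, pos_INR]. }
  assert (Hq0 : forall k, 0 <= q ^ k) by (intros k; apply pow_le; unfold q; lra).
  assert (HK1 : 0 <= M1 * rho) by (apply Rmult_le_pos; unfold rho; lra).
  assert (HK2 : 0 <= M2 * r2) by (apply Rmult_le_pos; unfold r2; lra).
  (* After multiplication by [t] and summation over the [M] points [t j], the coefficient [v 0]
     appears [M] times, and any other surviving term has an index [k] with [k + 1 >= M]. Its [M]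
     copies are bounded by a multiple of the summable [(k + 1) q^k], independently of [M]. *)
  assert (Main : forall M, (0 < M)%nat -> INR M * Cmod (v 0%nat) <= K * S0).
  { intros M HM. set (z := root_of_unity M). set (t := fun j : nat => (rho * z ^ j)%C).
    assert (Hz : Cmod z = 1).
    { unfold z, root_of_unity. rewrite Cmod_Cexp. replace (Re _) with 0 by (unfold Re; simpl; ring). apply exp_0. }
    assert (Hrho : 0 < rho) by (unfold rho; lra).
    assert (Ht : forall j, Cmod (t j) = rho).
    { intros j. unfold t. rewrite Cmod_mult, Cmod_pow, Hz, pow1, Cmod_R, Rabs_right; lra. }
    assert (Hz0 : z <> 0%C) by (apply Cmod_gt_0; rewrite Hz; lra).
    assert (Hrho0 : RtoC rho <> 0%C) by (intros E; apply RtoC_inj in E; lra).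
    assert (Ht0 : forall j, t j <> 0%C) by (intros j; apply Cmod_gt_0; rewrite Ht; exact Hrho).
    set (term := fun k => csum (fun j => u k * t j ^ S k + v k / t j ^ k)%C M).
    assert (ST : cser term 0).
    { rewrite <- (csum_zero M). apply (cser_csum (fun j k => (u k * t j ^ S k + v k / t j ^ k)%C) (fun _ => 0%C)).
      intros j _. destruct (H (t j)) as [A [B [SA [SB E]]]]; [rewrite Ht; unfold rho; lra|].
      eapply cser_val; [|eapply cser_ext; [|apply cser_plus; [apply (cser_scal (t j)), SA|apply (cser_scal (t j)), SB]]].
      - rewrite <- Cmult_plus_distr_l, E. ring.
      - intros k. cbv beta. rewrite !Cpow_S. field. split; [apply Cpow_nz|]; apply Ht0. }
    set (c0 := fun k : nat => match k return C with O => (INR M * v 0%nat)%C | _ => RtoC 0 end).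
    assert (SC : cser c0 (c0 0%nat)) by (apply cser_first; reflexivity).
    assert (SD := cser_minus _ _ _ _ ST SC).
    replace (INR M * Cmod (v 0%nat)) with (Cmod (0 - c0 0%nat)).
    2:{ unfold c0. replace (0 - INR M * v 0%nat)%C with (- (INR M * v 0%nat))%C by ring.
        rewrite Cmod_opp, Cmod_mult, Cmod_R, Rabs_right; [reflexivity|apply Rle_ge, pos_INR]. }
    eapply cser_bound; [exact SD| |exact HS].
    assert (HU : forall k, Cmod (csum (fun j => u k * t j ^ S k)%C M) <= M1 * rho * (INR (S k) * q ^ k)).
    { intros k. destruct (Nat.lt_ge_cases (S k) M) as [Hk|Hk].
      - rewrite (csum_ext _ (fun j => (u k * rho ^ S k) * (z ^ S k) ^ j)%C).
        + rewrite csum_scal, csum_geometric_zero.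
          * rewrite Cmult_0_r, Cmod_0. apply Rmult_le_pos; [exact HK1|]. apply Rmult_le_pos; [apply pos_INR|apply Hq0].
          * rewrite <- Cpow_mult_r, Nat.mul_comm, Cpow_mult_r. unfold z. rewrite root_of_unity_M by exact HM. apply Cpow_1_l.
          * apply root_of_unity_neq_1; lia.
        + intros j _. unfold t. rewrite Cpow_mult_l, <- !Cpow_mult_r, (Nat.mul_comm j). ring.
      - eapply Rle_trans; [apply (csum_Cmod_le _ M (M1 * rho * q ^ k)); intros j _; apply Hu, Ht|].
        replace (INR M * (M1 * rho * q ^ k)) with (M1 * rho * (INR M * q ^ k)) by ring.
        apply Rmult_le_compat_l; [exact HK1|]. apply Rmult_le_compat_r; [apply Hq0|]. apply le_INR; lia. }
    assert (HV : forall k, Cmod (csum (fun j => v k / t j ^ k)%C M - c0 k) <= M2 * r2 * (INR (S k) * q ^ k)).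
    { intros k.
      assert (P : 0 <= M2 * r2 * (INR (S k) * q ^ k)) by (apply Rmult_le_pos; [exact HK2|]; apply Rmult_le_pos; [apply pos_INR|apply Hq0]).
      destruct k as [|k].
      - rewrite (csum_ext _ (fun j => v 0%nat * 1)%C) by (intros; simpl; field; intros E; apply RtoC_inj in E; lra).
        rewrite csum_scal. replace (csum (fun _ => RtoC 1) M) with (RtoC (INR M)).
        + unfold c0. replace (_ - _)%C with (RtoC 0) by ring. rewrite Cmod_0. exact P.
        + clear. induction M as [|M IH]; [reflexivity|]. simpl csum. rewrite <- IH, S_INR, RtoC_plus. reflexivity.
      - unfold c0. replace (csum (fun j => v (S k) / t j ^ S k)%C M - 0)%C with (csum (fun j => v (S k) / t j ^ S k)%C M) by ring.
        destruct (Nat.lt_ge_cases (S k) M) as [Hk|Hk].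
        + rewrite (csum_ext _ (fun j => (v (S k) / rho ^ S k) * (/ z ^ S k) ^ j)%C).
          * rewrite csum_scal, csum_geometric_zero.
            -- rewrite Cmult_0_r, Cmod_0. exact P.
            -- rewrite Cpow_inv by (now apply Cpow_nz). rewrite <- Cpow_mult_r, Nat.mul_comm, Cpow_mult_r. unfold z.
               rewrite root_of_unity_M by exact HM. rewrite Cpow_1_l. field.
            -- intros E. apply (root_of_unity_neq_1 M (S k)); [lia|]. fold z.
               replace (z ^ S k)%C with (/ (/ z ^ S k))%C by (field; now apply Cpow_nz). rewrite E. field.
          * intros j _. unfold t. rewrite Cpow_mult_l, Cpow_inv by now apply Cpow_nz.
            rewrite <- !Cpow_mult_r, (Nat.mul_comm j). field. split; apply Cpow_nz; assumption.
        + eapply Rle_trans; [apply (csum_Cmod_le _ M (M2 * r2 * q ^ S k)); intros j _; apply Hv, Ht|].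
          replace (INR M * (M2 * r2 * q ^ S k)) with (M2 * r2 * (INR M * q ^ S k)) by ring.
          apply Rmult_le_compat_l; [exact HK2|]. apply Rmult_le_compat_r; [apply Hq0|]. apply le_INR; lia. }
    intros k. cbv beta. unfold term. rewrite csum_plus.
    replace (csum (fun j => u k * t j ^ S k)%C M + csum (fun j => v k / t j ^ k)%C M - c0 k)%C
      with (csum (fun j => u k * t j ^ S k)%C M + (csum (fun j => v k / t j ^ k)%C M - c0 k))%C by ring.
    eapply Rle_trans; [apply Cmod_triangle|]. unfold K. rewrite Rmult_plus_distr_r.
    apply Rplus_le_compat; [apply HU|apply HV]. }
  apply Cmod_eq_0. apply Rle_antisym; [|apply Cmod_ge_0].
  destruct (Rle_lt_dec (Cmod (v 0%nat)) 0) as [E|E]; [exact E|exfalso].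
  destruct (nfloor_ex (Rabs (K * S0) / Cmod (v 0%nat))) as [n Hn].
  { apply Rdiv_le_0_compat; [apply Rabs_pos|exact E]. }
  specialize (Main (S n) ltac:(lia)). rewrite S_INR in Main.
  assert (Rabs (K * S0) < (INR n + 1) * Cmod (v 0%nat)).
  { apply Rmult_lt_reg_r with (/ Cmod (v 0%nat)); [now apply Rinv_0_lt_compat|].
    rewrite Rmult_assoc, Rinv_r, Rmult_1_r by lra. apply Hn. }
  generalize (Rle_abs (K * S0)); lra.
Qed.

(** The difference of two Laurent expansions vanishes on a common punctured disc. This determines
    the value of [Residue], which is defined by description. *)
Lemma is_residue_unique (f : C -> C) (a r1 r2 : C) : is_residue f a r1 -> is_residue f a r2 -> r1 = r2.
Proof.
  intros [R1 [u1 [v1 [HR1 [<- H1]]]]] [R2 [u2 [v2 [HR2 [<- H2]]]]].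
  cut ((v1 0%nat - v2 0%nat)%C = 0%C).
  { intros E. replace (v1 0%nat) with (v1 0%nat - v2 0%nat + v2 0%nat)%C by ring. rewrite E; ring. }
  apply (Laurent_zero (fun k => u1 k - u2 k)%C (fun k => v1 k - v2 k)%C (Rmin R1 R2)); [now apply Rmin_pos|].
  intros t Ht.
  destruct (H1 (a + t)%C) as [A1 [B1 [SA1 [SB1 E1]]]].
  { replace (a + t - a)%C with t by ring. generalize (Rmin_l R1 R2); lra. }
  destruct (H2 (a + t)%C) as [A2 [B2 [SA2 [SB2 E2]]]].
  { replace (a + t - a)%C with t by ring. generalize (Rmin_r R1 R2); lra. }
  replace (a + t - a)%C with t in * by ring.
  apply cser_iff in SA1, SA2, SB1, SB2.
  exists (A1 - A2)%C, (B1 - B2)%C. split; [|split].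
  - eapply cser_ext; [|apply (cser_minus _ _ _ _ SA1 SA2)]. intros k; cbv beta; ring.
  - eapply cser_ext; [|apply (cser_minus _ _ _ _ SB1 SB2)]. intros k; cbv beta. unfold Cdiv; ring.
  - replace (A1 - A2 + (B1 - B2))%C with (A1 + B1 - (A2 + B2))%C by ring. rewrite <- E1, <- E2. ring.
Qed.

Lemma cser_drop (u : nat -> C) (l : C) (n : nat) : cser u l -> cser (fun k => u (n + k)%nat) (l - csum u n).
Proof.
  induction n as [|n IH]; intros H.
  - simpl. eapply cser_val; [|exact H]. ring.
  - specialize (IH H). apply cser_decr in IH. eapply cser_val; [|eapply cser_ext; [|exact IH]].
    + simpl. rewrite Nat.add_0_r. ring.
    + intros k. cbv beta. f_equal. lia.
Qed.

Lemma cser_finite (u : nat -> C) (n : nat) : (forall k, (n <= k)%nat -> u k = 0%C) -> cser u (csum u n).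
Proof.
  revert u. induction n as [|n IH]; intros u H.
  - simpl. apply (cser_ext (fun _ => 0%C)); [intros; symmetry; apply H; lia|apply cser_zero].
  - rewrite csum_split_first. apply cser_decr. eapply cser_val; [|apply (IH (fun k => u (S k)))].
    + ring.
    + intros k Hk. apply H; lia.
Qed.

Lemma csum_rev (f : nat -> C) (n : nat) : csum (fun k => f (n - k)%nat) (S n) = csum f (S n).
Proof.
  induction n as [|n IH]; [reflexivity|]. rewrite csum_split_first.
  change (csum f (S (S n))) with (csum f (S n) + f (S n))%C. rewrite <- IH, Nat.sub_0_r.
  rewrite Cplus_comm. f_equal.
Qed.

(** Cutting the power series of [A] after [t^n] separates the principal part of the quotient from
    its regular part. *)
Lemma is_residue_psr (f A : C -> C) (a : C) (alpha : nat -> C) (rad : R) (n : nat) : 0 < rad -> psr rad alpha A ->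
  (forall t, 0 < Cmod t < rad -> f (a + t)%C = (A t / t ^ S n)%C) -> is_residue f a (alpha n).
Proof.
  intros Hr HA Hf.
  exists rad, (fun k => alpha (S n + k)%nat), (fun k => if Nat.leb k n then alpha (n - k)%nat else RtoC 0).
  split; [exact Hr|]. split; [simpl; now rewrite Nat.sub_0_r|].
  intros t Ht. set (s := (t - a)%C) in *.
  assert (Hs0 : s <> 0%C) by now apply Cmod_gt_0.
  assert (SA := HA s (proj2 Ht)).
  assert (D := cser_drop _ _ (S n) SA).
  set (S0 := csum (fun k => alpha k * s ^ k)%C (S n)) in *.
  exists ((A s - S0) / s ^ S n)%C, (S0 / s ^ S n)%C.
  assert (P : (s ^ S n)%C <> 0%C) by now apply Cpow_nz.
  split; [|split].
  - apply cser_iff. eapply cser_val; [|eapply cser_ext; [|apply (cser_scal (/ s ^ S n)), D]].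
    + unfold Cdiv; ring.
    + intros k. cbv beta. rewrite Cpow_add_r. field. exact P.
  - apply cser_iff. eapply cser_val; [|apply (cser_finite _ (S n))].
    + unfold S0. rewrite <- csum_rev. unfold Cdiv. rewrite Cmult_comm, <- csum_scal. apply csum_ext.
      intros k Hk. rewrite (proj2 (Nat.leb_le (n - k) n)) by lia.
      replace (n - (n - k))%nat with k by lia.
      replace (s ^ S n)%C with (s ^ S (n - k) * s ^ k)%C by (rewrite <- Cpow_add_r; f_equal; lia).
      field. split; now apply Cpow_nz.
    + intros k Hk. cbv beta. rewrite (proj2 (Nat.leb_gt k n)) by lia. unfold Cdiv. ring.
  - replace t with (a + s)%C by (unfold s; ring). rewrite Hf by exact Ht. field. exact P.
Qed.

Lemma Residue_psr (f A : C -> C) (a : C) (alpha : nat -> C) (rad : R) (n : nat) : 0 < rad -> psr rad alpha A ->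
  (forall t, 0 < Cmod t < rad -> f (a + t)%C = (A t / t ^ S n)%C) -> Residue f a = alpha n.
Proof.
  intros Hr HA Hf. assert (H := is_residue_psr f A a alpha rad n Hr HA Hf).
  apply (@iota_unique C_AbsRing C_CompleteNormedModule); [|exact H].
  intros y Hy. eapply is_residue_unique; eassumption.
Qed.

(** * Principal logarithm *)

(** With it, [principal_pow w s] is by definition [Cexp (s * Clog w)]. *)
Definition Clog (w : C) : C := (ln (Cmod w), Carg w).

Lemma Re_div_Cmod (w : C) : w <> 0%C -> -1 <= Re w / Cmod w <= 1.
Proof.
  intros Hw. apply Cmod_gt_0 in Hw. assert (H := re_le_Cmod w). apply Rabs_le_between in H.
  split; (apply Rmult_le_reg_r with (Cmod w); [exact Hw|]; unfold Rdiv; rewrite Rmult_assoc, Rinv_l; lra).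
Qed.

Lemma Cexp_Clog (w : C) : w <> 0%C -> Cexp (Clog w) = w.
Proof.
  intros Hw. assert (B := Re_div_Cmod w Hw). assert (Hp := Hw). apply Cmod_gt_0 in Hp.
  unfold Cexp, Clog. unfold Re at 1 2, Im at 1 2; cbn [fst snd]. rewrite exp_ln by exact Hp.
  (* [sin (acos _)] is nonnegative; the sign of [Im w] is restored by the case distinction in
     [Carg]. *)
  assert (S1 : sqrt (1 - (Re w / Cmod w)²) = Rabs (Im w) / Cmod w).
  { replace (1 - (Re w / Cmod w)²) with ((Rabs (Im w) / Cmod w)²).
    - apply sqrt_Rsqr. apply Rdiv_le_0_compat; [apply Rabs_pos|exact Hp].
    - rewrite !Rsqr_div'. rewrite <- Rsqr_abs. unfold Rsqr. assert (E := Cmod2_alt w).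
      apply Rmult_eq_reg_r with (Cmod w * Cmod w); [|nra]. field_simplify; [|lra|lra]. lra. }
  unfold Carg. destruct (Rle_dec 0 (Im w)) as [H|H].
  - rewrite cos_acos by exact B. rewrite sin_acos by exact B. rewrite S1, Rabs_right by lra.
    apply C_eq; simpl; field; lra.
  - rewrite cos_neg, sin_neg. rewrite cos_acos by exact B. rewrite sin_acos by exact B. rewrite S1, Rabs_left by lra.
    apply C_eq; simpl; field; lra.
Qed.

Lemma Clog_Cexp (L : C) : - PI < Im L < PI -> Clog (Cexp L) = L.
Proof.
  intros H. unfold Clog, Carg. rewrite Cmod_Cexp, ln_exp.
  assert (HE := exp_pos (Re L)).
  replace (Re (Cexp L) / exp (Re L)) with (cos (Im L)) by (unfold Cexp; simpl; field; lra).
  apply C_eq; [reflexivity|].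
  replace (Im (Cexp L)) with (exp (Re L) * sin (Im L)) by reflexivity.
  unfold Im at 1; cbn [snd].
  destruct (Rle_dec 0 (exp (Re L) * sin (Im L))) as [Hs|Hs].
  - apply acos_cos. split; [|lra]. destruct (Rle_lt_dec 0 (Im L)) as [Q|Q]; [exact Q|exfalso].
    assert (sin (Im L) < 0) by (apply sin_lt_0_var; lra). apply (Rlt_irrefl 0). eapply Rle_lt_trans; [exact Hs|]. rewrite <- (Rmult_0_r (exp (Re L))). now apply Rmult_lt_compat_l.
  - destruct (Rle_lt_dec 0 (Im L)) as [Q|Q].
    + exfalso. apply Hs. apply Rmult_le_pos; [lra|]. apply sin_ge_0; lra.
    + rewrite <- cos_neg. rewrite acos_cos; lra.
Qed.

Lemma principal_pow_Cexp (L s : C) : - PI < Im L < PI -> principal_pow (Cexp L) s = Cexp (s * L).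
Proof. intros H. change (principal_pow (Cexp L) s) with (Cexp (s * Clog (Cexp L))). now rewrite Clog_Cexp. Qed.

Lemma Cder_unique (f : R -> C) (s : R) (l m : C) : Cder f s l -> Cder f s m -> l = m.
Proof.
  intros [A B] [A' B'].
  apply is_derive_unique in A. apply is_derive_unique in B. apply is_derive_unique in A'. apply is_derive_unique in B'.
  apply C_eq; congruence.
Qed.

(** The coefficient of index [n] is the residue of [f / t^(n+1)], so uniqueness of residues
    suffices. *)
Lemma psr_unique (R0 : R) (a b : nat -> C) (f : C -> C) (n : nat) :
  0 < R0 -> psr R0 a f -> psr R0 b f -> a n = b n.
Proof.
  intros HR A B.
  assert (E : forall t, 0 < Cmod t < R0 -> (f (0 + t) / (0 + t) ^ S n)%C = (f t / t ^ S n)%C).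
  { intros t _. replace (0 + t)%C with t by ring. reflexivity. }
  assert (H1 := is_residue_psr (fun t => f t / t ^ S n)%C f 0 a R0 n HR A E).
  assert (H2 := is_residue_psr (fun t => f t / t ^ S n)%C f 0 b R0 n HR B E).
  eapply is_residue_unique; eassumption.
Qed.

(** * Expansions in powers of a local coordinate *)

(** Expansion of [f] to order [N] in powers of [u], in a form stable under products:
    [f = a_0 + u (a_1 + u (... + u f_N))] with [f_N] bounded. *)
Fixpoint asy (R0 : R) (u : C -> C) (N : nat) (a : nat -> C) (f : C -> C) : Prop :=
  match N with
  | O => exists K, forall t, Cmod t < R0 -> Cmod (f t) <= K
  | S N' => exists f1, (forall t, Cmod t < R0 -> f t = (a 0%nat + u t * f1 t)%C) /\
              asy R0 u N' (fun n => a (S n)) f1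
  end.

Lemma asy_ext (R0 : R) (u : C -> C) (N : nat) (a b : nat -> C) (f g : C -> C) :
  (forall n, (n < N)%nat -> a n = b n) -> (forall t, Cmod t < R0 -> f t = g t) -> asy R0 u N a f -> asy R0 u N b g.
Proof.
  revert a b f g. induction N as [|N IH]; intros a b f g Ha Hf; simpl.
  - intros [K HK]. exists K. intros t Ht. rewrite <- Hf by exact Ht. now apply HK.
  - intros [f1 [E H]]. exists f1. split.
    + intros t Ht. rewrite <- Hf, <- Ha by (exact Ht || lia). now apply E.
    + apply (IH (fun n => a (S n)) _ f1); auto. intros n Hn. apply Ha; lia.
Qed.

Lemma asy_plus (R0 : R) (u : C -> C) (N : nat) (a b : nat -> C) (f g : C -> C) :
  asy R0 u N a f -> asy R0 u N b g -> asy R0 u N (fun n => a n + b n)%C (fun t => f t + g t)%C.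
Proof.
  revert a b f g. induction N as [|N IH]; intros a b f g; simpl.
  - intros [K HK] [K' HK']. exists (K + K'). intros t Ht. eapply Rle_trans; [apply Cmod_triangle|].
    apply Rplus_le_compat; auto.
  - intros [f1 [E H]] [g1 [E' H']]. exists (fun t => f1 t + g1 t)%C. split.
    + intros t Ht. rewrite E, E' by exact Ht. ring.
    + apply (IH _ _ _ _ H H').
Qed.

Lemma asy_scal (R0 : R) (u : C -> C) (N : nat) (c : C) (a : nat -> C) (f : C -> C) :
  asy R0 u N a f -> asy R0 u N (fun n => c * a n)%C (fun t => c * f t)%C.
Proof.
  revert a f. induction N as [|N IH]; intros a f; simpl.
  - intros [K HK]. exists (Cmod c * K). intros t Ht. rewrite Cmod_mult. apply Rmult_le_compat_l; [apply Cmod_ge_0|auto].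
  - intros [f1 [E H]]. exists (fun t => c * f1 t)%C. split.
    + intros t Ht. rewrite E by exact Ht. ring.
    + apply (IH _ _ H).
Qed.

Lemma asy_weaken (R0 : R) (u : C -> C) (N : nat) (a : nat -> C) (f : C -> C) (M : R) :
  (forall t, Cmod t < R0 -> Cmod (u t) <= M) -> asy R0 u (S N) a f -> asy R0 u N a f.
Proof.
  intros Hu. revert a f. induction N as [|N IH]; intros a f.
  - intros [f1 [E [K HK]]]. exists (Cmod (a 0%nat) + M * K). intros t Ht. rewrite E by exact Ht.
    eapply Rle_trans; [apply Cmod_triangle|]. rewrite Cmod_mult. apply Rplus_le_compat_l.
    apply Rmult_le_compat; try apply Cmod_ge_0; auto.
  - intros [f1 [E H]]. exists f1. split; [exact E|]. now apply IH.
Qed.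

(** In the product, [u] is multiplied by [a 0 * g1 + f1 * g], where [g] is needed only to the lower
    order; boundedness of [u] provides that weakening. *)
Lemma asy_mult (R0 : R) (u : C -> C) (N : nat) (a b : nat -> C) (f g : C -> C) (M : R) :
  (forall t, Cmod t < R0 -> Cmod (u t) <= M) ->
  asy R0 u N a f -> asy R0 u N b g -> asy R0 u N (cconv a b) (fun t => f t * g t)%C.
Proof.
  intros Hu. revert a b f g. induction N as [|N IH]; intros a b f g.
  - intros [K HK] [K' HK']. exists (K * K'). intros t Ht. rewrite Cmod_mult.
    apply Rmult_le_compat; try apply Cmod_ge_0; auto.
  - intros [f1 [E H]] Hg. assert (Hg0 := asy_weaken _ _ _ _ _ _ Hu Hg). destruct Hg as [g1 [E' H']].
    exists (fun t => a 0%nat * g1 t + f1 t * g t)%C. split.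
    + intros t Ht. rewrite E by exact Ht. unfold cconv; simpl.
      replace ((a 0%nat + u t * f1 t) * g t)%C with (a 0%nat * g t + u t * f1 t * g t)%C by ring.
      rewrite E' at 1 by exact Ht. ring.
    + eapply asy_ext; [| |apply asy_plus; [apply (asy_scal _ _ _ (a 0%nat)), H'|apply IH; [exact H|exact Hg0]]].
      * intros n _. unfold cconv. rewrite (csum_split_first _ (S n)), Nat.sub_0_r. reflexivity.
      * reflexivity.
Qed.

(** Unfolding the nested form leaves exactly [r * u^N] with [r] bounded. *)
Lemma asy_error (R0 : R) (u : C -> C) (N : nat) (a : nat -> C) (f : C -> C) :
  asy R0 u N a f -> exists K, 0 <= K /\ forall t, Cmod t < R0 ->
    Cmod (f t - csum (fun n => a n * u t ^ n)%C N) <= K * Cmod (u t) ^ N.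
Proof.
  intros H. cut (exists K r, forall t, Cmod t < R0 -> Cmod (r t) <= K /\ (f t - csum (fun n => a n * u t ^ n) N = r t * u t ^ N)%C).
  { intros [K [r Hr]]. exists (Rabs K). split; [apply Rabs_pos|]. intros t Ht. destruct (Hr t Ht) as [B ->].
    rewrite Cmod_mult, Cmod_pow. apply Rmult_le_compat_r; [apply pow_le, Cmod_ge_0|]. generalize (Rle_abs K); lra. }
  revert a f H. induction N as [|N IH]; intros a f.
  - intros [K HK]. exists K, f. intros t Ht. split; [now apply HK|]. simpl. ring.
  - intros [f1 [E H]]. destruct (IH _ _ H) as [K [r Hr]]. exists K, r. intros t Ht.
    destruct (Hr t Ht) as [B ER]. split; [exact B|].
    rewrite csum_split_first, E by exact Ht.
    rewrite (csum_ext _ (fun k => u t * (a (S k) * u t ^ k))%C) by (intros; rewrite Cpow_S; ring).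
    rewrite csum_scal. rewrite Cpow_S.
    replace (r t * (u t * u t ^ N))%C with (u t * (r t * u t ^ N))%C by ring. rewrite <- ER. simpl. ring.
Qed.

Lemma asy_const (R0 : R) (u : C -> C) (N : nat) (c : C) :
  asy R0 u N (fun n => match n with O => c | S _ => 0%C end) (fun _ => c).
Proof.
  destruct N as [|N]; [exists (Cmod c); intros; lra|].
  exists (fun _ => 0%C). split; [intros; ring|].
  induction N as [|N IH]; [exists 0; intros; rewrite Cmod_0; lra|].
  exists (fun _ => 0%C). split; [intros; ring|exact IH].
Qed.

Lemma series_pow_S (u : nat -> C) (m n : nat) : series_pow u (S m) n = cconv u (series_pow u m) n.
Proof. simpl. rewrite Csum_range_csum, Nat.sub_0_r. reflexivity. Qed.

Lemma asy_series_pow (R0 : R) (u : C -> C) (N : nat) (a : nat -> C) (f : C -> C) (M : R) (m : nat) :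
  (forall t, Cmod t < R0 -> Cmod (u t) <= M) -> asy R0 u N a f ->
  asy R0 u N (series_pow a m) (fun t => f t ^ m)%C.
Proof.
  intros Hu H. induction m as [|m IH].
  - apply (asy_const R0 u N 1).
  - eapply asy_ext; [| |apply (asy_mult _ _ _ _ _ _ _ _ Hu H IH)].
    + intros n _. now rewrite series_pow_S.
    + reflexivity.
Qed.

Lemma series_pow_lt (a : nat -> C) (m n : nat) : a 0%nat = 0%C -> (n < m)%nat -> series_pow a m n = 0%C.
Proof.
  intros H0. revert n. induction m as [|m IH]; intros n Hn; [lia|].
  rewrite series_pow_S. unfold cconv. rewrite (csum_ext _ (fun _ => 0%C)); [apply csum_zero|].
  intros [|k] Hk; [rewrite H0; ring|]. rewrite IH by lia. ring.
Qed.

(** [Y] will be [z^{1/mu} u], so the estimate has to be uniform in [Y] as well as in [t]. The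
    exponential is cut after [N] terms, its remainder being of order [(Y h)^N] with [h = O(u)], and
    each term kept is expanded to order [N] in [u]. The square range of indices adds nothing to the
    triangle, since [f n m = 0] for [m > n]. *)
Lemma asy_exp_product (R0 : R) (u B h : C -> C) (N : nat) (b c : nat -> C) (f : nat -> nat -> C) (M : R) :
  (forall t, Cmod t < R0 -> Cmod (u t) <= M) -> c 0%nat = 0%C ->
  (forall k, asy R0 u k b B) -> (forall k, asy R0 u k c h) ->
  (forall n m, f n m = (/ INR (fact m) * cconv b (series_pow c m) n)%C) ->
  exists K, 0 <= K /\ forall t Y, Cmod t < R0 ->
    Cmod (B t * Cexp (Y * h t) - csum (fun n => csum (fun m => f n m * (u t ^ n * Y ^ m))%C N) N)
      <= K * Cmod (u t) ^ N * ((1 + Cmod Y) ^ N * exp (K * (Cmod (u t) * Cmod Y))).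
Proof.
  intros Hu Hc0 HB Hh Hf.
  destruct (HB 0%nat) as [KB HKB]. destruct (Hh 1%nat) as [h1 [Eh [Kh HKh]]].
  assert (Hhb : forall t, Cmod t < R0 -> Cmod (h t) <= Rabs Kh * Cmod (u t)).
  { intros t Ht. rewrite Eh, Hc0 by exact Ht. replace (0 + u t * h1 t)%C with (h1 t * u t)%C by ring.
    rewrite Cmod_mult. apply Rmult_le_compat_r; [apply Cmod_ge_0|]. specialize (HKh t Ht). generalize (Rle_abs Kh); lra. }
  (* Induction on the number of terms kept in the exponential, the order in [u] staying [N]. *)
  assert (HT : forall n, exists K, 0 <= K /\ forall t Y, Cmod t < R0 ->
    Cmod (B t * csum (fun m => / INR (fact m) * (Y * h t) ^ m)%C n - csum (fun m => csum (fun k => f k m * (u t ^ k * Y ^ m))%C N) n)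
      <= K * Cmod (u t) ^ N * (1 + Cmod Y) ^ n).
  { induction n as [|n [K [HK IH]]].
    - exists 0. split; [lra|]. intros t Y Ht. simpl. replace (B t * 0 - 0)%C with (RtoC 0) by ring. rewrite Cmod_0. lra.
    - destruct (asy_error R0 u N (cconv b (series_pow c n)) (fun t => B t * h t ^ n)%C) as [K' [HK' E']].
      { apply (asy_mult _ _ _ _ _ _ _ M Hu); [apply HB|]. apply (asy_series_pow _ _ _ _ _ M); auto. }
      exists (K + Cmod (/ INR (fact n)) * K'). split.
      { assert (Q := Cmod_ge_0 (/ INR (fact n))). nra. }
      intros t Y Ht. simpl csum.
      set (S1 := csum (fun m => / INR (fact m) * (Y * h t) ^ m)%C n).
      set (S2 := csum (fun m => csum (fun k => f k m * (u t ^ k * Y ^ m))%C N) n).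
      replace (csum (fun k => f k n * (u t ^ k * Y ^ n))%C N)
        with (/ INR (fact n) * Y ^ n * csum (fun k => cconv b (series_pow c n) k * u t ^ k)%C N)%C.
      2:{ rewrite <- csum_scal. apply csum_ext. intros k _. rewrite Hf. ring. }
      set (S3 := csum (fun k => cconv b (series_pow c n) k * u t ^ k)%C N).
      replace (B t * (S1 + / INR (fact n) * (Y * h t) ^ n) - (S2 + / INR (fact n) * Y ^ n * S3))%C
        with ((B t * S1 - S2) + / INR (fact n) * Y ^ n * (B t * h t ^ n - S3))%C by (rewrite Cpow_mult_l; ring).
      eapply Rle_trans; [apply Cmod_triangle|]. rewrite (Cmod_mult (_ * _)), (Cmod_mult (/ _)), Cmod_pow.
      specialize (IH t Y Ht). specialize (E' t Ht). cbv beta in E'. fold S3 in E'. fold S1 S2 in IH.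
      set (y := Cmod Y) in *. assert (Hy : 0 <= y) by apply Cmod_ge_0.
      assert (P : 0 <= Cmod (u t) ^ N) by (apply pow_le, Cmod_ge_0).
      assert (Q1 : y ^ n <= (1 + y) ^ n) by (apply pow_incr; lra).
      assert (Q2 : 0 <= (1 + y) ^ n) by (apply pow_le; lra).
      assert (Q3 : 0 <= y ^ n) by (apply pow_le; lra).
      assert (Q4 : (1 + y) ^ n <= (1 + y) ^ S n) by (simpl; nra).
      set (cf := Cmod (/ INR (fact n))). assert (Hcf : 0 <= cf) by apply Cmod_ge_0.
      rewrite !Rmult_plus_distr_r. apply Rplus_le_compat.
      + eapply Rle_trans; [exact IH|]. apply Rmult_le_compat_l; [|exact Q4]. now apply Rmult_le_pos.
      + apply Rle_trans with (cf * (1 + y) ^ S n * (K' * Cmod (u t) ^ N)); [|right; ring].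
        apply Rmult_le_compat; [now apply Rmult_le_pos|apply Cmod_ge_0| |exact E'].
        apply Rmult_le_compat_l; [exact Hcf|lra]. }
  destruct (HT N) as [K1 [HK1 E1]].
  set (Kh' := Rabs Kh) in *. assert (HKh' : 0 <= Kh') by apply Rabs_pos.
  (* The constant of the exponential remainder: a bound for [B] times the [N]-th power of a bound
     for [h / u]. *)
  set (K2 := Rabs KB * Kh' ^ N). assert (HK2 : 0 <= K2) by (apply Rmult_le_pos; [apply Rabs_pos|now apply pow_le]).
  exists (K1 + K2 + Kh'). split; [lra|]. intros t Y Ht.
  rewrite csum_swap.
  specialize (E1 t Y Ht).
  set (S1 := csum (fun m => / INR (fact m) * (Y * h t) ^ m)%C N) in *.
  set (S2 := csum (fun m => csum (fun k => f k m * (u t ^ k * Y ^ m))%C N) N) in *.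
  replace (B t * Cexp (Y * h t) - S2)%C with (B t * (Cexp (Y * h t) - S1) + (B t * S1 - S2))%C by ring.
  eapply Rle_trans; [apply Cmod_triangle|]. rewrite Cmod_mult.
  assert (E2 := Cexp_remainder (Y * h t)%C N). fold S1 in E2. rewrite Cmod_mult in E2.
  set (y := Cmod Y) in *. assert (Hy : 0 <= y) by apply Cmod_ge_0.
  set (v := Cmod (u t)) in *. assert (Hv : 0 <= v) by apply Cmod_ge_0.
  specialize (Hhb t Ht). fold v in Hhb.
  assert (Hhp := Cmod_ge_0 (h t)).
  set (Ex := exp ((K1 + K2 + Kh') * (v * y))).
  assert (Hvy : 0 <= v * y) by now apply Rmult_le_pos.
  assert (HEx : 1 <= Ex).
  { unfold Ex. rewrite <- exp_0. apply exp_le. apply Rmult_le_pos; lra. }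
  assert (P : 0 <= v ^ N) by now apply pow_le.
  assert (Py : 0 <= (1 + y) ^ N) by (apply pow_le; lra).
  assert (F1 : Cmod (B t) * Cmod (Cexp (Y * h t) - S1)%C <= K2 * v ^ N * ((1 + y) ^ N * Ex)).
  { apply Rle_trans with (Rabs KB * ((y * (Kh' * v)) ^ N * Ex)).
    - apply Rmult_le_compat; try apply Cmod_ge_0.
      + specialize (HKB t Ht). generalize (Rle_abs KB); lra.
      + eapply Rle_trans; [exact E2|]. apply Rmult_le_compat.
        * apply pow_le. now apply Rmult_le_pos.
        * left; apply exp_pos.
        * apply pow_incr. split; [now apply Rmult_le_pos|]. now apply Rmult_le_compat_l.
        * apply exp_le. apply Rle_trans with (y * (Kh' * v)); [now apply Rmult_le_compat_l|]. nra.
    - rewrite !Rpow_mult_distr. unfold K2.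
      replace (Rabs KB * (y ^ N * (Kh' ^ N * v ^ N) * Ex)) with ((Rabs KB * Kh' ^ N * v ^ N * Ex) * y ^ N) by ring.
      replace (Rabs KB * Kh' ^ N * v ^ N * ((1 + y) ^ N * Ex)) with ((Rabs KB * Kh' ^ N * v ^ N * Ex) * (1 + y) ^ N) by ring.
      apply Rmult_le_compat_l; [|apply pow_incr; lra].
      fold K2. apply Rmult_le_pos; [now apply Rmult_le_pos|lra]. }
  assert (F2 : Cmod (B t * S1 - S2)%C <= K1 * v ^ N * ((1 + y) ^ N * Ex)).
  { eapply Rle_trans; [exact E1|]. apply Rmult_le_compat_l; [now apply Rmult_le_pos|]. nra. }
  assert (F3 : 0 <= Kh' * v ^ N * ((1 + y) ^ N * Ex)).
  { apply Rmult_le_pos; [now apply Rmult_le_pos|apply Rmult_le_pos; lra]. }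
  rewrite !Rmult_plus_distr_r. lra.
Qed.

(** [u = P0 t e^{Lm t}] is the local coordinate [(p(t) - p(a))^{1/mu}] (with [t - a] for [t]), and [u' / u = om / t]. *)
Record local_branch (R1 : R) (Lm Lm' : C -> C) : Prop := {
  branch_radius : 0 < R1;
  branch_PS : PS R1 Lm;
  branch_PS' : PS R1 Lm';
  branch_0 : Lm 0%C = 0%C;
  branch_diff : forall t, Cmod t < R1 -> Cdiff Lm t (Lm' t)
}.

Definition local_coord (P0 : C) (Lm : C -> C) (t : C) : C := (P0 * (t * Cexp (Lm t)))%C.
Definition local_om (Lm' : C -> C) (t : C) : C := (1 + t * Lm' t)%C.

(** Relational, because the series of products and exponentials are only known to exist;
    [psr_unique] makes the value well determined. *)
Definition tcoef (R1 : R) (n : nat) (f : C -> C) (c : C) : Prop := exists al, psr R1 al f /\ al n = c.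

(** The residue of [u' / u^{n+1}] vanishes for [n > 0]. *)
Lemma tcoef_om_exp (R1 : R) (Lm Lm' : C -> C) (n : nat) : local_branch R1 Lm Lm' ->
  tcoef R1 (S n) (fun t => local_om Lm' t * Cexp (- (INR (S n) * Lm t)))%C 0.
Proof.
  intros [HR H H' H0 HD].
  destruct (PS_exp R1 (fun t => - (INR (S n)) * Lm t)%C HR (PS_scal _ _ _ H)) as [e He].
  assert (E : forall t, Cmod t < R1 -> CPS (dcoef e) t = (- INR (S n) * Lm' t * Cexp (- INR (S n) * Lm t))%C).
  { intros t Ht.
    assert (Dt : Cder (fun s : R => (t + s)%C) 0 1).
    { eapply Cder_val; [|apply Cder_plus; [apply Cder_const|apply Cder_id]]. ring. }
    assert (Et : (t + RtoC 0)%C = t) by ring.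
    assert (D1 := psr_Cder R1 e _ (fun s : R => (t + s)%C) 0 1 He).
    cbv beta in D1. rewrite Et in D1. specialize (D1 Ht Dt).
    assert (D2 := Cder_comp Lm (fun s : R => (t + s)%C) 0 (Lm' t) 1).
    cbv beta in D2. rewrite Et in D2. specialize (D2 (HD t Ht) Dt).
    assert (D3 := Cder_exp _ _ _ (Cder_scal (- INR (S n)) _ _ _ D2)).
    assert (E := Cder_unique _ _ _ _ D1 D3). cbv beta in E. rewrite Et in E.
    transitivity (CPS (dcoef e) t * 1)%C; [ring|]. rewrite E. ring. }
  exists (fun k => e k + (- / INR (S n)) * match k with O => 0 | S j => dcoef e j end)%C. split.
  - eapply psr_ext; [|apply psr_plus; [exact He|apply psr_scal, psr_shift, (psr_dcoef _ _ _ He)]].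
    intros t Ht. cbv beta. rewrite (E t Ht). unfold local_om.
    replace (- (INR (S n) * Lm t))%C with (- INR (S n) * Lm t)%C by ring. field. apply INR_S_C_neq_0.
  - unfold dcoef. field. apply INR_S_C_neq_0.
Qed.

(** Lagrange inversion without an inverse function. The hypothesis says that [beta n] is the residue
    of [f u' / u^(n+1)]. Passing to [f1 = (f - f 0) / u] shifts these residues by one, because the
    residue of [u' / u^(n+2)] is zero. *)
Lemma PS_asy (R1 R0 : R) (P0 : C) (Lm Lm' f : C -> C) (beta : nat -> C) (N : nat) :
  local_branch R1 Lm Lm' -> R0 < R1 -> P0 <> 0%C -> PS R1 f ->
  (forall n, tcoef R1 n (fun t => local_om Lm' t * (f t * Cexp (- (INR n * Lm t))))%C (beta n * P0 ^ n)%C) ->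
  asy R0 (local_coord P0 Lm) N beta f.
Proof.
  intros LB HR0 HP. assert (LB0 := LB). destruct LB0 as [HR H H' H0 HD].
  revert beta f. induction N as [|N IH]; intros beta f Hf Hb.
  - destruct (PS_bounded R1 f R0 HR0 Hf) as [M [_ HM]]. exists M. intros t Ht. apply HM; lra.
  - destruct (PS_unshift R1 f HR Hf) as [g [Hg Eg]].
    assert (HE : PS R1 (fun t => Cexp (-1 * Lm t))) by (apply PS_exp; [exact HR|now apply PS_scal]).
    set (f1 := fun t => (/ P0 * (g t * Cexp (-1 * Lm t)))%C).
    assert (Hf1 : PS R1 f1) by (apply PS_scal, PS_mult; assumption).
    assert (Eb : beta 0%nat = f 0%C).
    { destruct (Hb 0%nat) as [al [Hal Eal]].
      assert (E := psr_at_0 _ _ _ HR Hal). cbv beta in E. rewrite Eal in E. unfold local_om in E. simpl in E.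
      replace (- (0 * Lm 0))%C with (RtoC 0) in E by ring. rewrite Cexp_0 in E.
      replace (beta 0%nat) with (beta 0%nat * 1)%C by ring. rewrite <- E. ring. }
    exists f1. split.
    + intros t Ht. rewrite Eg, Eb by lra. unfold local_coord, f1.
      replace (-1 * Lm t)%C with (- Lm t)%C by ring. rewrite Cexp_opp. field. split; [apply Cexp_neq_0|exact HP].
    + apply IH; [exact Hf1|]. intros n.
      destruct (Hb (S n)) as [al [Hal Eal]].
      assert (HW : PS R1 (fun t => local_om Lm' t * (f1 t * Cexp (- (INR n * Lm t))))%C).
      { apply PS_mult; [|apply PS_mult; [exact Hf1|]].
        - apply PS_plus; [apply PS_const|]. apply PS_mult; [apply PS_id|exact H'].
        - apply PS_exp; [exact HR|]. apply (PS_ext _ (fun t => (- INR n) * Lm t)%C); [intros; ring|now apply PS_scal]. }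
      destruct HW as [w Hw]. exists w. split; [exact Hw|].
      destruct (tcoef_om_exp R1 Lm Lm' n LB) as [v [Hv Ev]].
      assert (HS : psr R1 (fun k => f 0%C * v k + P0 * match k with O => 0 | S j => w j end)%C
                  (fun t => local_om Lm' t * (f t * Cexp (- (INR (S n) * Lm t))))%C).
      { eapply psr_ext; [|apply psr_plus; [apply (psr_scal _ (f 0%C)), Hv|apply (psr_scal _ P0), psr_shift, Hw]].
        intros t Ht. cbv beta. rewrite (Eg t Ht). unfold f1.
        rewrite S_INR, RtoC_plus.
        replace (- ((INR n + 1) * Lm t))%C with (- (INR n * Lm t) + (-1 * Lm t))%C by (apply C_eq; simpl; ring).
        rewrite !Cexp_plus. field. exact HP. }
      assert (E := psr_unique _ _ _ _ (S n) HR Hal HS). cbv beta in E. rewrite Eal, Ev in E.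
      transitivity (/ P0 * (f 0%C * 0 + P0 * w n))%C; [field; exact HP|].
      rewrite <- E. rewrite Cpow_S. field. exact HP.
Qed.

Lemma PS_small (R0 : R) (f : C -> C) (eps : R) : 0 < R0 -> 0 < eps -> PS R0 f ->
  exists R1, 0 < R1 <= R0 /\ forall t, Cmod t < R1 -> Cmod (f t - f 0%C) <= eps.
Proof.
  intros HR He H. destruct (PS_unshift R0 f HR H) as [g [Hg Eg]].
  destruct (PS_bounded R0 g (R0 / 2)) as [M [HM0 HM]]; [lra|exact Hg|].
  exists (Rmin (R0 / 2) (eps / M)).
  assert (0 < eps / M) by (apply Rdiv_lt_0_compat; lra).
  split; [split; [apply Rmin_pos; lra|eapply Rle_trans; [apply Rmin_l|lra]]|].
  intros t Ht.
  assert (H1 : Cmod t < R0 / 2) by (eapply Rlt_le_trans; [exact Ht|apply Rmin_l]).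
  assert (H2 : Cmod t < eps / M) by (eapply Rlt_le_trans; [exact Ht|apply Rmin_r]).
  rewrite Eg by lra. replace (f 0%C + t * g t - f 0%C)%C with (t * g t)%C by ring.
  rewrite Cmod_mult. apply Rle_trans with (eps / M * M); [|right; field; lra].
  apply Rmult_le_compat; try apply Cmod_ge_0; [lra|]. apply HM; lra.
Qed.

Lemma Cexp_polar (rho theta : R) : 0 < rho -> Cexp (ln rho, theta) = (rho * Cexp (Ci * theta))%C.
Proof. intros H. unfold Cexp, Re, Im; simpl. rewrite exp_ln by exact H. apply C_eq; simpl;
  replace (0 * theta - 1 * 0) with 0 by ring; replace (0 * 0 + 1 * theta) with theta by ring; rewrite exp_0; ring. Qed.

Lemma Cexp_is_arg (w : C) (phi : R) : w <> 0%C -> is_arg w phi -> Cexp (ln (Cmod w), phi) = w.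
Proof. intros Hw H. rewrite Cexp_polar by now apply Cmod_gt_0. symmetry. exact H. Qed.

(** The power common to all terms, in general not an integral one, is pulled out and leaves an
    ordinary power series. *)
Lemma CPS_principal (u : nat -> C) (R0 : R) (t e : C) (ex : nat -> C) : geo R0 u -> 0 < Cmod t < R0 ->
  (forall n, ex n = (INR n + e)%C) ->
  Csum (fun n => u n * principal_pow t (ex n))%C = (Cexp (e * Clog t) * CPS u t)%C.
Proof.
  intros G Ht Hex. apply Csum_cser.
  assert (Ht0 : t <> 0%C) by now apply Cmod_gt_0.
  eapply cser_ext; [|apply (cser_scal (Cexp (e * Clog t))), (geo_psr _ _ G t (proj2 Ht))].
  intros n. cbv beta. rewrite Hex.
  change (principal_pow t (INR n + e)) with (Cexp ((INR n + e) * Clog t)).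
  replace ((INR n + e) * Clog t)%C with (INR n * Clog t + e * Clog t)%C by ring.
  rewrite Cexp_plus, Cexp_pow, Cexp_Clog by exact Ht0. ring.
Qed.

Lemma INR_C_neq_0 (n : nat) : (0 < n)%nat -> RtoC (INR n) <> 0%C.
Proof. intros H E. apply RtoC_inj in E. apply (not_0_INR n); [lia|exact E]. Qed.

(** [Lm] is [1 / mu] times the logarithm of [(p(t) - p(a)) / (p_0 (t-a)^mu)], [B] is [q dt] divided
    by [mu u^(lam-1) du], and [h] is [r / u - x]. Since [B] and [h] are power series in [t - a], the
    residues defining [b_n] and [c_n] become the Taylor coefficients that [PS_asy] asks for. *)
Lemma local_expansion (a : C) (mu : nat) (lam : C) (varpi0 : R) (pn qn rn : nat -> C) (R0 eps : R) :
  (1 <= mu)%nat -> pn 0%nat <> 0%C -> is_arg (pn 0%nat) varpi0 -> 0 < R0 -> 0 < eps ->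
  geo R0 pn -> geo R0 qn -> geo R0 rn ->
  let P0 := polar_pow (Cmod (pn 0%nat)) varpi0 (1 / INR mu)%R in
  let x := (rn 0%nat / P0)%C in
  exists R1 Lm Lm' B h, R1 <= R0 /\ local_branch R1 Lm Lm' /\ P0 <> 0%C /\
    (forall t, Cmod t < R1 -> CPS pn t = (pn 0%nat * Cexp (INR mu * Lm t))%C) /\
    (forall t, Cmod t < R1 -> CPS qn t =
       (INR mu * polar_pow (Cmod (pn 0%nat)) varpi0 (lam / INR mu)%C * Cexp (lam * Lm t) * (local_om Lm' t * B t))%C) /\
    (forall t, Cmod t < R1 -> (t * CPS rn t = local_coord P0 Lm t * (x + h t))%C) /\
    (forall t, Cmod t < R1 -> Cmod (INR mu * Lm t) <= eps) /\
    (forall t, Cmod t < R1 -> Cmod (local_om Lm' t - 1) <= 1 / 2) /\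
    (forall N, asy R1 (local_coord P0 Lm) N (b_coef a (INR mu) lam varpi0 pn qn) B) /\
    (forall N, asy R1 (local_coord P0 Lm) N
       (fun j => match j with O => 0%C | S _ => c_coef a (INR mu) 1 varpi0 pn rn j end) h).
Proof.
  intros Hmu Hp0 Harg HR Heps Gp Gq Gr P0 x.
  set (p0 := pn 0%nat) in *. set (lp := (ln (Cmod p0), varpi0) : C).
  assert (Elp : Cexp lp = p0) by (apply Cexp_is_arg; assumption).
  assert (Hmu0 : RtoC (INR mu) <> 0%C) by (apply INR_C_neq_0; lia).
  assert (HmuR : INR mu <> 0) by (apply not_0_INR; lia).
  assert (EP0 : P0 = Cexp (/ INR mu * lp)).
  { unfold P0, polar_pow. f_equal. f_equal. rewrite RtoC_div by exact HmuR. unfold Cdiv; ring. }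
  assert (HP0 : P0 <> 0%C) by (rewrite EP0; apply Cexp_neq_0).
  set (A := fun t => (/ p0 * CPS pn t)%C).
  assert (HA : PS R0 A) by (apply PS_scal; exists pn; now apply geo_psr).
  assert (HA0 : A 0%C = 1%C).
  { unfold A. rewrite (psr_at_0 _ _ _ HR (geo_psr _ _ Gp)). fold p0. field. exact Hp0. }
  destruct (PS_log R0 A HR HA HA0) as [R1 [L [L' [HR1 [HL [HL' [L0 [DL EL]]]]]]]].
  set (om := fun t => local_om (fun t => / INR mu * L' t)%C t).
  assert (Hom : PS R1 om).
  { apply PS_plus; [apply PS_const|]. apply PS_mult; [apply PS_id|]. now apply PS_scal. }
  assert (Hom0 : om 0%C = 1%C) by (unfold om, local_om; ring).
  destruct (PS_inv R1 om) as [R2 [HR2 [Hiom NZom]]]; [lra|exact Hom|rewrite Hom0; intros E; apply RtoC_inj in E; lra|].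
  (* The bound 1 keeps [Im L] inside [(- PI, PI)], so that the principal power in [p_diff_pow] is
     [Cexp (s * L)]. *)
  destruct (PS_small R1 L (Rmin eps 1)) as [R3 [HR3 SL]]; [lra|apply Rmin_pos; lra|exact HL|].
  destruct (PS_small R1 om (1 / 2)) as [R4 [HR4 Som]]; [lra|lra|exact Hom|].
  set (R5 := Rmin R2 (Rmin R3 R4)).
  assert (HR5 : 0 < R5) by (repeat apply Rmin_pos; lra).
  assert (HR52 : R5 <= R2) by apply Rmin_l.
  assert (HR53 : R5 <= R3) by (eapply Rle_trans; [apply Rmin_r|apply Rmin_l]).
  assert (HR54 : R5 <= R4) by (eapply Rle_trans; [apply Rmin_r|apply Rmin_r]).
  set (Lm := fun t => (/ INR mu * L t)%C). set (Lm' := fun t => (/ INR mu * L' t)%C).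
  assert (LB : local_branch R5 Lm Lm').
  { split; [exact HR5|apply PS_scal, (PS_le R1); [lra|exact HL]|apply PS_scal, (PS_le R1); [lra|exact HL']|unfold Lm; rewrite L0; ring|].
    intros t Ht. destruct (DL t ltac:(lra)) as [K [d [Hd HK]]].
    exists (Cmod (/ INR mu) * K), d. split; [exact Hd|]. intros k Hk. unfold Lm, Lm'.
    replace (_ - _ - _)%C with (/ INR mu * (L (t + k) - L t - L' t * k))%C by ring.
    rewrite Cmod_mult, Rmult_assoc. apply Rmult_le_compat_l; [apply Cmod_ge_0|now apply HK]. }
  set (Q0 := polar_pow (Cmod p0) varpi0 (lam / INR mu)%C).
  assert (EQ0 : Q0 = Cexp (lam / INR mu * lp)) by reflexivity.
  set (B := fun t => (/ (INR mu * Q0) * (CPS qn t * (Cexp (- lam * Lm t) * / om t)))%C).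
  set (h0 := fun t => (/ P0 * (CPS rn t * Cexp (- (1) * Lm t)))%C).
  assert (LPS : PS R5 Lm) by apply LB.
  assert (HQ0 : Q0 <> 0%C) by (rewrite EQ0; apply Cexp_neq_0).
  assert (HB : PS R5 B).
  { apply PS_scal, PS_mult; [exists qn; apply (psr_le R0); [lra|now apply geo_psr]|].
    apply PS_mult; [|apply (PS_le R2); [lra|exact Hiom]]. apply PS_exp; [exact HR5|]. now apply PS_scal. }
  assert (Hh0 : PS R5 h0).
  { apply PS_scal, PS_mult; [exists rn; apply (psr_le R0); [lra|now apply geo_psr]|].
    apply PS_exp; [exact HR5|]. now apply PS_scal. }
  assert (EA : forall t, Cmod t < R5 -> CPS pn t = (p0 * Cexp (L t))%C).
  { intros t Ht. rewrite EL by lra. unfold A. field. exact Hp0. }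
  assert (SL1 : forall t, Cmod t < R5 -> Cmod (L t) <= Rmin eps 1).
  { intros t Ht. specialize (SL t ltac:(lra)). rewrite L0 in SL. replace (L t - 0)%C with (L t) in SL by ring. exact SL. }
  assert (Epow : forall (s : C) t, 0 < Cmod t < R5 ->
    p_diff_pow a (INR mu) varpi0 pn s (a + t)%C = (Cexp (s * lp) * Cexp (INR mu * s * Clog t) * Cexp (s * L t))%C).
  { intros s t Ht. unfold p_diff_pow. replace (a + t - a)%C with t by ring. fold p0. f_equal.
    replace (1 + Csum (fun n => pn (S n) / p0 * t ^ S n))%C with (Cexp (L t)).
    - apply principal_pow_Cexp.
        assert (Q := Im_le_Cmod (L t)). assert (Q2 := SL1 t (proj2 Ht)).
        assert (Q3 := Rmin_r eps 1). assert (Q4 := PI2_1). apply Rabs_le_between in Q. lra.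
    - rewrite EL by lra. transitivity (1 + (A t - 1))%C; [ring|]. f_equal. symmetry. apply Csum_cser.
        assert (S0 := cser_scal (/ p0) _ _ (geo_psr _ _ Gp t ltac:(lra))).
        apply cser_decr in S0. eapply cser_val; [|eapply cser_ext; [|exact S0]].
        * unfold A. fold p0. simpl. field. exact Hp0.
        * intros n. cbv beta. unfold Cdiv. ring. }
  (* The exponents of [t] add up to [lam - 1 - (n + lam) = - (n + 1)], an integer, so the choice of
     [Clog t] drops out. *)
  assert (Bt : forall n t, 0 < Cmod t < R5 ->
    (q_expansion a lam qn (a + t) / p_diff_pow a (INR mu) varpi0 pn ((INR n + lam) / INR mu) (a + t))%C
      = (INR mu * / P0 ^ n * (om t * (B t * Cexp (- (INR n * Lm t)))) / t ^ S n)%C).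
  { intros n t Ht. rewrite Epow by exact Ht. unfold q_expansion. replace (a + t - a)%C with t by ring.
    rewrite (CPS_principal qn R0 t (lam - 1)); [|exact Gq|lra|intros k; ring].
    assert (Ht0 : t <> 0%C) by now apply Cmod_gt_0.
    replace (t ^ S n)%C with (Cexp (INR (S n) * Clog t)) by (rewrite Cexp_pow, Cexp_Clog by exact Ht0; reflexivity).
    replace (P0 ^ n)%C with (Cexp (INR n * (/ INR mu * lp))) by (rewrite Cexp_pow, <- EP0; reflexivity).
    unfold B. rewrite EQ0. unfold Lm.
    replace (Cexp ((lam - 1) * Clog t)) with (Cexp (INR mu * ((INR n + lam) / INR mu) * Clog t) / Cexp (INR (S n) * Clog t))%C.
    2:{ rewrite <- Cexp_minus. f_equal. rewrite S_INR, RtoC_plus. field. exact Hmu0. }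
    replace (Cexp ((INR n + lam) / INR mu * lp)) with (Cexp (INR n * (/ INR mu * lp)) * Cexp (lam / INR mu * lp))%C.
    2:{ rewrite <- Cexp_plus. f_equal. field. exact Hmu0. }
    replace (Cexp ((INR n + lam) / INR mu * L t)) with (/ (Cexp (- lam * (/ INR mu * L t)) * Cexp (- (INR n * (/ INR mu * L t)))))%C.
    2:{ rewrite <- Cexp_plus, <- Cexp_opp. f_equal. field. exact Hmu0. }
    field. repeat split; try apply Cexp_neq_0; try exact Hmu0. apply NZom; lra. }
  (* The derived series is evaluated by differentiating [p_0 Cexp L] along a real line through [t]
     and comparing the two derivatives. *)
  assert (EdP : forall t, Cmod t < R5 -> CPS (dcoef pn) t = (p0 * (L' t * Cexp (L t)))%C).
  { intros t Ht.
    assert (Dt : Cder (fun s : R => (t + s)%C) 0 1).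
    { eapply Cder_val; [|apply Cder_plus; [apply Cder_const|apply Cder_id]]. ring. }
    assert (Et : (t + RtoC 0)%C = t) by ring.
    assert (D1 := psr_Cder R0 pn _ (fun s : R => (t + s)%C) 0 1 (geo_psr _ _ Gp)).
    cbv beta in D1. rewrite Et in D1. specialize (D1 ltac:(lra) Dt).
    assert (D2 := Cder_comp L (fun s : R => (t + s)%C) 0 (L' t) 1).
    cbv beta in D2. rewrite Et in D2. specialize (D2 (DL t ltac:(lra)) Dt).
    assert (D3 := Cder_scal p0 _ _ _ (Cder_exp _ _ _ D2)). cbv beta in D3. rewrite Et in D3.
    transitivity (CPS (dcoef pn) t * 1)%C; [ring|].
    rewrite (Cder_unique (fun s : R => CPS pn (t + s)%C) 0 (CPS (dcoef pn) t * 1) (p0 * (L' t * 1 * Cexp (L t)))); [ring|exact D1|].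
    apply (Cder_ext_loc (fun s : R => (p0 * Cexp (L (t + s)%C))%C) _ _ _ (R5 - Cmod t)); [lra| |exact D3].
    intros s Hs. rewrite Rminus_0_r in Hs. rewrite EA; [reflexivity|].
    eapply Rle_lt_trans; [apply Cmod_triangle|]. rewrite Cmod_R. lra. }
  assert (Edp : forall t, 0 < Cmod t < R5 -> p_deriv_expansion a (INR mu) pn (a + t)%C
     = (Cexp ((INR mu - 1) * Clog t) * (INR mu * p0 * Cexp (L t) * om t))%C).
  { intros t Ht. unfold p_deriv_expansion. replace (a + t - a)%C with t by ring.
    rewrite (CPS_principal (fun n => (INR n + INR mu)%R * pn n)%C R0 t (INR mu - 1)); [| |lra|].
    - f_equal. unfold om, local_om. transitivity (t * CPS (dcoef pn) t + INR mu * CPS pn t)%C.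
      + eapply cser_unique; [apply (geo_psr R0)|]; [|lra|].
        * assert (Gd := psr_geo _ _ _ (psr_plus _ _ _ _ _ (psr_shift _ _ _ (psr_dcoef _ _ _ (geo_psr _ _ Gp))) (psr_scal _ (INR mu) _ _ (geo_psr _ _ Gp)))).
          intros r Hr. destruct (Gd r Hr) as [M HM]. exists M. intros k. eapply Rle_trans; [|apply (HM k)]. right. f_equal. f_equal.
          rewrite RtoC_plus. destruct k; [simpl; ring|unfold dcoef; ring].
        * eapply cser_ext; [|apply (psr_plus _ _ _ _ _ (psr_shift _ _ _ (psr_dcoef _ _ _ (geo_psr _ _ Gp))) (psr_scal _ (INR mu) _ _ (geo_psr _ _ Gp)) t); lra].
          intros k. cbv beta. rewrite RtoC_plus. destruct k; [simpl; ring|unfold dcoef; ring].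
      + rewrite EdP, EA by lra. field. exact Hmu0.
    - assert (Gd := psr_geo _ _ _ (psr_plus _ _ _ _ _ (psr_shift _ _ _ (psr_dcoef _ _ _ (geo_psr _ _ Gp))) (psr_scal _ (INR mu) _ _ (geo_psr _ _ Gp)))).
      intros r Hr. destruct (Gd r Hr) as [M HM]. exists M. intros k. eapply Rle_trans; [|apply (HM k)]. right. f_equal. f_equal.
      rewrite RtoC_plus. destruct k; [simpl; ring|unfold dcoef; ring].
    - intros n. rewrite RtoC_minus, RtoC_plus. ring. }
  assert (Ct : forall n t, 0 < Cmod t < R5 ->
    (p_deriv_expansion a (INR mu) pn (a + t) * r_expansion a 1 rn (a + t)
       / p_diff_pow a (INR mu) varpi0 pn ((INR n + 1) / INR mu + 1)%R (a + t))%C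
      = (INR mu * / P0 ^ n * (om t * (h0 t * Cexp (- (INR n * Lm t)))) / t ^ S n)%C).
  { intros n t Ht. rewrite Epow, Edp by exact Ht. unfold r_expansion. replace (a + t - a)%C with t by ring.
    rewrite (CPS_principal rn R0 t 1); [|exact Gr|lra|intros k; rewrite RtoC_plus; ring].
    assert (Ht0 : t <> 0%C) by now apply Cmod_gt_0.
    replace (t ^ S n)%C with (Cexp (INR (S n) * Clog t)) by (rewrite Cexp_pow, Cexp_Clog by exact Ht0; reflexivity).
    replace (P0 ^ n)%C with (Cexp (INR n * (/ INR mu * lp))) by (rewrite Cexp_pow, <- EP0; reflexivity).
    unfold h0. rewrite EP0. unfold Lm.
    rewrite RtoC_plus, RtoC_div, RtoC_plus by exact HmuR.
    replace (Cexp (((INR n + 1) / INR mu + 1) * lp)) with (Cexp (INR n * (/ INR mu * lp)) * Cexp (/ INR mu * lp) * p0)%C.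
    2:{ rewrite <- Elp at 1. rewrite <- !Cexp_plus. f_equal. field. exact Hmu0. }
    replace (Cexp (INR mu * ((INR n + 1) / INR mu + 1) * Clog t)) with (Cexp (INR (S n) * Clog t) * (Cexp ((INR mu - 1) * Clog t) * Cexp (1 * Clog t)))%C.
    2:{ rewrite <- !Cexp_plus. f_equal. rewrite S_INR, RtoC_plus. field. exact Hmu0. }
    replace (Cexp (((INR n + 1) / INR mu + 1) * L t)) with (Cexp (L t) / (Cexp (- (1) * (/ INR mu * L t)) * Cexp (- (INR n * (/ INR mu * L t)))))%C.
    2:{ rewrite <- Cexp_plus, <- Cexp_minus. f_equal. field. exact Hmu0. }
    field. repeat split; try apply Cexp_neq_0; try exact Hp0. }
  assert (TC : forall (f F : C -> C) n, PS R5 f ->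
     (forall t, 0 < Cmod t < R5 -> F (a + t)%C = (INR mu * / P0 ^ n * (om t * (f t * Cexp (- (INR n * Lm t)))) / t ^ S n)%C) ->
     tcoef R5 n (fun t => local_om Lm' t * (f t * Cexp (- (INR n * Lm t))))%C (/ INR mu * Residue F a * P0 ^ n)).
  { intros f F n Hf HF.
    assert (HW : PS R5 (fun t => local_om Lm' t * (f t * Cexp (- (INR n * Lm t))))%C).
    { apply PS_mult; [apply (PS_le R1); [lra|exact Hom]|]. apply PS_mult; [exact Hf|].
      apply PS_exp; [exact HR5|]. apply (PS_ext _ (fun t => (- INR n) * Lm t)%C); [intros; ring|now apply PS_scal]. }
    destruct HW as [w Hw]. exists w. split; [exact Hw|].
    rewrite (Residue_psr F _ a _ R5 n HR5 (psr_scal _ (INR mu * / P0 ^ n) _ _ Hw) HF).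
    field. split; [now apply Cpow_nz|exact Hmu0]. }
  (* The radius is halved because a power series is bounded only on strictly smaller discs. *)
  destruct (Rlt_le_dec 0 (R5 / 2)) as [HR6|]; [|lra].
  assert (LB6 : local_branch (R5 / 2) Lm Lm').
  { destruct LB as [? ? ? ? DB]. split; [exact HR6|apply (PS_le R5); [lra|assumption]|apply (PS_le R5); [lra|assumption]|assumption|]. intros t Ht. apply DB; lra. }
  assert (Ac : forall N, asy (R5 / 2) (local_coord P0 Lm) N (c_coef a (INR mu) 1 varpi0 pn rn) h0).
  { intros N. apply (PS_asy R5 (R5 / 2) P0 Lm Lm'); try assumption; [lra|].
    intros n. apply TC; [exact Hh0|apply Ct]. }
  (* The coefficient of index 0 equals [x]; subtracting it makes [h] vanish at 0. *)
  assert (Ec : c_coef a (INR mu) 1 varpi0 pn rn 0%nat = x).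
  { destruct (Ac 1%nat) as [f1 [E _]]. specialize (E 0%C ltac:(rewrite Cmod_0; exact HR6)).
    unfold local_coord in E. unfold h0 in E. rewrite (psr_at_0 _ _ _ HR (geo_psr _ _ Gr)) in E.
    unfold Lm in E. rewrite L0 in E. replace (- (1) * (/ INR mu * 0))%C with (RtoC 0) in E by ring. rewrite Cexp_0 in E.
    replace (P0 * (0 * Cexp (/ INR mu * 0)) * f1 0)%C with (RtoC 0) in E by ring.
    unfold x. transitivity (c_coef a (INR mu) 1 varpi0 pn rn 0 + 0)%C; [ring|]. rewrite <- E. unfold Cdiv; ring. }
  exists (R5 / 2), Lm, Lm', B, (fun t => (-x + h0 t)%C).
  split; [lra|]. split; [exact LB6|]. split; [exact HP0|].
  split; [|split; [|split; [|split; [|split; [|split]]]]].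
  - intros t Ht. rewrite EA by lra. unfold Lm. do 2 f_equal. field. exact Hmu0.
  - intros t Ht. unfold B. fold om. fold Q0.
    replace (Cexp (- lam * Lm t)) with (/ Cexp (lam * Lm t))%C by (rewrite <- Cexp_opp; f_equal; ring).
    unfold om. fold Lm'. fold (om t). change (local_om Lm' t) with (om t). field. repeat split; try assumption; [apply NZom; lra|apply Cexp_neq_0].
  - intros t Ht. unfold local_coord, h0.
    replace (- (1) * Lm t)%C with (- Lm t)%C by ring. rewrite Cexp_opp. field. split; [apply Cexp_neq_0|exact HP0].
  - intros t Ht. unfold Lm. replace (INR mu * (/ INR mu * L t))%C with (L t) by (field; exact Hmu0).
    eapply Rle_trans; [apply SL1; lra|apply Rmin_l].
  - intros t Ht. specialize (Som t ltac:(lra)). rewrite Hom0 in Som. change (local_om Lm' t) with (om t).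
    exact Som.
  - intros N. apply (PS_asy R5 (R5 / 2) P0 Lm Lm'); try assumption; [lra|].
    intros n. apply (TC B); [exact HB|apply Bt].
  - intros N. eapply asy_ext; [| |apply asy_plus; [apply (asy_const _ _ N (- x))|apply (Ac N)]].
    + intros [|n] _; [rewrite Ec; ring|ring].
    + reflexivity.
Qed.

(** * Entire functions *)

(** With the radius quantified inside, one coefficient sequence serves all discs, so that
    [psr_power_primitive] yields a primitive independent of the radius. *)
Definition entire (f : C -> C) : Prop := exists a, forall R0, psr R0 a f.

Lemma entire_ext (f g : C -> C) : (forall t, f t = g t) -> entire f -> entire g.
Proof. intros E [a H]. exists a. intros R0. apply (psr_ext _ _ f); auto. Qed.

Lemma entire_plus (f g : C -> C) : entire f -> entire g -> entire (fun t => f t + g t)%C.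
Proof. intros [a A] [b B]. eexists. intros R0. apply psr_plus; auto. Qed.

Lemma entire_scal (c : C) (f : C -> C) : entire f -> entire (fun t => c * f t)%C.
Proof. intros [a A]. eexists. intros R0. apply psr_scal; auto. Qed.

Lemma entire_mult (f g : C -> C) : entire f -> entire g -> entire (fun t => f t * g t)%C.
Proof. intros [a A] [b B]. eexists. intros R0. apply psr_mult; auto. Qed.

Lemma entire_const (c : C) : entire (fun _ => c).
Proof. eexists. intros R0. apply psr_const. Qed.

Lemma entire_id : entire (fun t => t).
Proof.
  apply (entire_ext (fun t => t * 1)%C); [intros; ring|]. eexists. intros R0. apply psr_shift, psr_const.
Qed.

Lemma entire_pow (n : nat) : entire (fun t => t ^ n)%C.
Proof.
  induction n; [exact (entire_const 1)|]. apply (entire_ext (fun t => t * t ^ n)%C); [reflexivity|].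
  apply entire_mult; [apply entire_id|assumption].
Qed.

Lemma entire_exp (f : C -> C) : entire f -> entire (fun t => Cexp (f t)).
Proof.
  intros [a A]. destruct (psr_exp a) as [h Hh]. exists h. intros R0.
  destruct (Rlt_le_dec 0 R0) as [H|H]; [now apply Hh|].
  intros t Ht. generalize (Cmod_ge_0 t); lra.
Qed.

Lemma entire_Cdiff (f : C -> C) : entire f -> exists f', entire f' /\ forall t, Cdiff f t (f' t).
Proof.
  intros [a A]. exists (CPS (dcoef a)). split.
  - exists (dcoef a). intros R0. eapply psr_dcoef, A.
  - intros t. apply (psr_Cdiff (Cmod t + 1)); [apply A|lra].
Qed.

(** Bridge to the complex derivative behind [C_derive], in terms of which [Faxen_derive_n] and
    [g_poly] are defined. *)
Lemma Cdiff_is_derive (f : C -> C) (t l : C) :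
  Cdiff f t l -> is_derive (K := C_AbsRing) (V := C_NormedModule) f t l.
Proof.
  intros [K [d [Hd H]]]. split; [apply is_linear_scal_l|].
  intros t' Ht'. apply (@is_filter_lim_locally_unique C_AbsRing (AbsRing_NormedModule C_AbsRing)) in Ht'. subst t'.
  intros eps. set (K' := Rabs K + 1). assert (HK : 0 < K') by (unfold K'; generalize (Rabs_pos K); lra).
  assert (Hd' : 0 < Rmin d (eps / K')).
  { apply Rmin_pos; [exact Hd|]. apply Rdiv_lt_0_compat; [apply cond_pos|exact HK]. }
  exists (mkposreal _ Hd'). intros y0 Hy. set (y := y0 : C). change y0 with y in Hy |- *. clearbody y. clear y0.
  change (Cmod (y - t) < Rmin d (eps / K')) in Hy.
  change (Cmod ((f y - f t) - (y - t) * l)%C <= eps * Cmod (y - t)).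
  set (h := (y - t)%C) in *.
  assert (H1 : Cmod h < d) by (eapply Rlt_le_trans; [exact Hy|apply Rmin_l]).
  assert (H2 : Cmod h < eps / K') by (eapply Rlt_le_trans; [exact Hy|apply Rmin_r]).
  specialize (H h H1). replace (t + h)%C with y in H by (unfold h; ring).
  replace (h * l)%C with (l * h)%C by ring. eapply Rle_trans; [exact H|].
  assert (P := Cmod_ge_0 h).
  rewrite <- Rmult_assoc. apply Rmult_le_compat_r; [exact P|].
  apply Rle_trans with (K' * Cmod h); [unfold K'; generalize (Rle_abs K); nra|].
  apply Rle_trans with (K' * (eps / K')); [apply Rmult_le_compat_l; lra|]. right. field. lra.
Qed.

(** * Growth estimates *)

(** [(1+y)^m <= e^{m y}] and [y^mu >= y^2 - 1] reduce the exponent to a quadratic one; completing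
    the square gives [L^2 / (4 kappa) + kappa]. Here [mu >= 2] lets [exp(- kappa y^mu)] beat
    [exp(K y)]. *)
Lemma growth_bound (mu : nat) (kappa K : R) (m : nat) : (2 <= mu)%nat -> 0 < kappa ->
  exists C0, 0 < C0 /\ forall y, 0 <= y -> (1 + y) ^ m * exp (K * y - kappa * y ^ mu) <= C0.
Proof.
  intros Hmu Hk. set (L := INR m + K). exists (exp (L * L / (4 * kappa) + kappa)).
  split; [apply exp_pos|]. intros y Hy.
  assert (E : (1 + y) ^ m <= exp (INR m * y)).
  { clear - Hy. induction m as [|m IH]; [simpl; rewrite Rmult_0_l, exp_0; lra|].
    rewrite S_INR, Rmult_plus_distr_r, exp_plus, Rmult_1_l. simpl ((1 + y) ^ S m). rewrite Rmult_comm.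
    apply Rmult_le_compat; [apply pow_le; lra|lra|exact IH|]. apply exp_ineq1_le. }
  apply Rle_trans with (exp (INR m * y) * exp (K * y - kappa * y ^ mu)).
  { apply Rmult_le_compat_r; [left; apply exp_pos|exact E]. }
  rewrite <- exp_plus. apply exp_le.
  assert (Q : y * y - 1 <= y ^ mu).
  { destruct (Rle_lt_dec 1 y) as [H1|H1].
    - replace mu with (2 + (mu - 2))%nat by lia. rewrite pow_add. simpl.
      assert (1 <= y ^ (mu - 2)) by now apply pow_R1_Rle. nra.
    - assert (0 <= y ^ mu) by now apply pow_le. nra. }
  assert (kappa * (y * y - 1) <= kappa * y ^ mu) by (apply Rmult_le_compat_l; lra).
  assert (Sq : L * y - kappa * (y * y) <= L * L / (4 * kappa)).
  { apply Rmult_le_reg_r with (4 * kappa); [lra|].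
    replace (L * L / (4 * kappa) * (4 * kappa)) with (L * L) by (field; lra).
    assert (0 <= (L - 2 * kappa * y) * (L - 2 * kappa * y)) by apply Rle_0_sqr. nra. }
  replace (INR m * y) with (L * y - K * y) by (unfold L; ring). lra.
Qed.

Lemma nat_above (s : R) : exists m, s <= INR m.
Proof.
  destruct (nfloor_ex (Rabs s) (Rabs_pos s)) as [n Hn]. exists (S n). rewrite S_INR. generalize (Rle_abs s); lra.
Qed.

Lemma exp_le_pow (s eta : R) (m : nat) : 0 <= s <= INR m -> exp (s * eta) <= (1 + exp eta) ^ m.
Proof.
  intros Hs. assert (He := exp_pos eta).
  destruct (Rle_lt_dec 0 eta) as [H|H].
  - apply Rle_trans with (exp (INR m * eta)).
    + apply exp_le. apply Rmult_le_compat_r; lra.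
    + clear Hs. induction m as [|m IH]; [simpl; rewrite Rmult_0_l, exp_0; lra|].
      rewrite S_INR, Rmult_plus_distr_r, exp_plus, Rmult_1_l. simpl. rewrite Rmult_comm.
      apply Rmult_le_compat; try (left; apply exp_pos); [lra|exact IH].
  - apply Rle_trans with 1; [|apply pow_R1_Rle; lra].
    rewrite <- exp_0. apply exp_le. nra.
Qed.

(** A bounded increasing function on [R] whose derivative dominates [e^{sigma eta}] times any decaying factor;
    in the variable [y = e^eta] it is [(y / (1 + y))^sigma]. *)
Definition maj (sigma eta : R) : R := exp (- sigma * ln (1 + exp (- eta))).
Definition maj' (sigma eta : R) : R := sigma * maj sigma eta / (1 + exp eta).

Lemma maj_pos (sigma eta : R) : 0 < maj sigma eta.
Proof. apply exp_pos. Qed.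

Lemma maj_le_1 (sigma eta : R) : 0 <= sigma -> maj sigma eta <= 1.
Proof.
  intros H. unfold maj. apply Rle_trans with (exp 0); [|rewrite exp_0; lra]. apply exp_le.
  assert (0 <= ln (1 + exp (- eta))).
  { rewrite <- ln_1. left. apply ln_increasing; generalize (exp_pos (- eta)); lra. }
  nra.
Qed.

Lemma maj_derive (sigma eta : R) : is_derive (maj sigma) eta (maj' sigma eta).
Proof.
  assert (H := exp_pos (- eta)). assert (H1 := exp_pos eta).
  unfold maj', maj. auto_derive; [lra|].
  assert (E : exp eta = / exp (- eta)) by (rewrite exp_Ropp, Rinv_inv; reflexivity).
  rewrite E. field. lra.
Qed.

(** With [y = e^eta] this is [(1+y)^sigma <= (1+y)^n]. *)
Lemma exp_le_maj (sigma eta : R) (n : nat) : 0 <= sigma <= INR n ->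
  exp (sigma * eta) <= (1 + exp eta) ^ n * maj sigma eta.
Proof.
  intros Hs. assert (He := exp_pos eta). assert (He' := exp_pos (- eta)).
  unfold maj.
  replace (ln (1 + exp (- eta))) with (ln (1 + exp eta) - eta).
  2:{ replace (1 + exp (- eta)) with ((1 + exp eta) * exp (- eta)).
      - rewrite ln_mult, ln_exp by lra. ring.
      - rewrite Rmult_plus_distr_r, <- exp_plus, Rplus_opp_r, exp_0. ring. }
  replace (- sigma * (ln (1 + exp eta) - eta)) with (sigma * eta + - (sigma * ln (1 + exp eta))) by ring.
  rewrite exp_plus. rewrite (Rmult_comm ((1 + exp eta) ^ n)), Rmult_assoc.
  rewrite <- (Rmult_1_r (exp (sigma * eta))) at 1. apply Rmult_le_compat_l; [left; apply exp_pos|].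
  rewrite exp_Ropp.
  apply Rmult_le_reg_l with (exp (sigma * ln (1 + exp eta))); [apply exp_pos|].
  rewrite <- Rmult_assoc, Rinv_r, Rmult_1_r, Rmult_1_l by (apply Rgt_not_eq, exp_pos).
  rewrite <- Rpower_pow by lra. unfold Rpower. apply exp_le. apply Rmult_le_compat_r; [|lra].
  rewrite <- ln_1. left. apply ln_increasing; lra.
Qed.

(** Towards [eta = -infinity] both sides behave like [e^{sigma eta}]; towards [+infinity] the left
    side decays faster than any power of [e^eta]. The exponent [n + m + 1] given to [growth_bound]
    provides for [exp_le_maj], for the given power and for the denominator of [maj']. *)
Lemma maj_bound (mu : nat) (sigma kappa K : R) (m : nat) : (2 <= mu)%nat -> 0 < sigma -> 0 < kappa ->
  exists C0, 0 < C0 /\ forall eta,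
    exp (sigma * eta) * (1 + exp eta) ^ m * exp (K * exp eta - kappa * exp eta ^ mu) <= C0 * maj' sigma eta.
Proof.
  intros Hmu Hs Hk. destruct (nat_above sigma) as [n Hn].
  destruct (growth_bound mu kappa K (n + m + 1) Hmu Hk) as [C0 [HC0 HC]].
  exists (C0 / sigma). split; [now apply Rdiv_lt_0_compat|]. intros eta.
  assert (He := exp_pos eta). specialize (HC (exp eta) ltac:(lra)).
  assert (E := exp_le_maj sigma eta n ltac:(lra)).
  set (X := exp (K * exp eta - kappa * exp eta ^ mu)) in *. assert (HX : 0 < X) by apply exp_pos.
  assert (HM := maj_pos sigma eta).
  apply Rle_trans with ((1 + exp eta) ^ n * maj sigma eta * (1 + exp eta) ^ m * X).
  { apply Rmult_le_compat_r; [lra|]. apply Rmult_le_compat_r; [apply pow_le; lra|exact E]. }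
  unfold maj'. rewrite !pow_add, pow_1 in HC.
  apply Rmult_le_reg_r with (1 + exp eta); [lra|].
  replace (C0 / sigma * (sigma * maj sigma eta / (1 + exp eta)) * (1 + exp eta)) with (C0 * maj sigma eta) by (field; lra).
  replace ((1 + exp eta) ^ n * maj sigma eta * (1 + exp eta) ^ m * X * (1 + exp eta))
    with ((1 + exp eta) ^ n * (1 + exp eta) ^ m * (1 + exp eta) * X * maj sigma eta) by ring.
  apply Rmult_le_compat_r; [lra|exact HC].
Qed.

Lemma decay_bound (mu : nat) (s k kappa K : R) : (2 <= mu)%nat -> 0 < kappa ->
  exists C0, 0 < C0 /\ forall eta, 0 <= eta ->
    exp (s * eta) * exp (K * exp eta - kappa * exp eta ^ mu) <= C0 * exp (- k * eta).
Proof.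
  intros Hmu Hk. destruct (nat_above (Rabs (s + k))) as [m Hm].
  destruct (growth_bound mu kappa K m Hmu Hk) as [C0 [HC0 HC]]. exists C0. split; [exact HC0|]. intros eta Heta.
  assert (He := exp_pos eta). specialize (HC (exp eta) ltac:(lra)).
  set (X := exp (K * exp eta - kappa * exp eta ^ mu)) in *. assert (HX : 0 < X) by apply exp_pos.
  assert (E := exp_le_pow (Rabs (s + k)) eta m (conj (Rabs_pos _) Hm)).
  assert (E2 : exp ((s + k) * eta) <= exp (Rabs (s + k) * eta)).
  { apply exp_le. apply Rmult_le_compat_r; [exact Heta|apply Rle_abs]. }
  apply Rmult_le_reg_r with (exp (k * eta)); [apply exp_pos|].
  rewrite (Rmult_assoc C0), <- exp_plus.
  replace (- k * eta + k * eta) with 0 by ring. rewrite exp_0, Rmult_1_r.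
  apply Rle_trans with (exp ((s + k) * eta) * X).
  { right. rewrite Rmult_plus_distr_r, exp_plus. ring. }
  eapply Rle_trans; [|exact HC]. apply Rmult_le_compat_r; lra.
Qed.

(** * The model integrand [y^beta exp(-y^mu + x y) dy / y] with [y = e^W] *)

Definition model (mu : nat) (beta x W : C) : C :=
  (Cexp (beta * W) * Cexp (- Cexp W ^ mu + x * Cexp W))%C.

Lemma Re_Cexp_pow (W : C) (mu : nat) : Re (Cexp W ^ mu)%C = exp (Re W) ^ mu * cos (INR mu * Im W).
Proof.
  rewrite <- Cexp_pow. unfold Cexp, Re, Im; simpl.
  replace (INR mu * fst W - 0 * snd W) with (INR mu * fst W) by ring.
  replace (INR mu * snd W + 0 * fst W) with (INR mu * snd W) by ring.
  f_equal. induction mu as [|n IH]; [simpl; rewrite Rmult_0_l; apply exp_0|].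
  rewrite S_INR, Rmult_plus_distr_r, exp_plus, IH, Rmult_1_l. simpl; ring.
Qed.

(** [kappa] bounds from below the cosine of the argument of [y^mu]; when positive, it measures the
    distance to the boundary of the sector where [exp(-y^mu)] decays. *)
Lemma Cmod_model (mu : nat) (beta x W : C) (kappa : R) : kappa <= cos (INR mu * Im W) ->
  Cmod (model mu beta x W) <=
    exp (Rabs (Im beta) * Rabs (Im W)) * (exp (Re beta * Re W) * exp (Cmod x * exp (Re W) - kappa * exp (Re W) ^ mu)).
Proof.
  intros Hk. unfold model. rewrite Cmod_mult, !Cmod_Cexp, <- !exp_plus. apply exp_le.
  set (y := Cexp W).
  assert (E1 : Re (beta * W)%C <= Rabs (Im beta) * Rabs (Im W) + Re beta * Re W).
  { replace (Re (beta * W)%C) with (Re beta * Re W - Im beta * Im W) by reflexivity.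
    rewrite <- Rabs_mult. generalize (Rle_abs (- (Im beta * Im W))). rewrite Rabs_Ropp. lra. }
  assert (E2 : Re (- y ^ mu + x * y)%C <= Cmod x * exp (Re W) - kappa * exp (Re W) ^ mu).
  { replace (Re (- y ^ mu + x * y)%C) with (- Re (y ^ mu)%C + Re (x * y)%C) by reflexivity.
    unfold y. rewrite Re_Cexp_pow.
    assert (Re (x * Cexp W)%C <= Cmod x * exp (Re W)).
    { eapply Rle_trans; [apply Rle_abs|]. eapply Rle_trans; [apply re_le_Cmod|]. rewrite Cmod_mult, Cmod_Cexp. lra. }
    assert (0 < exp (Re W) ^ mu) by (apply pow_lt, exp_pos).
    nra. }
  lra.
Qed.

(** [E] is [y^beta F(y)] with [F] a power series, so it tends to 0 with [y] as long as the argument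
    stays bounded: the primitive is normalised at [y = 0]. *)
Lemma model_primitive (mu : nat) (beta x : C) : 0 < Re beta ->
  exists E : C -> C,
    (forall W s v, Cder W s v -> Cder (fun u => E (W u)) s (v * model mu beta x (W s))) /\
    (exists K, 0 < K /\ forall W, Re W <= 0 -> Cmod (E W) <= K * exp (Re beta * Re W + Rabs (Im beta) * Rabs (Im W))).
Proof.
  intros Hb.
  assert (HE : entire (fun y => Cexp (- y ^ mu + x * y))%C).
  { apply entire_exp, entire_plus; [|apply entire_scal, entire_id].
    apply (entire_ext (fun y => -1 * y ^ mu)%C); [intros; ring|]. apply entire_scal, entire_pow. }
  destruct HE as [a Ha].
  destruct (psr_power_primitive a beta Hb) as [F HF].
  exists (fun W => Cexp (beta * W) * F (Cexp W))%C. split.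
  - intros W s v D. destruct (HF (Cmod (Cexp (W s)) + 1) _ ltac:(generalize (Cmod_ge_0 (Cexp (W s))); lra) (Ha _)) as [_ HD].
    apply HD; [lra|exact D].
  - destruct (HF 2 _ ltac:(lra) (Ha 2)) as [HP _].
    destruct (PS_bounded 2 F 1 ltac:(lra) HP) as [K [HK0 HK]]. exists K. split; [exact HK0|]. intros W HW.
    rewrite Cmod_mult, Rmult_comm. apply Rmult_le_compat; try apply Cmod_ge_0.
    + apply HK. rewrite Cmod_Cexp, <- exp_0. now apply exp_le.
    + rewrite Cmod_Cexp. apply exp_le.
      replace (Re (beta * W)%C) with (Re beta * Re W - Im beta * Im W) by reflexivity.
      rewrite <- Rabs_mult. generalize (Rle_abs (- (Im beta * Im W))). rewrite Rabs_Ropp. lra.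
Qed.

(** The neighbourhoods of the product structure are squares; squares and discs contain each other up
    to a factor [sqrt 2]. *)
Lemma filterlim_C_eps {T : Type} (F : (T -> Prop) -> Prop) {FF : Filter F} (f : T -> C) (l : C) :
  filterlim f F (locally (T := C_UniformSpace) l) <-> forall eps, 0 < eps -> F (fun x => Cmod (f x - l) <= eps).
Proof.
  rewrite filterlim_locally. split.
  - intros H eps He. assert (Hs : 0 < eps / 2) by lra.
    eapply filter_imp; [|apply (H (mkposreal _ Hs))]. intros x Hx.
    apply C_NormedModule_mixin_compat2 in Hx. change (Cmod (f x - l) < sqrt 2 * (eps / 2)) in Hx.
    assert (sqrt 2 <= 2).
    { rewrite <- (sqrt_square 2) at 2 by lra. apply sqrt_le_1; lra. }
    assert (sqrt 2 * (eps / 2) <= 2 * (eps / 2)) by (apply Rmult_le_compat_r; lra). lra.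
  - intros H eps. assert (He : 0 < eps / 2) by (generalize (cond_pos eps); lra).
    eapply filter_imp; [|apply (H _ He)]. intros x Hx. apply C_NormedModule_mixin_compat1.
    change (Cmod (f x - l) < eps). generalize (cond_pos eps); lra.
Qed.

Lemma filterlim_C_bound {T : Type} (F : (T -> Prop) -> Prop) {FF : ProperFilter F} (f : T -> C) (l c : C) (M : R) :
  filterlim f F (locally (T := C_UniformSpace) l) -> F (fun x => Cmod (f x - c) <= M) -> Cmod (l - c) <= M.
Proof.
  intros H HM. apply le_epsilon. intros eps He.
  apply (proj1 (filterlim_C_eps F f l)) with (eps := eps) in H; [|exact He].
  destruct (filter_ex _ (filter_and _ _ H HM)) as [x [H1 H2]].
  replace (l - c)%C with ((f x - c) - (f x - l))%C by ring.
  unfold Cminus at 1. eapply Rle_trans; [apply Cmod_triangle|]. rewrite Cmod_opp. lra.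
Qed.

Lemma filterlim_C_cauchy {T : Type} (F : (T -> Prop) -> Prop) {FF : ProperFilter F} (f : T -> C) :
  (forall eps, 0 < eps -> exists P, F P /\ forall u v, P u -> P v -> Cmod (f u - f v) <= eps) ->
  exists l, filterlim f F (locally (T := C_UniformSpace) l).
Proof.
  intros H. apply (@filterlim_locally_cauchy T C_CompleteNormedModule F FF f).
  intros eps. destruct (H (eps / 2)) as [P [HP HP2]]; [generalize (cond_pos eps); lra|].
  exists P. split; [exact HP|]. intros u v Hu Hv. apply C_NormedModule_mixin_compat1.
  change (Cmod (f v - f u) < eps). specialize (HP2 v u Hv Hu). generalize (cond_pos eps); lra.
Qed.

Lemma exp_scal_derive (c k s : R) : is_derive (fun u => c * exp (- k * u)) s (- k * c * exp (- k * s)).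
Proof. auto_derive; [exact I|ring]. Qed.

Lemma exp_decay_eventually (C0 k eps : R) : 0 < C0 -> 0 < k -> 0 < eps -> exists M, 0 <= M /\ forall eta, M <= eta -> C0 * exp (- k * eta) <= eps.
Proof.
  intros HC Hk He. exists (Rmax 0 (- ln (eps / C0) / k)). split; [apply Rmax_l|]. intros eta H.
  assert (H1 : - ln (eps / C0) / k <= eta) by (eapply Rle_trans; [apply Rmax_r|exact H]).
  assert (H2 : - ln (eps / C0) <= k * eta).
  { apply Rmult_le_reg_r with (/ k); [now apply Rinv_0_lt_compat|]. replace (k * eta * / k) with eta by (field; lra). exact H1. }
  apply Rle_trans with (C0 * exp (ln (eps / C0))).
  - apply Rmult_le_compat_l; [lra|]. apply exp_le; lra.
  - rewrite exp_ln by now apply Rdiv_lt_0_compat. right. field. lra.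
Qed.

Lemma cos_Rabs (u : R) : cos (Rabs u) = cos u.
Proof. unfold Rabs. destruct (Rcase_abs u); [apply cos_neg|reflexivity]. Qed.

(** The limit is taken along the real axis. A point [W] of the sector is joined to [Re W] by a
    vertical segment, on which the cosine only grows towards the axis, so the integrand is uniformly
    small there. This replaces a rotation of the path of integration, and [l] does not depend on [k]
    or [kappa]. *)
Lemma model_limit (mu : nat) (beta x : C) (E : C -> C) : (2 <= mu)%nat ->
  (forall W s v, Cder W s v -> Cder (fun u => E (W u)) s (v * model mu beta x (W s))) ->
  exists l : C, forall k kappa, 0 < k -> 0 < kappa -> exists C0, 0 < C0 /\ forall W, 0 <= Re W ->
    Rabs (INR mu * Im W) <= PI -> kappa <= cos (INR mu * Im W) -> Cmod (E W - l) <= C0 * exp (- k * Re W).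
Proof.
  intros Hmu HE.
  assert (Real : forall k, 0 < k -> exists C0, 0 < C0 /\ forall e1 e2, 0 <= e1 <= e2 ->
    Cmod (E (RtoC e2) - E (RtoC e1)) <= C0 * exp (- k * e1)).
  { intros k Hk. destruct (decay_bound mu (Re beta) k 1 (Cmod x) Hmu ltac:(lra)) as [C0 [HC0 HC]].
    exists (C0 / k). split; [now apply Rdiv_lt_0_compat|]. intros e1 e2 He.
    eapply Rle_trans.
    - apply (Cder_mean_value (fun u : R => E (RtoC u)) (fun u : R => (1 * model mu beta x u)%C)
        (fun u => - (C0 / k) * exp (- k * u)) (fun u => - k * (- (C0 / k)) * exp (- k * u)) e1 e2); try lra.
      + intros s Hs. apply HE, Cder_id.
      + intros s Hs. apply exp_scal_derive.
      + intros s Hs. rewrite Cmult_1_l. eapply Rle_trans; [apply (Cmod_model mu beta x s 1)|].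
        * unfold Im; simpl. rewrite Rmult_0_r, cos_0. lra.
        * unfold Im at 2, Re at 2 3 4; simpl. rewrite Rabs_R0, Rmult_0_r, exp_0, Rmult_1_l.
          specialize (HC s ltac:(lra)). eapply Rle_trans; [exact HC|]. right. field. lra.
    - assert (0 < C0 / k) by now apply Rdiv_lt_0_compat.
      generalize (exp_pos (- k * e2)). nra. }
  destruct (filterlim_C_cauchy (Rbar_locally p_infty) (fun u : R => E (RtoC u))) as [l Hl].
  { intros eps He. destruct (Real 1 ltac:(lra)) as [C0 [HC0 HC]].
    destruct (exp_decay_eventually C0 1 eps HC0 ltac:(lra) He) as [M [HM0 HM]].
    exists (fun u => M < u). split; [exists M; auto|]. intros u v Hu Hv.
    destruct (Rle_lt_dec u v) as [Q|Q].
    - rewrite Cmod_minus_sym. eapply Rle_trans; [apply HC; lra|apply HM; lra].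
    - eapply Rle_trans; [apply HC; lra|apply HM; lra]. }
  exists l. intros k kappa Hk Hkap.
  destruct (Real k Hk) as [C1 [HC1 HR]].
  destruct (decay_bound mu (Re beta) k kappa (Cmod x) Hmu Hkap) as [C2 [HC2 HD]].
  set (A := exp (Rabs (Im beta) * PI)). assert (HA : 0 < A) by apply exp_pos.
  exists (C1 + PI * (A * C2)). assert (HPI := PI_RGT_0).
  assert (HAC : 0 < A * C2) by now apply Rmult_lt_0_compat.
  split; [nra|]. intros W HW HI HC.
  assert (Hmu1 : 1 <= INR mu) by (apply (le_INR 1); lia).
  assert (HI2 : Rabs (Im W) <= PI).
  { rewrite Rabs_mult, Rabs_right in HI by lra. generalize (Rabs_pos (Im W)); nra. }
  assert (B1 : Cmod (l - E (RtoC (Re W))) <= C1 * exp (- k * Re W)).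
  { apply (filterlim_C_bound (Rbar_locally p_infty) (fun u : R => E (RtoC u)) l (E (RtoC (Re W))) _ Hl).
    exists (Re W). intros u Hu. apply HR. lra. }
  assert (B2 : Cmod (E W - E (RtoC (Re W))) <= PI * (A * C2) * exp (- k * Re W)).
  { set (path := fun u : R => (Re W + u * (Ci * Im W))%C).
    assert (EP1 : path 1 = W) by (unfold path; apply C_eq; simpl; ring).
    assert (EP0 : path 0 = RtoC (Re W)) by (unfold path; apply C_eq; simpl; ring).
    assert (Dp : forall s, Cder path s (Ci * Im W)).
    { intros s. eapply Cder_val; [|apply Cder_plus; [apply Cder_const|apply Cder_mult; [apply Cder_id|apply Cder_const]]]. cbv beta; ring. }
    set (c := PI * (A * C2) * exp (- k * Re W)).
    replace c with (c * 1 - c * 0) by ring. rewrite <- EP1 at 1. rewrite <- EP0.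
    apply (Cder_mean_value (fun u => E (path u)) (fun u => (Ci * Im W * model mu beta x (path u))%C) (fun u => c * u) (fun u => c) 0 1); try lra.
    - intros s Hs. apply HE, Dp.
    - intros s Hs. auto_derive; [exact I|ring].
    - intros s Hs.
      assert (ER : Re (path s) = Re W) by (unfold path; simpl; ring).
      assert (EI : Im (path s) = s * Im W) by (unfold path; simpl; ring).
      rewrite !Cmod_mult, Cmod_Ci, Cmod_R, Rmult_1_l.
      assert (Q : Cmod (model mu beta x (path s)) <= A * (C2 * exp (- k * Re W))).
      { eapply Rle_trans; [apply (Cmod_model mu beta x (path s) kappa)|].
        - rewrite EI. apply Rle_trans with (1 := HC).
          rewrite <- (cos_Rabs (INR mu * Im W)), <- (cos_Rabs (INR mu * (s * Im W))).
          apply cos_decr_1; try apply Rabs_pos; try exact HI.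
          + replace (INR mu * (s * Im W)) with (s * (INR mu * Im W)) by ring. rewrite Rabs_mult, (Rabs_right s) by lra.
            generalize (Rabs_pos (INR mu * Im W)); nra.
          + replace (INR mu * (s * Im W)) with (s * (INR mu * Im W)) by ring. rewrite Rabs_mult, (Rabs_right s) by lra.
            generalize (Rabs_pos (INR mu * Im W)); nra.
        - rewrite ER. apply Rmult_le_compat; try (left; apply exp_pos).
          + rewrite <- exp_plus. left; apply exp_pos.
          + apply exp_le. apply Rmult_le_compat_l; [apply Rabs_pos|].
            rewrite EI, Rabs_mult, (Rabs_right s) by lra. generalize (Rabs_pos (Im W)); nra.
          + apply HD, HW. }
      unfold c. apply Rle_trans with (PI * (A * (C2 * exp (- k * Re W)))); [|right; ring].
      apply Rmult_le_compat; try assumption; [apply Rabs_pos|apply Cmod_ge_0]. }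
  replace (E W - l)%C with ((E W - E (RtoC (Re W))) - (l - E (RtoC (Re W))))%C by ring.
  unfold Cminus at 1. eapply Rle_trans; [apply Cmod_triangle|]. rewrite Cmod_opp.
  rewrite Rmult_plus_distr_r. lra.
Qed.

(** * Integrals from primitives *)

Lemma continuous_C_components (f : R -> C) (s : R) :
  continuous (U := C_UniformSpace) f s -> continuous (fun u => Re (f u)) s /\ continuous (fun u => Im (f u)) s.
Proof. intros H. apply (filterlim_C_components (locally s) f (f s)). exact H. Qed.

Lemma is_RInt_components (f : R -> C) (a b : R) (l : C) :
  is_RInt (fun u => Re (f u)) a b (Re l) -> is_RInt (fun u => Im (f u)) a b (Im l) ->
  is_RInt (V := C_R_NormedModule) f a b l.
Proof.
  intros A B. destruct l as [l1 l2].
  apply (is_RInt_fct_extend_pair (U := R_NormedModule) (V := R_NormedModule) f a b l1 l2); assumption.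
Qed.

Lemma Cder_is_RInt (F f : R -> C) (a b : R) : a <= b ->
  (forall s, a <= s <= b -> Cder F s (f s)) ->
  (forall s, a <= s <= b -> continuous (U := C_UniformSpace) f s) ->
  is_RInt (V := C_R_NormedModule) f a b (F b - F a)%C.
Proof.
  intros Hab HD HC. apply is_RInt_components.
  - apply (is_RInt_derive (V := R_CompleteNormedModule) (fun u => Re (F u)) (fun u => Re (f u)));
    intros s Hs; rewrite Rmin_left, Rmax_right in Hs by lra.
    + apply (HD s Hs).
    + apply continuous_C_components, HC, Hs.
  - apply (is_RInt_derive (V := R_CompleteNormedModule) (fun u => Im (F u)) (fun u => Im (f u)));
    intros s Hs; rewrite Rmin_left, Rmax_right in Hs by lra.
    + apply (HD s Hs).
    + apply continuous_C_components, HC, Hs.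
Qed.

Lemma is_RInt_gen_primitive (f F : R -> C) (Fa Fb : (R -> Prop) -> Prop) {FFa : ProperFilter Fa} {FFb : ProperFilter Fb} (la lb : C) :
  filter_prod Fa Fb (fun ab => is_RInt (V := C_R_NormedModule) f (fst ab) (snd ab) (F (snd ab) - F (fst ab))%C) ->
  filterlim F Fa (locally (T := C_UniformSpace) la) -> filterlim F Fb (locally (T := C_UniformSpace) lb) ->
  is_RInt_gen (V := C_R_NormedModule) f Fa Fb (lb - la)%C.
Proof.
  intros HI Ha Hb P [eps HP].
  assert (He : 0 < eps / 4) by (generalize (cond_pos eps); lra).
  apply (proj1 (filterlim_C_eps Fa F la)) with (eps := eps / 4) in Ha; [|exact He].
  apply (proj1 (filterlim_C_eps Fb F lb)) with (eps := eps / 4) in Hb; [|exact He].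
  assert (HAB : filter_prod Fa Fb (fun ab => Cmod (F (fst ab) - la) <= eps / 4 /\ Cmod (F (snd ab) - lb) <= eps / 4)).
  { econstructor; [exact Ha|exact Hb|]. intros x y Hx Hy. split; assumption. }
  unfold filtermapi. eapply filter_imp; [|apply (filter_and _ _ HI HAB)].
  intros [x y] [H1 [H2 H3]]. exists (F y - F x)%C. split; [exact H1|]. apply HP.
  apply C_NormedModule_mixin_compat1. cbn [fst snd] in *.
  change (Cmod ((F y - F x) - (lb - la))%C < eps).
  replace (F y - F x - (lb - la))%C with ((F y - lb) - (F x - la))%C by ring.
  unfold Cminus at 1. eapply Rle_lt_trans; [apply Cmod_triangle|]. rewrite Cmod_opp. lra.
Qed.

(** Since [E] vanishes at [Re W = -infinity], [l] is the complete integral of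
    [y^(beta-1) exp(-y^mu + x y)] over the positive axis. *)
Definition model_prim (mu : nat) (beta x : C) (E : C -> C) (l : C) : Prop :=
  (forall W s v, Cder W s v -> Cder (fun u => E (W u)) s (v * model mu beta x (W s))) /\
  (exists K, 0 < K /\ forall W, Re W <= 0 -> Cmod (E W) <= K * exp (Re beta * Re W + Rabs (Im beta) * Rabs (Im W))) /\
  (forall k kappa, 0 < k -> 0 < kappa -> exists C0, 0 < C0 /\ forall W, 0 <= Re W ->
    Rabs (INR mu * Im W) <= PI -> kappa <= cos (INR mu * Im W) -> Cmod (E W - l) <= C0 * exp (- k * Re W)).

Lemma model_prim_exists (mu : nat) (beta x : C) : (2 <= mu)%nat -> 0 < Re beta -> exists E l, model_prim mu beta x E l.
Proof.
  intros Hmu Hb. destruct (model_primitive mu beta x Hb) as [E [H1 H2]].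
  destruct (model_limit mu beta x E Hmu H1) as [l Hl]. exists E, l. exact (conj H1 (conj H2 Hl)).
Qed.

Lemma model_prim_real_lim (mu : nat) (beta x : C) (E : C -> C) (l : C) : model_prim mu beta x E l ->
  filterlim (fun u : R => E (RtoC u)) (Rbar_locally p_infty) (locally (T := C_UniformSpace) l).
Proof.
  intros [_ [_ H]]. apply (filterlim_C_eps (Rbar_locally p_infty)). intros eps He.
  destruct (H 1 1 ltac:(lra) ltac:(lra)) as [C0 [HC0 HC]].
  destruct (exp_decay_eventually C0 1 eps HC0 ltac:(lra) He) as [M [HM0 HM]].
  exists M. intros u Hu. eapply Rle_trans; [apply HC|].
  - unfold Re; simpl; lra.
  - unfold Im; simpl. rewrite Rmult_0_r, Rabs_R0. generalize PI_RGT_0; lra.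
  - unfold Im; simpl. rewrite Rmult_0_r, cos_0. lra.
  - unfold Re; simpl. apply HM; lra.
Qed.

Lemma model_prim_real_lim_0 (mu : nat) (beta x : C) (E : C -> C) (l : C) : 0 < Re beta -> model_prim mu beta x E l ->
  filterlim (fun u : R => E (RtoC u)) (Rbar_locally m_infty) (locally (T := C_UniformSpace) (RtoC 0)).
Proof.
  intros Hb [_ [[K [HK H]] _]]. apply (filterlim_C_eps (Rbar_locally m_infty)). intros eps He.
  destruct (exp_decay_eventually K (Re beta) eps HK Hb He) as [M [HM0 HM]].
  exists (- M). intros u Hu. replace (E u - 0)%C with (E u) by ring.
  eapply Rle_trans; [apply H; unfold Re; simpl; lra|].
  unfold Im at 2, Re at 2; simpl. rewrite Rabs_R0, Rmult_0_r, Rplus_0_r.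
  replace (Re beta * u) with (- Re beta * - u) by ring. apply HM; lra.
Qed.

Lemma filterlim_ln_infty (c : R) : 0 < c -> filterlim (fun t => ln t * c) (Rbar_locally p_infty) (Rbar_locally p_infty).
Proof.
  intros Hc P [M HM]. exists (exp (M / c)). intros t Ht. apply HM.
  apply Rmult_lt_reg_r with (/ c); [now apply Rinv_0_lt_compat|].
  replace (ln t * c * / c) with (ln t) by (field; lra).
  replace (M * / c) with (ln (exp (M / c))) by apply ln_exp. apply ln_increasing; [apply exp_pos|exact Ht].
Qed.

Lemma filterlim_ln_0 (c : R) : 0 < c -> filterlim (fun t => ln t * c) (at_right 0) (Rbar_locally m_infty).
Proof.
  intros Hc P [M HM]. exists (mkposreal _ (exp_pos (M / c))). intros t Ht Ht0. apply HM.
  change (Rabs (t - 0) < exp (M / c)) in Ht. rewrite Rminus_0_r, Rabs_right in Ht by lra.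
  apply Rmult_lt_reg_r with (/ c); [now apply Rinv_0_lt_compat|].
  replace (ln t * c * / c) with (ln t) by (field; lra).
  replace (M * / c) with (ln (exp (M / c))) by apply ln_exp. now apply ln_increasing.
Qed.

Lemma is_derive_ln_scal (c t : R) : 0 < t -> is_derive (fun u => ln u * c) t (c / t).
Proof. intros H. auto_derive; [exact H|field; lra]. Qed.

(** Substitution [t = y^mu], that is, [W = ln t / mu]; the factor [mu] is the ratio of [dt / t] to
    [dy / y]. *)
Lemma Faxen_model (mu : nat) (beta x : C) (E : C -> C) (l : C) : (2 <= mu)%nat -> 0 < Re beta ->
  model_prim mu beta x E l -> Faxen (1 / INR mu) (beta / INR mu) x = (INR mu * l)%C.
Proof.
  intros Hmu Hb HE.
  assert (Hm : 0 < INR mu) by (apply lt_0_INR; lia).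
  assert (HmC : RtoC (INR mu) <> 0%C) by (apply INR_C_neq_0; lia).
  set (g := fun t : R => (Cexp (- t + x * Cexp (RtoC (ln t * / INR mu))) * Cexp ((beta / INR mu - 1) * RtoC (ln t * 1)))%C).
  assert (Eg : forall t : R, (Cexp (- t + x * Rpower t (1 / INR mu)) * polar_pow t 0 (beta / INR mu - 1))%C = g t).
  { intros t. unfold g, polar_pow, Rpower. rewrite Cexp_real. rewrite Rmult_1_r.
    replace (ln t * / INR mu) with (1 / INR mu * ln t) by (field; lra). reflexivity. }
  assert (Dg : forall t, 0 < t -> exists v, Cder g t v).
  { intros t Ht. eexists. unfold g. apply Cder_mult; apply Cder_exp.
    - apply Cder_plus; [apply Cder_opp, Cder_id|]. apply Cder_scal, Cder_exp, Cder_RtoC, is_derive_ln_scal, Ht.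
    - apply Cder_scal, Cder_RtoC, is_derive_ln_scal, Ht. }
  set (F := fun t : R => (INR mu * E (RtoC (ln t * / INR mu)))%C).
  assert (DF : forall t, 0 < t -> Cder F t (g t)).
  { intros t Ht. unfold F. eapply Cder_val; [|apply Cder_scal, (proj1 HE (fun t : R => RtoC (ln t * / INR mu))), Cder_RtoC, is_derive_ln_scal, Ht].
    unfold model, g. rewrite <- Cexp_pow.
    replace (INR mu * RtoC (ln t * / INR mu))%C with (RtoC (ln t)).
    2:{ rewrite <- RtoC_mult. f_equal. field. lra. }
    rewrite Cexp_real, exp_ln by exact Ht.
    replace ((beta / INR mu - 1) * RtoC (ln t * 1))%C with (beta * RtoC (ln t * / INR mu) - RtoC (ln t))%C.
    2:{ rewrite Rmult_1_r, RtoC_mult, RtoC_inv by lra. field. exact HmC. }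
    rewrite Cexp_minus, (Cexp_real (ln t)), exp_ln by exact Ht.
    rewrite RtoC_div, RtoC_inv by lra. field. split; [intros Q; apply RtoC_inj in Q; lra|exact HmC]. }
  unfold Faxen. apply (@is_RInt_gen_unique C_R_CompleteNormedModule).
  { apply Proper_StrongProper, at_right_proper_filter. } { apply Proper_StrongProper, Rbar_locally_filter. }
  replace (INR mu * l)%C with (INR mu * l - INR mu * 0)%C by ring.
  apply (is_RInt_gen_primitive _ F (at_right 0) (Rbar_locally p_infty)).
  - apply (Filter_prod _ _ _ (fun t => 0 < t < 1) (fun t => 1 < t)).
    + exists (mkposreal 1 Rlt_0_1). intros t Ht Ht0. change (Rabs (t - 0) < 1) in Ht.
      rewrite Rminus_0_r, Rabs_right in Ht by lra. lra.
    + exists 1. auto.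
    + intros t1 t2 H1 H2. cbn [fst snd].
      apply (is_RInt_ext (V := C_R_NormedModule) g); [intros; symmetry; apply Eg|].
      apply Cder_is_RInt; [lra| |].
      * intros s Hs. apply DF; lra.
      * intros s Hs. destruct (Dg s) as [v Hv]; [lra|]. eapply Cder_continuous; exact Hv.
  - apply (filterlim_C_eps (at_right 0)). intros eps He.
    assert (HL := filterlim_comp _ _ _ _ _ _ _ _ (filterlim_ln_0 (/ INR mu) (Rinv_0_lt_compat _ Hm)) (model_prim_real_lim_0 _ _ _ _ _ Hb HE)).
    assert (He' : 0 < eps / INR mu) by now apply Rdiv_lt_0_compat.
    eapply filter_imp; [|apply (proj1 (filterlim_C_eps (at_right 0) _ _) HL _ He')].
    intros t Ht. cbv beta in Ht. unfold F. replace (INR mu * E (RtoC (ln t * / INR mu)) - INR mu * 0)%C with (INR mu * (E (RtoC (ln t * / INR mu)) - 0))%C by ring.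
    rewrite Cmod_mult, Cmod_R, Rabs_right by lra. apply Rle_trans with (INR mu * (eps / INR mu)); [apply Rmult_le_compat_l; lra|right; field; lra].
  - apply (filterlim_C_eps (Rbar_locally p_infty)). intros eps He.
    assert (HL := filterlim_comp _ _ _ _ _ _ _ _ (filterlim_ln_infty (/ INR mu) (Rinv_0_lt_compat _ Hm)) (model_prim_real_lim _ _ _ _ _ HE)).
    assert (He' : 0 < eps / INR mu) by now apply Rdiv_lt_0_compat.
    eapply filter_imp; [|apply (proj1 (filterlim_C_eps (Rbar_locally p_infty) _ _) HL _ He')].
    intros t Ht. cbv beta in Ht. unfold F. replace (INR mu * E (RtoC (ln t * / INR mu)) - INR mu * l)%C with (INR mu * (E (RtoC (ln t * / INR mu)) - l))%C by ring.
    rewrite Cmod_mult, Cmod_R, Rabs_right by lra. apply Rle_trans with (INR mu * (eps / INR mu)); [apply Rmult_le_compat_l; lra|right; field; lra].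
Qed.

(** * Differentiation and recurrence of the Faxén integrals *)

(** The integral of index [j] is defined by its shifted second parameter; that it is the [j]-th
    derivative of the one of index 0 is [Faxen_derive_n_eq]. *)
Definition Fi (mu : nat) (lam : C) (j : nat) (x : C) : C := Faxen (1 / INR mu) ((lam + INR j) / INR mu) x.

Lemma Re_plus_INR (lam : C) (j : nat) : 0 < Re lam -> 0 < Re (lam + INR j)%C.
Proof. intros H. simpl. unfold Re in H. generalize (pos_INR j); lra. Qed.

Lemma filterlim_C_unique {T : Type} (F : (T -> Prop) -> Prop) {FF : ProperFilter F} (f : T -> C) (l m : C) :
  filterlim f F (locally (T := C_UniformSpace) l) -> filterlim f F (locally (T := C_UniformSpace) m) -> l = m.
Proof. intros A B. apply (@filterlim_locally_unique T C_AbsRing C_NormedModule F _ f l m A B). Qed.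

Lemma filterlim_C_scal {T : Type} (F : (T -> Prop) -> Prop) {FF : Filter F} (c : C) (f : T -> C) (l : C) :
  filterlim f F (locally (T := C_UniformSpace) l) -> filterlim (fun x => c * f x)%C F (locally (T := C_UniformSpace) (c * l)%C).
Proof.
  intros H. apply (filterlim_comp _ _ _ f (fun y => c * y)%C F (locally (T := C_UniformSpace) l) _ H).
  apply (filterlim_scal_r (K := C_AbsRing) (V := C_NormedModule) c l).
Qed.

Lemma filterlim_C_plus {T : Type} (F : (T -> Prop) -> Prop) {FF : Filter F} (f g : T -> C) (l m : C) :
  filterlim f F (locally (T := C_UniformSpace) l) -> filterlim g F (locally (T := C_UniformSpace) m) ->
  filterlim (fun x => f x + g x)%C F (locally (T := C_UniformSpace) (l + m)%C).
Proof.
  intros H1 H2. apply (filterlim_comp_2 f g Cplus H1 H2). apply (filterlim_plus (K := C_AbsRing) (V := C_NormedModule) l m).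
Qed.

Lemma filterlim_C_minus {T : Type} (F : (T -> Prop) -> Prop) {FF : Filter F} (f g : T -> C) (l m : C) :
  filterlim f F (locally (T := C_UniformSpace) l) -> filterlim g F (locally (T := C_UniformSpace) m) ->
  filterlim (fun x => f x - g x)%C F (locally (T := C_UniformSpace) (l - m)%C).
Proof.
  intros H1 H2. apply (filterlim_C_scal F (-1)) in H2.
  eapply filterlim_ext; [|replace (l - m)%C with (l + -1 * m)%C by ring; apply (filterlim_C_plus F _ _ _ _ H1 H2)].
  intros x. cbv beta. ring.
Qed.

(** Differentiation under the integral sign, carried out on primitives. The derivative of
    [Eh - E0 - h E1] is the model integrand times [e^{h y} - 1 - h y], hence at most [|h|^2 C0]
    times the derivative of [maj]; its total increment over the line is therefore at most
    [|h|^2 C0]. *)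
Lemma Faxen_Cdiff (mu : nat) (lam x : C) (j : nat) : (2 <= mu)%nat -> 0 < Re lam ->
  Cdiff (Fi mu lam j) x (Fi mu lam (S j) x).
Proof.
  intros Hmu Hl.
  assert (Hj := Re_plus_INR lam j Hl). assert (HSj := Re_plus_INR lam (S j) Hl).
  set (be := (lam + INR j)%C) in *.
  destruct (model_prim_exists mu be x Hmu Hj) as [E0 [l0 M0]].
  destruct (model_prim_exists mu (lam + INR (S j)) x Hmu HSj) as [E1 [l1 M1]].
  (* For [|h| < 1] the remainder of [e^{h y}] is at most [|h|^2 (1+y)^2 e^y], which accounts for the
     exponent 2 and for the 1 added to [|x|]; on the real axis [kappa = 1]. *)
  destruct (maj_bound mu (Re be) 1 (Cmod x + 1) 2 Hmu Hj ltac:(lra)) as [C0 [HC0 HC]].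
  exists (INR mu * C0), 1. split; [lra|]. intros h Hh.
  destruct (model_prim_exists mu be (x + h) Hmu Hj) as [Eh [lh Mh]].
  unfold Fi. fold be. rewrite (Faxen_model mu be x E0 l0), (Faxen_model mu (lam + INR (S j)) x E1 l1), (Faxen_model mu be (x + h) Eh lh) by assumption.
  assert (Hm : 0 < INR mu) by (apply lt_0_INR; lia).
  replace (INR mu * lh - INR mu * l0 - INR mu * l1 * h)%C with (INR mu * (lh - l0 - h * l1))%C by ring.
  rewrite Cmod_mult, Cmod_R, Rabs_right, Rmult_assoc by lra. apply Rmult_le_compat_l; [lra|].
  set (D := fun u : R => (Eh u - E0 u - h * E1 u)%C).
  set (H2 := Cmod h * Cmod h). assert (HH : 0 <= H2) by (unfold H2; generalize (Cmod_ge_0 h); nra).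
  assert (LD : filterlim D (Rbar_locally p_infty) (locally (T := C_UniformSpace) (lh - l0 - h * l1)%C)).
  { apply (filterlim_C_minus (Rbar_locally p_infty)); [apply (filterlim_C_minus (Rbar_locally p_infty))|apply (filterlim_C_scal (Rbar_locally p_infty))]; eapply model_prim_real_lim; eassumption. }
  assert (LD0 : filterlim D (Rbar_locally m_infty) (locally (T := C_UniformSpace) (0 - 0 - h * 0)%C)).
  { apply (filterlim_C_minus (Rbar_locally m_infty)); [apply (filterlim_C_minus (Rbar_locally m_infty))|apply (filterlim_C_scal (Rbar_locally m_infty))];
    [exact (model_prim_real_lim_0 _ _ _ _ _ Hj Mh)|exact (model_prim_real_lim_0 _ _ _ _ _ Hj M0)|exact (model_prim_real_lim_0 _ _ _ _ _ HSj M1)]. }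
  assert (DD : forall u v, u <= v -> Cmod (D v - D u) <= H2 * C0).
  { intros u v Huv.
    eapply Rle_trans.
    - apply (Cder_mean_value D (fun s : R => (1 * model mu be (x + h) s - 1 * model mu be x s - h * (1 * model mu (lam + INR (S j)) x s))%C)
        (fun s => H2 * C0 * maj (Re be) s) (fun s => H2 * C0 * maj' (Re be) s) u v Huv).
      + intros s _. apply Cder_minus; [apply Cder_minus|apply Cder_scal]; [apply (proj1 Mh)|apply (proj1 M0)|apply (proj1 M1)]; apply Cder_id.
      + intros s _. apply (is_derive_scal (maj (Re be))), maj_derive.
      + intros s _.
        replace (1 * model mu be (x + h) s - 1 * model mu be x s - h * (1 * model mu (lam + INR (S j)) x s))%C
          with (model mu be x s * (Cexp (h * Cexp s) - 1 - h * Cexp s))%C.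
        2:{ unfold model. replace (- Cexp s ^ mu + (x + h) * Cexp s)%C with ((- Cexp s ^ mu + x * Cexp s) + h * Cexp s)%C by ring.
            rewrite (Cexp_plus _ (h * Cexp s)).
            replace ((lam + INR (S j)) * s)%C with (be * s + s)%C by (unfold be; rewrite S_INR, RtoC_plus; ring).
            rewrite (Cexp_plus (be * s)). ring. }
        rewrite Cmod_mult.
        assert (Q1 := Cmod_model mu be x s 1). unfold Im at 1 3, Re at 2 3 4 in Q1; simpl in Q1.
        rewrite Rmult_0_r, cos_0, Rabs_R0, Rmult_0_r, exp_0, Rmult_1_l in Q1. specialize (Q1 ltac:(lra)).
        set (y := exp s) in *. assert (Hy : 0 < y) by apply exp_pos.
        assert (Ey : Cexp s = RtoC y) by apply Cexp_real.
        assert (Q2 := Cexp_remainder (h * Cexp s)%C 2).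
        replace (Cexp (h * Cexp s) - csum (fun m => / INR (fact m) * (h * Cexp s) ^ m) 2)%C with (Cexp (h * Cexp s) - 1 - h * Cexp s)%C in Q2
          by (simpl; apply C_eq; simpl; field).
        assert (Eh2 : Cmod (h * Cexp s)%C = Cmod h * y) by (rewrite Ey, Cmod_mult, Cmod_R, Rabs_right; lra).
        rewrite Eh2 in Q2.
        assert (Q3 : exp (Cmod h * y) <= exp y) by (apply exp_le; nra).
        assert (Q4 : Cmod (Cexp (h * Cexp s) - 1 - h * Cexp s)%C <= H2 * ((1 + y) ^ 2 * exp y)).
        { eapply Rle_trans; [exact Q2|]. replace ((Cmod h * y) ^ 2) with (H2 * (y * y)) by (unfold H2; ring).
          rewrite Rmult_assoc. apply Rmult_le_compat_l; [exact HH|].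
          apply Rmult_le_compat; [nra|left; apply exp_pos|simpl; nra|exact Q3]. }
        specialize (HC s). fold y in HC.
        apply Rle_trans with ((exp (Re be * s) * exp (Cmod x * y - 1 * y ^ mu)) * (H2 * ((1 + y) ^ 2 * exp y))).
        * apply Rmult_le_compat; try apply Cmod_ge_0; assumption.
        * rewrite Rmult_assoc. apply Rle_trans with (H2 * (exp (Re be * s) * (1 + y) ^ 2 * exp ((Cmod x + 1) * y - 1 * y ^ mu))).
          -- right. replace ((Cmod x + 1) * y - 1 * y ^ mu) with ((Cmod x * y - 1 * y ^ mu) + y) by ring. rewrite exp_plus. ring.
          -- rewrite (Rmult_assoc H2). apply Rmult_le_compat_l; assumption.
    - assert (P1 := maj_pos (Re be) u). assert (P2 := maj_le_1 (Re be) v ltac:(lra)).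
      assert (0 <= H2 * C0) by (apply Rmult_le_pos; lra). nra. }
  assert (Step : forall u, Cmod ((lh - l0 - h * l1) - D u) <= H2 * C0).
  { intros u. apply (filterlim_C_bound (Rbar_locally p_infty) D _ _ _ LD). exists u. intros v Hv. apply DD; lra. }
  rewrite (Rmult_comm C0).
  assert (Fin : Cmod ((0 - 0 - h * 0) - (lh - l0 - h * l1)) <= H2 * C0).
  { apply (filterlim_C_bound (Rbar_locally m_infty) D _ _ _ LD0). exists 0. intros u _. rewrite Cmod_minus_sym. apply Step. }
  rewrite Cmod_minus_sym in Fin. replace (lh - l0 - h * l1 - (0 - 0 - h * 0))%C with (lh - l0 - h * l1)%C in Fin by ring. exact Fin.
Qed.

Lemma Faxen_derive_n_eq (mu : nat) (lam x : C) (n : nat) : (2 <= mu)%nat -> 0 < Re lam ->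
  Faxen_derive_n n (1 / INR mu) (lam / INR mu) x = Fi mu lam n x.
Proof.
  intros Hmu Hl. unfold Faxen_derive_n. revert x. induction n as [|n IH]; intros x.
  - unfold Fi. simpl. do 2 f_equal. ring.
  - simpl. apply is_C_derive_unique.
    apply (is_derive_ext (K := C_AbsRing) (V := C_NormedModule) (Fi mu lam n)); [intros; symmetry; apply IH|].
    apply Cdiff_is_derive, Faxen_Cdiff; assumption.
Qed.

(** The combination [Z] of the boundary term [model mu lam x] with three primitives has derivative
    zero. The boundary term vanishes at both ends, and equating the two limits of [Z] gives the
    relation. *)
Lemma Faxen_by_parts (mu : nat) (lam x : C) : (2 <= mu)%nat -> 0 < Re lam ->
  Fi mu lam mu x = (lam / INR mu * Fi mu lam 0 x + x / INR mu * Fi mu lam 1 x)%C.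
Proof.
  intros Hmu Hl.
  assert (HmC : RtoC (INR mu) <> 0%C) by (apply INR_C_neq_0; lia).
  assert (Hm : 0 < INR mu) by (apply lt_0_INR; lia).
  destruct (model_prim_exists mu (lam + INR 0) x Hmu (Re_plus_INR lam 0 Hl)) as [E0 [l0 M0]].
  destruct (model_prim_exists mu (lam + INR 1) x Hmu (Re_plus_INR lam 1 Hl)) as [E1 [l1 M1]].
  destruct (model_prim_exists mu (lam + INR mu) x Hmu (Re_plus_INR lam mu Hl)) as [Em [lm Mm]].
  unfold Fi. rewrite (Faxen_model mu (lam + INR 0) x E0 l0), (Faxen_model mu (lam + INR 1) x E1 l1), (Faxen_model mu (lam + INR mu) x Em lm)
    by (assumption || now apply Re_plus_INR).
  set (Z := fun u : R => (model mu lam x u - lam * E0 u - x * E1 u + INR mu * Em u)%C).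
  assert (DZ : forall u, Cder Z u 0).
  { intros u. unfold Z.
    assert (Did := Cder_id u).
    assert (D1 : Cder (fun v : R => model mu lam x v) u (model mu lam x u * (lam - INR mu * Cexp u ^ mu + x * Cexp u))%C).
    { unfold model.
      apply (Cder_ext (fun v : R => Cexp (lam * v) * Cexp (- Cexp (INR mu * v) + x * Cexp v))%C).
      { intros v. rewrite Cexp_pow. reflexivity. }
      eapply Cder_val; [|apply Cder_mult; apply Cder_exp; [apply Cder_scal, Did|apply Cder_plus; [apply Cder_opp, Cder_exp, Cder_scal, Did|apply Cder_scal, Cder_exp, Did]]].
      cbv beta. rewrite Cexp_pow. ring. }
    eapply Cder_val; [|apply Cder_plus; [apply Cder_minus; [apply Cder_minus; [exact D1|]|]|]; apply Cder_scal; [apply (proj1 M0)|apply (proj1 M1)|apply (proj1 Mm)]; exact Did].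
    unfold model.
    replace ((lam + INR 0) * u)%C with (lam * u)%C by (simpl; ring).
    replace ((lam + INR 1) * u)%C with (lam * u + u)%C by (simpl; ring).
    replace ((lam + INR mu) * u)%C with (lam * u + INR mu * u)%C by ring.
    rewrite !(Cexp_plus (lam * u)), Cexp_pow. ring. }
  assert (CZ : forall u v, Z u = Z v).
  { intros u v. destruct (Rle_lt_dec u v) as [H|H].
    - symmetry. apply Cder_zero_const; [exact H|intros; apply DZ].
    - apply Cder_zero_const; [lra|intros; apply DZ]. }
  assert (LM0 : filterlim (fun u : R => model mu lam x u) (Rbar_locally m_infty) (locally (T := C_UniformSpace) (RtoC 0))).
  { apply (filterlim_C_eps (Rbar_locally m_infty)). intros eps He.
    destruct (exp_decay_eventually (exp (Cmod x)) (Re lam) eps (exp_pos _) Hl He) as [M [HM0 HM]].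
    exists (- M). intros u Hu. replace (model mu lam x u - 0)%C with (model mu lam x u) by ring.
    assert (Q1 := Cmod_model mu lam x u 1). unfold Im at 1 3, Re at 2 3 4 in Q1; simpl in Q1.
    rewrite Rmult_0_r, cos_0, Rabs_R0, Rmult_0_r, exp_0, Rmult_1_l in Q1. specialize (Q1 ltac:(lra)).
    eapply Rle_trans; [exact Q1|]. rewrite Rmult_comm.
    specialize (HM (- u) ltac:(lra)). replace (- Re lam * - u) with (Re lam * u) in HM by ring.
    eapply Rle_trans; [|exact HM]. apply Rmult_le_compat_r; [left; apply exp_pos|]. apply exp_le.
    assert (exp u <= 1) by (rewrite <- exp_0; apply exp_le; lra).
    assert (0 <= exp u ^ mu) by (apply pow_le; left; apply exp_pos).
    generalize (Cmod_ge_0 x); nra. }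
  assert (LMi : filterlim (fun u : R => model mu lam x u) (Rbar_locally p_infty) (locally (T := C_UniformSpace) (RtoC 0))).
  { apply (filterlim_C_eps (Rbar_locally p_infty)). intros eps He.
    destruct (decay_bound mu (Re lam) 1 1 (Cmod x) Hmu ltac:(lra)) as [C0 [HC0 HC]].
    destruct (exp_decay_eventually C0 1 eps HC0 ltac:(lra) He) as [M [HM0 HM]].
    exists M. intros u Hu. replace (model mu lam x u - 0)%C with (model mu lam x u) by ring.
    assert (Q1 := Cmod_model mu lam x u 1). unfold Im at 1 3, Re at 2 3 4 in Q1; simpl in Q1.
    rewrite Rmult_0_r, cos_0, Rabs_R0, Rmult_0_r, exp_0, Rmult_1_l in Q1. specialize (Q1 ltac:(lra)).
    eapply Rle_trans; [exact Q1|]. eapply Rle_trans; [apply HC; lra|apply HM; lra]. }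
  assert (LZ : forall (F : (R -> Prop) -> Prop) {FF : ProperFilter F} e0 e1 em,
    filterlim (fun u : R => model mu lam x u) F (locally (T := C_UniformSpace) (RtoC 0)) ->
    filterlim (fun u : R => E0 u) F (locally (T := C_UniformSpace) e0) ->
    filterlim (fun u : R => E1 u) F (locally (T := C_UniformSpace) e1) ->
    filterlim (fun u : R => Em u) F (locally (T := C_UniformSpace) em) ->
    Z 0 = (0 - lam * e0 - x * e1 + INR mu * em)%C).
  { intros F FF e0 e1 em HM H0 H1 H2.
    apply (filterlim_C_unique F Z).
    - apply (filterlim_ext (fun _ => Z 0)); [intros; apply CZ|apply filterlim_const].
    - apply (filterlim_C_plus F); [apply (filterlim_C_minus F); [apply (filterlim_C_minus F); [exact HM|]|]|]; apply (filterlim_C_scal F); assumption. }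
  assert (Z0 := LZ (Rbar_locally m_infty) _ (RtoC 0) (RtoC 0) (RtoC 0) LM0
    (model_prim_real_lim_0 _ _ _ _ _ (Re_plus_INR lam 0 Hl) M0) (model_prim_real_lim_0 _ _ _ _ _ (Re_plus_INR lam 1 Hl) M1)
    (model_prim_real_lim_0 _ _ _ _ _ (Re_plus_INR lam mu Hl) Mm)).
  assert (Zi := LZ (Rbar_locally p_infty) _ l0 l1 lm LMi
    (model_prim_real_lim _ _ _ _ _ M0) (model_prim_real_lim _ _ _ _ _ M1) (model_prim_real_lim _ _ _ _ _ Mm)).
  rewrite Z0 in Zi.
  transitivity (lam * l0 + x * l1 + (0 - lam * l0 - x * l1 + INR mu * lm))%C; [ring|].
  rewrite <- Zi. field. exact HmC.
Qed.

Lemma g_poly_lt (mu : nat) (lam : C) (j n : nat) (x : C) : (j < mu)%nat ->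
  g_poly mu lam j n x = if Nat.eqb n j then 1%C else 0%C.
Proof.
  intros H. destruct j as [|j]; [destruct n; reflexivity|].
  cbn [g_poly]. rewrite (proj2 (Nat.ltb_lt (S j) mu) H). reflexivity.
Qed.

Lemma g_poly_mu (mu : nat) (lam : C) (n : nat) (x : C) : (1 <= mu)%nat ->
  g_poly mu lam mu n x = match n with 0%nat => (lam / INR mu)%C | 1%nat => (x / INR mu)%C | _ => 0%C end.
Proof.
  intros H. destruct mu as [|j]; [lia|]. cbn [g_poly]. rewrite Nat.ltb_irrefl, Nat.eqb_refl. reflexivity.
Qed.

Lemma g_poly_gt (mu : nat) (lam : C) (j n : nat) (x : C) : (mu <= j)%nat ->
  g_poly mu lam (S j) n x = match n with
    | 0%nat => (C_derive (g_poly mu lam j 0) x + lam / INR mu * g_poly mu lam j (mu - 1) x)%C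
    | 1%nat => (g_poly mu lam j 0 x + C_derive (g_poly mu lam j 1) x + x / INR mu * g_poly mu lam j (mu - 1) x)%C
    | S n' => (g_poly mu lam j n' x + C_derive (g_poly mu lam j n) x)%C
    end.
Proof.
  intros H. cbn [g_poly].
  rewrite (proj2 (Nat.ltb_ge (S j) mu)) by lia. rewrite (proj2 (Nat.eqb_neq (S j) mu)) by lia. reflexivity.
Qed.

Lemma entire_C_derive (f : C -> C) : entire f -> entire (C_derive f) /\ forall t, Cdiff f t (C_derive f t).
Proof.
  intros H. destruct (entire_Cdiff f H) as [f' [Hf' Df]].
  assert (E : forall t, C_derive f t = f' t) by (intros t; apply is_C_derive_unique, Cdiff_is_derive, Df).
  split; [apply (entire_ext f'); auto|]. intros t. rewrite E. apply Df.
Qed.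

(** The recursion for [g_poly] uses [C_derive], which is meaningful only once differentiability is
    known; closure of the entire functions under the recursion provides it. *)
Lemma entire_g_poly (mu : nat) (lam : C) (j n : nat) : (1 <= mu)%nat -> entire (g_poly mu lam j n).
Proof.
  intros Hmu. revert n. induction j as [|j IH]; intros n.
  - apply (entire_ext (fun _ => if Nat.eqb n 0 then RtoC 1 else RtoC 0)); [|apply entire_const].
    intros t. symmetry. apply g_poly_lt; lia.
  - destruct (lt_eq_lt_dec (S j) mu) as [[H|H]|H].
    + apply (entire_ext (fun _ => if Nat.eqb n (S j) then RtoC 1 else RtoC 0)); [|apply entire_const].
      intros t. symmetry. now apply g_poly_lt.
    + rewrite H. destruct n as [|[|n]].
      * apply (entire_ext (fun _ => (lam / INR mu)%C)); [|apply entire_const]. intros t. symmetry. now apply g_poly_mu.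
      * apply (entire_ext (fun t => / INR mu * t)%C); [|apply entire_scal, entire_id]. intros t. rewrite g_poly_mu by lia. unfold Cdiv; ring.
      * apply (entire_ext (fun _ => RtoC 0)); [|apply entire_const]. intros t. symmetry. now apply g_poly_mu.
    + assert (Hj : (mu <= j)%nat) by lia. destruct n as [|[|n]].
      * apply (entire_ext (fun x => C_derive (g_poly mu lam j 0) x + lam / INR mu * g_poly mu lam j (mu - 1) x)%C).
        { intros t. symmetry. now apply g_poly_gt. }
        apply entire_plus; [apply entire_C_derive, IH|apply entire_scal, IH].
      * apply (entire_ext (fun x => (g_poly mu lam j 0 x + C_derive (g_poly mu lam j 1) x) + / INR mu * (x * g_poly mu lam j (mu - 1) x))%C).
        { intros t. rewrite g_poly_gt by exact Hj. unfold Cdiv; ring. }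
        apply entire_plus; [apply entire_plus; [apply IH|apply entire_C_derive, IH]|].
        apply entire_scal, entire_mult; [apply entire_id|apply IH].
      * apply (entire_ext (fun x => g_poly mu lam j (S n) x + C_derive (g_poly mu lam j (S (S n))) x)%C).
        { intros t. symmetry. now apply g_poly_gt. }
        apply entire_plus; [apply IH|apply entire_C_derive, IH].
Qed.

Lemma Cder_csum (f : nat -> R -> C) (l : nat -> C) (s : R) (n : nat) :
  (forall k, (k < n)%nat -> Cder (f k) s (l k)) -> Cder (fun u => csum (fun k => f k u) n) s (csum l n).
Proof.
  induction n as [|n IH]; intros H; simpl; [apply Cder_const|].
  apply Cder_plus; [apply IH; auto|apply H; lia].
Qed.

Lemma csum_delta (f : nat -> C) (j n : nat) : (j < n)%nat ->
  csum (fun k => (if Nat.eqb k j then 1 else 0) * f k)%C n = f j.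
Proof.
  induction n as [|n IH]; intros H; [lia|]. simpl.
  destruct (Nat.eq_dec n j) as [->|Hn].
  - rewrite Nat.eqb_refl. rewrite (csum_ext _ (fun _ => 0%C)).
    + rewrite csum_zero. ring.
    + intros k Hk. rewrite (proj2 (Nat.eqb_neq k j)) by lia. ring.
  - rewrite IH by lia. rewrite (proj2 (Nat.eqb_neq n j)) by lia. ring.
Qed.

Lemma csum_split_two (f : nat -> C) (n : nat) : (2 <= n)%nat ->
  csum f n = (f 0%nat + f 1%nat + csum (fun k => f (S (S k))) (n - 2))%C.
Proof.
  intros H. replace n with (S (S (n - 2))) at 1 by lia. rewrite !csum_split_first. ring.
Qed.

Lemma csum_split_ends (f : nat -> C) (n : nat) : (2 <= n)%nat ->
  csum f n = (f 0%nat + csum (fun k => f (S k)) (n - 2) + f (n - 1)%nat)%C.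
Proof.
  intros H. replace n with (S (S (n - 2))) at 1 by lia. cbn [csum].
  change (csum f (n - 2) + f (n - 2)%nat)%C with (csum f (S (n - 2))).
  rewrite csum_split_first. do 2 f_equal. lia.
Qed.

(** For [j >= mu] the identity for [j] is differentiated, hence the induction over all [x]. The only
    integral that leaves the range is the one of index [mu], and rewriting it by parts adds the
    terms with [lam / mu] and [x / mu]. *)
Lemma Faxen_g_poly (mu : nat) (lam : C) (j : nat) (x : C) : (2 <= mu)%nat -> 0 < Re lam ->
  Fi mu lam j x = csum (fun n => g_poly mu lam j n x * Fi mu lam n x)%C mu.
Proof.
  intros Hmu Hl. revert x. induction j as [|j IH]; intros x.
  { rewrite (csum_ext _ (fun n => (if Nat.eqb n 0 then 1 else 0) * Fi mu lam n x)%C).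
    - now rewrite csum_delta by lia.
    - intros n _. now rewrite g_poly_lt by lia. }
  destruct (lt_eq_lt_dec (S j) mu) as [[H|H]|H].
  - rewrite (csum_ext _ (fun n => (if Nat.eqb n (S j) then 1 else 0) * Fi mu lam n x)%C).
    + now rewrite csum_delta by lia.
    + intros n _. now rewrite g_poly_lt by lia.
  - rewrite H. rewrite Faxen_by_parts by assumption.
    rewrite (csum_ext (fun n => g_poly mu lam mu n x * Fi mu lam n x)%C
      (fun n => match n with 0%nat => (lam / INR mu)%C | 1%nat => (x / INR mu)%C | _ => 0%C end * Fi mu lam n x)%C).
    2:{ intros n _. now rewrite g_poly_mu by lia. }
    rewrite csum_split_two by exact Hmu.
    rewrite (csum_ext _ (fun _ => 0%C)) by (intros; ring). rewrite csum_zero. ring.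
  - assert (Hj : (mu <= j)%nat) by lia.
    set (g := fun n => g_poly mu lam j n). set (g' := fun n => C_derive (g_poly mu lam j n)).
    assert (E : Fi mu lam (S j) x = csum (fun n => g' n x * Fi mu lam n x + g n x * Fi mu lam (S n) x)%C mu).
    { assert (Et : (x + RtoC 0)%C = x) by ring.
      assert (Dt : Cder (fun s : R => (x + s)%C) 0 1).
      { eapply Cder_val; [|apply Cder_plus; [apply Cder_const|apply Cder_id]]. ring. }
      assert (DC : forall F F', Cdiff F x F' -> Cder (fun s : R => F (x + s)%C) 0 F').
      { intros F F' HF. eapply Cder_val; [|apply (Cder_comp F (fun s : R => (x + s)%C) 0 F' 1); [rewrite Et; exact HF|exact Dt]]. ring. }
      apply (Cder_unique (fun s : R => Fi mu lam j (x + s)%C) 0).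
      - apply DC, Faxen_Cdiff; assumption.
      - eapply Cder_ext; [intros u; symmetry; apply IH|].
        apply Cder_csum. intros n _.
        eapply Cder_val; [|apply Cder_mult; apply DC; [apply entire_C_derive, entire_g_poly; lia|apply Faxen_Cdiff; assumption]].
        cbv beta. rewrite Et. reflexivity. }
    rewrite E, csum_plus.
    rewrite (csum_ext (fun n => g_poly mu lam (S j) n x * Fi mu lam n x)%C (fun n => match n with
      | 0%nat => (g' 0%nat x + lam / INR mu * g (mu - 1)%nat x)%C
      | 1%nat => (g 0%nat x + g' 1%nat x + x / INR mu * g (mu - 1)%nat x)%C
      | S n' => (g n' x + g' n x)%C end * Fi mu lam n x)%C).
    2:{ intros n _. now rewrite g_poly_gt by exact Hj. }
    assert (E3 := Faxen_by_parts mu lam x Hmu Hl).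
    rewrite (csum_split_two (fun n => g' n x * Fi mu lam n x)%C), (csum_split_ends (fun n => g n x * Fi mu lam (S n) x)%C) by exact Hmu.
    replace (S (mu - 1)) with mu by lia. rewrite E3. rewrite (csum_split_two _ mu) by exact Hmu.
    rewrite (csum_ext (fun k => (g (S k) x + g' (S (S k)) x) * Fi mu lam (S (S k)) x)%C
      (fun k => g' (S (S k)) x * Fi mu lam (S (S k)) x + g (S k) x * Fi mu lam (S (S k)) x)%C) by (intros; ring).
    rewrite csum_plus. ring.
Qed.

(** * Rearrangement of the partial sums *)

(** Reindexing by the total order [k = c + m]: the orders below [c], absent on the left, contribute
    nothing, and the test cuts the range at [N]. *)
Lemma csum_shifted (T : nat -> C) (c N : nat) : (forall k, (k < c)%nat -> T k = 0%C) ->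
  csum (fun m => if Nat.ltb (c + m) N then T (c + m)%nat else 0%C) (S N) = csum T N.
Proof.
  intros H. set (T' := fun k => if Nat.ltb k N then T k else RtoC 0).
  transitivity (csum T' (c + S N)).
  - rewrite csum_add_range. rewrite (csum_ext T' (fun _ => 0%C)).
    + rewrite csum_zero. unfold T'. ring.
    + intros k Hk. unfold T'. destruct (Nat.ltb k N); [now apply H|reflexivity].
  - replace (c + S N)%nat with (N + (c + 1))%nat by lia. rewrite csum_add_range.
    rewrite (csum_ext (fun k => T' (N + k)%nat) (fun _ => 0%C)).
    + rewrite csum_zero, (csum_ext T' T); [ring|]. intros k Hk. unfold T'. now rewrite (proj2 (Nat.ltb_lt k N) Hk).
    + intros k _. unfold T'. now rewrite (proj2 (Nat.ltb_ge (N + k) N)) by lia.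
Qed.

Lemma ceil_half_spec (n k : nat) : (k < ceil_half n)%nat -> (2 * k < n)%nat.
Proof.
  unfold ceil_half. intros H. assert (D := Nat.div2_odd (S n)). destruct (Nat.odd (S n)); simpl Nat.b2n in D; lia.
Qed.

(** Regrouping by the order [k = ceil_half n + m]: [f_tilde] collects, for each [n < mu], the share
    of [Fi n] in the integrals of index [k + i], and [Faxen_g_poly] reassembles these integrals. *)
Lemma partial_expansion_eq (a : C) (mu : nat) (lam : C) (varpi0 : R) (pn qn rn : nat -> C) (x : C) (F : nat -> C) (N : nat) (rho theta : R) :
  (2 <= mu)%nat -> 0 < Re lam -> (forall n, (n < mu)%nat -> F n = Fi mu lam n x) ->
  partial_expansion mu lam F (f_tilde a mu lam varpi0 pn qn rn x) N rho theta =
  csum (fun k => / polar_pow rho theta ((INR k + lam) / INR mu) *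
     csum (fun i => f_coef a (INR mu) lam varpi0 pn qn rn k i * Fi mu lam (k + i) x) (S k))%C N.
Proof.
  intros Hmu Hl HF. assert (HmC : RtoC (INR mu) <> 0%C) by (apply INR_C_neq_0; lia).
  assert (HmR : INR mu <> 0) by (apply not_0_INR; lia).
  set (f := f_coef a (INR mu) lam varpi0 pn qn rn).
  set (pp := fun k => (/ polar_pow rho theta ((INR k + lam) / INR mu))%C).
  set (T := fun n k => (pp k * csum (fun i => g_poly mu lam (k + i) n x * f k i) (S k) * Fi mu lam n x)%C).
  unfold partial_expansion. rewrite Csum_range_csum. replace (S (mu - 1) - 0)%nat with mu by lia.
  transitivity (csum (fun n => csum (T n) N) mu).
  - apply csum_ext. intros n Hn. rewrite Csum_range_csum. replace (S N - 0)%nat with (S N) by lia. cbn [Nat.add].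
    rewrite <- (csum_shifted (T n) (ceil_half n) N).
    + apply csum_ext. intros m _. destruct (Nat.ltb (ceil_half n + m) N); [|reflexivity].
      unfold T, f_tilde. rewrite Csum_range_csum.
      replace (S (ceil_half n + 2 * m) - m)%nat with (S (ceil_half n + m)) by lia.
      rewrite (csum_ext (fun k => g_poly mu lam (ceil_half n + (m + k)) n x * f_coef a (INR mu) lam varpi0 pn qn rn (ceil_half n + m) (m + k - m))%C
        (fun i => g_poly mu lam (ceil_half n + m + i) n x * f (ceil_half n + m)%nat i)%C).
      * set (S0 := csum _ _). rewrite HF by exact Hn. unfold pp.
        replace (polar_pow rho theta ((INR (ceil_half n + m) + lam) / INR mu)) with
          (polar_pow rho theta ((INR (ceil_half n) + lam) / INR mu) * polar_pow rho theta (INR m / INR mu)%R)%C.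
        -- field. split; apply Cexp_neq_0.
        -- unfold polar_pow. rewrite <- Cexp_plus. f_equal. rewrite plus_INR, RtoC_plus, RtoC_div by exact HmR. field. exact HmC.
      * intros k _. rewrite Nat.add_assoc. replace (m + k - m)%nat with k by lia. reflexivity.
    (* For [k < ceil_half n] the index [k + i <= 2 k] is below [n], hence below [mu], and [g_poly]
       vanishes there. *)
    + intros k Hk. apply ceil_half_spec in Hk. unfold T. rewrite (csum_ext _ (fun _ => 0%C)).
      * rewrite csum_zero. ring.
      * intros i Hi. rewrite g_poly_lt by lia. rewrite (proj2 (Nat.eqb_neq n (k + i))) by lia. ring.
  - rewrite csum_swap. apply csum_ext. intros k _. unfold T. fold (pp k).
    rewrite (csum_ext _ (fun n => pp k * csum (fun i => f k i * (g_poly mu lam (k + i) n x * Fi mu lam n x)) (S k))%C).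
    + rewrite csum_scal. f_equal. rewrite csum_swap. apply csum_ext. intros i _.
      rewrite csum_scal. f_equal. symmetry. now apply Faxen_g_poly.
    + intros n _. rewrite <- Cmult_assoc. f_equal. rewrite Cmult_comm, <- csum_scal. apply csum_ext. intros; ring.
Qed.

(** * Comparison with the model integral along a ray *)

(** Finitely many choices by induction, so that no choice principle is involved; the values beyond
    [n] are arbitrary. *)
Lemma finite_choice (P : nat -> (C -> C) -> C -> Prop) (n : nat) :
  (forall j, exists E l, P j E l) -> exists (E : nat -> C -> C) (l : nat -> C), forall j, (j < n)%nat -> P j (E j) (l j).
Proof.
  intros H. induction n as [|n [E [l IH]]].
  - exists (fun _ c => c), (fun _ => RtoC 0). intros; lia.
  - destruct (H n) as [E0 [l0 H0]].
    exists (fun j => if Nat.eqb j n then E0 else E j), (fun j => if Nat.eqb j n then l0 else l j).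
    intros j Hj. destruct (Nat.eqb_spec j n) as [->|Hn]; [exact H0|]. apply IH; lia.
Qed.

Lemma csum_le_range (f : nat -> C) (m n : nat) : (m <= n)%nat -> (forall k, (m <= k < n)%nat -> f k = 0%C) -> csum f n = csum f m.
Proof.
  intros H H0. replace n with (m + (n - m))%nat by lia. rewrite csum_add_range.
  rewrite (csum_ext (fun k => f (m + k)%nat) (fun _ => 0%C)); [rewrite csum_zero; ring|].
  intros k Hk. apply H0; lia.
Qed.

Lemma filterlim_C_csum {T : Type} (F : (T -> Prop) -> Prop) {FF : Filter F} (f : nat -> T -> C) (l : nat -> C) (n : nat) :
  (forall k, (k < n)%nat -> filterlim (f k) F (locally (T := C_UniformSpace) (l k))) ->
  filterlim (fun u => csum (fun k => f k u) n) F (locally (T := C_UniformSpace) (csum l n)).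
Proof.
  induction n as [|n IH]; intros H; simpl; [apply filterlim_const|].
  apply (filterlim_C_plus F); [apply IH; auto|apply H; lia].
Qed.

(** The logarithm of the point [t - a] of modulus [e^xi] in direction [phi], with [phi] not reduced
    modulo [2 PI]. *)
Definition ray (phi xi : R) : C := (xi, phi).

Lemma ray_Cder (phi xi : R) : Cder (ray phi) xi 1.
Proof.
  apply (Cder_ext (fun u : R => u + Ci * phi)%C).
  - intros u. unfold ray. apply C_eq; simpl; ring.
  - eapply Cder_val; [|apply Cder_plus; [apply Cder_id|apply Cder_const]]. ring.
Qed.

(** The logarithm of [Y = z^{1/mu} u] along the ray, where [lz] and [lp] are logarithms of [z] and
    [p_0]. *)
Definition ray_W (mu : nat) (lz lp : C) (Lm : C -> C) (phi xi : R) : C :=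
  (/ INR mu * lz + / INR mu * lp + ray phi xi + Lm (Cexp (ray phi xi)))%C.

(** Comparison of the local integral along a ray with its model, term by term: the difference of the two
    primitives has a derivative dominated by [rho^{-(N + Re lam)/mu}] times that of the bounded function [maj]. *)
Lemma local_ray (mu : nat) (lam x lp : C) (R1 : R) (Lm Lm' B h : C -> C) (b c : nat -> C) (f : nat -> nat -> C)
    (phi xi1 kappa Th : R) (N : nat) :
  (2 <= mu)%nat -> 0 < Re lam -> local_branch R1 Lm Lm' ->
  (forall t, Cmod t < R1 -> Cmod (local_om Lm' t - 1) <= 1 / 2) ->
  (forall t, Cmod t < R1 -> Cmod (INR mu * Lm t) <= 1) ->
  c 0%nat = 0%C ->
  (forall k, asy R1 (local_coord (Cexp (/ INR mu * lp)) Lm) k b B) ->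
  (forall k, asy R1 (local_coord (Cexp (/ INR mu * lp)) Lm) k c h) ->
  (forall n m, f n m = (/ INR (fact m) * cconv b (series_pow c m) n)%C) ->
  exp xi1 < R1 -> 0 < kappa ->
  exists K X, 0 < X /\ forall (rho theta : R) (Phi : R -> C), X <= rho -> Rabs theta <= Th ->
    let lz := (ln rho, theta) : C in
    (forall xi, xi <= xi1 -> Rabs (INR mu * Im (ray_W mu lz lp Lm phi xi)) <= PI /\
       kappa <= cos (INR mu * Im (ray_W mu lz lp Lm phi xi))) ->
    (forall xi, xi <= xi1 -> let t := Cexp (ray phi xi) in
       let Y := Cexp (ray_W mu lz lp Lm phi xi) in
       Cder Phi xi (INR mu * Cexp (lam * (/ INR mu * lp + ray phi xi + Lm t)) * (local_om Lm' t * B t)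
                    * Cexp (- Y ^ mu + Y * (x + h t)))%C) ->
    filterlim Phi (Rbar_locally m_infty) (locally (T := C_UniformSpace) (RtoC 0)) ->
    Cmod (Phi xi1 - csum (fun k => / Cexp ((INR k + lam) / INR mu * lz) *
       csum (fun i => f k i * Fi mu lam (k + i) x) (S k))%C N)
    <= K * Rpower rho (- ((INR N + Re lam) / INR mu)).
Proof.
  intros Hmu Hl LB Hom Hsm Hc0 HB Hh Hf Hxi Hk.
  assert (Hm : 0 < INR mu) by (apply lt_0_INR; lia).
  assert (Hm1 : 1 <= INR mu) by (apply (le_INR 1); lia).
  assert (HmC : RtoC (INR mu) <> 0%C) by (apply INR_C_neq_0; lia).
  set (u := local_coord (Cexp (/ INR mu * lp)) Lm) in *.
  set (sg := Re lam) in *.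
  assert (HLm : forall t, Cmod t < R1 -> Cmod (Lm t) <= 1).
  { intros t Ht. specialize (Hsm t Ht). rewrite Cmod_mult, Cmod_R, Rabs_right in Hsm by lra.
    generalize (Cmod_ge_0 (Lm t)); nra. }
  set (Mu := Cmod (Cexp (/ INR mu * lp)) * (R1 * exp 1)).
  assert (HMu : forall t, Cmod t < R1 -> Cmod (u t) <= Mu).
  { intros t Ht. unfold u, local_coord, Mu. rewrite !Cmod_mult. apply Rmult_le_compat_l; [apply Cmod_ge_0|].
    apply Rmult_le_compat; try apply Cmod_ge_0; [lra|]. eapply Rle_trans; [apply Cmod_Cexp_le|]. apply exp_le. now apply HLm. }
  destruct (asy_exp_product R1 u B h N b c f Mu HMu Hc0 HB Hh Hf) as [K0 [HK0 EB]].
  (* Primitives are needed for the indices [k + i] with [k, i < N]. *)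
  destruct (finite_choice (fun j E l => model_prim mu (lam + INR j) x E l) (N + N)) as [E [l HE]].
  { intros j. apply model_prim_exists; [exact Hmu|now apply Re_plus_INR]. }
  (* One power [N] of [1 + |Y|] comes from [asy_exp_product], the other from
     [|u|^N = |Y|^N rho^(-N/mu)]. Since [|u| <= Mu], the factor [exp (K0 |u| |Y|)] only adds
     [K0 |Mu|] to the rate in [|Y|]. *)
  destruct (maj_bound mu sg kappa (K0 * Rabs Mu + Cmod x) (2 * N) Hmu Hl Hk) as [C1 [HC1 EM]].
  (* Bounds the argument of [u] along the ray, hence the effect of [Im lam] on the modulus of
     [u^lam]. *)
  set (A0 := Rabs (Im (/ INR mu * lp)) + Rabs phi + 1).
  set (EA := exp (Rabs (Im lam) * A0)). assert (HEA : 0 < EA) by apply exp_pos.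
  assert (Hf0 : forall k i, (k < i)%nat -> f k i = 0%C).
  { intros k i Hki. rewrite Hf. unfold cconv. rewrite <- csum_rev. rewrite (csum_ext _ (fun _ => 0%C)).
    - rewrite csum_zero. ring.
    - intros j Hj. rewrite (series_pow_lt c i) by (exact Hc0 || lia). ring. }
  (* [Re (W xi1)] is [ln rho / mu + w0]; the threshold for [rho] chosen below makes it
     nonnegative. *)
  set (w0 := Re (/ INR mu * lp)%C + xi1 + Re (Lm (Cexp (ray phi xi1)))).
  (* At the end of the ray [E - l] has to be [O(rho^(-N/mu))]; the rate [N + 1] achieves this and is
     positive also for [N = 0]. *)
  set (kk := INR (S N)). assert (Hkk : 0 < kk) by (apply lt_0_INR; lia).
  assert (HC2 : exists C2, 0 < C2 /\ forall j, (j < N + N)%nat -> forall W, 0 <= Re W ->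
    Rabs (INR mu * Im W) <= PI -> kappa <= cos (INR mu * Im W) -> Cmod (E j W - l j) <= C2 * exp (- kk * Re W)).
  { clear - HE Hkk Hk. induction (N + N)%nat as [|n IH].
    - exists 1. split; [lra|]. intros; lia.
    - destruct IH as [C2 [HC2 IH]]; [intros; apply HE; lia|].
      destruct (proj2 (proj2 (HE n (Nat.lt_succ_diag_r n))) kk kappa Hkk Hk) as [C3 [HC3 H3]].
      exists (C2 + C3). split; [lra|]. intros j Hj W H1 H2 H4.
      assert (P := exp_pos (- kk * Re W)).
      destruct (Nat.eq_dec j n) as [->|Hn].
      + eapply Rle_trans; [now apply H3|]. nra.
      + eapply Rle_trans; [apply IH; auto; lia|]. nra. }
  destruct HC2 as [C2 [HC2 EL]].
  set (Sf := fun k i => Cmod (f k i)).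
  assert (HSf : exists S0, 0 <= S0 /\ forall k i, (k < N)%nat -> (i < N)%nat -> Cmod (f k i) <= S0).
  { assert (G : forall n m, exists S0, 0 <= S0 /\ forall k i, (k < n)%nat -> (i < m)%nat -> Cmod (f k i) <= S0).
    { induction n as [|n IHn]; intros m; [exists 0; split; [lra|intros; lia]|].
      destruct (IHn m) as [S0 [HS0 H0]].
      destruct (finite_bound (fun i => Cmod (f n i)) m) as [M HM].
      exists (S0 + Rabs M). split; [generalize (Rabs_pos M); lra|]. intros k i Hk1 Hi.
      destruct (Nat.eq_dec k n) as [->|Hn].
      - generalize (HM i ltac:(lia)) (Rle_abs M); lra.
      - generalize (H0 k i ltac:(lia) Hi) (Rabs_pos M); lra. }
    apply G. }
  destruct HSf as [S0 [HS0 HS]].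
  set (ET := exp (Rabs (Im lam) * (Th / INR mu))). assert (HET : 0 < ET) by apply exp_pos.
  set (K1 := 2 * (INR mu * (3 / 2) * EA * K0 * C1)).
  set (K2 := INR N * (INR N * (S0 * (INR mu * ET * (C2 * exp (- kk * w0)))))).
  exists (K1 + K2), (Rmax 1 (exp (- INR mu * w0))). split; [eapply Rlt_le_trans; [|apply Rmax_l]; lra|].
  intros rho theta Phi Hrho Hth lz HA HPhi HPhi0.
  assert (Hrho1 : 1 <= rho) by (eapply Rle_trans; [apply Rmax_l|exact Hrho]).
  assert (Hrho2 : exp (- INR mu * w0) <= rho) by (eapply Rle_trans; [apply Rmax_r|exact Hrho]).
  set (W := ray_W mu lz lp Lm phi) in *.
  assert (Hln : 0 <= ln rho).
  { rewrite <- ln_1. destruct Hrho1 as [H1| <-]; [left; apply ln_increasing; lra|lra]. }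
  assert (Ht : forall xi, xi <= xi1 -> Cmod (Cexp (ray phi xi)) < R1).
  { intros xi H. rewrite Cmod_Cexp. unfold ray, Re; simpl. eapply Rle_lt_trans; [|exact Hxi]. now apply exp_le. }
  assert (DW : forall xi, xi <= xi1 -> Cder W xi (local_om Lm' (Cexp (ray phi xi)))).
  { intros xi H. unfold W, ray_W, local_om.
    assert (Dt := Cder_exp _ _ _ (ray_Cder phi xi)).
    eapply Cder_val; [|apply Cder_plus; [apply Cder_plus; [apply Cder_const|apply ray_Cder]|]].
    2:{ apply (Cder_comp Lm (fun v => Cexp (ray phi v)) xi _ _ (branch_diff _ _ _ LB _ (Ht xi H)) Dt). }
    ring. }
  assert (ReW : forall xi, Re (W xi) = ln rho / INR mu + (Re (/ INR mu * lp)%C + xi + Re (Lm (Cexp (ray phi xi))))).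
  { intros xi. unfold W, ray_W. rewrite <- RtoC_inv by lra. unfold lz, ray, Re; simpl. field. lra. }
  assert (ImW' : forall xi, xi <= xi1 -> Rabs (Im (/ INR mu * lp + ray phi xi + Lm (Cexp (ray phi xi)))%C) <= A0).
  { intros xi H. unfold A0.
    replace (Im _) with (Im (/ INR mu * lp)%C + phi + Im (Lm (Cexp (ray phi xi)))) by (unfold ray, Im; simpl; ring).
    eapply Rle_trans; [apply Rabs_triang|]. apply Rplus_le_compat; [apply Rabs_triang|].
    eapply Rle_trans; [apply Im_le_Cmod|]. apply HLm, Ht, H. }
  assert (EY : forall xi, Cexp (W xi) = (Cexp (/ INR mu * lz) * u (Cexp (ray phi xi)))%C).
  { intros xi. unfold W, ray_W, u, local_coord. rewrite !Cexp_plus. ring. }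
  set (rs := Rpower rho (- (sg / INR mu))). set (rN := Rpower rho (- (INR N / INR mu))).
  assert (Hrs : 0 < rs) by apply exp_pos. assert (HrN : 0 < rN) by apply exp_pos.
  assert (Ers : Rpower rho (- ((INR N + sg) / INR mu)) = rN * rs).
  { unfold rN, rs. rewrite <- Rpower_plus. f_equal. field. lra. }
  (* The primitive of the truncated integrand: the constants in front express [u^k Y^i] as
     [z^(-k/mu) Y^(k+i)] and [u^lam] as [z^(-lam/mu) Y^lam]. *)
  set (M := fun xi => csum (fun k => csum (fun i => f k i * (INR mu * / Cexp ((INR k + lam) / INR mu * lz)) * E (k + i)%nat (W xi))%C N) N).
  set (XX := fun xi => Cexp (- Cexp (W xi) ^ mu + x * Cexp (W xi))%C).
  set (pre := fun xi => (INR mu * Cexp (lam * (/ INR mu * lp + ray phi xi + Lm (Cexp (ray phi xi)))) * local_om Lm' (Cexp (ray phi xi)))%C).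
  assert (DM : forall xi, xi <= xi1 -> Cder M xi (pre xi * XX xi * csum (fun k => csum (fun i => f k i * (u (Cexp (ray phi xi)) ^ k * Cexp (W xi) ^ i))%C N) N)).
  { intros xi H. eapply Cder_val; [|apply Cder_csum; intros k Hk1; apply Cder_csum; intros i Hi; apply Cder_scal, (proj1 (HE (k + i)%nat ltac:(lia))), (DW xi H)].
    rewrite <- csum_scal. apply csum_ext. intros k Hk1. rewrite <- csum_scal. apply csum_ext. intros i Hi.
    unfold pre, XX, model.
    replace (Cexp ((lam + INR (k + i)) * W xi)) with (Cexp (lam / INR mu * lz) * Cexp (lam * (/ INR mu * lp + ray phi xi + Lm (Cexp (ray phi xi)))) * (Cexp (W xi) ^ k * Cexp (W xi) ^ i))%C.
    2:{ rewrite <- Cpow_add_r, <- (Cexp_pow (W xi)), <- !Cexp_plus. f_equal. unfold W, ray_W. field. exact HmC. }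
    replace (Cexp ((INR k + lam) / INR mu * lz)) with (Cexp (/ INR mu * lz) ^ k * Cexp (lam / INR mu * lz))%C.
    2:{ rewrite <- Cexp_pow, <- Cexp_plus. f_equal. field. exact HmC. }
    replace (Cexp (W xi) ^ k)%C with (Cexp (/ INR mu * lz) ^ k * u (Cexp (ray phi xi)) ^ k)%C by (rewrite <- Cpow_mult_l, <- EY; reflexivity).
    field.
    split; [apply Cexp_neq_0|apply Cpow_nz, Cexp_neq_0]. }
  assert (DPhi : forall xi, xi <= xi1 -> Cder Phi xi (pre xi * XX xi * (B (Cexp (ray phi xi)) * Cexp (Cexp (W xi) * h (Cexp (ray phi xi)))))).
  { intros xi H. eapply Cder_val; [|apply (HPhi xi H)]. cbv zeta. unfold pre, XX.
    replace (- Cexp (W xi) ^ mu + Cexp (W xi) * (x + h (Cexp (ray phi xi))))%C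
      with ((- Cexp (W xi) ^ mu + x * Cexp (W xi)) + Cexp (W xi) * h (Cexp (ray phi xi)))%C by ring.
    rewrite (Cexp_plus (_ + x * _)). ring. }
  set (D := fun xi => (Phi xi - M xi)%C).
  set (KD := 2 * (INR mu * (3 / 2) * EA * K0 * C1) * (rN * rs)).
  assert (HKD : 0 <= KD).
  { unfold KD. repeat apply Rmult_le_pos; try lra. }
  assert (Step : forall xi, xi <= xi1 -> Cmod (D xi1 - D xi) <= KD).
  { intros xi Hx. apply Rle_trans with (KD * maj sg (Re (W xi1)) - KD * maj sg (Re (W xi))).
    2:{ assert (P1 := maj_le_1 sg (Re (W xi1)) ltac:(lra)). assert (P2 := maj_pos sg (Re (W xi))). nra. }
    apply (Cder_mean_value D (fun s => pre s * XX s * (B (Cexp (ray phi s)) * Cexp (Cexp (W s) * h (Cexp (ray phi s))))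
         - pre s * XX s * csum (fun k => csum (fun i => f k i * (u (Cexp (ray phi s)) ^ k * Cexp (W s) ^ i)) N) N)%C (fun v => KD * maj sg (Re (W v)))
       (fun v => KD * (Re (local_om Lm' (Cexp (ray phi v))) * maj' sg (Re (W v)))) xi xi1 Hx).
    - intros s Hs. apply Cder_minus; [apply DPhi; lra|apply DM; lra].
    - intros s Hs. apply (is_derive_scal (fun v => maj sg (Re (W v)))).
      apply (is_derive_comp (maj sg) (fun v => Re (W v))); [apply maj_derive|apply (DW s); lra].
    - intros s Hs. set (t := Cexp (ray phi s)). set (Y := Cexp (W s)).
      assert (Hts : Cmod t < R1) by (apply Ht; lra).
      replace (pre s * XX s * (B t * Cexp (Y * h t)) - pre s * XX s * csum (fun k => csum (fun i => f k i * (u t ^ k * Y ^ i)) N) N)%C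
        with (pre s * XX s * (B t * Cexp (Y * h t) - csum (fun k => csum (fun i => f k i * (u t ^ k * Y ^ i)) N) N))%C by ring.
      rewrite !Cmod_mult.
      set (w := Re (W s)).
      assert (EYm : Cmod Y = exp w) by apply Cmod_Cexp.
      assert (Ebr := EB t Y Hts). rewrite EYm in Ebr.
      assert (Eu : Cmod (u t) = exp w * Rpower rho (- / INR mu)).
      { assert (Q : Cmod Y = Cmod (Cexp (/ INR mu * lz)) * Cmod (u t)) by (unfold Y; rewrite EY, Cmod_mult; reflexivity).
        rewrite EYm in Q. rewrite Q. rewrite Cmod_Cexp. rewrite <- RtoC_inv by lra.
        replace (Re (RtoC (/ INR mu) * lz)%C) with (/ INR mu * ln rho) by (unfold lz, Re; simpl; ring).
        unfold Rpower. rewrite (Rmult_comm (exp _)), Rmult_assoc, <- exp_plus.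
        replace (/ INR mu * ln rho + - / INR mu * ln rho) with 0 by ring. rewrite exp_0. ring. }
      assert (EuN : Cmod (u t) ^ N = exp w ^ N * rN).
      { rewrite Eu, Rpow_mult_distr. f_equal. unfold rN. rewrite <- Rpower_pow by apply exp_pos.
        rewrite Rpower_mult. f_equal. unfold Rdiv. ring. }
      assert (Epre : Cmod (pre s) <= INR mu * (EA * (exp (sg * w) * rs)) * (3 / 2)).
      { unfold pre. fold t. rewrite !Cmod_mult, Cmod_R, (Rabs_right (INR mu)) by lra.
        apply Rmult_le_compat; try apply Cmod_ge_0.
        - apply Rmult_le_pos; [lra|apply Cmod_ge_0].
        - apply Rmult_le_compat_l; [lra|]. rewrite Cmod_Cexp. unfold EA, rs, Rpower. rewrite <- !exp_plus. apply exp_le.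
          set (v := (/ INR mu * lp + ray phi s + Lm t)%C).
          replace (Re (lam * v)%C) with (sg * Re v - Im lam * Im v) by (unfold sg, Re, Im; simpl; ring).
          assert (Rv : Re v = w - ln rho / INR mu).
          { unfold w. rewrite ReW. fold t. unfold v, ray, Re; simpl. ring. }
          rewrite Rv.
          assert (Q : - (Im lam * Im v) <= Rabs (Im lam) * A0).
          { apply Rle_trans with (Rabs (Im lam) * Rabs (Im v)).
            - rewrite <- Rabs_mult. generalize (Rle_abs (- (Im lam * Im v))). rewrite Rabs_Ropp. lra.
            - apply Rmult_le_compat_l; [apply Rabs_pos|]. apply ImW'; lra. }
          unfold Rdiv. lra.
        - replace (local_om Lm' t) with (1 + (local_om Lm' t - 1))%C by ring.
          eapply Rle_trans; [apply Cmod_triangle|]. rewrite Cmod_1. specialize (Hom t Hts). lra. }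
      assert (EXX : Cmod (XX s) <= exp (Cmod x * exp w - kappa * exp w ^ mu)).
      { unfold XX. rewrite Cmod_Cexp. apply exp_le. fold Y.
        replace (Re (- Y ^ mu + x * Y)%C) with (- Re (Y ^ mu)%C + Re (x * Y)%C) by (unfold Re; simpl; ring).
        unfold Y at 1. rewrite Re_Cexp_pow. fold w.
        destruct (HA s ltac:(lra)) as [_ HA2].
        assert (Re (x * Y)%C <= Cmod x * exp w).
        { eapply Rle_trans; [apply Rle_abs|]. eapply Rle_trans; [apply re_le_Cmod|]. rewrite Cmod_mult, EYm. lra. }
        assert (0 < exp w ^ mu) by (apply pow_lt, exp_pos). nra. }
      assert (Ebr2 : Cmod (B t * Cexp (Y * h t) - csum (fun k => csum (fun i => f k i * (u t ^ k * Y ^ i))%C N) N)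
         <= K0 * rN * ((1 + exp w) ^ (2 * N) * exp (K0 * Rabs Mu * exp w))).
      { eapply Rle_trans; [exact Ebr|]. rewrite EuN.
        assert (P1 := exp_pos w).
        assert (Q1 : exp w ^ N <= (1 + exp w) ^ N) by (apply pow_incr; lra).
        assert (Q2 : exp (K0 * (Cmod (u t) * exp w)) <= exp (K0 * Rabs Mu * exp w)).
        { apply exp_le. rewrite Rmult_assoc. apply Rmult_le_compat_l; [exact HK0|]. apply Rmult_le_compat_r; [lra|].
          generalize (HMu t Hts) (Rle_abs Mu); lra. }
        replace (2 * N)%nat with (N + N)%nat by lia. rewrite pow_add.
        assert (P2 : 0 <= (1 + exp w) ^ N) by (apply pow_le; lra).
        assert (P3 : 0 <= exp w ^ N) by (apply pow_le; lra).
        apply Rle_trans with (K0 * rN * (exp w ^ N * ((1 + exp w) ^ N * exp (K0 * (Cmod (u t) * exp w))))); [right; ring|].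
        apply Rmult_le_compat_l; [apply Rmult_le_pos; lra|]. rewrite Rmult_assoc.
        apply Rmult_le_compat; try assumption.
        - apply Rmult_le_pos; [exact P2|left; apply exp_pos].
        - apply Rmult_le_compat_l; assumption. }
      assert (HEMw := EM w).
      (* [Re W] increases at rate at least 1/2 along the ray, so the derivative of [maj] along it
         still dominates, at the price of the factor 2 in [KD]. *)
      assert (HRo : 1 / 2 <= Re (local_om Lm' t)).
      { specialize (Hom t Hts). assert (Q := re_le_Cmod (local_om Lm' t - 1)%C). apply Rabs_le_between in Q.
        replace (Re (local_om Lm' t - 1)%C) with (Re (local_om Lm' t) - 1) in Q by (unfold Re; simpl; ring). lra. }
      assert (Hmaj : 0 <= maj' sg w).
      { unfold maj'. apply Rdiv_le_0_compat; [|generalize (exp_pos w); lra]. apply Rmult_le_pos; [lra|left; apply maj_pos]. }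
      eapply Rle_trans.
      { apply Rmult_le_compat; [|apply Cmod_ge_0| |exact Ebr2].
        - apply Rmult_le_pos; apply Cmod_ge_0.
        - apply Rmult_le_compat; [apply Cmod_ge_0|apply Cmod_ge_0|exact Epre|exact EXX]. }
      apply Rle_trans with ((INR mu * (3 / 2) * EA * K0 * (rN * rs)) * (C1 * maj' sg w)).
      + apply Rle_trans with ((INR mu * (3 / 2) * EA * K0 * (rN * rs)) * (exp (sg * w) * (1 + exp w) ^ (2 * N) * exp ((K0 * Rabs Mu + Cmod x) * exp w - kappa * exp w ^ mu))).
        * right. replace ((K0 * Rabs Mu + Cmod x) * exp w - kappa * exp w ^ mu) with ((Cmod x * exp w - kappa * exp w ^ mu) + K0 * Rabs Mu * exp w) by ring.
          rewrite exp_plus. ring.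
        * apply Rmult_le_compat_l; [|exact HEMw]. repeat apply Rmult_le_pos; try lra.
      + unfold KD. apply Rle_trans with ((INR mu * (3 / 2) * EA * K0 * C1 * (rN * rs)) * maj' sg w); [right; ring|].
        replace (2 * (INR mu * (3 / 2) * EA * K0 * C1) * (rN * rs) * (Re (local_om Lm' t) * maj' sg w))
          with ((INR mu * (3 / 2) * EA * K0 * C1 * (rN * rs)) * (2 * Re (local_om Lm' t) * maj' sg w)) by ring.
        apply Rmult_le_compat_l; [repeat apply Rmult_le_pos; lra|]. nra. }
  (* Here [rho] and [theta] are fixed and only the limit matters, so the threshold may depend on
     [rho]. *)
  assert (LM : filterlim M (Rbar_locally m_infty) (locally (T := C_UniformSpace) (RtoC 0))).
  { replace (RtoC 0) with (csum (fun k => csum (fun i => f k i * (INR mu * / Cexp ((INR k + lam) / INR mu * lz)) * 0)%C N) N).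
    2:{ rewrite (csum_ext _ (fun _ => 0%C)); [apply csum_zero|]. intros k _. rewrite (csum_ext _ (fun _ => 0%C)); [apply csum_zero|]. intros; ring. }
    apply (filterlim_C_csum (Rbar_locally m_infty) (fun k xi => csum (fun i => f k i * (INR mu * / Cexp ((INR k + lam) / INR mu * lz)) * E (k + i)%nat (W xi))%C N)).
    intros k Hk1.
    apply (filterlim_C_csum (Rbar_locally m_infty) (fun i xi => (f k i * (INR mu * / Cexp ((INR k + lam) / INR mu * lz)) * E (k + i)%nat (W xi))%C)).
    intros i Hi. apply (filterlim_C_scal (Rbar_locally m_infty)).
    apply (filterlim_C_eps (Rbar_locally m_infty)). intros eps He.
    destruct (HE (k + i)%nat ltac:(lia)) as [_ [[K3 [HK3 H3]] _]].
    set (bj := (lam + INR (k + i))%C) in *. assert (Hbj : 0 < Re bj) by now apply Re_plus_INR.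
    set (c0 := Re bj * (ln rho / INR mu + Re (/ INR mu * lp)%C + 1) + Rabs (Im bj) * PI).
    destruct (exp_decay_eventually (K3 * exp c0) (Re bj) eps (Rmult_lt_0_compat _ _ HK3 (exp_pos _)) Hbj He) as [M0 [HM0 HM]].
    exists (Rmin xi1 (- Rmax M0 (ln rho / INR mu + Re (/ INR mu * lp)%C + 1))). intros xi Hx.
    assert (Hx1 : xi <= xi1) by (left; eapply Rlt_le_trans; [exact Hx|apply Rmin_l]).
    assert (Hx2 : xi < - Rmax M0 (ln rho / INR mu + Re (/ INR mu * lp)%C + 1)) by (eapply Rlt_le_trans; [exact Hx|apply Rmin_r]).
    assert (Hx3 := Rmax_l M0 (ln rho / INR mu + Re (/ INR mu * lp)%C + 1)).
    assert (Hx4 := Rmax_r M0 (ln rho / INR mu + Re (/ INR mu * lp)%C + 1)).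
    assert (HRL : Re (Lm (Cexp (ray phi xi))) <= 1).
    { eapply Rle_trans; [apply Rle_abs|]. eapply Rle_trans; [apply re_le_Cmod|]. apply HLm, Ht, Hx1. }
    replace (E (k + i)%nat (W xi) - 0)%C with (E (k + i)%nat (W xi)) by ring.
    eapply Rle_trans; [apply H3; rewrite ReW; lra|].
    eapply Rle_trans; [|apply (HM (- xi)); lra]. rewrite Rmult_assoc. apply Rmult_le_compat_l; [lra|].
    rewrite <- exp_plus. apply exp_le. unfold c0. rewrite ReW.
    assert (HI : Rabs (Im (W xi)) <= PI).
    { destruct (HA xi Hx1) as [Q _]. rewrite Rabs_mult, Rabs_right in Q by lra. generalize (Rabs_pos (Im (W xi))); nra. }
    assert (Rabs (Im bj) * Rabs (Im (W xi)) <= Rabs (Im bj) * PI) by (apply Rmult_le_compat_l; [apply Rabs_pos|exact HI]).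
    assert (Re bj * Re (Lm (Cexp (ray phi xi))) <= Re bj * 1) by (apply Rmult_le_compat_l; lra).
    lra. }
  assert (LD : filterlim D (Rbar_locally m_infty) (locally (T := C_UniformSpace) (RtoC 0))).
  { replace (RtoC 0) with (RtoC 0 - RtoC 0)%C by ring. apply (filterlim_C_minus (Rbar_locally m_infty)); assumption. }
  assert (EDfin : Cmod (D xi1) <= KD).
  { replace (D xi1) with (- (RtoC 0 - D xi1))%C by ring. rewrite Cmod_opp.
    apply (filterlim_C_bound (Rbar_locally m_infty) D _ _ _ LD). exists xi1. intros v Hv. rewrite Cmod_minus_sym. apply Step; lra. }
  set (Tot := csum (fun k => / Cexp ((INR k + lam) / INR mu * lz) * csum (fun i => f k i * Fi mu lam (k + i) x) (S k))%C N).
  assert (ETot : Tot = csum (fun k => csum (fun i => f k i * (INR mu * / Cexp ((INR k + lam) / INR mu * lz)) * l (k + i)%nat)%C N) N).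
  { apply csum_ext. intros k Hk1.
    (* The square of indices shrinks to [i <= k], outside of which [f] vanishes. *)
    rewrite <- (csum_le_range (fun i => f k i * Fi mu lam (k + i) x)%C (S k) N) by (lia || (intros i Hi; rewrite Hf0 by lia; ring)).
    rewrite <- csum_scal. apply csum_ext. intros i Hi. unfold Fi.
    rewrite (Faxen_model mu (lam + INR (k + i)) x (E (k + i)%nat) (l (k + i)%nat) Hmu (Re_plus_INR lam _ Hl) (HE (k + i)%nat ltac:(lia))). ring. }
  assert (HReW1 : Re (W xi1) = ln rho / INR mu + w0) by (rewrite ReW; reflexivity).
  assert (HReW0 : 0 <= Re (W xi1)).
  { rewrite HReW1. assert (- INR mu * w0 <= ln rho).
    { rewrite <- (ln_exp (- INR mu * w0)). destruct Hrho2 as [Q| <-]; [left; apply ln_increasing; [apply exp_pos|exact Q]|lra]. }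
    apply Rmult_le_reg_r with (INR mu); [exact Hm|]. rewrite Rmult_0_l, Rmult_plus_distr_r. replace (ln rho / INR mu * INR mu) with (ln rho) by (field; lra). lra. }
  destruct (HA xi1 (Rle_refl _)) as [HA1 HA2].
  (* At the end of the ray [|Y|] is of order [rho^(1/mu)]; replacing each primitive there by its
     limit costs [O(rho^(-N/mu))] besides the common factor [rho^(- Re lam / mu)]. *)
  assert (EMT : Cmod (M xi1 - Tot) <= K2 * (rN * rs)).
  { rewrite ETot. unfold M.
    replace (csum _ N - csum _ N)%C with (csum (fun k => csum (fun i => f k i * (INR mu * / Cexp ((INR k + lam) / INR mu * lz)) * (E (k + i)%nat (W xi1) - l (k + i)%nat))%C N) N).
    2:{ match goal with |- _ = (?a - ?b)%C => transitivity (a + (-1) * b)%C; [|ring] end.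
        rewrite <- csum_scal, <- csum_plus. apply csum_ext. intros k _. rewrite <- csum_scal, <- csum_plus. apply csum_ext. intros; ring. }
    set (Z := S0 * (INR mu * ET * (C2 * exp (- kk * w0)))).
    assert (HZ : 0 <= Z).
    { unfold Z. assert (0 < exp (- kk * w0)) by apply exp_pos. repeat apply Rmult_le_pos; lra. }
    replace (K2 * (rN * rs)) with (INR N * (INR N * (Z * (rN * rs)))) by (unfold K2, Z; ring).
    apply csum_Cmod_le. intros k Hk1. apply csum_Cmod_le. intros i Hi.
    rewrite !Cmod_mult.
    assert (Q1 : Cmod (/ Cexp ((INR k + lam) / INR mu * lz)) <= ET * rs).
    { rewrite <- Cexp_opp, Cmod_Cexp. unfold ET, rs, Rpower. rewrite <- exp_plus. apply exp_le.
      unfold Cdiv. rewrite <- RtoC_inv by lra.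
      replace (Re (- ((INR k + lam) * RtoC (/ INR mu) * lz))%C) with (- (INR k + sg) * / INR mu * ln rho + Im lam * (theta * / INR mu))
        by (unfold lz, sg, Re, Im; simpl; ring).
      assert (Q : Im lam * (theta * / INR mu) <= Rabs (Im lam) * (Th / INR mu)).
      { eapply Rle_trans; [apply Rle_abs|]. rewrite Rabs_mult. apply Rmult_le_compat_l; [apply Rabs_pos|].
        assert (0 < / INR mu) by now apply Rinv_0_lt_compat.
        rewrite Rabs_mult, (Rabs_right (/ INR mu)) by lra. apply Rmult_le_compat_r; lra. }
      assert (0 <= INR k * / INR mu * ln rho).
      { repeat apply Rmult_le_pos; [apply pos_INR|left; now apply Rinv_0_lt_compat|exact Hln]. }
      unfold Rdiv in *. lra. }
    assert (Q2 : Cmod (E (k + i)%nat (W xi1) - l (k + i)%nat) <= C2 * exp (- kk * w0) * rN).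
    { eapply Rle_trans; [apply EL; [lia|exact HReW0|exact HA1|exact HA2]|]. rewrite Rmult_assoc. apply Rmult_le_compat_l; [lra|].
      rewrite HReW1. unfold rN, Rpower. rewrite <- exp_plus. apply exp_le.
      unfold kk. rewrite S_INR. assert (0 <= ln rho / INR mu) by (apply Rdiv_le_0_compat; lra).
      unfold Rdiv in *. nra. }
    rewrite Cmod_R, (Rabs_right (INR mu)) by lra.
    apply Rle_trans with (S0 * (INR mu * (ET * rs)) * (C2 * exp (- kk * w0) * rN)); [|right; unfold Z; ring].
    apply Rmult_le_compat; [|apply Cmod_ge_0| |exact Q2].
    - apply Rmult_le_pos; [apply Cmod_ge_0|]. apply Rmult_le_pos; [lra|apply Cmod_ge_0].
    - apply Rmult_le_compat; [apply Cmod_ge_0| |now apply HS|].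
      + apply Rmult_le_pos; [lra|apply Cmod_ge_0].
      + apply Rmult_le_compat_l; [lra|exact Q1]. }
  fold Tot. replace (Phi xi1 - Tot)%C with (D xi1 + (M xi1 - Tot))%C by (unfold D; ring).
  eapply Rle_trans; [apply Cmod_triangle|]. rewrite Ers, Rmult_plus_distr_r. apply Rplus_le_compat; [exact EDfin|exact EMT].
Qed.

(** * Calculus along the contour *)

Lemma norm_C_R (w : C) : norm (V := C_R_NormedModule) w = Cmod w.
Proof.
  destruct w as [x y]. unfold norm, Cmod; simpl. unfold prod_norm, norm; simpl. unfold abs; simpl. rewrite !Rmult_1_r.
  rewrite <- !Rabs_mult, !Rabs_right by (apply Rle_ge, Rle_0_sqr). reflexivity.
Qed.

Lemma is_derive_C_R_Cder (f : R -> C) (s : R) (l : C) :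
  is_derive (K := R_AbsRing) (V := C_R_NormedModule) f s l -> Cder f s l.
Proof.
  intros [_ H]. specialize (H s (fun P HP => HP)).
  apply Cder_eps. intros eps He. destruct (H (mkposreal eps He)) as [d Hd].
  exists d. split; [apply cond_pos|]. intros h Hh.
  specialize (Hd (s + h)).
  assert (Hb : ball s d (s + h)) by (change (Rabs (s + h - s) < d); replace (s + h - s) with h by ring; exact Hh).
  specialize (Hd Hb). rewrite norm_C_R in Hd.
  match type of Hd with Cmod ?w <= _ => assert (E : (f (s + h)%R - f s - l * h)%C = w) end.
  - apply C_eq; unfold minus, plus, opp, scal; simpl; unfold scal, mult, minus, plus, opp; simpl; unfold mult; simpl; unfold Re, Im; ring.
  - rewrite E. eapply Rle_trans; [exact Hd|]. right. simpl. f_equal. unfold norm; simpl. unfold abs; simpl. f_equal.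
    unfold minus, plus, opp; simpl. ring.
Qed.

Lemma ex_derive_velocity (gam : R -> C) (s : R) :
  ex_derive (K := R_AbsRing) (V := C_R_NormedModule) gam s -> Cder gam s (velocity gam s).
Proof.
  intros [l H]. apply is_derive_C_R_Cder in H. destruct H as [A B].
  split; [apply (Derive_correct (fun u => Re (gam u)))|apply (Derive_correct (fun u => Im (gam u)))]; eexists; eassumption.
Qed.

Lemma filterlim_C_mult {T : Type} (F : (T -> Prop) -> Prop) {FF : Filter F} (f g : T -> C) (l m : C) :
  filterlim f F (locally (T := C_UniformSpace) l) -> filterlim g F (locally (T := C_UniformSpace) m) ->
  filterlim (fun x => f x * g x)%C F (locally (T := C_UniformSpace) (l * m)%C).
Proof.
  rewrite !(filterlim_C_components F).
  intros [A B] [A' B']. split.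
  - replace (Re (l * m)%C) with (Re l * Re m + - (Im l * Im m)) by (unfold Re, Im; simpl; ring).
    apply (filterlim_ext (fun x => Re (f x) * Re (g x) + - (Im (f x) * Im (g x)))); [intros; unfold Re, Im; simpl; ring|].
    eapply (filterlim_comp_2 _ _ Rplus); [|apply (filterlim_comp _ _ _ _ Ropp _ (locally (Im l * Im m)))|apply (filterlim_plus (V := R_NormedModule))].
    + eapply (filterlim_comp_2 _ _ Rmult); [exact A|exact A'|apply (filterlim_mult (K := R_AbsRing))].
    + eapply (filterlim_comp_2 _ _ Rmult); [exact B|exact B'|apply (filterlim_mult (K := R_AbsRing))].
    + apply (filterlim_opp (V := R_NormedModule)).
  - replace (Im (l * m)%C) with (Re l * Im m + Im l * Re m) by (unfold Re, Im; simpl; ring).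
    apply (filterlim_ext (fun x => Re (f x) * Im (g x) + Im (f x) * Re (g x))); [intros; unfold Re, Im; simpl; ring|].
    eapply (filterlim_comp_2 _ _ Rplus); [| |apply (filterlim_plus (V := R_NormedModule))].
    + eapply (filterlim_comp_2 _ _ Rmult); [exact A|exact B'|apply (filterlim_mult (K := R_AbsRing))].
    + eapply (filterlim_comp_2 _ _ Rmult); [exact B|exact A'|apply (filterlim_mult (K := R_AbsRing))].
Qed.

Lemma filterlim_Cdiff {T : Type} (F : (T -> Prop) -> Prop) {FF : Filter F} (G : C -> C) (f : T -> C) (l v : C) :
  Cdiff G l v -> filterlim f F (locally (T := C_UniformSpace) l) ->
  filterlim (fun x => G (f x)) F (locally (T := C_UniformSpace) (G l)).
Proof.
  intros HG. rewrite !(filterlim_C_eps F). intros H eps He.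
  destruct (Cdiff_Lipschitz _ _ _ HG) as [K [d [HK [Hd HL]]]].
  assert (Hm : 0 < Rmin (d / 2) (eps / K)) by (apply Rmin_pos; [lra|now apply Rdiv_lt_0_compat]).
  eapply filter_imp; [|apply (H _ Hm)]. intros x Hx.
  assert (H1 : Cmod (f x - l) <= d / 2) by (eapply Rle_trans; [exact Hx|apply Rmin_l]).
  assert (H2 : Cmod (f x - l) <= eps / K) by (eapply Rle_trans; [exact Hx|apply Rmin_r]).
  specialize (HL (f x - l)%C ltac:(lra)). replace (l + (f x - l))%C with (f x) in HL by ring.
  eapply Rle_trans; [exact HL|]. apply Rle_trans with (K * (eps / K)); [apply Rmult_le_compat_l; lra|]. right. field. lra.
Qed.

Lemma analytic_filterlim {T : Type} (F : (T -> Prop) -> Prop) {FF : Filter F} (p : C -> C) (f : T -> C) (t : C) :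
  ex_derive (K := C_AbsRing) (V := C_NormedModule) p t -> filterlim f F (locally (T := C_UniformSpace) t) ->
  filterlim (fun x => p (f x)) F (locally (T := C_UniformSpace) (p t)).
Proof.
  intros Hp Hf. apply ex_derive_continuous in Hp.
  apply (filterlim_comp _ _ _ f p F (locally (T := C_UniformSpace) t) _ Hf).
  (* Limits use the product structure on C, the derivative uses discs; the neighbourhoods agree. *)
  intros P HP. apply locally_C. apply (Hp P HP).
Qed.

(** A continuous logarithm of a differentiable function is differentiable: continuity makes the
    increment [dl] small, and [dl] differs by a quadratic term from [e^dl - 1], the relative
    increment of [g]. The argument along the contour is only given as continuous, so its derivative
    is obtained in this way. *)
Lemma Cder_log (tau g : R -> C) (s : R) (v : C) (d0 : R) : 0 < d0 ->
  (forall u, Rabs (u - s) < d0 -> Cexp (tau u) = g u) ->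
  continuous (U := C_UniformSpace) tau s -> Cder g s v -> Cder tau s (v / g s).
Proof.
  intros Hd0 Hexp Hc Hg. apply Cder_eps. intros eps He. rewrite Cder_eps in Hg.
  assert (Hgs : Cexp (tau s) = g s) by (apply Hexp; rewrite Rminus_diag, Rabs_R0; exact Hd0).
  assert (Hg0 : g s <> 0%C) by (rewrite <- Hgs; apply Cexp_neq_0).
  set (m := Cmod (g s)). assert (Hm : 0 < m) by now apply Cmod_gt_0.
  set (V := Cmod v + 1). assert (HV : 1 <= V) by (unfold V; generalize (Cmod_ge_0 v); lra).
  set (K := exp 1). assert (HK : 1 <= K) by (unfold K; apply Rle_trans with (exp 0); [rewrite exp_0; lra|apply exp_le; lra]).
  set (e1 := Rmin 1 (eps * m / 2)). assert (He1 : 0 < e1).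
  { apply Rmin_pos; [lra|]. apply Rdiv_lt_0_compat; [now apply Rmult_lt_0_compat|lra]. }
  destruct (Hg e1 He1) as [d1 [Hd1 H1]].
  (* The first bound gives [K |dl| <= 1/2], hence [|dl| <= 2 |e^dl - 1|]; the second makes the
     quadratic term at most [eps / 2] times [|h|]. *)
  set (e2 := Rmin (/ (2 * K)) (eps * m / (4 * K * V))).
  assert (HKV : 0 < 4 * K * V) by (apply Rmult_lt_0_compat; lra).
  assert (He2 : 0 < e2).
  { apply Rmin_pos; [apply Rinv_0_lt_compat; lra|]. apply Rdiv_lt_0_compat; [now apply Rmult_lt_0_compat|exact HKV]. }
  apply (proj1 (filterlim_C_eps (locally s) tau (tau s))) with (eps := e2) in Hc; [|exact He2].
  destruct Hc as [d2 Hd2].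
  exists (Rmin d0 (Rmin d1 d2)). split; [repeat apply Rmin_pos; try assumption; apply cond_pos|].
  intros h Hh.
  assert (Hh0 : Rabs h < d0) by (eapply Rlt_le_trans; [exact Hh|apply Rmin_l]).
  assert (Hh1 : Rabs h < d1) by (eapply Rlt_le_trans; [exact Hh|eapply Rle_trans; [apply Rmin_r|apply Rmin_l]]).
  assert (Hh2 : Rabs h < d2) by (eapply Rlt_le_trans; [exact Hh|eapply Rle_trans; [apply Rmin_r|apply Rmin_r]]).
  specialize (H1 h Hh1).
  specialize (Hd2 (s + h)). assert (Hb : ball s d2 (s + h)) by (change (Rabs (s + h - s) < d2); replace (s + h - s) with h by ring; exact Hh2).
  specialize (Hd2 Hb). set (dl := (tau (s + h)%R - tau s)%C) in *.
  assert (Edl : (Cexp dl - 1 = (g (s + h)%R - g s) / g s)%C).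
  { unfold dl. rewrite Cexp_minus, Hgs, Hexp by (replace (s + h - s) with h by ring; exact Hh0). field. exact Hg0. }
  assert (Hdl1 : Cmod dl <= / (2 * K)) by (eapply Rle_trans; [exact Hd2|apply Rmin_l]).
  assert (Hdl2 : Cmod dl <= eps * m / (4 * K * V)) by (eapply Rle_trans; [exact Hd2|apply Rmin_r]).
  assert (Hdp := Cmod_ge_0 dl).
  assert (HK2 : / (2 * K) <= 1 / 2).
  { apply Rmult_le_reg_r with (2 * K); [lra|]. rewrite Rinv_l by lra. lra. }
  assert (Q : Cmod (Cexp dl - 1 - dl)%C <= K * (Cmod dl * Cmod dl)).
  { assert (E := Cexp_remainder dl 2).
    replace (Cexp dl - csum (fun m => / INR (fact m) * dl ^ m) 2)%C with (Cexp dl - 1 - dl)%C in E by (simpl; apply C_eq; simpl; field).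
    eapply Rle_trans; [exact E|]. rewrite Rmult_comm. simpl. rewrite Rmult_1_r. apply Rmult_le_compat_r; [nra|]. apply exp_le; lra. }
  assert (Lg : Cmod (g (s + h)%R - g s) <= V * Rabs h).
  { eapply Rle_trans; [apply (Cmod_triangle_inv _ (v * h)%C)|]. rewrite Cmod_mult, Cmod_R. unfold V.
    assert (e1 * Rabs h <= 1 * Rabs h) by (apply Rmult_le_compat_r; [apply Rabs_pos|apply Rmin_l]). lra. }
  assert (Q2 : Cmod dl <= 2 * (V * Rabs h / m)).
  { assert (Cmod (Cexp dl - 1)%C <= V * Rabs h / m).
    { rewrite Edl, Cmod_div by exact Hg0. fold m. apply Rmult_le_compat_r; [left; now apply Rinv_0_lt_compat|exact Lg]. }
    assert (Cmod dl <= Cmod (Cexp dl - 1)%C + K * (Cmod dl * Cmod dl)).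
    { replace dl with ((Cexp dl - 1) - (Cexp dl - 1 - dl))%C at 1 by ring. unfold Cminus at 1.
      eapply Rle_trans; [apply Cmod_triangle|]. rewrite Cmod_opp. lra. }
    assert (K * Cmod dl <= 1 / 2).
    { apply Rle_trans with (K * / (2 * K)); [apply Rmult_le_compat_l; lra|]. right. field. lra. }
    nra. }
  replace (dl - v / g s * h)%C with ((g (s + h)%R - g s - v * h) / g s - (Cexp dl - 1 - dl))%C.
  2:{ transitivity (dl + ((g (s + h)%R - g s) / g s - (Cexp dl - 1)) - v / g s * h)%C; [field; exact Hg0|]. rewrite <- Edl. ring. }
  unfold Cminus at 1. eapply Rle_trans; [apply Cmod_triangle|]. rewrite Cmod_opp, Cmod_div by exact Hg0. fold m.
  assert (P1 : Cmod (g (s + h)%R - g s - v * h) / m <= eps / 2 * Rabs h).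
  { apply Rmult_le_reg_r with m; [exact Hm|]. unfold Rdiv at 1. rewrite Rmult_assoc, Rinv_l, Rmult_1_r by lra.
    eapply Rle_trans; [exact H1|]. replace (eps / 2 * Rabs h * m) with (eps * m / 2 * Rabs h) by field.
    apply Rmult_le_compat_r; [apply Rabs_pos|apply Rmin_r]. }
  assert (P2 : K * (Cmod dl * Cmod dl) <= eps / 2 * Rabs h).
  { apply Rle_trans with (K * (eps * m / (4 * K * V) * (2 * (V * Rabs h / m)))).
    - apply Rmult_le_compat_l; [lra|]. apply Rmult_le_compat; assumption.
    - right. field. repeat split; lra. }
  lra.
Qed.

(** * Integrals of piecewise continuous functions *)

(** Induction on the list of corners, splitting at each one that falls inside the interval. Without
    corners the function extends continuously by its one-sided limits. *)
Lemma ex_RInt_corners {V : CompleteNormedModule R_AbsRing} (f : R -> V) (corners : list R) (a b : R) : a < b ->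
  (forall s, a < s < b -> ~ In s corners -> continuous f s) ->
  (forall s, a <= s < b -> exists l, filterlim f (at_right s) (locally l)) ->
  (forall s, a < s <= b -> exists l, filterlim f (at_left s) (locally l)) -> ex_RInt f a b.
Proof.
  revert a b. induction corners as [|d l IH]; intros a b Hab HC HR HL.
  - destruct (HR a ltac:(lra)) as [la Hla]. destruct (HL b ltac:(lra)) as [lb Hlb].
    destruct (C0_extension_lt f la lb a b Hab) as [g [Hg [Eg _]]]; try assumption.
    { intros c Hc. apply HC; [exact Hc|intros []]. }
    apply (ex_RInt_ext g); [intros x Hx; rewrite Rmin_left, Rmax_right in Hx by lra; apply Eg; exact Hx|].
    apply ex_RInt_continuous. intros z _. apply Hg.
  - destruct (Rlt_le_dec a d) as [H1|H1]; [destruct (Rlt_le_dec d b) as [H2|H2]|].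
    + apply ex_RInt_Chasles with d; apply IH; try lra.
      * intros s Hs Hn. apply HC; [lra|]. intros [E|E]; [lra|auto].
      * intros s Hs. apply HR; lra.
      * intros s Hs. apply HL; lra.
      * intros s Hs Hn. apply HC; [lra|]. intros [E|E]; [lra|auto].
      * intros s Hs. apply HR; lra.
      * intros s Hs. apply HL; lra.
    + apply IH; auto. intros s Hs Hn. apply HC; [exact Hs|]. intros [E|E]; [lra|auto].
    + apply IH; auto. intros s Hs Hn. apply HC; [exact Hs|]. intros [E|E]; [lra|auto].
Qed.

(** The derivative is known only in the interior, as the ends may be corners of [F]; the difference
    between [F] and the integral is constant by the mean value theorem. *)
Lemma is_RInt_open_primitive (F g : R -> R) (a b : R) : a < b -> (forall s, continuous g s) ->
  (forall s, a < s < b -> is_derive F s (g s)) -> (forall s, a <= s <= b -> continuous F s) ->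
  is_RInt g a b (F b - F a).
Proof.
  intros Hab Hg HD HF.
  assert (HI : forall y, ex_RInt g a y) by (intros y; apply (ex_RInt_continuous (V := R_CompleteNormedModule)); intros; apply Hg).
  assert (DI : forall y, is_derive (fun y => RInt g a y) y (g y)).
  { intros y. apply (is_derive_RInt (V := R_NormedModule) g (fun y => RInt g a y) a y).
    - exists (mkposreal 1 Rlt_0_1). intros z _. apply (RInt_correct (V := R_CompleteNormedModule)), HI.
    - apply Hg. }
  destruct (MVT_gen (fun y => F y - RInt g a y) a b (fun _ => 0)) as [c [_ E]].
  - intros s Hs. rewrite Rmin_left, Rmax_right in Hs by lra.
    replace 0 with (minus (g s) (g s)) by (unfold minus, plus, opp; simpl; ring).
    apply (is_derive_minus F (fun y => RInt g a y)); [now apply HD|apply DI].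
  - intros s Hs. rewrite Rmin_left, Rmax_right in Hs by lra.
    apply continuity_pt_minus; apply continuity_pt_filterlim; [now apply HF|].
    apply (ex_derive_continuous (fun y => RInt g a y)). eexists; apply DI.
  - rewrite RInt_point in E. change (@zero _) with 0 in E. rewrite Rmult_0_l in E.
    replace (F b - F a) with (RInt g a b) by lra. apply (RInt_correct (V := R_CompleteNormedModule)), HI.
Qed.

(** Continuity of [F] across the corners makes the increments over the pieces add up. *)
Lemma is_RInt_corners (F f : R -> C) (corners : list R) (a b : R) : a < b ->
  (forall s, a < s < b -> ~ In s corners -> continuous (U := C_UniformSpace) f s /\ Cder F s (f s)) ->
  (forall s, a <= s < b -> exists l, filterlim f (at_right s) (locally (T := C_UniformSpace) l)) ->
  (forall s, a < s <= b -> exists l, filterlim f (at_left s) (locally (T := C_UniformSpace) l)) ->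
  (forall s, a <= s <= b -> continuous (U := C_UniformSpace) F s) ->
  is_RInt (V := C_R_NormedModule) f a b (F b - F a)%C.
Proof.
  revert a b. induction corners as [|d l IH]; intros a b Hab HC HR HL HF.
  - destruct (HR a ltac:(lra)) as [la Hla]. destruct (HL b ltac:(lra)) as [lb Hlb].
    destruct (C0_extension_lt (T := C_UniformSpace) f la lb a b Hab) as [g [Hg [Eg _]]]; try assumption.
    { intros c Hc. apply HC; [exact Hc|intros []]. }
    apply (is_RInt_ext (V := C_R_NormedModule) g); [intros x Hx; rewrite Rmin_left, Rmax_right in Hx by lra; apply Eg; exact Hx|].
    apply is_RInt_components.
    + apply (is_RInt_open_primitive (fun s => Re (F s)) (fun s => Re (g s)) a b Hab).
      * intros s. apply (continuous_C_components g). apply Hg.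
      * intros s Hs. destruct (HC s Hs (fun H => H)) as [_ [D _]]. rewrite Eg by exact Hs. exact D.
      * intros s Hs. apply (continuous_C_components F). now apply HF.
    + apply (is_RInt_open_primitive (fun s => Im (F s)) (fun s => Im (g s)) a b Hab).
      * intros s. apply (continuous_C_components g). apply Hg.
      * intros s Hs. destruct (HC s Hs (fun H => H)) as [_ [_ D]]. rewrite Eg by exact Hs. exact D.
      * intros s Hs. apply (continuous_C_components F). now apply HF.
  - destruct (Rlt_le_dec a d) as [H1|H1]; [destruct (Rlt_le_dec d b) as [H2|H2]|].
    + replace (F b - F a)%C with (plus (F d - F a)%C (F b - F d)%C) by (apply C_eq; unfold plus; simpl; unfold plus; simpl; unfold Re, Im; ring).
      apply (is_RInt_Chasles (V := C_R_NormedModule)) with d; apply IH; try lra.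
      * intros s Hs Hn. apply HC; [lra|]. intros [E|E]; [lra|auto].
      * intros s Hs. apply HR; lra.
      * intros s Hs. apply HL; lra.
      * intros s Hs. apply HF; lra.
      * intros s Hs Hn. apply HC; [lra|]. intros [E|E]; [lra|auto].
      * intros s Hs. apply HR; lra.
      * intros s Hs. apply HL; lra.
      * intros s Hs. apply HF; lra.
    + apply IH; auto. intros s Hs Hn. apply HC; [exact Hs|]. intros [E|E]; [lra|auto].
    + apply IH; auto. intros s Hs Hn. apply HC; [exact Hs|]. intros [E|E]; [lra|auto].
Qed.

Lemma at_left_1 (c : R) (P : R -> Prop) : c < 1 -> (forall y, c < y < 1 -> P y) -> at_left 1 P.
Proof.
  intros Hc H. assert (Hd : 0 < 1 - c) by lra. exists (mkposreal _ Hd). intros y Hy Hy1. apply H.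
  change (Rabs (y - 1) < 1 - c) in Hy. rewrite Rabs_left in Hy by lra. lra.
Qed.

Lemma at_right_0 (c : R) (P : R -> Prop) : 0 < c -> (forall y, 0 < y < c -> P y) -> at_right 0 P.
Proof.
  intros Hc H. exists (mkposreal _ Hc). intros y Hy Hy1. apply H.
  change (Rabs (y - 0) < c) in Hy. rewrite Rminus_0_r, Rabs_right in Hy by lra. lra.
Qed.

(** The partial integrals of [g] are nondecreasing and bounded. Close to their supremum [m] their
    increments are small, and those of [f] with them, which is the Cauchy criterion. *)
Lemma dominated_at_left_1 (f : R -> C) (g : R -> R) (c B M : R) : c < 1 -> 0 <= B ->
  (forall y, c <= y < 1 -> ex_RInt (V := C_R_NormedModule) f c y) -> (forall y, c <= y < 1 -> ex_RInt g c y) ->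
  (forall y, c <= y < 1 -> 0 <= g y /\ Cmod (f y) <= B * g y) ->
  (forall y, c <= y < 1 -> RInt g c y <= M) ->
  exists J, filterlim (fun y => CRInt f c y) (at_left 1) (locally (T := C_UniformSpace) J) /\ Cmod J <= B * M.
Proof.
  intros Hc HB Hf Hg Hfg HM.
  assert (Step : forall y1 y2, c <= y1 <= y2 -> y2 < 1 ->
    0 <= RInt g c y2 - RInt g c y1 /\ Cmod (CRInt f c y2 - CRInt f c y1) <= B * (RInt g c y2 - RInt g c y1)).
  { intros y1 y2 Hy Hy2.
    assert (G12 : is_RInt g y1 y2 (RInt g c y2 - RInt g c y1)).
    { replace (RInt g c y2 - RInt g c y1) with (plus (opp (RInt g c y1)) (RInt g c y2)) by (unfold plus, opp; simpl; ring).
      apply (is_RInt_Chasles (V := R_NormedModule)) with c; [apply (is_RInt_swap (V := R_NormedModule))|]; apply (RInt_correct (V := R_CompleteNormedModule)), Hg; lra. }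
    assert (F12 : is_RInt (V := C_R_NormedModule) f y1 y2 (CRInt f c y2 - CRInt f c y1)%C).
    { replace (CRInt f c y2 - CRInt f c y1)%C with (plus (opp (CRInt f c y1)) (CRInt f c y2))
        by (apply C_eq; unfold plus, opp; simpl; unfold plus, opp; simpl; unfold Re, Im; ring).
      apply (is_RInt_Chasles (V := C_R_NormedModule)) with c; [apply (is_RInt_swap (V := C_R_NormedModule))|]; apply (RInt_correct (V := C_R_CompleteNormedModule)), Hf; lra. }
    split.
    - apply (is_RInt_ge_0 g y1 y2); [lra|exact G12|]. intros x Hx. apply Hfg; lra.
    - rewrite <- norm_C_R.
      apply (norm_RInt_le (V := C_R_NormedModule) f (fun y => B * g y) y1 y2); [lra| |exact F12|].
      + intros x Hx. rewrite norm_C_R. apply Hfg; lra.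
      + apply (is_RInt_scal (V := R_NormedModule) g y1 y2 B _ G12). }
  assert (Sup : exists m, is_lub (fun v => exists y, c <= y < 1 /\ v = RInt g c y) m).
  { destruct (completeness (fun v => exists y, c <= y < 1 /\ v = RInt g c y)) as [m Hm].
    - exists M. intros v [y [Hy ->]]. now apply HM.
    - exists (RInt g c c), c. split; [lra|reflexivity].
    - now exists m. }
  destruct Sup as [m [Hub Hlub]].
  destruct (filterlim_C_cauchy (at_left 1) (fun y => CRInt f c y)) as [J HJ].
  { intros eps He.
    assert (Hex : exists y0, c <= y0 < 1 /\ m - eps / (B + 1) <= RInt g c y0).
    { destruct (Classical_Prop.classic (exists y0, c <= y0 < 1 /\ m - eps / (B + 1) <= RInt g c y0)) as [H|H]; [exact H|exfalso].
      assert (P : 0 < eps / (B + 1)) by (apply Rdiv_lt_0_compat; lra).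
      assert (Q : m <= m - eps / (B + 1)); [|lra].
      apply Hlub. intros v [y [Hy ->]]. destruct (Rle_lt_dec (m - eps / (B + 1)) (RInt g c y)) as [Q|Q]; [|lra].
      exfalso. apply H. exists y. auto. }
    destruct Hex as [y0 [Hy0 Hm0]].
    assert (Main : forall u v, y0 < u < 1 -> u <= v < 1 -> Cmod (CRInt f c v - CRInt f c u) <= eps).
    { intros u v Hu Hv. destruct (Step u v) as [_ S2]; [lra|lra|]. eapply Rle_trans; [exact S2|].
      destruct (Step y0 u) as [S1 _]; [lra|lra|].
      assert (Um : RInt g c v <= m) by (apply Hub; exists v; split; [lra|reflexivity]).
      apply Rle_trans with (B * (eps / (B + 1))); [apply Rmult_le_compat_l; lra|].
      apply Rmult_le_reg_r with (B + 1); [lra|]. unfold Rdiv. rewrite !Rmult_assoc, Rinv_l by lra. nra. }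
    exists (fun y => y0 < y < 1). split; [apply (at_left_1 y0); [lra|auto]|]. intros u v Hu Hv.
    destruct (Rle_lt_dec u v); [rewrite Cmod_minus_sym|]; apply Main; lra. }
  exists J. split; [exact HJ|].
  replace J with (J - 0)%C by ring.
  apply (filterlim_C_bound (at_left 1) (fun y => CRInt f c y) J 0 _ HJ). apply (at_left_1 c); [exact Hc|]. intros y Hy.
  destruct (Step c y) as [_ S2]; [lra|lra|].
  replace (CRInt f c c) with (RtoC 0) in S2 by (unfold CRInt; rewrite RInt_point; reflexivity).
  rewrite RInt_point in S2. change (@zero _) with 0 in S2. rewrite Rminus_0_r in S2.
  eapply Rle_trans; [exact S2|]. apply Rmult_le_compat_l; [exact HB|]. apply HM; lra.
Qed.

(** * Coefficients, exponentially small terms and regularity of the integrand *)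

(** The defining sum starts at [j = m]; the further terms of the full convolution vanish because
    [series_pow _ m] has no term below index [m]. Reversing the sum matches the two index
    conventions. *)
Lemma f_coef_cconv (a : C) (mu : R) (lam : C) (varpi0 : R) (pn qn rn : nat -> C) (n m : nat) :
  f_coef a mu lam varpi0 pn qn rn n m = (/ INR (fact m) * cconv (b_coef a mu lam varpi0 pn qn)
    (series_pow (fun j => match j with O => 0%C | S _ => c_coef a mu 1 varpi0 pn rn j end) m) n)%C.
Proof.
  unfold f_coef. f_equal. rewrite Csum_range_csum. unfold ordinary_bell.
  set (b := b_coef a mu lam varpi0 pn qn). set (c := fun j : nat => match j return C with O => RtoC 0 | S _ => c_coef a mu 1 varpi0 pn rn j end).
  unfold cconv. rewrite <- csum_rev.
  destruct (Nat.le_gt_cases m n) as [H|H].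
  - replace (S n) with (m + (S n - m))%nat at 2 by lia. rewrite csum_add_range.
    rewrite (csum_ext (fun k => b (n - k)%nat * series_pow c m (n - (n - k))%nat)%C (fun _ => 0%C)).
    + rewrite csum_zero, Cplus_0_l. apply csum_ext. intros k Hk. do 2 f_equal. lia.
    + intros k Hk. rewrite (series_pow_lt c m) by (reflexivity || lia). ring.
  - replace (S n - m)%nat with 0%nat by lia. simpl csum at 1.
    rewrite (csum_ext _ (fun _ => 0%C)); [now rewrite csum_zero|].
    intros k Hk. rewrite (series_pow_lt c m) by (reflexivity || lia). ring.
Qed.

(** From [ln y <= y - 1] at [y = d rho]; taking [d = eta / (s + 1)] rather than [eta / s] allows
    [s = 0]. *)
Lemma exp_small_Rpower (eta s : R) : 0 < eta -> 0 <= s ->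
  exists K, 0 < K /\ forall rho, 1 <= rho -> exp (- eta * rho) <= K * Rpower rho (- s).
Proof.
  intros He Hs. set (d := eta / (s + 1)). assert (Hd : 0 < d) by (apply Rdiv_lt_0_compat; lra).
  exists (exp (- (s * (1 + ln d)))). split; [apply exp_pos|]. intros rho Hr.
  unfold Rpower. rewrite <- exp_plus. apply exp_le.
  assert (L : ln rho <= d * rho - 1 - ln d).
  { assert (Hdr : 0 < d * rho) by (apply Rmult_lt_0_compat; lra).
    assert (E := exp_ineq1_le (ln (d * rho))). rewrite exp_ln in E by exact Hdr. rewrite ln_mult in E by lra. lra. }
  assert (s * ln rho <= s * (d * rho - 1 - ln d)) by (apply Rmult_le_compat_l; assumption).
  assert (s * d <= eta).
  { apply Rmult_le_reg_r with (s + 1); [lra|]. unfold d. replace (s * (eta / (s + 1)) * (s + 1)) with (s * eta) by (field; lra). nra. }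
  assert (s * d * rho <= eta * rho) by (apply Rmult_le_compat_r; lra). lra.
Qed.

Lemma continuous_within (f : R -> C) (s : R) (D : R -> Prop) :
  continuous (U := C_UniformSpace) f s -> filterlim f (within D (locally s)) (locally (T := C_UniformSpace) (f s)).
Proof. intros H P HP. unfold filtermap, within. eapply filter_imp; [|apply (H P HP)]. auto. Qed.

Lemma integrand_piecewise (T : C -> Prop) (p q r : C -> C) (gam : R -> C) (a : C) (b : option C) (mu nu rho theta x y : R) :
  cond_i_analytic T p q r -> cond_ii_contour T gam a b -> 0 < x -> y < 1 ->
  exists corners,
    (forall s, x < s < y -> ~ In s corners ->
       continuous (U := C_UniformSpace) (I_integrand p q r gam mu nu rho theta) s /\ Cder gam s (velocity gam s)) /\
    (forall s, x <= s < y -> exists l, filterlim (I_integrand p q r gam mu nu rho theta) (at_right s) (locally (T := C_UniformSpace) l)) /\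
    (forall s, x < s <= y -> exists l, filterlim (I_integrand p q r gam mu nu rho theta) (at_left s) (locally (T := C_UniformSpace) l)).
Proof.
  intros [_ [Hp [Hq Hr]]] [HG HT] Hx Hy.
  destruct (contour_piecewise_C1 _ _ _ HG ((y + 1) / 2)) as [cor Hcor]; [lra|].
  (* Stated for an arbitrary filter, so that continuity and both one-sided limits are instances of
     one computation. *)
  assert (HK : forall (F : (R -> Prop) -> Prop) {FF : Filter F} s l, 0 < s < 1 ->
    filterlim gam F (locally (T := C_UniformSpace) (gam s)) -> filterlim (velocity gam) F (locally (T := C_UniformSpace) l) ->
    filterlim (I_integrand p q r gam mu nu rho theta) F (locally (T := C_UniformSpace)
      (Cexp (- polar_pow rho theta 1 * p (gam s) + polar_pow rho theta (nu / mu)%R * r (gam s)) * q (gam s) * l)%C)).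
  { intros F FF s l Hs HF HV. unfold I_integrand.
    apply (filterlim_C_mult F); [|exact HV]. apply (filterlim_C_mult F).
    - apply (filterlim_Cdiff F Cexp _ _ _ (Cdiff_Cexp _)). apply (filterlim_C_plus F); apply (filterlim_C_mult F); try apply filterlim_const;
      apply (analytic_filterlim F); auto.
    - apply (analytic_filterlim F); auto. }
  exists cor. split; [|split].
  - intros s Hs Hn. destruct (Hcor s) as [H1 H2]; [lra|exact Hn|].
    split; [|now apply ex_derive_velocity].
    apply (HK (locally s) _ s); [lra|apply (contour_continuous _ _ _ HG); lra|exact H2].
  - intros s Hs. destruct (contour_velocity_right _ _ _ HG s ltac:(lra)) as [v Hv]. eexists.
    apply (HK (at_right s) _ s v); [lra| |exact Hv].
    apply continuous_within, (contour_continuous _ _ _ HG); lra.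
  - intros s Hs. destruct (contour_velocity_left _ _ _ HG s ltac:(lra)) as [v Hv]. eexists.
    apply (HK (at_left s) _ s v); [lra| |exact Hv].
    apply continuous_within, (contour_continuous _ _ _ HG); lra.
Qed.

Lemma filterlim_Cmod {T : Type} (F : (T -> Prop) -> Prop) {FF : Filter F} (f : T -> C) (l : C) :
  filterlim f F (locally (T := C_UniformSpace) l) -> filterlim (fun x => Cmod (f x)) F (locally (Cmod l)).
Proof.
  intros H. apply (filterlim_comp _ _ _ f Cmod F (locally (T := C_UniformSpace) l) _ H).
  apply (filterlim_norm (K := C_AbsRing) (V := C_NormedModule) l).
Qed.

Lemma integrand_ex_RInt (T : C -> Prop) (p q r : C -> C) (gam : R -> C) (a : C) (b : option C) (mu nu rho theta x y : R) :
  cond_i_analytic T p q r -> cond_ii_contour T gam a b -> 0 < x < 1 -> 0 < y < 1 ->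
  ex_RInt (V := C_R_NormedModule) (I_integrand p q r gam mu nu rho theta) x y /\
  ex_RInt (fun s => Cmod (I_integrand p q r gam mu nu rho theta s)) x y.
Proof.
  intros H1 H2.
  assert (Main : forall x y, 0 < x -> x < y -> y < 1 ->
    ex_RInt (V := C_R_NormedModule) (I_integrand p q r gam mu nu rho theta) x y /\
    ex_RInt (fun s => Cmod (I_integrand p q r gam mu nu rho theta s)) x y).
  { clear x y. intros x y Hx Hxy Hy.
    destruct (integrand_piecewise T p q r gam a b mu nu rho theta x y H1 H2 Hx Hy) as [cor [HC [HR HL]]]. split.
    - apply (ex_RInt_corners (V := C_R_CompleteNormedModule) _ cor); auto. intros s Hs Hn. now apply HC.
    - apply (ex_RInt_corners (V := R_CompleteNormedModule) _ cor); auto.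
      + intros s Hs Hn. apply (filterlim_Cmod (locally s)). now apply HC.
      + intros s Hs. destruct (HR s Hs) as [l Hl]. exists (Cmod l). now apply (filterlim_Cmod (at_right s)).
      + intros s Hs. destruct (HL s Hs) as [l Hl]. exists (Cmod l). now apply (filterlim_Cmod (at_left s)). }
  intros Hx Hy. destruct (Rtotal_order x y) as [H|[->|H]].
  - apply Main; lra.
  - split; apply ex_RInt_point.
  - destruct (Main y x) as [A B]; try lra. split; apply ex_RInt_swap; assumption.
Qed.

(** * The contribution of the endpoint [a] *)

(** Two arguments of the same number are compared through their cosines only, so the multiple of
    [2 PI] between them never has to be determined. *)
Lemma cos_is_arg (v w : C) (psi : R) : Cexp v = w -> is_arg w psi -> cos (Im v) = cos psi.
Proof.
  intros E H. unfold is_arg in H. rewrite <- E, Cmod_Cexp in H.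
  assert (Q := f_equal Re H).
  replace (Re (Cexp v)) with (exp (Re v) * cos (Im v)) in Q by reflexivity.
  replace (Re (exp (Re v) * Cexp (Ci * psi))%C) with (exp (Re v) * cos psi) in Q.
  - apply Rmult_eq_reg_l with (exp (Re v)); [exact Q|apply Rgt_not_eq, exp_pos].
  - unfold Cexp. unfold Re at 2; simpl. replace (0 * psi - 1 * 0) with 0 by ring. replace (0 * 0 + 1 * psi) with psi by ring.
    rewrite exp_0. ring.
Qed.

Lemma cos_arg_bound (psi delta : R) : 0 < delta -> Rabs psi <= PI / 2 - delta -> 0 < sin delta /\ sin delta <= cos psi.
Proof.
  intros Hd H. assert (P := PI_RGT_0). assert (H0 := Rabs_pos psi). split; [apply sin_gt_0; lra|].
  rewrite <- cos_shift, <- (cos_Rabs psi). apply cos_decr_1; lra.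
Qed.

Lemma cos_Lipschitz (u v : R) : cos u - Rabs (v - u) <= cos v.
Proof.
  assert (Main : forall u v, u <= v -> Rabs (cos v - cos u) <= v - u).
  { clear. intros u v Huv. destruct (MVT_gen cos u v (fun s => - sin s)) as [c [_ E]].
    - intros s _. auto_derive; [exact I|ring].
    - intros s _. apply continuity_cos.
    - rewrite E, Rabs_mult, (Rabs_right (v - u)), Rabs_Ropp by lra. assert (B := SIN_bound c).
      rewrite <- (Rmult_1_l (v - u)) at 2. apply Rmult_le_compat_r; [lra|]. apply Rabs_le; lra. }
  destruct (Rle_lt_dec u v) as [H|H].
  - specialize (Main u v H). apply Rabs_le_between in Main. rewrite Rabs_right by lra. lra.
  - specialize (Main v u (Rlt_le _ _ H)). apply Rabs_le_between in Main. rewrite Rabs_left by lra. lra.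
Qed.

(** Dividing by the common branch of [t^e] turns an expansion with shifted exponents into an
    ordinary power series at the point [t]. *)
Lemma series_polar (u : nat -> C) (t S0 e : C) (phi : R) (ex : nat -> C) : t <> 0%C -> is_arg t phi ->
  (forall n, ex n = (INR n + e)%C) ->
  is_series (K := C_AbsRing) (V := C_NormedModule) (fun n => u n * polar_pow (Cmod t) phi (ex n))%C S0 ->
  cser (fun n => u n * t ^ n)%C (S0 / Cexp (e * (ln (Cmod t), phi))).
Proof.
  intros Ht Harg Hex H. apply cser_iff in H. set (tau := (ln (Cmod t), phi) : C) in *.
  assert (E : Cexp tau = t) by now apply Cexp_is_arg.
  apply (cser_scal (/ Cexp (e * tau))) in H. eapply cser_val; [|eapply cser_ext; [|exact H]].
  - unfold Cdiv; ring.
  - intros n. cbv beta. rewrite Hex.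
    replace (polar_pow (Cmod t) phi (INR n + e)) with (Cexp (INR n * tau) * Cexp (e * tau))%C.
    + rewrite Cexp_pow, E. field. apply Cexp_neq_0.
    + rewrite <- Cexp_plus. unfold polar_pow. fold tau. f_equal. ring.
Qed.

Lemma ln_continuous (y : R) : 0 < y -> continuous ln y.
Proof.
  intros H. apply (ex_derive_continuous (K := R_AbsRing) (V := R_NormedModule) ln).
  exists (/ y). apply is_derive_Reals. now apply derivable_pt_lim_ln.
Qed.

(** [L] is the value at [c] of a primitive [Fz] of the local integrand on the Riemann surface of the
    logarithm. [Fz] tends to 0 at [a] because [Re lam > 0] and the argument stays bounded. Hence [L]
    is at once the improper integral over the contour up to [c], freed of [Cexp (- z * p a)], and
    the integral along the ray, to which [local_ray] applies. *)
Lemma local_part (T : C -> Prop) (p q r : C -> C) (gam : R -> C) (a : C) (b : option C)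
    (mu : nat) (lam : C) (varpi varpi0 theta1 theta2 : R) (pn qn rn : nat -> C) :
  (2 <= mu)%nat -> cond_i_analytic T p q r -> cond_ii_contour T gam a b ->
  cond_iii_expansions p q r gam a (INR mu) 1 lam varpi pn qn rn -> theta1 <= theta2 ->
  cond_v_phase p gam a theta1 theta2 -> is_arg_p0 (pn 0%nat) (INR mu) varpi theta1 theta2 varpi0 ->
  let x := (rn 0%nat / polar_pow (Cmod (pn 0%nat)) varpi0 (1 / INR mu)%R)%C in
  exists c, 0 < c < 1 /\ forall N, exists K X, 0 < X /\ forall rho theta, X <= rho -> theta1 <= theta <= theta2 ->
    exists L, filterlim (fun y => CRInt (I_integrand p q r gam (INR mu) 1 rho theta) y c) (at_right 0)
        (locally (T := C_UniformSpace) (Cexp (- polar_pow rho theta 1 * p a) * L)%C) /\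
      Cmod (L - csum (fun k => / polar_pow rho theta ((INR k + lam) / INR mu) *
        csum (fun i => f_coef a (INR mu) lam varpi0 pn qn rn k i * Fi mu lam (k + i) x) (S k))%C N)
      <= K * Rpower rho (- ((INR N + Re lam) / INR mu)).
Proof.
  intros Hmu HI HII [Hp0 [_ [Hl [phi [[Harg [Hphic Hphi0]] [c3 [Hc3 Hser]]]]]]] Hth [[delta [Hdel Hph]] _] [Ha0 Hang] x.
  assert (Hm : 0 < INR mu) by (apply lt_0_INR; lia).
  assert (Hm1 : 1 <= INR mu) by (apply (le_INR 1); lia).
  assert (HmC : RtoC (INR mu) <> 0%C) by (apply INR_C_neq_0; lia).
  assert (HPI := PI_RGT_0). assert (HPI2 := PI2_3_2).
  assert (HG := proj1 HII).
  assert (Hga : forall s, 0 < s < 1 -> (gam s - a)%C <> 0%C).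
  { intros s Hs E. destruct (Hph theta1 s ltac:(lra) Hs) as [H _]. apply H.
    replace (gam s) with a by (replace (gam s) with (gam s - a + a)%C by ring; rewrite E; ring). ring. }
  set (tau := fun s => (ln (Cmod (gam s - a)), phi s) : C).
  assert (Etau : forall s, 0 < s < 1 -> Cexp (tau s) = (gam s - a)%C).
  { intros s Hs. apply Cexp_is_arg; [now apply Hga|now apply Harg]. }
  assert (Sp : forall s, 0 < s < c3 -> cser (fun n => pn n * (gam s - a) ^ n)%C ((p (gam s) - p a) / Cexp (INR mu * tau s))).
  { intros s Hs. destruct (Hser s Hs) as [H _]. apply (series_polar pn _ _ (INR mu) (phi s) (fun n => RtoC (INR n + INR mu))); [apply Hga; lra|apply Harg; lra| |exact H].
    intros n. apply RtoC_plus. }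
  assert (Sq : forall s, 0 < s < c3 -> cser (fun n => qn n * (gam s - a) ^ n)%C (q (gam s) / Cexp ((lam - 1) * tau s))).
  { intros s Hs. destruct (Hser s Hs) as [_ [H _]]. apply (series_polar qn _ _ (lam - 1) (phi s) (fun n => INR n + lam - 1)%C); [apply Hga; lra|apply Harg; lra| |exact H].
    intros n. ring. }
  assert (Sr : forall s, 0 < s < c3 -> cser (fun n => rn n * (gam s - a) ^ n)%C (r (gam s) / Cexp (1 * tau s))).
  { intros s Hs. destruct (Hser s Hs) as [_ [_ H]]. apply (series_polar rn _ _ 1 (phi s) (fun n => RtoC (INR n + 1))); [apply Hga; lra|apply Harg; lra| |exact H].
    intros n. apply RtoC_plus. }
  (* Convergence at this one point of the contour already gives a common radius [R0] for the three
     series. *)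
  set (s0 := c3 / 2). assert (Hs0 : 0 < s0 < c3) by (unfold s0; lra).
  set (R0 := Cmod (gam s0 - a)). assert (HR0 : 0 < R0) by (apply Cmod_gt_0, Hga; lra).
  assert (Gp : geo R0 pn) by (eapply geo_of_point; apply Sp; exact Hs0).
  assert (Gq : geo R0 qn) by (eapply geo_of_point; apply Sq; exact Hs0).
  assert (Gr : geo R0 rn) by (eapply geo_of_point; apply Sr; exact Hs0).
  assert (Hsd : 0 < sin delta).
  { destruct (Hph theta1 s0 ltac:(lra) ltac:(lra)) as [_ [psi [_ Hpsi]]]. now apply (cos_arg_bound psi delta). }
  (* Two perturbations of at most [sin delta / 4] each cost at most half of the cosine bound
     [sin delta], which leaves [kappa = sin delta / 2]; the 1 enters the bound [PI] on the total
     argument. *)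
  destruct (local_expansion a mu lam varpi0 pn qn rn R0 (Rmin 1 (sin delta / 4))) as [R1 [Lm [Lm' [B [h [HR1 [LB [HP0 [EP [EQ [ER [HLm [Hom [HB Hh]]]]]]]]]]]]]];
    try assumption; [lia|apply Rmin_pos; lra|].
  set (p0 := pn 0%nat) in *. set (lp := (ln (Cmod p0), varpi0) : C).
  assert (Elp : Cexp lp = p0) by (apply Cexp_is_arg; assumption).
  assert (EP0 : polar_pow (Cmod p0) varpi0 (1 / INR mu)%R = Cexp (/ INR mu * lp)).
  { unfold polar_pow. f_equal. f_equal. rewrite RtoC_div by lra. unfold Cdiv; ring. }
  fold x in ER. rewrite EP0 in HB, Hh, ER.
  assert (HR1p : 0 < R1) by apply LB.
  assert (Hd : exists d, 0 < d /\ forall s, 0 < s < d -> s < 1 -> Cmod (gam s - a) < R1 /\ Rabs (phi s - varpi) <= / (2 * INR mu)).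
  { assert (H1 := proj1 (filterlim_C_eps (at_right 0) _ _) (contour_start _ _ _ HG) (R1 / 2) ltac:(lra)).
    (* Multiplied by [mu], the deviation of [phi] from [varpi] is at most 1/2, and
       [PI/2 + 1/2 + 1 <= PI]. *)
    assert (Hmi : 0 < / (2 * INR mu)) by (apply Rinv_0_lt_compat; lra).
    assert (H2 := proj1 (filterlim_locally phi varpi) Hphi0 (mkposreal _ Hmi)).
    destruct (filter_and _ _ H1 H2) as [d Hd]. exists d. split; [apply cond_pos|]. intros s Hs Hs1.
    destruct (Hd s) as [A1 A2]; [|lra|].
    - change (Rabs (s - 0) < d). rewrite Rminus_0_r, Rabs_right; lra.
    - split; [lra|]. left. exact A2. }
  destruct Hd as [d [Hd0 Hd]].
  set (c := Rmin d c3 / 2). assert (Hc : 0 < c) by (apply Rdiv_lt_0_compat; [apply Rmin_pos; lra|lra]).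
  assert (Hcd : c < d) by (unfold c; generalize (Rmin_l d c3); lra).
  assert (Hcc : c < c3) by (unfold c; generalize (Rmin_r d c3); lra).
  exists c. split; [lra|]. intros N.
  set (xi1 := ln (Cmod (gam c - a))). set (phc := phi c).
  assert (Exi1 : exp xi1 = Cmod (gam c - a)) by (apply exp_ln, Cmod_gt_0, Hga; lra).
  assert (Hxi1 : exp xi1 < R1) by (rewrite Exi1; apply Hd; lra).
  destruct (local_ray mu lam x lp R1 Lm Lm' B h (b_coef a (INR mu) lam varpi0 pn qn)
      (fun j => match j with O => 0%C | S _ => c_coef a (INR mu) 1 varpi0 pn rn j end)
      (f_coef a (INR mu) lam varpi0 pn qn rn) phc xi1 (sin delta / 2) (Rabs theta1 + Rabs theta2) N) as [K [X [HX HK]]];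
    try assumption; try lra.
  { intros t Ht. eapply Rle_trans; [now apply HLm|apply Rmin_l]. }
  { reflexivity. }
  { intros n m. apply f_coef_cconv. }
  exists K, X. split; [exact HX|]. intros rho theta Hrho Htheta.
  set (z := polar_pow rho theta 1). set (z1 := polar_pow rho theta (1 / INR mu)%R).
  set (lz := (ln rho, theta) : C).
  assert (Ez : z = Cexp lz) by (unfold z, polar_pow; f_equal; fold lz; ring).
  assert (Ez1 : z1 = Cexp (/ INR mu * lz)).
  { unfold z1, polar_pow. fold lz. f_equal. f_equal. rewrite RtoC_div by lra. unfold Cdiv; ring. }
  (* For fixed [z], the integrand freed of [Cexp (- z * p a)] and of [(t-a)^(lam-1)] is a power
     series in [t - a]. *)
  set (H := fun t => (Cexp (- z * (t ^ mu * CPS pn t) + z1 * (t * CPS rn t)) * CPS qn t)%C).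
  assert (HH : PS R0 H).
  { apply PS_mult; [|exists qn; now apply geo_psr]. apply PS_exp; [exact HR0|].
    assert (HPp : PS R0 (CPS pn)) by (exists pn; now apply geo_psr).
    assert (HPr : PS R0 (CPS rn)) by (exists rn; now apply geo_psr).
    apply PS_plus; apply PS_scal.
    - exact (PS_mult _ _ _ (PS_pow R0 (fun t => t) mu (PS_id R0)) HPp).
    - exact (PS_mult _ _ _ (PS_id R0) HPr). }
  destruct HH as [al Hal]. destruct (psr_power_primitive al lam Hl) as [F HF].
  destruct (HF R0 H HR0 Hal) as [PF DF].
  set (Fz := fun w => (Cexp (lam * w) * F (Cexp w))%C).
  assert (HFz : exists M, 0 < M /\ forall w, Re w <= xi1 -> Cmod (Fz w) <= M * exp (Re lam * Re w + Rabs (Im lam) * Rabs (Im w))).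
  { destruct (PS_bounded R0 F (exp xi1) ltac:(lra) PF) as [M [HM0 HM]]. exists M. split; [exact HM0|]. intros w Hw.
    unfold Fz. rewrite Cmod_mult, Rmult_comm. apply Rmult_le_compat; try apply Cmod_ge_0.
    - apply HM. rewrite Cmod_Cexp. now apply exp_le.
    - rewrite Cmod_Cexp. apply exp_le. replace (Re (lam * w)%C) with (Re lam * Re w - Im lam * Im w) by (unfold Re, Im; simpl; ring).
      rewrite <- Rabs_mult. generalize (Rle_abs (- (Im lam * Im w))). rewrite Rabs_Ropp. lra. }
  destruct HFz as [M [HM0 HM]].
  set (L := Fz (tau c)). exists L. split.
  - 
    set (f := I_integrand p q r gam (INR mu) 1 rho theta).
    assert (Ef : forall s, 0 < s < d -> s < c3 -> f s = (Cexp (- z * p a) * (velocity gam s / (gam s - a) * (Cexp (lam * tau s) * H (Cexp (tau s)))))%C).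
    { intros s Hs Hs3. assert (Hs1 : 0 < s < 1) by lra. destruct (Hd s Hs ltac:(lra)) as [Hts _].
      unfold f, I_integrand. fold z z1. unfold H. rewrite (Etau s Hs1). set (t := (gam s - a)%C) in *.
      assert (Ht0 : t <> 0%C) by now apply Hga.
      assert (E1 : CPS pn t = ((p (gam s) - p a) / Cexp (INR mu * tau s))%C).
      { eapply cser_unique; [apply (geo_psr _ _ Gp); lra|apply Sp; lra]. }
      assert (E2 : CPS qn t = (q (gam s) / Cexp ((lam - 1) * tau s))%C).
      { eapply cser_unique; [apply (geo_psr _ _ Gq); lra|apply Sq; lra]. }
      assert (E3 : CPS rn t = (r (gam s) / Cexp (1 * tau s))%C).
      { eapply cser_unique; [apply (geo_psr _ _ Gr); lra|apply Sr; lra]. }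
      rewrite E1, E2, E3. rewrite Cexp_pow, (Etau s Hs1). fold t.
      replace (1 * tau s)%C with (tau s) by ring. rewrite (Etau s Hs1). fold t.
      replace (Cexp ((lam - 1) * tau s)) with (Cexp (lam * tau s) / t)%C.
      2:{ unfold t. rewrite <- (Etau s Hs1), <- Cexp_minus. f_equal. ring. }
      replace (- z * p (gam s) + z1 * r (gam s))%C with (- z * p a + (- z * (t ^ mu * ((p (gam s) - p a) / t ^ mu)) + z1 * (t * (r (gam s) / t))))%C
        by (field; split; [now apply Cpow_nz|exact Ht0] || (field; split; [exact Ht0|now apply Cpow_nz])).
      rewrite Cexp_plus. field. split; [exact Ht0|apply Cexp_neq_0]. }
    assert (Ctau : forall s, 0 < s < 1 -> continuous (U := C_UniformSpace) tau s).
    { intros s Hs. apply (proj2 (filterlim_C_components (locally s) tau (tau s))). split.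
      - apply (continuous_comp (fun u => Cmod (gam u - a)) ln).
        + apply (filterlim_Cmod (locally s)). apply (filterlim_C_minus (locally s)); [now apply (contour_continuous _ _ _ HG)|apply filterlim_const].
        + apply ln_continuous, Cmod_gt_0. now apply Hga.
      - now apply Hphic. }
    assert (CFz : forall s, 0 < s < d -> s < c3 -> continuous (U := C_UniformSpace) (fun u => (Cexp (- z * p a) * Fz (tau u))%C) s).
    { intros s Hs Hs3. destruct (Hd s Hs ltac:(lra)) as [Hts _]. apply (filterlim_C_scal (locally s)). unfold Fz.
      assert (Ct := Ctau s ltac:(lra)).
      apply (filterlim_C_mult (locally s)).
      - apply (filterlim_Cdiff (locally s) Cexp _ _ _ (Cdiff_Cexp _)). apply (filterlim_C_scal (locally s)). exact Ct.
      - destruct (PS_Cdiff R0 F PF) as [F' [_ HF']].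
        apply (filterlim_Cdiff (locally s) F (fun u => Cexp (tau u)) (Cexp (tau s)) (F' (Cexp (tau s)))).
        + apply HF'. rewrite Etau by lra. lra.
        + apply (filterlim_Cdiff (locally s) Cexp _ _ _ (Cdiff_Cexp _)). exact Ct. }
    assert (Int : forall y, 0 < y < c -> CRInt f y c = (Cexp (- z * p a) * L - Cexp (- z * p a) * Fz (tau y))%C).
    { intros y Hy. apply (is_RInt_unique (V := C_R_CompleteNormedModule)).
      destruct (integrand_piecewise T p q r gam a b (INR mu) 1 rho theta y c HI HII) as [cor [HC [HRt HLt]]]; [lra|lra|].
      apply (is_RInt_corners (fun u => (Cexp (- z * p a) * Fz (tau u))%C) f cor y c); try assumption; [lra| |].
      - intros s Hs Hn. destruct (HC s Hs Hn) as [C1 C2]. split; [exact C1|].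
        rewrite Ef by lra. apply Cder_scal.
        apply (DF tau s (velocity gam s / (gam s - a))%C).
        + rewrite Etau by lra. destruct (Hd s) as [Q _]; lra.
        + apply (Cder_log tau (fun u => gam u - a)%C s (velocity gam s) (Rmin s (1 - s))).
          * apply Rmin_pos; lra.
          * intros u Hu. apply Etau. assert (Q1 := Rmin_l s (1 - s)). assert (Q2 := Rmin_r s (1 - s)).
            assert (Q3 : Rabs (u - s) < s) by lra. assert (Q4 : Rabs (u - s) < 1 - s) by lra.
            apply Rabs_lt_between in Q3. apply Rabs_lt_between in Q4. lra.
          * apply Ctau; lra.
          * eapply Cder_val; [|apply Cder_minus; [exact C2|apply Cder_const]]. ring.
      - intros s Hs. apply CFz; lra. }
    apply (filterlim_C_eps (at_right 0)). intros eps He.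
    set (A1 := Cmod (Cexp (- z * p a))). assert (HA1 : 0 < A1) by (apply Cmod_gt_0, Cexp_neq_0).
    set (Bd := Rabs (Im lam) * (Rabs varpi + 1)).
    destruct (exp_decay_eventually (A1 * (M * exp Bd)) (Re lam) eps) as [M0 [HM00 HM1]]; [|exact Hl|exact He|].
    { apply Rmult_lt_0_compat; [exact HA1|]. apply Rmult_lt_0_compat; [exact HM0|apply exp_pos]. }
    assert (H1 := proj1 (filterlim_C_eps (at_right 0) _ _) (contour_start _ _ _ HG) (Rmin (exp (- M0)) (exp xi1)) ltac:(apply Rmin_pos; apply exp_pos)).
    eapply filter_imp; [|apply (filter_and _ _ H1 (at_right_0 c (fun y => 0 < y < c) Hc (fun y Hy => Hy)))].
    intros y [Hy1 Hy]. rewrite Int by exact Hy.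
    replace (Cexp (- z * p a) * L - Cexp (- z * p a) * Fz (tau y) - Cexp (- z * p a) * L)%C with (- (Cexp (- z * p a) * Fz (tau y)))%C by ring.
    rewrite Cmod_opp, Cmod_mult. fold A1.
    assert (Hgy : 0 < Cmod (gam y - a)) by (apply Cmod_gt_0, Hga; lra).
    assert (Q1 : ln (Cmod (gam y - a)) <= - M0).
    { rewrite <- (ln_exp (- M0)). assert (Q : Cmod (gam y - a) <= exp (- M0)) by (eapply Rle_trans; [exact Hy1|apply Rmin_l]).
      destruct Q as [Q| ->]; [left; now apply ln_increasing|lra]. }
    assert (Q2 : ln (Cmod (gam y - a)) <= xi1).
    { rewrite <- (ln_exp xi1). assert (Q : Cmod (gam y - a) <= exp xi1) by (eapply Rle_trans; [exact Hy1|apply Rmin_r]).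
      destruct Q as [Q| ->]; [left; now apply ln_increasing|lra]. }
    specialize (HM (tau y) Q2). specialize (HM1 (- ln (Cmod (gam y - a))) ltac:(lra)).
    eapply Rle_trans; [|exact HM1].
    rewrite !Rmult_assoc. apply Rmult_le_compat_l; [lra|]. eapply Rle_trans; [exact HM|]. apply Rmult_le_compat_l; [lra|].
    rewrite <- exp_plus. apply exp_le. unfold tau; unfold Re at 2, Im at 2; cbn [fst snd].
    assert (Q3 : Rabs (phi y) <= Rabs varpi + 1).
    { destruct (Hd y) as [_ Q3]; [lra|lra|]. replace (phi y) with (varpi + (phi y - varpi)) by ring.
      eapply Rle_trans; [apply Rabs_triang|]. apply Rplus_le_compat_l. eapply Rle_trans; [exact Q3|].
      rewrite <- Rinv_1. apply Rinv_le_contravar; lra. }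
    assert (Rabs (Im lam) * Rabs (phi y) <= Bd) by (apply Rmult_le_compat_l; [apply Rabs_pos|exact Q3]). lra.
  - 
    assert (EL : L = Fz (ray phc xi1)) by reflexivity. rewrite EL.
    assert (HT : Rabs theta <= Rabs theta1 + Rabs theta2).
    { unfold Rabs. destruct (Rcase_abs theta), (Rcase_abs theta1), (Rcase_abs theta2); lra. }
    assert (Ht : forall xi, xi <= xi1 -> Cmod (Cexp (ray phc xi)) < R1).
    { intros xi Hx. rewrite Cmod_Cexp. unfold ray, Re; simpl. eapply Rle_lt_trans; [|exact Hxi1]. now apply exp_le. }
    apply (HK rho theta (fun xi => Fz (ray phc xi)) Hrho HT).
    + set (al0 := theta + varpi0 + INR mu * phc).
      assert (EI : forall xi, INR mu * Im (ray_W mu (ln rho, theta) lp Lm phc xi) = al0 + Im (INR mu * Lm (Cexp (ray phc xi)))%C).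
      { intros xi. unfold ray_W, al0. rewrite <- RtoC_inv by lra. unfold lp, ray, Im; simpl. field. lra. }
      assert (Hal0 : Rabs al0 <= PI / 2 + 1 / 2).
      { unfold al0. replace (theta + varpi0 + INR mu * phc) with ((varpi0 + theta + INR mu * varpi) + INR mu * (phc - varpi)) by ring.
        eapply Rle_trans; [apply Rabs_triang|]. apply Rplus_le_compat; [now apply Hang|].
        rewrite Rabs_mult, (Rabs_right (INR mu)) by lra. destruct (Hd c) as [_ Q]; [lra|lra|]. fold phc in Q.
        apply Rle_trans with (INR mu * / (2 * INR mu)); [apply Rmult_le_compat_l; lra|]. right. field. lra. }
      assert (Hsm : forall xi, xi <= xi1 -> Rabs (Im (INR mu * Lm (Cexp (ray phc xi)))%C) <= Rmin 1 (sin delta / 4)).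
      { intros xi Hx. eapply Rle_trans; [apply Im_le_Cmod|]. apply HLm, Ht, Hx. }
      assert (Hr1 := Rmin_l 1 (sin delta / 4)). assert (Hr2 := Rmin_r 1 (sin delta / 4)).
      (* Condition (v) speaks only of points of the contour. It is used at [c], where contour and
         ray meet; elsewhere on the ray the direction is the same and only the higher-order terms of
         [p] change the argument. *)
      assert (Ec : sin delta <= cos (al0 + Im (INR mu * Lm (Cexp (ray phc xi1)))%C)).
      { destruct (Hph theta c Htheta ltac:(lra)) as [_ [psi [Hpsi Hpsi2]]].
        destruct (cos_arg_bound psi delta Hdel Hpsi2) as [_ Q].
        rewrite <- (cos_is_arg (Ci * theta + (lp + INR mu * ray phc xi1 + INR mu * Lm (Cexp (ray phc xi1))))%C
          (Cexp (Ci * theta) * (p (gam c) - p a))%C psi) in Q; [| |exact Hpsi].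
        - replace (al0 + Im (INR mu * Lm (Cexp (ray phc xi1)))%C) with (Im (Ci * theta + (lp + INR mu * ray phc xi1 + INR mu * Lm (Cexp (ray phc xi1))))%C); [exact Q|].
          unfold al0, lp, ray, Im; simpl. ring.
        - rewrite Cexp_plus. f_equal. rewrite !Cexp_plus, Elp.
          assert (E1 : CPS pn (gam c - a)%C = ((p (gam c) - p a) / Cexp (INR mu * tau c))%C).
          { eapply cser_unique; [apply (geo_psr _ _ Gp); destruct (Hd c) as [Q1 _]; lra|apply Sp; lra]. }
          change (ray phc xi1) with (tau c). rewrite (Etau c) by lra.
          rewrite EP in E1 by (destruct (Hd c) as [Q1 _]; lra).
          transitivity (p0 * Cexp (INR mu * Lm (gam c - a)%C) * Cexp (INR mu * tau c))%C; [ring|]. rewrite E1. field. apply Cexp_neq_0. }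
      intros xi Hx. rewrite EI. specialize (Hsm xi Hx) as Hs1. assert (Hs2 := Hsm xi1 (Rle_refl _)). split.
      * eapply Rle_trans; [apply Rabs_triang|]. lra.
      * eapply Rle_trans; [|apply (cos_Lipschitz (al0 + Im (INR mu * Lm (Cexp (ray phc xi1)))%C))].
        set (i1 := Im (INR mu * Lm (Cexp (ray phc xi1)))%C) in *. set (i2 := Im (INR mu * Lm (Cexp (ray phc xi)))%C) in *.
        replace (al0 + i2 - (al0 + i1)) with (i2 + - i1) by ring.
        assert (Rabs (i2 + - i1) <= sin delta / 2).
        { eapply Rle_trans; [apply Rabs_triang|]. rewrite Rabs_Ropp. lra. }
        lra.
    + intros xi Hx t Y. assert (Hts := Ht xi Hx). fold t in Hts.
      eapply Cder_val; [|apply (DF (ray phc) xi 1); [fold t; lra|apply ray_Cder]]. fold t. rewrite Cmult_1_l.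
      unfold H. rewrite EP, EQ, ER by exact Hts.
      assert (EYu : Y = (Cexp (/ INR mu * lz) * local_coord (Cexp (/ INR mu * lp)) Lm t)%C).
      { unfold Y, ray_W, local_coord. fold t lz. rewrite !Cexp_plus. fold t. ring. }
      replace (z1 * (local_coord (Cexp (/ INR mu * lp)) Lm t * (x + h t)))%C with (Y * (x + h t))%C by (rewrite EYu, Ez1; ring).
      replace (- z * (t ^ mu * (p0 * Cexp (INR mu * Lm t))))%C with (- Y ^ mu)%C.
      2:{ unfold Y. rewrite <- Cexp_pow. unfold ray_W. fold t lz.
          replace (INR mu * (/ INR mu * lz + / INR mu * lp + ray phc xi + Lm t))%C with (lz + lp + INR mu * ray phc xi + INR mu * Lm t)%C by (field; exact HmC).
          rewrite !Cexp_plus, Cexp_pow, Elp, <- Ez. fold t. ring. }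
      replace (Cexp (lam * (/ INR mu * lp + ray phc xi + Lm t))) with (polar_pow (Cmod p0) varpi0 (lam / INR mu) * Cexp (lam * ray phc xi) * Cexp (lam * Lm t))%C.
      2:{ unfold polar_pow. fold lp. rewrite <- !Cexp_plus. f_equal. field. exact HmC. }
      ring.
    + apply (filterlim_C_eps (Rbar_locally m_infty)). intros eps He.
      set (Bd := Rabs (Im lam) * Rabs phc).
      destruct (exp_decay_eventually (M * exp Bd) (Re lam) eps) as [M0 [HM00 HM1]]; [apply Rmult_lt_0_compat; [exact HM0|apply exp_pos]|exact Hl|exact He|].
      exists (Rmin xi1 (- M0)). intros xi Hx.
      assert (Q1 : xi < xi1) by (eapply Rlt_le_trans; [exact Hx|apply Rmin_l]).
      assert (Q2 : xi < - M0) by (eapply Rlt_le_trans; [exact Hx|apply Rmin_r]).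
      replace (Fz (ray phc xi) - RtoC 0)%C with (Fz (ray phc xi)) by ring.
      eapply Rle_trans; [apply HM; unfold ray, Re; simpl; lra|]. specialize (HM1 (- xi) ltac:(lra)). eapply Rle_trans; [|exact HM1].
      rewrite Rmult_assoc. apply Rmult_le_compat_l; [lra|]. rewrite <- exp_plus. apply exp_le.
      unfold ray; unfold Re at 2, Im at 2; cbn [fst snd]. unfold Bd. lra.
Qed.

(** * The contribution away from [a] *)

(** Up to [d] the contour is compact and [p - p(a)] does not vanish on it, so extrema give the
    constants; beyond [d] they come from the conditions at [b]. *)
Lemma contour_away_from_start (T : C -> Prop) (p q r : C -> C) (gam : R -> C) (a : C) (b : option C) (theta1 theta2 c : R) :
  cond_i_analytic T p q r -> cond_ii_contour T gam a b -> theta1 <= theta2 ->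
  cond_v_phase p gam a theta1 theta2 -> cond_vi_growth p r gam a -> 0 < c < 1 ->
  exists eta K, 0 < eta /\ 0 <= K /\ forall s, c <= s < 1 ->
    eta <= Cmod (p (gam s) - p a) /\ Cmod (r (gam s)) <= K * Cmod (p (gam s) - p a).
Proof.
  intros [_ [Hp [Hq Hr]]] [HG HT] Hth [[delta [Hdel Hph]] [eta [cv [Heta [Hcv Hev]]]]] [K [c6 [Hc6 Hgr]]] Hc.
  set (d := (Rmax c (Rmax cv c6) + 1) / 2).
  assert (Hm : Rmax c (Rmax cv c6) < 1) by (repeat apply Rmax_lub_lt; lra).
  assert (Hm1 := Rmax_l c (Rmax cv c6)). assert (Hm2 := Rmax_r c (Rmax cv c6)).
  assert (Hm3 := Rmax_l cv c6). assert (Hm4 := Rmax_r cv c6).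
  assert (Hd : c <= d < 1 /\ cv < d /\ c6 < d) by (unfold d; lra).
  assert (Cw : forall s, c <= s <= d -> continuity_pt (fun s => Cmod (p (gam s) - p a)) s).
  { intros s Hs. apply continuity_pt_filterlim. apply (filterlim_Cmod (locally s)).
    apply (filterlim_C_minus (locally s)); [|apply filterlim_const].
    apply (analytic_filterlim (locally s)); [apply Hp, HT; lra|apply (contour_continuous _ _ _ HG); lra]. }
  assert (Cr : forall s, c <= s <= d -> continuity_pt (fun s => Cmod (r (gam s))) s).
  { intros s Hs. apply continuity_pt_filterlim. apply (filterlim_Cmod (locally s)).
    apply (analytic_filterlim (locally s)); [apply Hr, HT; lra|apply (contour_continuous _ _ _ HG); lra]. }
  destruct (continuity_ab_min _ c d ltac:(lra) Cw) as [m1 [Hmin Hm1']].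
  destruct (continuity_ab_maj _ c d ltac:(lra) Cr) as [m2 [Hmax Hm2']].
  set (wm := Cmod (p (gam m1) - p a)) in *. set (rm := Cmod (r (gam m2))) in *.
  assert (Hwm : 0 < wm).
  { apply Cmod_gt_0. intros E. destruct (Hph theta1 m1 ltac:(lra) ltac:(lra)) as [H _]. apply H. rewrite E. ring. }
  assert (Hrm : 0 <= rm) by apply Cmod_ge_0.
  exists (Rmin eta wm), (Rmax (Rabs K) (rm / wm)).
  assert (HK := Rabs_pos K).
  split; [now apply Rmin_pos|]. split; [eapply Rle_trans; [exact HK|apply Rmax_l]|].
  intros s Hs. assert (Hw0 := Cmod_ge_0 (p (gam s) - p a)). destruct (Rle_lt_dec s d) as [H|H].
  - specialize (Hmin s ltac:(lra)). specialize (Hmax s ltac:(lra)). cbv beta in Hmin, Hmax. fold wm in Hmin. fold rm in Hmax.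
    split; [eapply Rle_trans; [apply Rmin_r|exact Hmin]|].
    eapply Rle_trans; [exact Hmax|]. apply Rle_trans with (rm / wm * wm); [right; field; lra|].
    apply Rmult_le_compat; [apply Rdiv_le_0_compat; lra|lra|apply Rmax_r|exact Hmin].
  - split.
    + eapply Rle_trans; [apply Rmin_l|]. eapply Rle_trans; [apply (Hev theta1 s); lra|].
      eapply Rle_trans; [apply re_le_Cmod|]. rewrite Cmod_mult, Cmod_Cexp.
      replace (Re (Ci * theta1)%C) with 0 by (unfold Re; simpl; ring). rewrite exp_0. lra.
    + eapply Rle_trans; [apply (Hgr s); lra|]. apply Rmult_le_compat_r; [exact Hw0|].
      eapply Rle_trans; [apply Rle_abs|apply Rmax_l].
Qed.

(** The bound is read off near 1 from the convergence of the improper integral and carried to every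
    [y] because the integrand is nonnegative. *)
Lemma absolute_integral_bounded (T : C -> Prop) (p q r : C -> C) (gam : R -> C) (a : C) (b : option C) (mu theta1 theta2 Z c : R) :
  cond_i_analytic T p q r -> cond_ii_contour T gam a b -> cond_iv_sector p q r gam mu 1 theta1 theta2 Z -> 0 < c < 1 ->
  exists M, forall y, c <= y < 1 -> RInt (fun s => Cmod (I_integrand p q r gam mu 1 Z theta1 s)) c y <= M.
Proof.
  intros HI HII [Hth [_ [_ [c4 [Hc4 [Habs _]]]]]] Hc.
  set (g := fun s => Cmod (I_integrand p q r gam mu 1 Z theta1 s)).
  assert (Hex : forall x y, 0 < x < 1 -> 0 < y < 1 -> ex_RInt g x y).
  { intros x y Hx Hy. now apply (integrand_ex_RInt T p q r gam a b). }
  destruct (Habs theta1 ltac:(lra)) as [l Hl].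
  assert (Hb := Hl (ball l 1)). specialize (Hb (locally_ball l (mkposreal 1 Rlt_0_1))).
  destruct Hb as [Q1 Q2 HQ1 HQ2 HQ]. destruct HQ2 as [e He].
  assert (Ev : forall y, 1 - e < y < 1 -> c4 < y -> RInt g c4 y <= l + 1).
  { intros y Hy Hy4. destruct (HQ c4 y HQ1) as [v [Hv Hv2]].
    - apply He; [|lra]. change (Rabs (y - 1) < e). rewrite Rabs_left by lra. lra.
    - cbn [fst snd] in Hv. apply (is_RInt_unique (V := R_CompleteNormedModule)) in Hv. fold g in Hv.
      unfold g in *. rewrite Hv. change (Rabs (v - l) < 1) in Hv2. apply Rabs_lt_between in Hv2. lra. }
  exists (RInt g c c4 + (l + 1)). intros y Hy.
  set (y' := (Rmax y (Rmax c4 (1 - e)) + 1) / 2).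
  assert (He0 := cond_pos e).
  assert (Hm : Rmax y (Rmax c4 (1 - e)) < 1) by (repeat apply Rmax_lub_lt; lra).
  assert (Hm1 := Rmax_l y (Rmax c4 (1 - e))). assert (Hm2 := Rmax_r y (Rmax c4 (1 - e))).
  assert (Hm3 := Rmax_l c4 (1 - e)). assert (Hm4 := Rmax_r c4 (1 - e)).
  assert (Hy' : y < y' < 1 /\ c4 < y' /\ 1 - e < y') by (unfold y'; lra).
  assert (C1 : RInt g c y + RInt g y y' = RInt g c y') by (apply (RInt_Chasles (V := R_CompleteNormedModule)); apply Hex; lra).
  assert (C2 : RInt g c c4 + RInt g c4 y' = RInt g c y') by (apply (RInt_Chasles (V := R_CompleteNormedModule)); apply Hex; lra).
  assert (P : 0 <= RInt g y y') by (apply RInt_ge_0; [lra|apply Hex; lra|intros; apply Cmod_ge_0]).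
  specialize (Ev y' ltac:(lra) ltac:(lra)). fold g. lra.
Qed.

(** Since [Re (e^{i theta} (p - p(a))) >= sin delta |p - p(a)|], for large [rho] the integrand is dominated, uniformly
    in [theta], by the one at [Z e^{i theta1}]: absolute convergence at a single point suffices. *)
Lemma tail_part (T : C -> Prop) (p q r : C -> C) (gam : R -> C) (a : C) (b : option C) (mu : nat) (theta1 theta2 Z c : R) :
  (2 <= mu)%nat -> cond_i_analytic T p q r -> cond_ii_contour T gam a b ->
  cond_iv_sector p q r gam (INR mu) 1 theta1 theta2 Z -> cond_v_phase p gam a theta1 theta2 -> cond_vi_growth p r gam a -> 0 < c < 1 ->
  exists K eta X, 0 < K /\ 0 < eta /\ 1 <= X /\ forall rho theta, X <= rho -> theta1 <= theta <= theta2 ->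
    exists J, filterlim (fun y => CRInt (I_integrand p q r gam (INR mu) 1 rho theta) c y) (at_left 1) (locally (T := C_UniformSpace) J) /\
      Cmod (Cexp (polar_pow rho theta 1 * p a) * J) <= K * exp (- eta * rho).
Proof.
  intros Hmu HI HII HIV HV HVI Hc.
  destruct (absolute_integral_bounded T p q r gam a b (INR mu) theta1 theta2 Z c HI HII HIV Hc) as [M HM].
  destruct HIV as [Hth [_ [HZ _]]].
  destruct (contour_away_from_start T p q r gam a b theta1 theta2 c HI HII Hth HV HVI Hc) as [eta [K [Heta [HK Haway]]]].
  destruct HV as [[delta [Hdel Hph]] _].
  assert (Hm : 2 <= INR mu) by (apply (le_INR 2); lia).
  assert (Hsd : 0 < sin delta).
  { destruct (Hph theta1 c ltac:(lra) Hc) as [_ [psi [_ Hpsi]]]. now apply (cos_arg_bound psi delta). }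
  set (sd := sin delta) in *.
  set (Z1 := exp (1 / INR mu * ln Z)). assert (HZ1 : 0 < Z1) by apply exp_pos.
  (* Collects what has to be beaten: [K] for [z^{1/mu} r], and [Z + Z1 * K] for the comparison with
     the integrand at [Z e^{i theta1}]. *)
  set (S := K + Z + Z1 * K). assert (HS : 0 < S).
  { unfold S. assert (0 <= Z1 * K) by (apply Rmult_le_pos; lra). lra. }
  (* For [rho >= A^2] one has [rho^{1/mu} <= sqrt rho] and [A <= sqrt rho], whence [rho^{1/mu} K + Z
     + Z1 K <= sqrt rho S <= rho sd / 2]. *)
  set (A := Rmax 1 (2 * S / sd)). assert (HA1 : 1 <= A) by apply Rmax_l.
  assert (HA2 : S <= A * sd / 2).
  { assert (Q : 2 * S / sd <= A) by apply Rmax_r. apply Rmult_le_reg_r with (2 / sd); [apply Rdiv_lt_0_compat; lra|].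
    replace (A * sd / 2 * (2 / sd)) with A by (field; lra). replace (S * (2 / sd)) with (2 * S / sd) by (field; lra). exact Q. }
  set (zZ := polar_pow Z theta1 1).
  set (Ca := exp (Re (zZ * p a)%C)). assert (HCa : 0 < Ca) by apply exp_pos.
  set (M' := Rabs M + 1). assert (HM' : 0 < M') by (unfold M'; generalize (Rabs_pos M); lra).
  exists (Ca * M'), (sd / 2 * eta), (A * A). split; [now apply Rmult_lt_0_compat|]. split; [apply Rmult_lt_0_compat; lra|].
  split; [nra|]. intros rho theta Hrho Htheta.
  assert (Hrho1 : 1 <= rho) by nra.
  set (z := polar_pow rho theta 1). set (z1 := polar_pow rho theta (1 / INR mu)%R).
  set (rho1 := exp (1 / INR mu * ln rho)).
  assert (Ez : z = (rho * Cexp (Ci * theta))%C).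
  { unfold z, polar_pow. rewrite Cmult_1_l. apply Cexp_polar. lra. }
  assert (EzZ : zZ = (Z * Cexp (Ci * theta1))%C).
  { unfold zZ, polar_pow. rewrite Cmult_1_l. apply Cexp_polar. exact HZ. }
  assert (Ci0 : forall t : R, Cmod (Cexp (Ci * t)) = 1).
  { intros t. rewrite Cmod_Cexp. replace (Re (Ci * t)%C) with 0 by (unfold Re; simpl; ring). apply exp_0. }
  assert (Ez1 : forall rr t : R, Cmod (polar_pow rr t (1 / INR mu)%R) = exp (1 / INR mu * ln rr)).
  { intros rr t. unfold polar_pow. rewrite Cmod_Cexp. f_equal. unfold Re; simpl. ring. }
  assert (Hsq : rho1 <= sqrt rho).
  { rewrite <- (exp_ln (sqrt rho)) by (apply sqrt_lt_R0; lra). unfold rho1. apply exp_le.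
    rewrite <- Rpower_sqrt by lra. unfold Rpower. rewrite ln_exp.
    assert (0 <= ln rho) by (rewrite <- ln_1; destruct Hrho1 as [Q| <-]; [left; apply ln_increasing; lra|lra]).
    apply Rmult_le_compat_r; [assumption|]. unfold Rdiv. rewrite Rmult_1_l. apply Rinv_le_contravar; lra. }
  assert (Hsr : A <= sqrt rho) by (rewrite <- (sqrt_square A) by lra; apply sqrt_le_1; nra).
  assert (Hrr : sqrt rho * sqrt rho = rho) by (apply sqrt_sqrt; lra).
  assert (Hlarge : rho * sd / 2 <= rho * sd - rho1 * K - Z - Z1 * K).
  { assert (rho1 * K + Z + Z1 * K <= sqrt rho * S).
    { assert (rho1 * K <= sqrt rho * K) by (apply Rmult_le_compat_r; assumption).
      assert (0 <= Z1 * K) by (apply Rmult_le_pos; lra).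
      assert (1 * (Z + Z1 * K) <= sqrt rho * (Z + Z1 * K)) by (apply Rmult_le_compat_r; lra).
      unfold S. lra. }
    assert (sqrt rho * S <= sqrt rho * (A * sd / 2)) by (apply Rmult_le_compat_l; lra).
    assert (sqrt rho * (A * sd / 2) <= rho * sd / 2).
    { replace (sqrt rho * (A * sd / 2)) with (sqrt rho * A * (sd / 2)) by field.
      replace (rho * sd / 2) with (sqrt rho * sqrt rho * (sd / 2)) by (rewrite Hrr; field).
      apply Rmult_le_compat_r; [lra|]. apply Rmult_le_compat_l; lra. }
    lra. }
  set (f := I_integrand p q r gam (INR mu) 1 rho theta).
  set (fZ := I_integrand p q r gam (INR mu) 1 Z theta1).
  set (E0 := exp (- Re (z * p a)%C)).
  set (Bx := Ca * exp (- (sd / 2 * eta) * rho)).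
  (* The decay [rho sd / 2] that is left, times [|p - p(a)| >= eta], gives the exponential in [Bx];
     the integrand at [Z e^{i theta1}] remains as an integrable majorant. *)
  assert (Bnd : forall s, c <= s < 1 -> Cmod (f s) <= E0 * Bx * Cmod (fZ s)).
  { intros s Hs. destruct (Haway s Hs) as [Hw Hrw]. set (w := (p (gam s) - p a)%C) in *.
    unfold f, fZ, I_integrand. fold z z1 zZ. rewrite !Cmod_mult, !Cmod_Cexp.
    set (zZ1 := polar_pow Z theta1 (1 / INR mu)%R).
    assert (Q1 : Re (- z * p (gam s) + z1 * r (gam s))%C <= - Re (z * p a)%C - (rho * sd - rho1 * K) * Cmod w).
    { replace (- z * p (gam s) + z1 * r (gam s))%C with (- (z * p a) + (- (z * w) + z1 * r (gam s)))%C by (unfold w; ring).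
      change (Re (- (z * p a) + (- (z * w) + z1 * r (gam s)))%C) with (- Re (z * p a)%C + (- Re (z * w)%C + Re (z1 * r (gam s))%C)).
      assert (P1 : rho * sd * Cmod w <= Re (z * w)%C).
      { rewrite Ez. replace (Re (rho * Cexp (Ci * theta) * w)%C) with (rho * Re (Cexp (Ci * theta) * w)%C) by (unfold Re; simpl; ring).
        rewrite Rmult_assoc. apply Rmult_le_compat_l; [lra|].
        destruct (Hph theta s Htheta ltac:(lra)) as [_ [psi [Hpsi Hpsi2]]]. fold w in Hpsi.
        destruct (cos_arg_bound psi delta Hdel Hpsi2) as [_ Q]. fold sd in Q.
        assert (Ew : Cmod (Cexp (Ci * theta) * w) = Cmod w) by (rewrite Cmod_mult, Ci0; ring).
        unfold is_arg in Hpsi. rewrite Hpsi, Ew.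
        replace (Re (Cmod w * Cexp (Ci * psi))%C) with (Cmod w * cos psi).
        - rewrite Rmult_comm. apply Rmult_le_compat_l; [apply Cmod_ge_0|exact Q].
        - unfold Cexp. unfold Re at 1; simpl. replace (0 * psi - 1 * 0) with 0 by ring. replace (0 * 0 + 1 * psi) with psi by ring. rewrite exp_0. ring. }
      assert (P2 : Re (z1 * r (gam s))%C <= rho1 * K * Cmod w).
      { eapply Rle_trans; [apply Rle_abs|]. eapply Rle_trans; [apply re_le_Cmod|]. rewrite Cmod_mult. unfold z1. rewrite Ez1. fold rho1.
        rewrite Rmult_assoc. apply Rmult_le_compat_l; [left; apply exp_pos|exact Hrw]. }
      lra. }
    assert (Q2 : - Re (zZ * p a)%C - (Z + Z1 * K) * Cmod w <= Re (- zZ * p (gam s) + zZ1 * r (gam s))%C).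
    { replace (- zZ * p (gam s) + zZ1 * r (gam s))%C with (- (zZ * p a) + (- (zZ * w) + zZ1 * r (gam s)))%C by (unfold w; ring).
      change (Re (- (zZ * p a) + (- (zZ * w) + zZ1 * r (gam s)))%C) with (- Re (zZ * p a)%C + (- Re (zZ * w)%C + Re (zZ1 * r (gam s))%C)).
      assert (P1 : Re (zZ * w)%C <= Z * Cmod w).
      { eapply Rle_trans; [apply Rle_abs|]. eapply Rle_trans; [apply re_le_Cmod|].
        rewrite EzZ, !Cmod_mult, Ci0, Cmod_R, Rabs_right by lra. lra. }
      assert (P2 : - (Z1 * K * Cmod w) <= Re (zZ1 * r (gam s))%C).
      { assert (Q := re_le_Cmod (zZ1 * r (gam s))%C). rewrite Cmod_mult in Q. unfold zZ1 in Q at 2. rewrite Ez1 in Q. fold Z1 in Q.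
        assert (Z1 * Cmod (r (gam s)) <= Z1 * (K * Cmod w)) by (apply Rmult_le_compat_l; lra).
        apply Rabs_le_between in Q. lra. }
      lra. }
    assert (Q3 : exp (Re (- z * p (gam s) + z1 * r (gam s))%C) <= E0 * Bx * exp (Re (- zZ * p (gam s) + zZ1 * r (gam s))%C)).
    { unfold E0, Bx, Ca. rewrite <- !exp_plus. apply exp_le.
      assert (Hw0 : 0 <= Cmod w) by apply Cmod_ge_0.
      assert (rho * sd / 2 * Cmod w <= (rho * sd - rho1 * K - Z - Z1 * K) * Cmod w) by (apply Rmult_le_compat_r; assumption).
      assert (rho * sd / 2 * eta <= rho * sd / 2 * Cmod w).
      { apply Rmult_le_compat_l; [|exact Hw]. apply Rmult_le_pos; [apply Rmult_le_pos; lra|lra]. }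
      lra. }
    apply Rle_trans with (E0 * Bx * exp (Re (- zZ * p (gam s) + zZ1 * r (gam s))%C) * Cmod (q (gam s)) * Cmod (velocity gam s)).
    - apply Rmult_le_compat_r; [apply Cmod_ge_0|]. apply Rmult_le_compat_r; [apply Cmod_ge_0|]. exact Q3.
    - right. ring. }
  assert (HE0 : 0 < E0) by apply exp_pos.
  assert (HBx : 0 < Bx) by (apply Rmult_lt_0_compat; [exact HCa|apply exp_pos]).
  destruct (dominated_at_left_1 f (fun s => Cmod (fZ s)) c (E0 * Bx) M') as [J [HJ1 HJ2]].
  - lra.
  - apply Rmult_le_pos; lra.
  - intros y Hy. apply (integrand_ex_RInt T p q r gam a b); try assumption; lra.
  - intros y Hy. apply (integrand_ex_RInt T p q r gam a b); try assumption; lra.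
  - intros y Hy. split; [apply Cmod_ge_0|now apply Bnd].
  - intros y Hy. eapply Rle_trans; [apply HM; exact Hy|]. unfold M'. generalize (Rle_abs M); lra.
  - exists J. split; [exact HJ1|]. rewrite Cmod_mult, Cmod_Cexp.
    apply Rle_trans with (exp (Re (z * p a)%C) * (E0 * Bx * M')); [apply Rmult_le_compat_l; [left; apply exp_pos|exact HJ2]|].
    right. unfold E0, Bx. rewrite <- !Rmult_assoc, <- exp_plus, Rplus_opp_r, exp_0. ring.
Qed.

(** * Assembly of the expansion *)

Theorem corollary1p1
    (T : C -> Prop) (p q r : C -> C) (gam : R -> C) (a : C) (b : option C)
    (mu : nat) (lam : C) (varpi varpi0 theta1 theta2 Z : R)
    (pn qn rn : nat -> C) :
  (2 <= mu)%nat ->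
  cond_i_analytic T p q r ->
  cond_ii_contour T gam a b ->
  cond_iii_expansions p q r gam a (INR mu) 1 lam varpi pn qn rn ->
  cond_iv_sector p q r gam (INR mu) 1 theta1 theta2 Z ->
  cond_v_phase p gam a theta1 theta2 ->
  cond_vi_growth p r gam a ->
  is_arg_p0 (pn 0%nat) (INR mu) varpi theta1 theta2 varpi0 ->
  let x : C :=
    (rn 0%nat / polar_pow (Cmod (pn 0%nat)) varpi0 (1 / INR mu)%R)%C in
  let ft := f_tilde a mu lam varpi0 pn qn rn x in
  let G := fun rho theta : R =>
    (Cexp (polar_pow rho theta 1 * p a)
     * I_integral p q r gam (INR mu) 1 rho theta)%C in
  let F1 := fun n : nat =>
    Faxen_derive_n n (1 / INR mu) (lam / INR mu)%C x in
  let F2 := fun n : nat =>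
    Faxen (1 / INR mu) ((lam + INR n) / INR mu)%C x in
  has_expansion G mu lam F1 ft theta1 theta2 /\
  has_expansion G mu lam F2 ft theta1 theta2 /\
  (forall n : nat, (n < mu)%nat -> F1 n = F2 n).
Proof.
  intros Hmu HI HII HIII HIV HV HVI Harg x ft G F1 F2.
  assert (Hl : 0 < Re lam) by apply HIII.
  assert (HF1 : forall n, F1 n = Fi mu lam n x) by (intros n; exact (Faxen_derive_n_eq mu lam x n Hmu Hl)).
  (* A single statement for every [F] agreeing with [Fi] below [mu] serves both forms of the
     expansion. *)
  assert (Main : forall F : nat -> C, (forall n, (n < mu)%nat -> F n = Fi mu lam n x) -> has_expansion G mu lam F ft theta1 theta2).
  { intros F HF N.
    destruct (local_part T p q r gam a b mu lam varpi varpi0 theta1 theta2 pn qn rn Hmu HI HII HIII (proj1 HIV) HV Harg) as [c [Hc HL]].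
    destruct (HL N) as [K1 [X1 [HX1 HL1]]].
    destruct (tail_part T p q r gam a b mu theta1 theta2 Z c Hmu HI HII HIV HV HVI Hc) as [K2 [eta [X2 [HK2 [Heta [HX2 HT]]]]]].
    assert (Hm : 0 < INR mu) by (apply lt_0_INR; lia).
    destruct (exp_small_Rpower eta ((INR N + Re lam) / INR mu) Heta) as [K3 [HK3 HE]].
    { apply Rdiv_le_0_compat; [generalize (pos_INR N); lra|exact Hm]. }
    exists (K1 + K2 * K3), (Rmax X1 X2). split; [eapply Rlt_le_trans; [exact HX1|apply Rmax_l]|].
    intros rho theta Hrho Htheta.
    assert (Hr1 : X1 <= rho) by (eapply Rle_trans; [apply Rmax_l|exact Hrho]).
    assert (Hr2 : X2 <= rho) by (eapply Rle_trans; [apply Rmax_r|exact Hrho]).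
    destruct (HL1 rho theta Hr1 Htheta) as [L [HL2 HL3]].
    destruct (HT rho theta Hr2 Htheta) as [J [HJ1 HJ2]].
    set (z := polar_pow rho theta 1) in *. set (f := I_integrand p q r gam (INR mu) 1 rho theta) in *.
    assert (Hex : forall y1 y2, 0 < y1 < 1 -> 0 < y2 < 1 -> ex_RInt (V := C_R_NormedModule) f y1 y2).
    { intros y1 y2 H1 H2. apply (integrand_ex_RInt T p q r gam a b); assumption. }
    (* The integral is split at [c] by taking [CRInt f c y] as primitive; its limit at 0 is minus
       the integral over the part near [a]. *)
    assert (EI : I_integral p q r gam (INR mu) 1 rho theta = (J - -1 * (Cexp (- z * p a) * L))%C).
    { unfold I_integral, CRInt_gen. fold f.
      apply (@is_RInt_gen_unique C_R_CompleteNormedModule).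
      { apply Proper_StrongProper, at_right_proper_filter. } { apply Proper_StrongProper, at_left_proper_filter. }
      apply (is_RInt_gen_primitive f (fun y => CRInt f c y) (at_right 0) (at_left 1)).
      - apply (Filter_prod _ _ _ (fun y => 0 < y < 1) (fun y => 0 < y < 1)).
        + apply (at_right_0 1); [lra|auto].
        + apply (at_left_1 0); [lra|auto].
        + intros y1 y2 H1 H2. cbn [fst snd].
          match goal with |- is_RInt _ _ _ ?v => replace v with (plus (opp (CRInt f c y1)) (CRInt f c y2))
            by (apply C_eq; unfold plus, opp; simpl; unfold plus, opp; simpl; unfold Re, Im; ring) end.
          apply (is_RInt_Chasles (V := C_R_NormedModule)) with c; [apply (is_RInt_swap (V := C_R_NormedModule))|]; apply (RInt_correct (V := C_R_CompleteNormedModule)), Hex; lra.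
      - apply (filterlim_C_scal (at_right 0) (-1)) in HL2.
        apply (filterlim_ext_loc (F := at_right 0) (fun y => -1 * CRInt f y c)%C); [|exact HL2].
        apply (at_right_0 1); [lra|]. intros y Hy.
        unfold CRInt. rewrite <- (opp_RInt_swap (V := C_R_CompleteNormedModule) f y c) by (apply Hex; lra).
        apply C_eq; unfold opp; simpl; unfold opp; simpl; unfold Re, Im; ring.
      - exact HJ1. }
    unfold ft. rewrite (partial_expansion_eq a mu lam varpi0 pn qn rn x F N rho theta Hmu Hl HF).
    set (Tot := csum _ N). change (Cmod (L - Tot) <= K1 * Rpower rho (- ((INR N + Re lam) / INR mu))) in HL3.
    unfold G. rewrite EI. fold z.
    replace (Cexp (z * p a) * (J - -1 * (Cexp (- z * p a) * L)) - Tot)%C with ((L - Tot) + Cexp (z * p a) * J)%C.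
    2:{ replace (- z * p a)%C with (- (z * p a))%C by ring. rewrite Cexp_opp. field. apply Cexp_neq_0. }
    eapply Rle_trans; [apply Cmod_triangle|]. rewrite Rmult_plus_distr_r. apply Rplus_le_compat; [exact HL3|].
    eapply Rle_trans; [exact HJ2|]. rewrite Rmult_assoc. apply Rmult_le_compat_l; [lra|]. apply HE. lra. }
  split; [|split].
  - apply Main. intros n _. apply HF1.
  - apply Main. reflexivity.
  - intros n _. rewrite HF1. reflexivity.
Qed.
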